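(* Let $G:\Omega\times\mathbb{R}\times\mathbb{R}^m\to\mathbb{R}$, with partial derivative $G_z$ with respect to the second variable, satisfy: (1) $G$ and $G_z$ are Carathéodory functions, i.e. measurable in $x$ for any $(z,u)\in\mathbb{R}\times\mathbb{R}^m$ and continuous in $(z,u)\in\mathbb{R}\times\mathbb{R}^m$ for a.e. $x\in\Omega$; (2) there is $s\in(2,2^*_\alpha)$ such that for any bounded subset $U_0\subset U$ there exists $c>0$ with $|G(x,z,u)|\le c(1+|z|^s)$ and $|G_z(x,z,u)|\le c(1+|z|^{s-1})$ for $z\in\mathbb{R}$, $u\in U_0$ and a.e. $x\in\Omega$; (3) there exist $p>2$, $a>0$, $R>0$ such that $a<pG(x,z,u)\le zG_z(x,z,u)$ for a.e. $x\in\Omega$, any $u\in U$ and $|z|\ge R$; (4) there exist $\zeta>0$ and $0<b<\frac{c(n,\alpha)}{2}$ such that $\left|G(x,z,u)+\frac{c(n,\alpha)}{2}z^2\right|\le\frac b2|z-v_0(x)|^2$ for $|z|\le\zeta$, $u\in U$ and a.e. $x\in\Omega$, and $\operatorname{ess\,sup}|v_0|<\zeta$; (5) for any $\bar u\in U$ and $\varepsilon>0$ there exists a constant $c>0$ such that $|G(x,z,u_1)-G(x,z,u_2)|\le c(1+|z|^2)|u_1-u_2|$ and $|G_z(x,z,u_1)-G_z(x,z,u_2)|\le c(1+|z|)|u_1-u_2|$ for a.e. $x\in\Omega$, any $z\in\mathbb{R}$ and $u_1,u_2\in U$ with $|u_1-\bar u|<\varepsilon$ and $|u_2-\bar u|<\varepsilon$.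 Suppose moreover that the sequence $\{v_k\}\subset\mathcal{V}$ tends to $v_0$ in $Y^{\alpha/2}$ and the sequence $\{u_k\}\subset\mathcal{U}$ tends to $u_0\in\mathcal{U}$ in $L^\infty$. Then there is a mountain pass endpoint $\omega_1\in X_0^{\alpha/2}$ (independent of $k$, as defined in the context) such that for the sets $W_k$ defined with $\omega_0=0$ and this $\omega_1$: (i) for any $k$ large enough, the set $W_k$ of critical points of $\mathcal{F}_k$ is nonempty and does not contain zero, nor in fact any point $w$ with $\mathcal{F}_k(w)=0$; (ii) any sequence $\{w_k\}$ such that $w_k\in W_k$, $k\in\mathbb{N}$, is relatively compact in $X_0^{\alpha/2}$, and $\mathrm{Lim}\sup W_k\subset W_0$.
   Context: Setting. $\alpha\in(1,2)$, $n\ge2$, $m\ge1$, $\Omega\subset\mathbb{R}^n$ is a bounded domain with Lipschitz boundary, $2^*_\alpha=2n/(n-\alpha)$, $c(n,\alpha)=\frac{\Gamma((n+\alpha)/2)}{|\Gamma(-\alpha/2)|\,\pi^{n/2}2^{1-\alpha}}$, and $Q=\mathbb{R}^{2n}\setminus\big((\mathbb{R}^n\setminus\Omega)\times(\mathbb{R}^n\setminus\Omega)\big)$. Spaces. $X^{\alpha/2}$ is the set of measurable $z:\mathbb{R}^n\to\mathbb{R}$ with $z|_\Omega\in L^2(\Omega)$ and $\frac{z(x)-z(y)}{|x-y|^{(n+\alpha)/2}}\in L^2(Q)$. $X_0^{\alpha/2}=\{z\in X^{\alpha/2}: z=0\text{ a.e. in }\mathbb{R}^n\setminus\Omega\}$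 has norm $\|z\|_{X_0^{\alpha/2}}=\Big(\int_Q\frac{|z(x)-z(y)|^2}{|x-y|^{n+\alpha}}dxdy\Big)^{1/2}$. $Y^{\alpha/2}=X^{\alpha/2}\cap L^2(\mathbb{R}^n)$ has norm $\|z\|_{Y^{\alpha/2}}=\|z\|_{L^2(\mathbb{R}^n)}+\Big(\int_Q\frac{|z(x)-z(y)|^2}{|x-y|^{n+\alpha}}dxdy\Big)^{1/2}$ and inner product $(z_1,z_2)_{Y^{\alpha/2}}=(z_1,z_2)_{L^2(\mathbb{R}^n)}+\int_Q\frac{(z_1(x)-z_1(y))(z_2(x)-z_2(y))}{|x-y|^{n+\alpha}}dxdy$. $(X_0^{\alpha/2})^\perp$ is the orthogonal complement of $X_0^{\alpha/2}$ in $Y^{\alpha/2}$ for this inner product. Data. $v_0\in Y^{\alpha/2}$ is fixed, $l_1,l_2>0$, $U\subset\mathbb{R}^m$; $\mathcal{V}=\{v\in Y^{\alpha/2}:\|v-v_0\|_{Y^{\alpha/2}}\le l_1\}$, where the elements $v$ (including $v_0$) are additionally required to lie in $(X_0^{\alpha/2})^\perp$; $\mathcal{U}=\{u\in L^\infty(\Omega,\mathbb{R}^m): u(x)\in U\text{ for a.e. }x\in\Omega,\ \|u\|_{L^\infty}\le l_2\}$. Functionals. For $k\in\mathbb{N}_0=\{0,1,2,\dots\}$ and $w\in X_0^{\alpha/2}$, $$\mathcal{F}_k(w)=c(n,\alpha)\Big(\int_Q\tfrac{|w(x)-w(y)|^2}{2|x-y|^{n+\alpha}}dxdy+\int_Q\tfrac{(v_k(x)-v_k(y))(w(x)-w(y))}{|x-y|^{n+\alpha}}dxdy\Big)-\int_\Omega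 G(x,(w+v_k)(x),u_k(x))dx+\int_\Omega G(x,v_k(x),u_k(x))dx.$$ Mountain pass level. A mountain pass endpoint is an element $\omega_1\in X_0^{\alpha/2}$ for which there is $\eta>0$ such that, with $B_\eta=\{w\in X_0^{\alpha/2}:\|w\|_{Y^{\alpha/2}}<\eta\}$, one has $\omega_1\notin\overline{B_\eta}$ and, for $k=0$ and for all sufficiently large $k$, $\inf_{w\in\partial B_\eta}\mathcal{F}_k(w)>0$ and $\mathcal{F}_k(\omega_1)<0$. With $\omega_0=0$ and $M=\{g\in C([0,1],X_0^{\alpha/2}):g(0)=\omega_0,\ g(1)=\omega_1\}$, $$c_k=\inf_{g\in M}\max_{t\in[0,1]}\mathcal{F}_k(g(t)),\qquad W_k=\{w\in X_0^{\alpha/2}:\mathcal{F}_k(w)=c_k\text{ and }\mathcal{F}_k'(w)=0\},\quad k\in\mathbb{N}_0.$$ Upper limit. For sets $S_k\subset E$ in a Banach space $E$, $\mathrm{Lim}\sup S_k$ (Painlevé-Kuratowski upper limit) is the set of all cluster points, in the strong topology of $E$, of sequences $\{s_k\}$ with $s_k\in S_k$; sequences are indexed by all sufficiently large $k\in\mathbb{N}$ when finitely many of the sets are empty, and the same convention applies to the sequences $\{w_k\}$ in the claim. *)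

(* Defs.v *)
From HB Require Import structures.
From mathcomp Require Import all_boot all_order all_algebra.
From mathcomp Require Import all_classical all_reals all_analysis.
Set Implicit Arguments.
Unset Strict Implicit.
Unset Printing Implicit Defensive.
Import Order.TTheory GRing.Theory Num.Theory.
Import numFieldNormedType.Exports.
Local Open Scope classical_set_scope.
Local Open Scope ring_scope.

(* 'rV[R]_n carries the product sigma-algebra of its coordinates, i.e. the Borel
   one, and the n-fold product of the one-dimensional Lebesgue measure, computed
   by integrating the measures of the slices along the first coordinate. *)
Definition rv_display : measure_display. Proof. exact: default_measure_display. Qed.

Section rv_measurable.
Variables (R : realType) (n : nat).

Definition rv_coord (i : 'I_n) (x : 'rV[R]_n) : R := x ord0 i.

Let rv_set0 : g_sigma_preimage rv_coord set0.
Proof. exact: sigma_algebra0. Qed.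

Let rv_setC A : g_sigma_preimage rv_coord A -> g_sigma_preimage rv_coord (~` A).
Proof. exact: sigma_algebraC. Qed.

Let rv_bigcup (F : (set 'rV[R]_n)^nat) :
  (forall i, g_sigma_preimage rv_coord (F i)) ->
  g_sigma_preimage rv_coord (\bigcup_i F i).
Proof. exact: sigma_algebra_bigcup. Qed.

HB.instance Definition _ := @isMeasurable.Build rv_display 'rV[R]_n
  (g_sigma_preimage rv_coord) rv_set0 rv_setC rv_bigcup.

Lemma measurable_rv_coord i : measurable_fun [set: 'rV[R]_n] (rv_coord i).
Proof.
move=> _ Y mY; rewrite setTI; apply: sub_sigma_algebra => /=.
rewrite -bigcup_seq/=; exists i => /=; first by rewrite mem_index_enum.
by exists Y => //; rewrite setTI.
Qed.

Lemma measurable_fun_rv d (T : measurableType d) (f : T -> 'rV[R]_n) :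
  (forall i, measurable_fun setT (rv_coord i \o f)) -> measurable_fun setT f.
Proof.
move=> mf _ Y; rewrite setTI; move: Y.
apply: (@smallest_sub _ _ _ (fun Y => measurable (f @^-1` Y))).
  split => /=.
  - by rewrite preimage_set0.
  - by move=> A mA; rewrite setTD preimage_setC; exact: measurableC.
  - by move=> F mF; rewrite preimage_bigcup; exact: bigcup_measurable.
move=> A /=; rewrite -bigcup_seq/= => -[i _ [B mB <-]].
by have := mf i measurableT _ mB; rewrite !setTI.
Qed.
End rv_measurable.

Lemma sigma_finite_product d1 d2 (T1 : measurableType d1)
    (T2 : measurableType d2) (R : realType)
    (m1 : {sigma_finite_measure set T1 -> \bar R})
    (m2 : {sigma_finite_measure set T2 -> \bar R}) :
  sigma_finite setT (m1 \x m2)%E.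
Proof.
have /sigma_finiteP[F [TF ndF Foo]] := sigma_finiteT m1.
have /sigma_finiteP[G [TG ndG Goo]] := sigma_finiteT m2.
exists (fun n => F n `*` G n).
  rewrite -setXTT TF TG predeqE => -[x y]; split.
    move=> [/= [n _ Fnx] [k _ Gky]]; exists (maxn n k) => //; split.
    - by move: x Fnx; exact/subsetPset/ndF/leq_maxl.
    - by move: y Gky; exact/subsetPset/ndG/leq_maxr.
  by move=> [n _ []/= ? ?]; split; exists n.
move=> k; have [? ?] := Foo k; have [? ?] := Goo k.
split; first exact: measurableX.
by rewrite product_measure1E// lte_mul_pinfty// ge0_fin_numE.
Qed.

Section sigma_finite_measure_pack.
Context d (T : measurableType d) (R : realType) (mu : set T -> \bar R).
Hypotheses (mu0 : mu set0 = 0%E) (mu_ge0 : forall A, (0 <= mu A)%E)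
  (mu_sigma_additive : semi_sigma_additive mu)
  (mu_sigma_finite : sigma_finite setT mu).

Definition packed_measure := mu.

HB.instance Definition _ := isMeasure.Build _ _ _ packed_measure
  mu0 mu_ge0 mu_sigma_additive.

HB.instance Definition _ := Measure_isSigmaFinite.Build _ _ _ packed_measure
  mu_sigma_finite.

Lemma packed_measureP :
  exists m : {sigma_finite_measure set T -> \bar R}, mu = m :> (set T -> \bar R).
Proof. by exists packed_measure. Qed.

End sigma_finite_measure_pack.

Section lebesgue_rv.
Variable R : realType.

Definition rv_cons n (p : R * 'rV[R]_n) : 'rV[R]_n.+1 :=
  row_mx (const_mx p.1 : 'rV_1) p.2.

Definition rv_uncons n (x : 'rV[R]_n.+1) : R * 'rV[R]_n :=
  (x ord0 ord0, rsubmx (x : 'rV_(1 + n))).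

Lemma rv_consK n : cancel (@rv_cons n) (@rv_uncons n).
Proof.
case=> t y; rewrite /rv_cons /rv_uncons row_mxKr; congr pair => /=.
have -> : (ord0 : 'I_n.+1) = lshift n (ord0 : 'I_1) by exact/val_inj.
by transitivity ((const_mx t : 'rV_1) ord0 ord0); [exact: (@row_mxEl R 1 1 n)|rewrite mxE].
Qed.

Lemma rv_unconsK n : cancel (@rv_uncons n) (@rv_cons n).
Proof.
move=> x; pose x' : 'rV[R]_(1 + n) := x.
transitivity (row_mx (lsubmx x') (rsubmx x')); last exact: (@hsubmxK R 1 1 n x').
suff <- : const_mx (x ord0 ord0) = lsubmx x' by [].
have e0 : ord0 = lshift n (ord0 : 'I_1) :> 'I_n.+1 by exact/val_inj.
by apply/rowP => i; rewrite !mxE (ord1 i); exact: (congr1 (x ord0) e0).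
Qed.

Lemma measurable_rv_cons n : measurable_fun setT (@rv_cons n).
Proof.
apply: measurable_fun_rv => i.
case: (@split_ordP 1 n i) => j ->.
- rewrite (_ : _ \o _ = fst)//; apply/funext => -[t y].
  transitivity ((const_mx t : 'rV_1) ord0 j); last by rewrite mxE.
  exact: (@row_mxEl R 1 1 n).
- rewrite (_ : _ \o _ = rv_coord j \o snd).
    by apply: measurableT_comp => //; exact: measurable_rv_coord.
  by apply/funext => -[t y]; exact: (@row_mxEr R 1 1 n).
Qed.

Lemma measurable_rv_uncons n : measurable_fun setT (@rv_uncons n).
Proof.
apply: measurable_fun_pair; first exact: measurable_rv_coord.
apply: measurable_fun_rv => i.
rewrite (_ : _ \o _ = rv_coord (rshift 1 i)); first exact: measurable_rv_coord.
by apply/funext => x; rewrite /rv_coord/= mxE.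
Qed.

Fixpoint lebesgue_rv n : set 'rV[R]_n -> \bar R :=
  match n with
  | 0%N => fun A => \d_ (0 : 'rV[R]_0) A
  | n'.+1 => fun A =>
    (\int[@lebesgue_measure R]_t lebesgue_rv [set y | A (rv_cons (t, y))])%E
  end.

Lemma lebesgue_rv_spec n :
  exists m : {sigma_finite_measure set 'rV[R]_n -> \bar R},
    @lebesgue_rv n = m.
Proof.
elim: n => [|n [m mE]].
  by exists (\d_ (0 : 'rV[R]_0)).
pose L : {sigma_finite_measure set (measurableTypeR R) -> \bar R} :=
  @lebesgue_measure R.
pose Lm : {measure set (measurableTypeR R * 'rV[R]_n)%type -> \bar R} :=
  (L \x m)%E.
have mcons : measurable_fun
    [set: (measurableTypeR R * 'rV[R]_n)%type] (@rv_cons n).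
  exact: measurable_rv_cons.
pose P :=
  measure_function_pushforward__canonical__measure_function_Measure Lm mcons.
have sfP : sigma_finite setT P.
  have [G GT Gfin] := sigma_finite_product L m.
  exists (fun i => @rv_uncons n @^-1` G i).
    by rewrite -preimage_bigcup -GT preimage_setT.
  move=> i; have [mG Goo] := Gfin i; split.
    by rewrite -[X in measurable X]setTI; exact: measurable_rv_uncons.
  rewrite /P /= /pushforward -comp_preimage (_ : _ \o _ = id)//.
  by apply/funext => x; exact: rv_consK.
have -> : @lebesgue_rv n.+1 = P.
  apply/funext => A /=; rewrite /pushforward /product_measure1.
  by apply: eq_integral => t _ /=; rewrite mE xsectionE.
by apply: packed_measureP => //; exact: measure_semi_sigma_additive.
Qed.

Section instance.
Variable n : nat.

Let leb0 : @lebesgue_rv n set0 = 0%E.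
Proof. by have [m ->] := lebesgue_rv_spec n; exact: measure0. Qed.

Let leb_ge0 A : (0 <= @lebesgue_rv n A)%E.
Proof. by have [m ->] := lebesgue_rv_spec n; exact: measure_ge0. Qed.

Let leb_sigma_additive : semi_sigma_additive (@lebesgue_rv n).
Proof.
by have [m ->] := lebesgue_rv_spec n; exact: measure_semi_sigma_additive.
Qed.

HB.instance Definition _ := isMeasure.Build _ _ _ (@lebesgue_rv n)
  leb0 leb_ge0 leb_sigma_additive.

Let leb_sigma_finite : sigma_finite setT (@lebesgue_rv n).
Proof. by have [m ->] := lebesgue_rv_spec n; exact: sigma_finiteT. Qed.

HB.instance Definition _ := Measure_isSigmaFinite.Build _ _ _ (@lebesgue_rv n)
  leb_sigma_finite.

End instance.
End lebesgue_rv.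

(* Lebesgue measurability, i.e. measurability for the completion of the Borel
   sigma-algebra (the sigma-algebra carried by 'rV[R]_n is the Borel one). *)
Definition lebesgue_measurable (R : realType) (n : nat) (A : set 'rV[R]_n) :=
  exists2 B, measurable B &
    (@lebesgue_rv R n).-negligible ((A `\` B) `|` (B `\` A)).

Definition lebesgue_measurable_fun (R : realType) (n : nat)
    (D : set 'rV[R]_n) (f : 'rV[R]_n -> R) :=
  forall Y : set R, measurable Y -> lebesgue_measurable (D `&` f @^-1` Y).

Section euclidean.
Variables (R : realType) (n : nat).
Implicit Types x y : 'rV[R]_n.

Definition dot x y : R := \sum_i x ord0 i * y ord0 i.

(* The norm `|x| of the library is the sup norm. *)
Definition enorm x : R := Num.sqrt (dot x x).

Definition bounded_domain (Omega : set 'rV[R]_n) :=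
  [/\ open Omega, connected Omega, Omega !=set0 & bounded_set Omega].

(* Near each boundary point Omega is, in suitable orthonormal coordinates, the
   strict epigraph of a Lipschitz function.  The last coordinate is the one
   along the unit vector nu; the remaining ones are recorded by the orthogonal
   projection x - (x . nu) nu on the hyperplane normal to nu, so gamma only
   matters on that hyperplane. *)
Definition lipschitz_boundary (Omega : set 'rV[R]_n) :=
  forall x0, (closure Omega `\` interior Omega) x0 ->
  exists (r : R) (nu : 'rV[R]_n) (gamma : 'rV[R]_n -> R),
    [/\ 0 < r, enorm nu = 1, [lipschitz gamma x | x in [set: 'rV[R]_n]] &
      forall x, enorm (x - x0) < r ->
        Omega x <-> gamma (x - dot x nu *: nu) < dot x nu].

End euclidean.

Section constant.
Variable R : realType.

Definition Euler_Gamma (x : R) : R :=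
  \int[@lebesgue_measure R]_(t in `]0, +oo[) (t `^ (x - 1) * expR (- t)).

(* Extended to non-integral x <= 0 by Gamma(x+k) = x (x+1) ... (x+k-1) Gamma(x),
   with k such that 0 < x + k. *)
Definition Gamma (x : R) : R :=
  if 0 < x then Euler_Gamma x else
  let k := (Num.truncn (- x)).+1 in
  Euler_Gamma (x + k%:R) / \prod_(i < k) (x + i%:R).

Definition frac_const (n : nat) (alpha : R) : R :=
  Gamma ((n%:R + alpha) / 2) /
  (`|Gamma (- (alpha / 2))| * pi `^ (n%:R / 2) * 2 `^ (1 - alpha)).

End constant.

(* The elements of the spaces below are classes of a.e. equal functions; they
   are represented by Borel functions, as in the Lp spaces of the library, and
   identified up to a.e. equality wherever equality matters. *)
Section spaces.
Variables (R : realType) (n : nat) (Omega : set 'rV[R]_n) (alpha : R).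

Local Notation mu := (@lebesgue_rv R n).
Local Notation mu2 := (@lebesgue_rv R n \x @lebesgue_rv R n)%E.
Local Notation fT := ('rV[R]_n -> R).

Definition Qset : set ('rV[R]_n * 'rV[R]_n) := ~` (~` Omega `*` ~` Omega).

Definition Xspace : set fT := [set z |
  [/\ measurable_fun [set: 'rV[R]_n] z,
      (z \_ Omega : fT) \in Lfun mu 2%:E &
      ((fun p : 'rV[R]_n * 'rV[R]_n =>
         (z p.1 - z p.2) / enorm (p.1 - p.2) `^ ((n%:R + alpha) / 2)) \_ Qset
       : 'rV[R]_n * 'rV[R]_n -> R) \in Lfun mu2 2%:E]].

Definition X0space : set fT := [set z | Xspace z /\
  {ae mu, forall x, ~ Omega x -> z x = 0}].

Definition Yspace : set fT := [set z | Xspace z /\ z \in Lfun mu 2%:E].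

Definition Qform (z1 z2 : fT) : R :=
  \int[mu2]_(p in Qset)
    ((z1 p.1 - z1 p.2) * (z2 p.1 - z2 p.2) /
     enorm (p.1 - p.2) `^ (n%:R + alpha)).

Definition normX0 (z : fT) : R := Num.sqrt (Qform z z).

Definition normY (z : fT) : R :=
  Num.sqrt (\int[mu]_x (z x ^+ 2)) + Num.sqrt (Qform z z).

Definition innerY (z1 z2 : fT) : R :=
  \int[mu]_x (z1 x * z2 x) + Qform z1 z2.

Definition X0orth : set fT := [set v | Yspace v /\
  forall w, X0space w -> innerY v w = 0].

Definition Vset (v0 : fT) (l1 : R) : set fT :=
  [set v | X0orth v /\ normY (v - v0) <= l1].

Definition normLinf (m : nat) (u : 'rV[R]_n -> 'rV[R]_m) : \bar R :=
  'N[mu]_+oo[EFin \o ((@enorm R m \o u) \_ Omega)].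

Definition Uset (m : nat) (U : set 'rV[R]_m) (l2 : R) :
    set ('rV[R]_n -> 'rV[R]_m) := [set u |
  [/\ measurable_fun Omega u, {ae mu, forall x, Omega x -> U (u x)} &
      (normLinf u <= l2%:E)%E]].

Definition functional (m : nat) (G : 'rV[R]_n -> R -> 'rV[R]_m -> R)
    (v : fT) (u : 'rV[R]_n -> 'rV[R]_m) (w : fT) : R :=
  frac_const n alpha * (Qform w w / 2 + Qform v w)
  - \int[mu]_(x in Omega) G x (w x + v x) (u x)
  + \int[mu]_(x in Omega) G x (v x) (u x).

End spaces.

(* E is a linear subspace of V and N a seminorm on E, so that N defines the
   (pseudo)metric topology of E.  It is applied to E = X0space, N = normX0,
   where N vanishes exactly on the functions that are zero a.e. *)
Section seminormed.
Variables (R : realType) (V : lmodType R) (E : set V) (N : V -> R).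

Definition closure_in (A : set V) : set V :=
  [set w | E w /\ forall e, 0 < e -> exists2 a, A a & N (a - w) < e].

Definition boundary_in (A : set V) : set V :=
  closure_in A `&` closure_in (E `\` A).

Definition continuous_path_in (g : R -> V) :=
  (forall t, `[0, 1]%classic t -> E (g t)) /\
  forall t, `[0, 1]%classic t ->
    N (g s - g t) @[s --> within `[0, 1]%classic (nbhs t)] --> (0 : R).

Definition is_frechet_derivative (F : V -> R) (w : V) (L : V -> R) :=
  [/\ forall (a : R) h1 h2, E h1 -> E h2 -> L (a *: h1 + h2) = a * L h1 + L h2,
      exists C, forall h, E h -> `|L h| <= C * N h &
      forall e, 0 < e -> exists2 d, 0 < d &
        forall h, E h -> N h < d -> `|F (w + h) - F w - L h| <= e * N h].

(* Relative compactness in the metric space E, in its sequential form. *)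
Definition relatively_compact_in (A : set V) :=
  forall s : nat -> V, (forall j, A (s j)) ->
  exists (sigma : nat -> nat) (l : V),
    [/\ {homo sigma : i j / (i < j)%N}, E l &
        N (s (sigma j) - l) @[j --> \oo] --> (0 : R)].

Definition cluster_point_in (s : nat -> V) (w : V) :=
  E w /\ forall e, 0 < e -> forall j, exists2 k, (j <= k)%N & N (s k - w) < e.

(* The selections s only have to satisfy S k (s k) for all large k. *)
Definition Limsup_in (S : nat -> set V) : set V :=
  [set w | exists2 s : nat -> V,
     \forall k \near \oo, S k (s k) & cluster_point_in s w].

End seminormed.

Section mountain_pass.
Variables (R : realType) (n : nat) (Omega : set 'rV[R]_n) (alpha : R).
Variable F : nat -> ('rV[R]_n -> R) -> R.

Local Notation mu := (@lebesgue_rv R n).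
Local Notation fT := ('rV[R]_n -> R).
Local Notation X0 := (X0space Omega alpha).
Local Notation N0 := (normX0 Omega alpha).

Definition Bball (eta : R) : set fT :=
  [set w | X0 w /\ normY Omega alpha w < eta].

Definition mountain_pass_endpoint (w1 : fT) :=
  X0 w1 /\ exists eta : R,
  let mountain k :=
    (0 < ereal_inf
       [set (F k w)%:E | w in boundary_in X0 N0 (Bball eta)])%E /\
    F k w1 < 0 in
  [/\ 0 < eta, ~ closure_in X0 N0 (Bball eta) w1, mountain 0%N &
      \forall k \near \oo, mountain k].

Definition mp_paths (w1 : fT) : set (R -> fT) := [set g |
  [/\ continuous_path_in X0 N0 g, g 0 = 0 %[ae mu] & g 1 = w1 %[ae mu]]].

(* On each path the supremum is a maximum, F k being continuous. *)
Definition mp_level (w1 : fT) (k : nat) : \bar R :=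
  ereal_inf [set ereal_sup [set (F k (g t))%:E | t in `[0, 1]%classic]
            | g in mp_paths w1].

Definition mp_critical (w1 : fT) (k : nat) : set fT := [set w |
  [/\ X0 w, (F k w)%:E = mp_level w1 k &
      is_frechet_derivative X0 N0 (F k) w (fun=> 0)]].

End mountain_pass.

(* Main.v *)
Require Import Defs.
From HB Require Import structures.
From mathcomp Require Import all_boot all_order all_algebra.
From mathcomp Require Import all_classical all_reals all_analysis.
From mathcomp Require Import ess_sup_inf measurable_realfun ring lra.
Set Implicit Arguments.
Unset Strict Implicit.
Unset Printing Implicit Defensive.
Import Order.TTheory GRing.Theory Num.Theory.
Import numFieldNormedType.Exports.
Local Open Scope classical_set_scope.
Local Open Scope ring_scope.

(* The elements v k are orthogonal to X0 for the inner product of Y, so the coupling term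
   Q (v k) w is minus the integral of v k * w and each functional is a quadratic form minus an
   integral functional of subcritical growth.  The Ambrosetti-Rabinowitz condition makes
   F k -> -oo along rays uniformly in k, hypothesis (4) makes F k positive on a small sphere, and
   fractional Sobolev, Poincare and Rellich inequalities give the Palais-Smale condition
   uniformly in k.  They follow from the measure density of Lipschitz domains: Sobolev by a
   Chebyshev bootstrap, Rellich by averaging over small pieces.  Paths can be truncated to a
   fixed ball, on which F k -> F 0 and their derivatives converge uniformly; hence the mountain
   pass levels c_k converge to c_0 and cluster points of critical points at level c_k are
   critical points of F 0 at level c_0.  Pointwise hypotheses hold outside one Borel null set,
   off which the Lebesgue measurable Caratheodory integrands are Borel. *)

(** * Mountain pass in a seminormed Hilbert space *)

(** Elements of [X0space] are functions, not classes, so [Qform] is only semidefinite: the Hilbert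
    space arguments run with a seminorm, and the L2 form on the domain detects null functions. The
    endpoint must not depend on k, hence it is placed so far out on a ray that all functionals are
    negative there at once. Comparing levels of different functionals needs almost optimal paths in
    one ball independent of k; a path that leaves the ball is rerouted through the region where the
    functional is nonpositive. A far segment towards the endpoint may meet a null function, where
    nothing forces the functional down; a second direction [psi], independent of the first, supplies
    a detour. The estimates use an exponent [s1] strictly between the growth exponent [s] and the
    critical one: by Young's inequality the gap leaves a small multiple of [s1]-integrals plus a
    large multiple of an L2 integral, and L2 is where Rellich compactness acts. The growth bounds
    see the nonlinearity only through the constants in [AR_nonlinearity], which makes them uniform
    in k. *)

Section real_lemmas.
Variable R : realType.

(** The hitting time is the infimum of the points beyond a where f is at least y. It serves to cut a
    path at its first exit from a ball, so that everything before stays inside, and to show that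
    paths cross a sphere. *)
Lemma first_hitting_time (f : R -> R) (a b y : R) : a <= b ->
  continuous f -> f a < y -> y <= f b ->
  exists t, [/\ a < t, t <= b, f t = y & forall s, a <= s -> s < t -> f s < y].
Proof.
move=> ab cf fay yfb.
pose S := [set t | a <= t /\ y <= f t].
have Sb : S b by [].
have hS : has_inf S by split; [exists b|exists a => t []].
pose t := inf S.
have at_ : a <= t by apply: lb_le_inf; [exists b|move=> s []].
have tb : t <= b by apply: ge_inf => //; exists a => s [].
have lt_t s : a <= s -> s < t -> f s < y.
  move=> as_ st; rewrite ltNge; apply/negP => ys.
  by move: st; rewrite ltNge => /negP; apply; apply: ge_inf => //; exists a => ? [].
have fty : y <= f t.
  rewrite leNgt; apply/negP => fty.
  have /cvgrPdist_lt/(_ (y - f t)) := cf t; rewrite subr_gt0 => /(_ fty).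
  move=> [e /= e0 he].
  have /(_ e e0)[s [as_ ys] ste] := inf_adherent _ hS.
  have ts : t <= s by apply: ge_inf => //; exists a => ? [].
  have := he s; rewrite /ball_/= ltr_distlC => /(_ _)/wrap[].
    by rewrite -/t in ste; apply/andP; split; lra.
  by rewrite ltr_distlC => /andP[_]; lra.
have a_t : a < t.
  by rewrite lt_neqAle at_ andbT; apply/eqP => e; move: fty; rewrite -e; lra.
exists t; split => //.
apply/eqP; rewrite eq_le fty andbT leNgt; apply/negP => yft.
have /cvgrPdist_lt/(_ (f t - y)) := cf t; rewrite subr_gt0 => /(_ yft).
move=> [e /= e0 he].
pose s := Num.max a (t - e / 2).
have st : s < t by rewrite /s gt_max a_t/=; lra.
have as_ : a <= s by rewrite /s le_max lexx.
have := lt_t s as_ st.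
have := he s; rewrite /ball_/= => /(_ _)/wrap[].
  rewrite ltr_distlC; apply/andP; split; last by lra.
  by rewrite /s lt_max; apply/orP; right; lra.
by rewrite ltr_distlC => /andP[]; lra.
Qed.

(** A continuity argument: the slope bound is known only below the level A + 1. Up to the first time
    at which h could reach A + 1 it decreases from a value at most A, so it never gets there and the
    slope bound holds throughout. *)
Lemma decreasing_ray (h h' : R -> R) (A K : R) : 0 <= A -> 0 <= K ->
  (forall t, is_derive t (1 : R) h (h' t)) -> h 1 <= A ->
  (forall t, 1 <= t -> h t <= A + 1 -> h' t <= - K) ->
  forall t, 1 <= t -> h t <= h 1 - K * (t - 1).
Proof.
move=> A0 K0 dh h1 dec.
have ch : continuous h.
  by move=> x; apply: differentiable_continuous; apply/derivable1_diffP; case: (dh x).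
have step t : 1 <= t -> (forall s, 1 <= s -> s < t -> h s <= A + 1) ->
    h t <= h 1 - K * (t - 1).
  rewrite le_eqVlt => /predU1P[<- _|t1 hs]; first by rewrite subrr mulr0 subr0.
  have [|c] := @MVT _ h h' 1 t t1 (fun x _ => dh x).
    exact: continuous_subspaceT.
  rewrite in_itv/= => /andP[c1 ct] e.
  have := dec c (ltW c1) (hs c (ltW c1) ct) => dc.
  have : h' c * (t - 1) <= - K * (t - 1) by rewrite ler_wpM2r// subr_ge0 ltW.
  by rewrite -e; lra.
move=> t t1; apply: (step) => // s s1 st; rewrite leNgt; apply/negP => hs.
have h1A : h 1 < A + 1 by lra.
have [u [u1 us hu hlt]] := first_hitting_time s1 ch h1A (ltW hs).
have /(step _ (ltW u1)) : forall s, 1 <= s -> s < u -> h s <= A + 1.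
  by move=> r r1 ru; apply/ltW/hlt.
have : 0 <= K * (u - 1) by rewrite mulr_ge0// subr_ge0 ltW.
by lra.
Qed.

(** Paths of the statement are continuous on [0, 1] only. Composition with this retraction extends
    them to the whole line, so that continuity can be handled without subspace topologies; it also
    serves as cut-off function and to concatenate paths. *)
Definition clamp01 (x : R) : R := Num.max 0 (Num.min 1 x).

Lemma clamp01_itv x : 0 <= clamp01 x <= 1.
Proof. by rewrite /clamp01 le_max lexx/= ge_max ler01 ge_min lexx. Qed.

Lemma clamp01_id x : 0 <= x -> x <= 1 -> clamp01 x = x.
Proof. by move=> x0 x1; rewrite /clamp01 min_r// max_r. Qed.

Lemma clamp01_le0 x : x <= 0 -> clamp01 x = 0.
Proof.
by move=> x0; rewrite /clamp01 max_l// ge_min x0 orbT.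
Qed.

Lemma clamp01_ge1 x : 1 <= x -> clamp01 x = 1.
Proof. by move=> x1; rewrite /clamp01 min_l// max_r. Qed.

Lemma continuous_clamp01 : continuous clamp01.
Proof.
move=> x; apply: continuous_max; first exact: cst_continuous.
by apply: continuous_min => //; exact: cst_continuous.
Qed.

Lemma continuous_compr (f g : R -> R) : continuous f -> continuous g ->
  continuous (fun x => g (f x)).
Proof. by move=> cf cg x; apply: continuous_comp; [exact: cf|exact: cg]. Qed.

End real_lemmas.

(** * Semidefinite forms, Riesz representation and continuous paths *)

Section seminormed_hilbert.
Variables (R : realType) (V : lmodType R) (E : set V) (Q : V -> V -> R).

Definition qnorm (w : V) : R := Num.sqrt (Q w w).
Local Notation N := qnorm.

Record psd_form := PsdForm {
  psd_E0 : E 0;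
  psd_ED : forall a b, E a -> E b -> E (a + b);
  psd_EZ : forall (r : R) a, E a -> E (r *: a);
  psd_sym : forall a b, E a -> E b -> Q a b = Q b a;
  psd_lin : forall (r : R) a b c, E a -> E b -> E c ->
     Q (r *: a + b) c = r * Q a c + Q b c;
  psd_ge0 : forall a, E a -> 0 <= Q a a }.

Hypothesis H : psd_form.

Let E0 := psd_E0 H.
Let ED := psd_ED H.
Let EZ := psd_EZ H.
Let Qsym := psd_sym H.
Let Qlin := psd_lin H.
Let Qge0 := psd_ge0 H.

Lemma psd_EN a : E a -> E (- a).
Proof. by move=> Ea; rewrite -scaleN1r; exact: EZ. Qed.

Lemma psd_EB a b : E a -> E b -> E (a - b).
Proof. by move=> Ea Eb; apply: ED => //; exact: psd_EN. Qed.

Lemma psd_linD a b c : E a -> E b -> E c -> Q (a + b) c = Q a c + Q b c.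
Proof. by move=> Ea Eb Ec; rewrite -{1}[a]scale1r Qlin// mul1r. Qed.

Lemma psd_0l c : E c -> Q 0 c = 0.
Proof.
by move=> Ec; have := psd_linD E0 E0 Ec; rewrite addr0; lra.
Qed.

Lemma psd_linZ (r : R) a c : E a -> E c -> Q (r *: a) c = r * Q a c.
Proof.
by move=> Ea Ec; rewrite -[r *: a]addr0 Qlin// psd_0l// addr0.
Qed.

Lemma psd_linB a b c : E a -> E b -> E c -> Q (a - b) c = Q a c - Q b c.
Proof.
move=> Ea Eb Ec; rewrite psd_linD//; last exact: psd_EN.
by rewrite -scaleN1r psd_linZ// mulN1r.
Qed.

Lemma psd_linDr a b c : E a -> E b -> E c -> Q c (a + b) = Q c a + Q c b.
Proof.
by move=> Ea Eb Ec; rewrite Qsym ?psd_linD//; [rewrite (Qsym Ea) ?(Qsym Eb)|exact: ED].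
Qed.

Lemma psd_linZr (r : R) a c : E a -> E c -> Q c (r *: a) = r * Q c a.
Proof.
by move=> Ea Ec; rewrite Qsym ?psd_linZ//; [rewrite (Qsym Ea)|exact: EZ].
Qed.

Lemma psd_sqrD (x y : R) a b : E a -> E b ->
  Q (x *: a + y *: b) (x *: a + y *: b) =
  x ^+ 2 * Q a a + 2 * x * y * Q a b + y ^+ 2 * Q b b.
Proof.
move=> Ea Eb.
have Exa := EZ x Ea; have Eyb := EZ y Eb; have Es := ED Exa Eyb.
rewrite psd_linD// !psd_linDr// !psd_linZ// !psd_linZr// (Qsym Eb Ea).
by ring.
Qed.

Lemma psd_CS2 a b : E a -> E b -> Q a b ^+ 2 <= Q a a * Q b b.
Proof.
move=> Ea Eb.
have P x y : 0 <= x ^+ 2 * Q a a + 2 * x * y * Q a b + y ^+ 2 * Q b b.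
  by rewrite -psd_sqrD//; apply: Qge0; apply: ED; exact: EZ.
have [b0|bn0] := eqVneq (Q b b) 0; last first.
  have bp : 0 < Q b b by rewrite lt0r bn0 Qge0.
  have := P (Q b b) (- Q a b).
  have -> : (Q b b) ^+ 2 * Q a a + 2 * Q b b * - Q a b * Q a b
    + (- Q a b) ^+ 2 * Q b b = Q b b * (Q a a * Q b b - Q a b ^+ 2) by ring.
  by rewrite pmulr_rge0// subr_ge0.
rewrite b0 mulr0.
have [->|abn0] := eqVneq (Q a b) 0; first by rewrite expr0n.
(* When Q b b = 0 the quadratic expression is affine in y, and this y makes it equal to -1. *)
have := P 1 (- (Q a a + 1) / (2 * Q a b)).
rewrite b0 mulr0 addr0.
have -> : 1 ^+ 2 * Q a a + 2 * 1 * (- (Q a a + 1) / (2 * Q a b)) * Q a b = - 1.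
  by field.
by rewrite ler0N1.
Qed.

Lemma qnorm_ge0 w : 0 <= N w.
Proof. exact: sqrtr_ge0. Qed.
Hint Resolve qnorm_ge0 : core.

Lemma qnorm_sqr w : E w -> N w ^+ 2 = Q w w.
Proof. by move=> Ew; rewrite sqr_sqrtr// Qge0. Qed.

Lemma psd_CS a b : E a -> E b -> `|Q a b| <= N a * N b.
Proof.
move=> Ea Eb; rewrite -ler_sqr ?nnegrE ?mulr_ge0//.
by rewrite real_normK ?num_real// exprMn !qnorm_sqr// psd_CS2.
Qed.

Lemma qnormZ (r : R) w : E w -> N (r *: w) = `|r| * N w.
Proof.
move=> Ew; rewrite /N psd_linZ//; last exact: EZ.
by rewrite psd_linZr// mulrA -expr2 sqrtrM ?sqr_ge0// sqrtr_sqr.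
Qed.

Lemma qnorm0 : N 0 = 0.
Proof. by rewrite /N psd_0l// sqrtr0. Qed.

Lemma qnormN w : E w -> N (- w) = N w.
Proof. by move=> Ew; rewrite -scaleN1r qnormZ// normrN normr1 mul1r. Qed.

Lemma qnormD a b : E a -> E b -> N (a + b) <= N a + N b.
Proof.
move=> Ea Eb; rewrite -ler_sqr ?nnegrE ?addr_ge0//.
rewrite qnorm_sqr; last exact: ED.
have := psd_sqrD 1 1 Ea Eb; rewrite !scale1r => ->.
have := psd_CS Ea Eb; have := ler_norm (Q a b).
by rewrite sqrrD !qnorm_sqr//; lra.
Qed.

Lemma qnormB a b : E a -> E b -> N (a - b) <= N a + N b.
Proof. by move=> Ea Eb; rewrite -(qnormN Eb) qnormD//; exact: psd_EN. Qed.

Lemma qnorm_distC a b : E a -> E b -> N (a - b) = N (b - a).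
Proof. by move=> Ea Eb; rewrite -opprB qnormN//; exact: psd_EB. Qed.

Lemma qnorm_dist a b : E a -> E b -> `|N a - N b| <= N (a - b).
Proof.
move=> Ea Eb; rewrite ler_norml lerBlDr lerNl opprB lerBlDr.
have h x y : E x -> E y -> N x <= N (x - y) + N y.
  by move=> Ex Ey; rewrite -{1}(subrK y x) qnormD//; exact: psd_EB.
by rewrite (qnorm_distC Ea Eb) {1}h//= -(qnorm_distC Ea Eb) h.
Qed.

Definition qcomplete := forall s : nat -> V, (forall j, E (s j)) ->
  (forall e : R, 0 < e -> exists j0, forall i j, (j0 <= i)%N -> (j0 <= j)%N ->
     N (s i - s j) <= e) ->
  exists2 l, E l & N (s j - l) @[j --> \oo] --> (0 : R).

Definition linear_on (l : V -> R) := forall (r : R) a b, E a -> E b ->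
  l (r *: a + b) = r * l a + l b.

Lemma linear_on0 l : linear_on l -> l 0 = 0.
Proof. by move=> ll; have := ll 1 0 0 E0 E0; rewrite scale1r addr0; lra. Qed.

Lemma linear_onZ l (r : R) a : linear_on l -> E a -> l (r *: a) = r * l a.
Proof. by move=> ll Ea; rewrite -[r *: a]addr0 ll// linear_on0// addr0. Qed.

Lemma linear_onD l a b : linear_on l -> E a -> E b -> l (a + b) = l a + l b.
Proof. by move=> ll Ea Eb; rewrite -{1}[a]scale1r ll// mul1r. Qed.

(** The representative minimises [J]; the parallelogram law makes minimising sequences Cauchy, and
    the first variation of [J] at the limit gives the identity. *)
Lemma riesz l (C : R) : qcomplete -> linear_on l ->
  (forall h, E h -> `|l h| <= C * N h) ->
  exists2 r, E r & forall h, E h -> l h = Q r h.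
Proof.
move=> cpl ll lC.
pose J w := Q w w / 2 - l w.
have C0 : 0 <= `|C| by [].
have lC' h : E h -> `|l h| <= `|C| * N h.
  by move=> Eh; apply: le_trans (lC h Eh) _; rewrite ler_wpM2r// ler_norm.
have Jlb w : E w -> - (`|C| ^+ 2 / 2) <= J w.
  move=> Ew; rewrite /J -qnorm_sqr//.
  have := lC' w Ew; have := ler_norm (l w); have := sqr_ge0 (N w - `|C|).
  by move: (N w) (l w) (`|l w|) (`|C|) => x y z k; rewrite !expr2; nra.
pose S := [set J w | w in E].
have hS : has_inf S.
  split; first by exists (J 0); exists 0.
  by exists (- (`|C| ^+ 2 / 2)) => _ [w Ew <-]; exact: Jlb.
pose m := inf S.
have mJ w : E w -> m <= J w by move=> Ew; apply: ge_inf; [exact: hS.2|exists w].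
have /choice[s sP] : forall j : nat, exists w, E w /\ J w < m + j.+1%:R^-1.
  move=> j; have [|_ [w Ew <-] Jw] := @inf_adherent _ S j.+1%:R^-1 _ hS.
    by rewrite invr_gt0 ltr0n.
  by exists w.
have Es j : E (s j) by have [] := sP j.
(* The parallelogram law, with the value of [J] at the midpoint of a and b bounded below by m. *)
have par a b : E a -> E b -> N (a - b) ^+ 2 <= 4 * (J a - m) + 4 * (J b - m).
  move=> Ea Eb; rewrite qnorm_sqr; last exact: psd_EB.
  have Eh : E (2^-1 *: a + 2^-1 *: b) by apply: ED; exact: EZ.
  have := mJ _ Eh; rewrite /J psd_sqrD// (linear_onD ll (EZ _ Ea) (EZ _ Eb)) !(linear_onZ _ ll)//.
  have := psd_sqrD 1 (-1) Ea Eb; rewrite scale1r scaleN1r => ->.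
  by rewrite !expr2; lra.
have cau : forall e : R, 0 < e -> exists j0, forall i j, (j0 <= i)%N -> (j0 <= j)%N ->
     N (s i - s j) <= e.
  move=> e e0.
  have [j0 _ hj] : \forall j \near \oo, (j.+1%:R^-1 : R) < e ^+ 2 / 8.
    apply: (@cvgr_lt _ _ _ _ _ (0 : R)); last by rewrite divr_gt0// exprn_gt0.
    exact: cvg_harmonic.
  exists j0 => i j ji jj; rewrite -ler_sqr ?nnegrE ?(ltW e0)//.
  apply: (le_trans (par _ _ (Es i) (Es j))).
  have := hj i ji; have := hj j jj; have [_] := sP i; have [_] := sP j.
  by rewrite /=; move: (j.+1%:R^-1) (i.+1%:R^-1) (e ^+ 2) (J (s i)) (J (s j)) => *; lra.
have [r Er rP] := cpl s Es cau.
have Jr : J r <= m.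
  rewrite leNgt; apply/negP => mr.
  pose e := J r - m; have e0 : 0 < e by rewrite subr_gt0.
  pose K := N r + `|C| + 1.
  have K0 : 0 < K by rewrite /K; have := qnorm_ge0 r; lra.
  have : \forall j \near \oo, N (s j - r) < e / (2 * K).
    by apply: (cvgr_lt (0 : R)) => //; rewrite divr_gt0// mulr_gt0.
  have : \forall j \near \oo, (j.+1%:R^-1 : R) < e / 2.
    by apply: (@cvgr_lt _ _ _ _ _ (0 : R)); [exact: cvg_harmonic|rewrite divr_gt0].
  move=> A1 A2; have [j [/= B1 B2]] := filter_ex (filterI A1 A2).
  have [_ Js] := sP j.
  have Ed := psd_EB (Es j) Er; set d := s j - r in Ed B2.
  have dE : s j = d + r by rewrite subrK.
  have := psd_sqrD 1 1 Ed Er; rewrite !scale1r -dE => q.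
  have ls : l (s j) = l d + l r by rewrite dE linear_onD.
  have Js2 : J (s j) = J r + Q d d / 2 + Q d r - l d.
    by rewrite /J q ls; lra.
  have := psd_CS Ed Er; have := lC' d Ed; have := Qge0 Ed.
  have := ler_norm (- Q d r); have := ler_norm (l d).
  rewrite normrN.
  have : N d * K < e / 2.
    by rewrite -ltr_pdivlMr//; move: B2; rewrite invfM mulrA.
  move: Js; rewrite Js2 /K /e in B1 *; rewrite mulrDr mulrDr.
  move: B1 (mulrC (N d) `|C|) (qnorm_ge0 d); rewrite /e; move: (j.+1%:R^-1) => x; lra.
exists r => // h Eh.
have Jh t : 0 <= t ^+ 2 * Q h h / 2 + t * (Q r h - l h).
  have := mJ (1 *: r + t *: h).
  rewrite /J psd_sqrD// (linear_onD ll (EZ _ Er) (EZ _ Eh)) !(linear_onZ _ ll)//.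
  move/(_ (ED (EZ _ Er) (EZ _ Eh))).
  by move: Jr; rewrite /J expr1n; lra.
apply/eqP; rewrite eq_sym -subr_eq0; apply/eqP.
set y := Q r h - l h in Jh *.
have q0 := Qge0 Eh.
have k0 : 0 < Q h h + 1 by lra.
(* The usual choice would be - y / Q h h, but Q h h may vanish; with the extra 1 the value is still
   a negative multiple of y^2. *)
have := Jh (- y / (Q h h + 1)).
have -> : (- y / (Q h h + 1)) ^+ 2 * Q h h / 2 + - y / (Q h h + 1) * y =
  - (y ^+ 2 * ((Q h h / 2 + 1) / (Q h h + 1) ^+ 2)) by field; rewrite gt_eqF.
rewrite oppr_ge0 pmulr_lle0; last by rewrite divr_gt0 ?exprn_gt0//; lra.
by rewrite exprn_even_le0//= => /eqP.
Qed.

Definition cpath (g : R -> V) := (forall t, E (g t)) /\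
  forall t, N (g s - g t) @[s --> t] --> (0 : R).

Lemma cvg_dist_le (f n : R -> R) (C t : R) : n s @[s --> t] --> (0 : R) ->
  (\forall s \near t, `|f s - f t| <= C * n s) -> f s @[s --> t] --> f t.
Proof.
move=> n0 fn; apply/cvgrPdist_le => /= e e0.
have /cvgrPdist_le/(_ (e / (`|C| + 1))) := n0.
rewrite divr_gt0 ?ltr_wpDl// => /(_ isT) n1.
near=> s; rewrite distrC.
have : `|0 - n s| <= e / (`|C| + 1) by near: s.
rewrite sub0r normrN ler_pdivlMr ?ltr_wpDl// => h.
have : `|f s - f t| <= C * n s by near: s.
move/le_trans; apply; apply: (le_trans (ler_norm _)); rewrite normrM.
by apply: le_trans h; rewrite mulrC ler_wpM2l// lerDl.
Unshelve. all: by end_near. Qed.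

Lemma cpath_normP (g : R -> V) (C : R) (n : R -> R) : (forall t, E (g t)) ->
  (forall t, exists2 n : R -> R, n s @[s --> t] --> (0 : R) &
    \forall s \near t, N (g s - g t) <= n s) -> cpath g.
Proof.
move=> Eg h; split => // t; have [n' n0 hn] := h t.
apply: (@squeeze_cvgr _ _ _ _ (cst 0) n') => //; last exact: cvg_cst.
by near=> s; rewrite qnorm_ge0/=; near: s.
Unshelve. all: by end_near. Qed.

Lemma cpath_cst a : E a -> cpath (fun=> a).
Proof.
by move=> Ea; split => // t; rewrite subrr qnorm0; exact: cvg_cst.
Qed.

Lemma cpath_comp g (f : R -> R) : cpath g -> continuous f -> cpath (g \o f).
Proof.
move=> [Eg gc] cf; split=> [t|t] /=; first exact: Eg.
have := cvg_comp _ _ (cf t) (gc (f t)); exact.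
Qed.

Lemma cpath_add g1 g2 : cpath g1 -> cpath g2 -> cpath (fun t => g1 t + g2 t).
Proof.
move=> [E1 c1] [E2 c2]; apply: (cpath_normP 0 (cst 0)) => [t|t]; first exact: ED.
exists (fun s => N (g1 s - g1 t) + N (g2 s - g2 t)).
  by rewrite -[0]addr0; apply: cvgD; [exact: c1|exact: c2].
near=> s; rewrite opprD addrACA; apply: qnormD; exact: psd_EB.
Unshelve. all: by end_near. Qed.

Lemma cpath_scale g (a : R -> R) : cpath g -> continuous a ->
  cpath (fun t => a t *: g t).
Proof.
move=> [Eg cg] ca; apply: (cpath_normP 0 (cst 0)) => [t|t]; first exact: EZ.
exists (fun s => `|a s| * N (g s - g t) + `|a s - a t| * N (g t)).
  rewrite [X in _ --> X](_ : _ = `|a t| * 0 + `|a t - a t| * N (g t)); last first.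
    by rewrite subrr normr0 mul0r mulr0 addr0.
  apply: cvgD; first by apply: cvgM; [apply: cvg_norm; exact: ca|exact: cg].
  apply: cvgM; last exact: cvg_cst.
  by apply: cvg_norm; apply: cvgB; [exact: ca|exact: cvg_cst].
near=> s.
have -> : a s *: g s - a t *: g t = a s *: (g s - g t) + (a s - a t) *: g t.
  by rewrite scalerBr scalerBl addrA subrK.
apply: le_trans (qnormD _ _) _; [exact/EZ/psd_EB|exact: EZ|].
by rewrite !qnormZ//; exact: psd_EB.
Unshelve. all: by end_near. Qed.

Lemma continuous_qnorm_cpath g : cpath g -> continuous (N \o g).
Proof.
move=> [Eg cg] t; apply: (@cvg_dist_le _ (fun s => N (g s - g t)) 1) => //.
by near=> s; rewrite mul1r qnorm_dist.
Unshelve. all: by end_near. Qed.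

Lemma cpath_line a b : E a -> E b -> cpath (fun t => a + t *: (b - a)).
Proof.
move=> Ea Eb; apply: cpath_add; first exact: cpath_cst.
apply: (@cpath_scale (fun=> b - a) id).
  by apply: cpath_cst; exact: psd_EB.
by move=> x; exact: cvg_id.
Qed.

Definition joined (S : V -> Prop) a b := exists g,
  [/\ cpath g, g 0 = a, g 1 = b & forall t : R, 0 <= t <= 1 -> S (g t)].

Lemma joined_line S a b : E a -> E b ->
  (forall t : R, 0 <= t <= 1 -> S ((1 - t) *: a + t *: b)) -> joined S a b.
Proof.
move=> Ea Eb h; exists (fun t => a + t *: (b - a)); split.
- exact: cpath_line.
- by rewrite scale0r addr0.
- by rewrite scale1r addrC subrK.
- move=> t /h; congr S; rewrite scalerBl scale1r scalerBr.
  by rewrite -addrA [- _ + _]addrC.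
Qed.

Lemma joined_trans S a b c : joined S a b -> joined S b c -> joined S a c.
Proof.
move=> [g1 [c1 a1 b1 S1]] [g2 [c2 a2 b2 S2]].
have Eb : E b by rewrite -b1; exact: c1.1.
pose f1 (t : R) := clamp01 (2 * t); pose f2 (t : R) := clamp01 (2 * t - 1).
have cf1 : continuous f1.
  apply: (@continuous_compr R (fun t => 2 * t)); last exact: continuous_clamp01.
  by move=> t; apply: cvgM; [exact: cvg_cst|exact: cvg_id].
have cf2 : continuous f2.
  apply: (@continuous_compr R (fun t => 2 * t - 1)); last exact: continuous_clamp01.
  move=> t; apply: cvgB; last exact: cvg_cst.
  by apply: cvgM; [exact: cvg_cst|exact: cvg_id].
(* Concatenation without case distinction: on each half one of the two clamped paths rests at b and
   cancels against - b, so continuity is that of a sum. *)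
exists (fun t => (g1 \o f1) t + ((g2 \o f2) t + - b)); split => /=.
- apply: cpath_add; first exact: cpath_comp.
  apply: cpath_add; first exact: cpath_comp.
  by apply: cpath_cst; exact: psd_EN.
- rewrite /f1 /f2 !mulr0 clamp01_id// a1 clamp01_le0 ?a2 ?subrr ?addr0//.
- rewrite /f1 /f2 !mulr1 clamp01_ge1 ?b1 ?ler1n// clamp01_ge1; last lra.
  by rewrite b2 addrC subrK.
- move=> t /andP[t0 t1]; have [th|th] := leP t 2^-1.
    rewrite {1}/f2 (@clamp01_le0 _ (2 * t - 1)); last lra.
    rewrite a2 subrr addr0; apply: S1; exact: clamp01_itv.
  rewrite {1}/f1 clamp01_ge1; last lra.
  by rewrite b1 addrC subrK; apply: S2; exact: clamp01_itv.
Qed.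

End seminormed_hilbert.

(** * Levels and critical points of a family of functionals *)

Section mountain_pass.
Variables (R : realType) (V : lmodType R) (E : set V) (Q B : V -> V -> R).
Hypotheses (HQ : psd_form E Q) (HB : psd_form E B).
Hypothesis cplQ : qcomplete E Q.
Local Notation N := (qnorm Q).
Variables (F : nat -> V -> R) (L : nat -> V -> V -> R).

Hypothesis Llin : forall k w, E w -> linear_on E (L k w).
Hypothesis F_diff : forall k (rho e : R), 0 < e -> exists2 d : R, 0 < d &
  forall w h, E w -> E h -> N w <= rho -> N h <= d ->
  `|F k (w + h) - F k w - L k w h| <= e * N h.
Hypothesis L_unif : forall k (rho e : R), 0 < e -> exists2 d : R, 0 < d &
  forall w w' h, E w -> E w' -> E h -> N w <= rho -> N (w' - w) <= d ->
  `|L k w' h - L k w h| <= e * N h.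
Hypothesis L_bnd : forall k (rho : R), exists C : R,
  forall w h, E w -> E h -> N w <= rho -> `|L k w h| <= C * N h.
Variables (p c1 C1 : R).
Hypotheses (p0 : 0 < p) (c10 : 0 < c1) (C10 : 0 <= C1).
Hypothesis F_AR : forall k w, E w -> L k w w <= p * F k w - c1 * N w ^+ 2 + C1.
Hypothesis F_cvg : forall rho e : R, 0 < e -> exists k0, forall k, (k0 <= k)%N ->
  forall w, E w -> N w <= rho -> `|F k w - F 0 w| <= e.
Hypothesis L_cvg : forall rho e : R, 0 < e -> exists k0, forall k, (k0 <= k)%N ->
  forall w h, E w -> E h -> N w <= rho -> `|L k w h - L 0 w h| <= e * N h.
Hypothesis PS : forall (kk : nat -> nat) (w : nat -> V) (K : R),
  (forall j, E (w j) /\ N (w j) <= K) ->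
  (forall e : R, 0 < e -> exists j0, forall j, (j0 <= j)%N ->
     forall h, E h -> `|L (kk j) (w j) h| <= e * N h) ->
  exists (sigma : nat -> nat) (l : V), [/\ {homo sigma : i j / (i < j)%N}, E l &
    N (w (sigma j) - l) @[j --> \oo] --> (0 : R)].
Variable c2 : R.
Hypothesis c20 : 0 <= c2.
Hypothesis F_anti : forall M : R, exists C : R, forall k w, E w ->
  F k w <= c2 * N w ^+ 2 + C - M * B w w.
Hypothesis B0 : forall w, E w -> B w w = 0 -> N w = 0.

Let EZ (r : R) a : E a -> E (r *: a).
Proof. exact: psd_EZ HQ r a. Qed.
Let ED a b : E a -> E b -> E (a + b).
Proof. exact: (psd_ED HQ (a:=a) (b:=b)). Qed.
Let EB a b : E a -> E b -> E (a - b).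
Proof. exact: psd_EB HQ _ _. Qed.
Let N0 w : 0 <= N w := qnorm_ge0 Q w.

(** Adding a vector of seminorm zero changes nothing, since both the derivative and the remainder
    are bounded by the seminorm. This makes values at path endpoints meaningful, as these are
    prescribed only up to seminorm zero. *)
Lemma F_norm0 k w h : E w -> E h -> N h = 0 -> F k (w + h) = F k w.
Proof.
move=> Ew Eh h0; have [d d0 /(_ w h Ew Eh)] := F_diff k (N w) ltr01.
rewrite h0 lexx (ltW d0) mulr0 => /(_ isT isT).
have [C /(_ w h Ew Eh (lexx _))] := L_bnd k (N w).
rewrite h0 mulr0 !normr_le0 => /eqP ->; rewrite subr0 subr_eq0.
by move=> /eqP.
Qed.

Lemma F_lip k (rho : R) : exists K d : R, [/\ 0 <= K, 0 < d &
  forall w w', E w -> E w' -> N w <= rho -> N (w' - w) <= d ->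
    `|F k w' - F k w| <= K * N (w' - w)].
Proof.
have [d d0 dP] := F_diff k rho ltr01; have [C CP] := L_bnd k rho.
exists (1 + `|C|), d; split => // w w' Ew Ew' wr wd.
have Eh := EB Ew' Ew.
have := dP _ _ Ew Eh wr wd; rewrite (addrC w) subrK => h1.
have h2 := CP _ _ Ew Eh wr.
have -> : F k w' - F k w = (F k w' - F k w - L k w (w' - w)) + L k w (w' - w).
  by rewrite subrK.
apply: (le_trans (ler_normD _ _)); rewrite mulrDl; apply: lerD => //.
by apply: (le_trans h2); rewrite ler_wpM2r// ler_norm.
Qed.

Lemma continuous_F_cpath k g : cpath E Q g -> continuous (F k \o g).
Proof.
move=> [Eg cg] t; have [K [d [K0 d0 h]]] := F_lip k (N (g t)).
apply: (@cvg_dist_le _ (F k \o g) (fun s => N (g s - g t)) K) => //.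
near=> s; apply: h => //; near: s.
have /cvgrPdist_le/(_ d d0) := cg t.
by apply: filterS => s; rewrite sub0r normrN; apply: le_trans; exact: ler_norm.
Unshelve. all: by end_near. Qed.

Lemma is_derive_ray k w (t : R) : E w ->
  is_derive t (1 : R) (fun s : R => F k (s *: w)) (L k (t *: w) w).
Proof.
move=> Ew.
suff H : (fun h : R => h^-1 *: (F k ((h *: 1 + t) *: w) - F k (t *: w)))
    @ 0^' --> L k (t *: w) w.
  apply: DeriveDef; first by apply/cvg_ex; exists (L k (t *: w) w).
  by apply: cvg_lim H; exact: Rhausdorff.
apply/cvgrPdist_le => e e0.
pose e' := e / (N w + 1).
have e'0 : 0 < e' by rewrite divr_gt0// ltr_wpDl.
have [d d0 dP] := F_diff k (N (t *: w)) e'0.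
have dd : 0 < d / (N w + 1) by rewrite divr_gt0// ltr_wpDl.
near=> h.
have hn0 : h != 0 by near: h; exact: nbhs_dnbhs_neq.
have hd : `|h| < d / (N w + 1).
  near: h; apply: dnbhs0_lt; exact: dd.
have Ehw := EZ h Ew; have Etw := EZ t Ew.
have := dP _ _ Etw Ehw (lexx _); rewrite (qnormZ HQ)//.
have hw : `|h| * N w <= d.
  apply: (@le_trans _ _ (`|h| * (N w + 1))); first by rewrite ler_wpM2l// lerDl.
  by rewrite -ler_pdivlMr ?ltr_wpDl// ltW.
move=> /(_ hw); rewrite -scalerDl (linear_onZ HQ _ (Llin k Etw))//.
move=> dP'; rewrite distrC (_ : h%:A = h) ?(addrC h); last exact: mulr1.
have -> : h^-1 * (F k ((t + h) *: w) - F k (t *: w)) - L k (t *: w) w =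
  h^-1 * (F k ((t + h) *: w) - F k (t *: w) - h * L k (t *: w) w) by field.
rewrite normrM normfV ler_pdivrMl ?normr_gt0//.
apply: (le_trans dP'); rewrite mulrCA ler_wpM2l// /e' -mulrA ler_piMr ?ltW//.
by rewrite ltr_pdivrMl ?ltr_wpDl// mulr1 ltrDl.
Unshelve. all: by end_near. Qed.

(** At radius [rho] the term c1 N^2 in [F_AR] equals [D], which outweighs the other terms: wherever
    F is at most A + 1 on the ray, its radial derivative is at most -(A + 1). So F decreases along
    the ray and has lost A + 1 by the time t = 2. *)
Lemma F_ray (A : R) : 0 <= A -> exists2 rho : R, 0 < rho & forall k w, E w ->
  N w = rho -> F k w <= A ->
  (forall t : R, 1 <= t -> F k (t *: w) <= F k w) /\
  (forall t : R, 2 <= t -> F k (t *: w) <= 0).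
Proof.
move=> A0; pose D := p * (A + 1) + C1 + (A + 1).
have A1 : 0 < A + 1 by lra.
have pA : 0 < p * (A + 1) by exact: mulr_gt0.
have D0 : 0 < D.
  rewrite /D; move: pA A1 C10; lra.
exists (Num.sqrt (D / c1)); first by rewrite sqrtr_gt0 divr_gt0.
move=> k w Ew Nw FA.
have Nw2 : c1 * N w ^+ 2 = D.
  by rewrite Nw sqr_sqrtr ?divr_ge0 ?ltW// mulrC divfK ?gt_eqF.
have F1 : F k (1 *: w) = F k w by rewrite scale1r.
have A10 : 0 <= A + 1 by lra.
have ray : forall t : R, 1 <= t -> F k (t *: w) <= F k (1 *: w) - (A + 1) * (t - 1).
  apply: (decreasing_ray A0 A10 (fun t => is_derive_ray k t Ew)).
    by rewrite F1.
  move=> t t1 FtA.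
  have := F_AR k (EZ t Ew); rewrite (linear_onZ HQ _ (Llin k (EZ t Ew)))//.
  rewrite (qnormZ HQ)// exprMn mulrCA Nw2 ger0_norm; last lra.
  have : p * F k (t *: w) <= p * (A + 1) by rewrite ler_wpM2l// ltW.
  have : D <= t ^+ 2 * D by rewrite ler_peMl ?(ltW D0)// exprn_ege1.
  have : t * D <= t ^+ 2 * D.
    by rewrite ler_wpM2r ?(ltW D0)// expr2 ler_peMl//; lra.
  move: (F k (t *: w)) (L k (t *: w) w) => x y h1 h2 h3 h4.
  have : t * y <= t * - (A + 1).
    have : p * (A + 1) + C1 <= t * (p * (A + 1) + C1).
      by rewrite ler_peMl//; move: pA C10; lra.
    by move: h1; rewrite {1}/D; lra.
  by rewrite ler_pM2l//; lra.
rewrite F1 in ray; split => t ht.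
  apply: (le_trans (ray t ht)); rewrite gerBl mulr_ge0//; lra.
have := ray t; have -> : 1 <= t by lra.
move=> /(_ isT) h; apply: (le_trans h).
have : A + 1 <= (A + 1) * (t - 1) by rewrite ler_peMr//; lra.
by lra.
Qed.
Lemma B_seg (a b : V) (t : R) : E a -> E b ->
  B ((1 - t) *: a + t *: b) ((1 - t) *: a + t *: b) =
  (1 - t) ^+ 2 * B a a + 2 * (1 - t) * t * B a b + t ^+ 2 * B b b.
Proof. by move=> Ea Eb; rewrite (psd_sqrD HB). Qed.

(** By compactness B is at least some m > 0 on the segment. Then [F_anti] with M = (c2 S + 1) / m
    bounds F on the segment dilated by T by C - T^2, with C independent of k. *)
Lemma far_segment_joined (a b : V) : E a -> E b ->
  (forall t : R, 0 <= t <= 1 ->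
    B ((1 - t) *: a + t *: b) ((1 - t) *: a + t *: b) != 0) ->
  exists2 T0 : R, 0 <= T0 & forall k T, T0 <= T ->
    joined E Q (fun w => F k w <= 0) (T *: a) (T *: b).
Proof.
move=> Ea Eb Bn0.
pose f (t : R) := (1 - t) ^+ 2 * B a a + 2 * (1 - t) * t * B a b + t ^+ 2 * B b b.
have cf : continuous f.
  have c1t : continuous (fun t : R => 1 - t).
    by move=> t; apply: cvgB; [exact: cvg_cst|exact: cvg_id].
  have cid : continuous (fun t : R => t) by move=> t; exact: cvg_id.
  move=> t; apply: cvgD; first apply: cvgD.
  - apply: cvgM; last exact: cvg_cst.
    by rewrite expr2; apply: (@cvgM _ _ _ _ (fun t => 1 - t) (fun t => 1 - t)); exact: c1t.
  - apply: cvgM; last exact: cvg_cst.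
    apply: cvgM; last exact: cid.
    by apply: cvgM; [exact: cvg_cst|exact: c1t].
  - apply: cvgM; last exact: cvg_cst.
    by rewrite expr2; apply: (@cvgM _ _ _ _ id id); exact: cid.
have [t0 t0i mt0] := EVT_min (@ler01 R) (continuous_subspaceT cf).
pose m := f t0.
have m0 : 0 < m.
  rewrite /m /f -B_seg// lt0r Bn0; last by move: t0i; rewrite in_itv.
  by rewrite (psd_ge0 HB)//; apply: ED; exact: EZ.
pose S := (N a + N b) ^+ 2.
have S0 : 0 <= S by exact: sqr_ge0.
have [C hC] := F_anti ((c2 * S + 1) / m).
exists (`|C| + 1); first by rewrite addr_ge0.
move=> k T TC; have C0 := normr_ge0 C.
apply: joined_line; [exact: HQ|exact: EZ|exact: EZ|] => t /andP[ta tb].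
have -> : (1 - t) *: (T *: a) + t *: (T *: b) = T *: ((1 - t) *: a + t *: b).
  by rewrite scalerDr !scalerA !(mulrC T).
set th := _ + _ : V.
have Eth : E th by apply: ED; exact: EZ.
apply: (le_trans (hC k _ (EZ T Eth))).
rewrite (qnormZ HQ)// ger0_norm; last lra.
rewrite (psd_linZ HB)//; last exact: EZ.
rewrite (psd_linZr HB)//.
have Bm : m <= B th th.
  by rewrite B_seg//; apply: mt0; rewrite in_itv/= ta.
have Ns : N th ^+ 2 <= S.
  rewrite ler_sqr ?nnegrE ?addr_ge0//; apply: (le_trans (qnormD HQ (EZ _ Ea) (EZ _ Eb))).
  rewrite !(qnormZ HQ)// !ger0_norm//; last by rewrite subr_ge0.
  by rewrite lerD// ler_piMl// gerBl.
have T1 : 1 <= T by lra.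
have h1 : c2 * (T ^+ 2 * N th ^+ 2) <= c2 * (T ^+ 2 * S).
  by rewrite ler_wpM2l// ler_wpM2l// sqr_ge0.
have h2 : T ^+ 2 * (c2 * S + 1) <= (c2 * S + 1) / m * (T * (T * B th th)).
  have -> : (c2 * S + 1) / m * (T * (T * B th th)) =
            T ^+ 2 * (c2 * S + 1) * (B th th / m) by rewrite expr2; field; rewrite gt_eqF.
  rewrite ler_peMr//; last by rewrite ler_pdivlMr// mul1r.
  by rewrite mulr_ge0 ?sqr_ge0// addr_ge0// mulr_ge0.
rewrite exprMn.
have h3 : T <= T ^+ 2 by rewrite expr2 ler_peMl//; lra.
have := ler_norm C.
by move: h1 h2 h3; rewrite (_ : T ^+ 2 * (c2 * S + 1) = c2 * (T ^+ 2 * S) + T ^+ 2); [lra|ring].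
Qed.

(** The same estimate as for segments, on a single ray. Since T does not depend on k, it provides an
    endpoint common to all functionals. *)
Lemma far_negative (phi : V) : E phi -> B phi phi != 0 ->
  exists2 T : R, 0 < T & forall k (t : R), T <= t -> F k (t *: phi) < 0.
Proof.
move=> Ep Bn0; have Bp : 0 < B phi phi by rewrite lt0r Bn0 (psd_ge0 HB).
have [C hC] := F_anti ((c2 * N phi ^+ 2 + 1) / B phi phi).
exists (`|C| + 1); first by rewrite ltr_wpDl.
move=> k t tC; apply: (le_lt_trans (hC k _ (EZ t Ep))).
have C0 := normr_ge0 C.
rewrite (qnormZ HQ)// ger0_norm; last lra.
rewrite (psd_linZ HB)//; last exact: EZ.
have := ler_norm C; rewrite (psd_linZr HB)// exprMn (mulrA t t) -expr2.
have -> : (c2 * N phi ^+ 2 + 1) / B phi phi * (t ^+ 2 * B phi phi) =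
  c2 * (t ^+ 2 * N phi ^+ 2) + t ^+ 2 by field; rewrite gt_eqF.
have h3 : t <= t ^+ 2 by rewrite expr2 ler_peMl//; lra.
by move: (c2 * _) => x; lra.
Qed.

Variables (w1 psi : V).
Hypotheses (Ew1 : E w1) (Epsi : E psi).
Hypothesis indep : forall x y : R,
  B (x *: w1 + y *: psi) (x *: w1 + y *: psi) = 0 -> x = 0 /\ y = 0.
Hypothesis w1_neg : forall k (t : R), 1 <= t -> F k (t *: w1) < 0.

(** By Cauchy-Schwarz the cross term vanishes as well, so null vectors of a semidefinite form are
    closed under combinations. *)
Lemma B_comb0 (x y : V) (r s : R) : E x -> E y -> B x x = 0 -> B y y = 0 ->
  B (r *: x + s *: y) (r *: x + s *: y) = 0.
Proof.
move=> Ex Ey x0 y0; rewrite (psd_sqrD HB)// x0 y0.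
have := psd_CS2 HB Ex Ey; rewrite x0 mul0r => h.
have /eqP : B x y ^+ 2 = 0 by apply/eqP; rewrite eq_le h sqr_ge0.
by rewrite sqrf_eq0 => /eqP ->; ring.
Qed.

(** If the segment from w to [w1] contains no null vector of B, dilate it. Otherwise go through
    [psi]: a null vector on the segment from w to [psi] as well would, after elimination of w, give
    a null combination of [w1] and [psi], which independence forces to be trivial, and then w itself
    would be null. *)
Lemma far_joined w : E w -> N w != 0 ->
  exists2 T0 : R, 0 <= T0 & forall k T, T0 <= T ->
    joined E Q (fun w => F k w <= 0) (T *: w) (T *: w1).
Proof.
move=> Ew wn0.
have [h|/existsNP[l /not_implyP[/andP[l0 l1]]]] := pselect (forall t : R, 0 <= t <= 1 ->
    B ((1 - t) *: w + t *: w1) ((1 - t) *: w + t *: w1) != 0).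
  exact: far_segment_joined.
move=> /negP; rewrite negbK => /eqP hl.
have [T1 T10 hT1] : exists2 T0 : R, 0 <= T0 & forall k T, T0 <= T ->
    joined E Q (fun w => F k w <= 0) (T *: psi) (T *: w1).
  apply: far_segment_joined => // t _; apply/eqP; rewrite addrC => /indep[-> /eqP].
  by rewrite subr0 oner_eq0.
have [T2 T20 hT2] : exists2 T0 : R, 0 <= T0 & forall k T, T0 <= T ->
    joined E Q (fun w => F k w <= 0) (T *: w) (T *: psi).
  apply: far_segment_joined => // r _; apply/eqP => hr.
  have Ex : E ((1 - l) *: w + l *: w1) by apply: ED; exact: EZ.
  have Ey : E ((1 - r) *: w + r *: psi) by apply: ED; exact: EZ.
  have := B_comb0 (1 - r) (- (1 - l)) Ex Ey hl hr.
  have -> : (1 - r) *: ((1 - l) *: w + l *: w1) + - (1 - l) *: ((1 - r) *: w + r *: psi)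
    = ((1 - r) * l) *: w1 + (- (1 - l) * r) *: psi.
    rewrite !scalerDr !scalerA addrACA -scalerDl.
    by rewrite mulNr (mulrC (1 - r)) subrr scale0r add0r.
  move=> /indep[/eqP h1 /eqP h2].
  have ln1 : 1 - l != 0.
    apply/eqP => l10; have l1' : l = 1 by lra.
    move: hl; rewrite l1' subrr scale0r scale1r add0r => w10.
    have [] := @indep 1 0; first by rewrite scale1r scale0r addr0.
    by move/eqP; rewrite oner_eq0.
  move: h2; rewrite mulf_eq0 oppr_eq0 (negbTE ln1)/= => /eqP r0.
  move: h1; rewrite r0 subr0 mul1r => /eqP l00.
  move: hl; rewrite l00 subr0 scale1r scale0r addr0 => /B0 => /(_ Ew) w0.
  by rewrite w0 eqxx in wn0.
exists (Num.max T1 T2); first by rewrite le_max T10.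
move=> k T; rewrite ge_max => /andP[h1 h2].
apply: (joined_trans HQ (b := T *: psi)); [exact: hT2|exact: hT1].
Qed.

(** Endpoints are prescribed up to seminorm zero, which is what prescribing functions almost
    everywhere amounts to. *)
Definition mpath g := [/\ cpath E Q g, N (g 0) = 0 & N (g 1 - w1) = 0].

(* Where a path first leaves a large ball, follow the ray, along which F stays below b
   and becomes negative, and return to w1 at negative level. *)
Lemma path_truncation (A : R) : 0 <= A -> exists2 rho : R, 0 < rho &
  forall k (b : R), 0 <= b -> b <= A -> forall g, mpath g ->
  (forall t : R, 0 <= t <= 1 -> N (g t) <= rho -> F k (g t) <= b) ->
  exists2 g', mpath g' & forall t : R, 0 <= t <= 1 ->
    F k (g' t) <= b /\ (F k (g' t) <= 0 \/ N (g' t) <= 2 * rho).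
Proof.
move=> A0; have [rho rho0 ray] := F_ray A0; exists rho => // k b b0 bA g [cg g0 g1] gb.
have [inside|/existsNP[t1 /not_implyP[/andP[t10 t11]]]] :=
  pselect (forall t : R, 0 <= t <= 1 -> N (g t) <= rho).
  exists g => // t ti; split; first by apply: gb => //; exact: inside.
  by right; apply: (le_trans (inside t ti)); lra.
move=> /negP; rewrite -ltNge => gt1.
have g0r : (N \o g) 0 < rho by rewrite /= g0.
have [tau [tau0 taut1 Ntau taul]] := first_hitting_time t10
  (continuous_qnorm_cpath HQ cg) g0r (ltW gt1).
have tau1 : tau <= 1 by exact: le_trans t11.
pose w' := g tau; have Ew' : E w' by exact: cg.1.
have Fw' : F k w' <= b.
  by apply: gb; rewrite ?tau1 ?(ltW tau0)//= -[leLHS]/((N \o g) tau) Ntau.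
have [ray1 ray2] := ray k w' Ew' Ntau (le_trans Fw' bA).
have w'n0 : N w' != 0 by rewrite -[N w']/((N \o g) tau) Ntau gt_eqF.
have [T0 T00 hT] := far_joined Ew' w'n0.
pose T := T0 + 2.
pose S w := F k w <= b /\ (F k w <= 0 \/ N w <= 2 * rho).
have S_neg w : F k w <= 0 -> S w by move=> h; split; [exact: le_trans b0|left].
have EgT : E (T *: w') by exact: EZ.
have J1 : joined E Q S (g 0) w'.
  exists (g \o (fun t => t * tau)); split => /=.
  - by apply: cpath_comp => // t; apply: cvgM; [exact: cvg_id|exact: cvg_cst].
  - by rewrite mul0r.
  - by rewrite mul1r.
  move=> t /andP[ta tb].
  have h0 : 0 <= t * tau by rewrite mulr_ge0// ltW.
  have h1 : t * tau <= tau by rewrite ler_piMl// ltW.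
  have Nr : N (g (t * tau)) <= rho.
    move: h1; rewrite le_eqVlt => /predU1P[->|h1]; first by rewrite -[leLHS]/((N \o g) tau) Ntau.
    exact/ltW/taul.
  split; last by right; lra.
  by apply: gb => //; rewrite h0/=; apply: (le_trans h1).
have J2 : joined E Q S w' (T *: w').
  apply: (joined_line HQ) => // t /andP[ta tb].
  rewrite scalerA -scalerDl; set r := 1 - t + _.
  have r1 : 1 <= r.
    by rewrite /r /T; have := mulr_ge0 ta T00; lra.
  split; first exact: (le_trans (ray1 r r1)).
  (* Origin of the radius 2 rho: from the factor 2 on, the ray is at nonpositive level, and before
     that the norm is at most twice the exit radius. *)
  have [r2|r2] := leP 2 r; first by left; exact: ray2.
  right; rewrite (qnormZ HQ)// ger0_norm; last lra.
  by rewrite -[N w']/((N \o g) tau) Ntau ler_wpM2r// ltW.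
have J3 : joined E Q S (T *: w') (T *: w1).
  have [|g' [h1 h2 h3 h4]] := hT k T; first by rewrite /T; lra.
  by exists g'; split => // t /h4; exact: S_neg.
have J4 : joined E Q S (T *: w1) w1.
  apply: (joined_line HQ) => //; first exact: EZ.
  move=> t /andP[ta tb]; rewrite scalerA -scalerDl; apply/S_neg/ltW/w1_neg.
  by have := mulr_ge0 (_ : 0 <= 1 - t) T00; rewrite /T subr_ge0 tb => /(_ isT); lra.
have [g' [h1 h2 h3 h4]] := joined_trans HQ J1 (joined_trans HQ J2 (joined_trans HQ J3 J4)).
by exists g' => //; split => //; rewrite ?h2// h3 subrr (qnorm0 HQ).
Qed.

Hypothesis F_0 : forall k, F k 0 = 0.

(** The min-max value, characterised by approximation from both sides, so that no supremum along a
    path has to be formed; [mp_levelE] identifies it with [mp_level]. *)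
Definition islevel k (c : R) :=
  (forall g, mpath g -> forall e : R, 0 < e ->
     exists2 t : R, 0 <= t <= 1 & c - e < F k (g t)) /\
  (forall e : R, 0 < e -> exists2 g, mpath g &
     forall t : R, 0 <= t <= 1 -> F k (g t) <= c + e).

Definition critical k w := E w /\ forall h, E h -> L k w h = 0.

Lemma gradient_exists k : exists gam : V -> V, forall w, E w ->
  E (gam w) /\ forall h, E h -> L k w h = Q (gam w) h.
Proof.
have /choice[gam gamP] : forall w, exists r, E w -> E r /\ forall h, E h -> L k w h = Q r h.
  move=> w; have [Ew|nEw] := pselect (E w); last by exists 0.
  have [C CP] := L_bnd k (N w).
  have [r Er rP] := riesz HQ cplQ (Llin k Ew) (fun h Eh => CP w h Ew Eh (lexx _)).
  by exists r.
by exists gam => w Ew; exact: gamP.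
Qed.

Lemma dual_norm_le r (e : R) : E r -> 0 <= e ->
  (forall h, E h -> `|Q r h| <= e * N h) -> N r <= e.
Proof.
move=> Er e0 h; have := h r Er.
rewrite -(qnorm_sqr HQ)// ger0_norm ?sqr_ge0// expr2.
have [->//|n0] := eqVneq (N r) 0.
by rewrite ler_pM2r// lt0r n0 N0.
Qed.

Lemma mono_ge (sigma : nat -> nat) : {homo sigma : i j / (i < j)%N} ->
  forall j, (j <= sigma j)%N.
Proof.
by move=> hs; elim=> // j ih; apply: leq_ltn_trans ih _; exact: hs.
Qed.

(** Only local information at l is used: [F_lip] carries the values and [L_unif] the derivatives
    from the sequence to its limit. *)
Lemma critical_limit k (c : R) (w : nat -> V) l : (forall j, E (w j)) -> E l ->
  N (w j - l) @[j --> \oo] --> (0 : R) ->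
  (forall e : R, 0 < e -> exists j0, forall j, (j0 <= j)%N ->
    `|F k (w j) - c| <= e /\ forall h, E h -> `|L k (w j) h| <= e * N h) ->
  F k l = c /\ critical k l.
Proof.
move=> Ew El wl H.
have wl' (e : R) : 0 < e -> \forall j \near \oo, N (w j - l) <= e.
  move=> e0; have /cvgrPdist_le/(_ e e0) := wl.
  by apply: filterS => j; rewrite sub0r normrN; apply: le_trans; exact: ler_norm.
have nH (e : R) : 0 < e -> \forall j \near \oo,
    `|F k (w j) - c| <= e /\ forall h, E h -> `|L k (w j) h| <= e * N h.
  by move=> /H[j0 hj0]; exists j0.
split.
  apply/eqP; rewrite -subr_eq0 -normr_le0; apply/ler_addgt0Pr => e e0.
  rewrite add0r.
  have [K [d [K0 d0 Kd]]] := F_lip k (N l).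
  have e2 : 0 < e / 2 by rewrite divr_gt0.
  have [j [[[h1 _] h2] h3]] := filter_ex (filterI (filterI (nH _ e2) (wl' d d0))
    (wl' (e / 2 / (K + 1)) (divr_gt0 e2 (ltr_wpDl K0 ltr01)))).
  have := Kd l (w j) El (Ew j) (lexx _) h2 => h4.
  have h5 : K * N (w j - l) <= e / 2.
    apply: (@le_trans _ _ ((K + 1) * N (w j - l))).
      by rewrite ler_wpM2r// lerDl.
    by rewrite mulrC -ler_pdivlMr// ltr_wpDl.
  rewrite (_ : _ - c = (F k (w j) - c) - (F k (w j) - F k l)); last by ring.
  by apply: (le_trans (ler_normB _ _)); lra.
split => // h Eh; apply/eqP; rewrite -normr_le0; apply/ler_addgt0Pr => e e0.
rewrite add0r.
have e2 : 0 < e / 2 / (N h + 1) by rewrite divr_gt0 ?divr_gt0// ltr_wpDl.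
have [d d0 dP] := L_unif k (N l) e2.
have [j [[_ h1] h2]] := filter_ex (filterI (nH _ e2) (wl' d d0)).
have := dP l (w j) h El (Ew j) Eh (lexx _) h2; have := h1 h Eh.
have : e / 2 / (N h + 1) * N h <= e / 2.
  by rewrite mulrAC ler_pdivrMr ?ltr_wpDl// ler_pM2l ?divr_gt0// lerDl.
move=> A1 A2 A3.
rewrite (_ : L k l h = L k (w j) h - (L k (w j) h - L k l h)); last by ring.
by apply: (le_trans (ler_normB _ _)); lra.
Qed.

Lemma harmonic_small (e : R) : 0 < e -> exists j0, forall j, (j0 <= j)%N ->
  (j.+1%:R^-1 : R) <= e.
Proof.
move=> e0; have [j0 _ h] : \forall j \near \oo, (j.+1%:R^-1 : R) < e.
  by apply: (@cvgr_lt _ _ _ _ _ (0 : R)) e0; exact: cvg_harmonic.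
by exists j0 => j /h/ltW.
Qed.

(* Truncated paths are nonnegative only in a fixed ball, on which F is uniformly
   differentiable; so one gradient step of fixed size, cut off below the level c,
   replaces a deformation flow. *)
Lemma mountain_pass_critical k (c : R) : 0 < c -> islevel k c ->
  exists2 w, F k w = c & critical k w.
Proof.
move=> cgt0 [lo up].
have [|rho rho0 trunc] := @path_truncation (c + 1); first by lra.
pose r := 2 * rho.
have [gam gamP] := gradient_exists k.
have [//|nocrit] := pselect (exists2 w, F k w = c & critical k w).
exfalso.
(* The Palais-Smale condition in contrapositive form: without critical points at level c, the
   gradient is bounded away from zero at levels near c inside the ball of radius r. *)
have [d d0 dP] : exists2 d : R, 0 < d & forall w, E w -> N w <= r ->
    `|F k w - c| <= d -> d <= N (gam w).
  have [//|nd] := pselect (exists2 d : R, 0 < d & forall w, E w -> N w <= r ->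
    `|F k w - c| <= d -> d <= N (gam w)).
  exfalso; apply: nocrit.
  have /choice[w wP] : forall j : nat, exists w, [/\ E w, N w <= r,
      `|F k w - c| <= j.+1%:R^-1 & N (gam w) <= j.+1%:R^-1].
    move=> j; have [//|nw] := pselect (exists w, [/\ E w, N w <= r,
      `|F k w - c| <= j.+1%:R^-1 & N (gam w) <= j.+1%:R^-1]).
    exfalso; apply: nd; exists j.+1%:R^-1; first by rewrite invr_gt0 ltr0n.
    move=> w Ew Nw Fw; rewrite leNgt; apply/negP => h; apply: nw.
    by exists w; split => //; exact: ltW.
  have Lw j h : E h -> `|L k (w j) h| <= j.+1%:R^-1 * N h.
    move=> Eh; have [Ew _ _ gw] := wP j; have [Eg gP] := gamP _ Ew.
    rewrite gP//; apply: (le_trans (psd_CS HQ Eg Eh)).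
    by rewrite ler_wpM2r.
  have [||sg [l [hsg El wl]]] := @PS (fun=> k) w r.
  - by move=> j; have [] := wP j.
  - move=> e /harmonic_small[j0 hj]; exists j0 => j jj h Eh.
    by apply: (le_trans (Lw j h Eh)); rewrite ler_wpM2r// hj.
  have [||Fl cl] := @critical_limit k c (w \o sg) l _ El wl.
  - by move=> j /=; have [] := wP (sg j).
  - move=> e /harmonic_small[j0 hj]; exists j0 => j jj.
    have hj' := hj (sg j) (leq_trans jj (mono_ge hsg j)).
    have [_ _ Fw _] := wP (sg j).
    split; first exact: (le_trans Fw).
    by move=> h Eh; apply: (le_trans (Lw (sg j) h Eh)); rewrite ler_wpM2r.
  by exists l.
(* With 2 m <= d the band of levels above c - 2 m lies where the gradient bound holds; with 2 m <= c
   the cut-off vanishes at both ends of the path, where F is at most 0. *)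
pose m := Num.min d c / 2.
have m0 : 0 < m by rewrite divr_gt0// lt_min d0.
have md : 2 * m <= d by rewrite /m mulrC divfK// ge_min lexx.
have mc : 2 * m <= c by rewrite /m mulrC divfK// ge_min lexx orbT.
have d2 : 0 < d / 2 by rewrite divr_gt0.
have [tau tau0 tauP] := F_diff k r d2.
(* A full step lowers F by at least tau d / 2, so it leads from at most c + tau d / 4 to at most c -
   tau d / 4; points below c - m need no step at all. *)
pose e2 := Num.min m (tau * d / 4).
have td : 0 < tau * d by rewrite mulr_gt0.
have e20 : 0 < e2 by rewrite lt_min m0/= divr_gt0.
have e2m : e2 <= m by rewrite ge_min lexx.
have e2t : e2 <= tau * d / 4 by rewrite ge_min lexx orbT.
pose e1 := Num.min e2 1.
have e10 : 0 < e1 by rewrite lt_min e20 ltr01.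
have e12 : e1 <= e2 by rewrite ge_min lexx.
have e11 : e1 <= 1 by rewrite ge_min lexx orbT.
have [g0 mg0 g0P] := up e1 e10.
have [||g mg gP] := @trunc k (c + e1) _ _ g0 mg0 (fun t ti _ => g0P t ti).
- by lra.
- by lra.
have [cg gs gt] := mg; have Eg := cg.1.
pose chi t := clamp01 ((F k (g t) - (c - 2 * m)) / m).
(* A normalised gradient step. The maximum with d keeps the denominator positive and continuous
   along the whole path, and equals the norm of the gradient wherever the cut-off is nonzero. *)
pose a t := - (tau * chi t) / Num.max (N (gam (g t))) d.
have max0 t : 0 < Num.max (N (gam (g t))) d by rewrite lt_max d0 orbT.
have cchi : continuous chi.
  apply: (@continuous_compr R (F k \o g) (fun y => clamp01 ((y - (c - 2 * m)) / m))).
    exact: (continuous_F_cpath cg).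
  apply: (@continuous_compr R (fun y => (y - (c - 2 * m)) / m)); last first.
    exact: continuous_clamp01.
  move=> y; apply: cvgM; last exact: cvg_cst.
  by apply: cvgB; [exact: cvg_id|exact: cvg_cst].
have cgam : cpath E Q (gam \o g).
  split => [t|t] /=; first by have [] := gamP _ (Eg t).
  apply/cvgrPdist_le => e e0; have [d' d'0 d'P] := L_unif k (N (g t)) e0.
  have /cvgrPdist_le/(_ d' d'0) := cg.2 t.
  apply: filterS => s; rewrite !sub0r !normrN !ger0_norm// => gd.
  have [Es sP] := gamP _ (Eg s); have [Et tP] := gamP _ (Eg t).
  apply: dual_norm_le; [exact: EB|exact: ltW|] => h Eh.
  by rewrite (psd_linB HQ)// -sP// -tP//; exact: d'P.
have ca : continuous a.
  move=> t; apply: cvgM.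
    by apply: cvgN; apply: cvgM; [exact: cvg_cst|exact: cchi].
  apply: cvgV; first by rewrite gt_eqF.
  apply: (@continuous_max _ _ (fun t => N (gam (g t))) (fun=> d)).
    exact: (continuous_qnorm_cpath HQ cgam).
  exact: cst_continuous.
pose g1 t := g t + a t *: (gam \o g) t.
have a_low t : F k (g t) <= c - 2 * m -> a t = 0.
  move=> h; rewrite /a /chi clamp01_le0 ?mulr0 ?oppr0 ?mul0r//.
  by rewrite pmulr_lle0 ?invr_gt0// subr_le0.
have mg1 : mpath g1.
  split.
  - by apply: (cpath_add HQ) => //; exact: (cpath_scale HQ).
  - have Fg0 : F k (g 0) = 0.
      by have := F_norm0 k (psd_E0 HQ) (Eg 0) gs; rewrite add0r F_0.
    by rewrite /g1 a_low ?scale0r ?addr0// Fg0; lra.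
  - have Fg1 : F k (g 1) < 0.
      have := F_norm0 k Ew1 (EB (Eg 1) Ew1) gt; rewrite addrC subrK => ->.
      by have := w1_neg k (lexx 1); rewrite scale1r.
    by rewrite /g1 a_low ?scale0r ?addr0//; lra.
have [t ti] := lo g1 mg1 e2 e20.
apply/negP; rewrite -leNgt.
have [Fg FgN] := gP t ti.
have [xlow|xhigh] := leP (F k (g t)) (c - 2 * m).
  by rewrite /g1 a_low// scale0r addr0; lra.
(* At positive level a truncated path lies in the ball. *)
have Nr : N (g t) <= r by case: FgN => //; lra.
have [Egam gamE] := gamP _ (Eg t).
have dG : d <= N (gam (g t)).
  by apply: dP => //; rewrite ler_norml; apply/andP; split; lra.
have /andP[chi0 chi1] : 0 <= chi t <= 1 by exact: clamp01_itv.
have aE : a t = - (tau * chi t) / N (gam (g t)) by rewrite /a max_l.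
have G0 : 0 < N (gam (g t)) by exact: lt_le_trans dG.
have tchi : 0 <= tau * chi t by rewrite mulr_ge0// ltW.
have Nh : N (a t *: gam (g t)) = tau * chi t.
  by rewrite (qnormZ HQ)// aE normrM normfV normrN !ger0_norm ?divfK ?gt_eqF.
have := tauP _ _ (Eg t) (EZ (a t) Egam) Nr.
rewrite Nh => /(_ _)/wrap[]; first by rewrite ler_piMr// ltW.
rewrite gamE; last exact: EZ.
rewrite (psd_linZr HQ)// -(qnorm_sqr HQ)// -/(g1 t).
have -> : a t * N (gam (g t)) ^+ 2 = - (tau * chi t * N (gam (g t))).
  by rewrite aE expr2; field; rewrite gt_eqF.
have hh : tau * chi t * d <= tau * chi t * N (gam (g t)) by rewrite ler_wpM2l.
move=> /ler_normlP[_ est].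
have est2 : F k (g1 t) <= F k (g t) - tau * chi t * d / 2 by lra.
have [xm|xm] := leP (c - m) (F k (g t)).
  have chiE : chi t = 1.
    by rewrite /chi clamp01_ge1// ler_pdivlMr// mul1r; lra.
  by move: est2; rewrite chiE mulr1; lra.
have : 0 <= tau * chi t * d by rewrite mulr_ge0// ltW.
by lra.
Qed.

Lemma line_mpath : mpath (fun t => 0 + t *: (w1 - 0)).
Proof.
have E0 := psd_E0 HQ.
split; first exact: (cpath_line HQ).
- by rewrite scale0r addr0 (qnorm0 HQ).
- by rewrite scale1r subr0 add0r subrr (qnorm0 HQ).
Qed.

(** The level is the infimum of all upper bounds of F along some path. The crossing hypothesis
    bounds these below by b, and the straight line provides one of them. *)
Lemma level_exists k (b : R) :
  (forall g, mpath g -> exists2 t : R, 0 <= t <= 1 & b <= F k (g t)) ->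
  exists2 c : R, b <= c & islevel k c.
Proof.
move=> cross.
pose S := [set M : R | exists2 g, mpath g & forall t : R, 0 <= t <= 1 -> F k (g t) <= M].
have lbS M : S M -> b <= M.
  by move=> [g mg gM]; have [t ti bt] := cross g mg; apply: (le_trans bt); exact: gM.
have hS : has_inf S.
  split; last by exists b.
  have [cl _ _] := line_mpath.
  have [t0 _ tm] := EVT_max (@ler01 R) (continuous_subspaceT (@continuous_F_cpath k _ cl)).
  exists (F k (0 + t0 *: (w1 - 0))); exists (fun t => 0 + t *: (w1 - 0)).
    exact: line_mpath.
  by move=> t ti; apply: tm; rewrite in_itv.
exists (inf S); first by apply: lb_le_inf => //; exact: hS.1.
split=> [g mg e e0|e e0].
  have [//|nt] := pselect (exists2 t : R, 0 <= t <= 1 & inf S - e < F k (g t)).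
  have : S (inf S - e).
    exists g => // t ti; rewrite leNgt; apply/negP => h; apply: nt; by exists t.
  by move=> /(ge_inf hS.2); rewrite lerBrDl gerDr leNgt e0.
have [M [g mg gM] Me] := inf_adherent e0 hS.
by exists g => // t /gM h; apply: (le_trans h); exact: ltW.
Qed.

(** An almost optimal path for F 0 is bounded, so F k is close to F 0 along it, whence the upper
    bound for c k. Almost optimal paths for F k have no common bound; each is truncated with respect
    to F 0, and the comparison of F 0 with F k is needed only in the ball of truncation. *)
Lemma levels_converge (c : nat -> R) k0 :
  (forall k, k = 0%N \/ (k0 <= k)%N -> islevel k (c k) /\ 0 <= c k) ->
  forall e : R, 0 < e -> exists k1, forall k, (k1 <= k)%N -> `|c k - c 0%N| <= e.
Proof.
move=> lev e e0.
have [[lo0 up0] c00] := lev 0%N (or_introl erefl).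
pose d := Num.min (e / 4) 1.
have d0 : 0 < d by rewrite lt_min ltr01 andbT divr_gt0.
have de : d <= e / 4 by rewrite ge_min lexx.
have d1 : d <= 1 by rewrite ge_min lexx orbT.
have [g [cg g0 g1] gP] := up0 d d0.
have [t0 _ tm] := EVT_max (@ler01 R) (continuous_subspaceT (continuous_qnorm_cpath HQ cg)).
have [kA hA] := F_cvg (N (g t0)) d0.
have upper k : (k0 <= k)%N -> (kA <= k)%N -> c k <= c 0%N + 3 * d.
  move=> kk0 kkA; have [[lok _] _] := lev k (or_intror kk0).
  have [t ti ht] := lok g (And3 cg g0 g1) d d0.
  have Ng : N (g t) <= N (g t0) by apply: tm; rewrite in_itv.
  have := hA k kkA _ (cg.1 t) Ng; have := gP t ti.
  by move=> h1 /ler_normlP[_ h2]; lra.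
(* Truncation happens at the level c k + 2 d, which is at most c 0 + 5 d by [upper], and d <= 1. *)
have [|rho rho0 trunc] := @path_truncation (c 0%N + 5); first by lra.
have [kB hB] := F_cvg rho d0.
exists (maxn k0 (maxn kA kB)) => k; rewrite !geq_max => /and3P[kk0 kkA kkB].
have u := upper k kk0 kkA.
rewrite ler_norml; apply/andP; split; last lra.
have [[_ upk] ck0] := lev k (or_intror kk0).
have [g' mg' g'P] := upk d d0.
have [|||g2 mg2 g2P] := @trunc 0%N (c k + 2 * d) _ _ g' mg'.
- by lra.
- by lra.
- move=> t ti Nt; have := hB k kkB _ (let: And3 c _ _ := mg' in c.1 t) Nt.
  by have := g'P t ti => h1 /ler_normlP[h2 h3]; lra.
have [t ti ht] := lo0 g2 mg2 d d0.
by have [h _] := g2P t ti; lra.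
Qed.

(** A diagonal choice: the j-th point is critical for some F k with k >= j and lies within 1 / (j +
    1) of w. On bounded sets F k and L k are uniformly close to F 0 and L 0, so these points are
    almost critical for F 0. *)
Lemma critical_cluster (c : nat -> R) w : E w ->
  (forall e : R, 0 < e -> exists k1, forall k, (k1 <= k)%N -> `|c k - c 0%N| <= e) ->
  (forall e : R, 0 < e -> forall j, exists k s, [/\ (j <= k)%N, N (s - w) <= e,
     F k s = c k & critical k s]) ->
  F 0 w = c 0%N /\ critical 0 w.
Proof.
move=> Ew cc cl.
have /choice[s sP] : forall j : nat, exists s, exists k, [/\ (j <= k)%N,
    N (s - w) <= j.+1%:R^-1, F k s = c k & critical k s].
  move=> j; have [|k [s h]] := cl j.+1%:R^-1 _ j; first by rewrite invr_gt0 ltr0n.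
  by exists s, k.
have Es j : E (s j) by have [k [_ _ _ []]] := sP j.
apply: (@critical_limit 0%N (c 0%N) s w Es Ew).
  apply/cvgrPdist_le => e /harmonic_small[j0 hj]; exists j0 => // j /= jj.
  rewrite sub0r normrN ger0_norm//; have [k [_ h _ _]] := sP j.
  by apply: (le_trans h); exact: hj.
move=> e e0; have e2 : 0 < e / 2 by rewrite divr_gt0.
have [k1 h1] := cc (e / 2) e2.
have [k2 h2] := F_cvg (N w + 1) e2.
have [k3 h3] := L_cvg (N w + 1) e0.
exists (maxn k1 (maxn k2 k3)) => j; rewrite !geq_max => /and3P[jk1 jk2 jk3].
have [k [jk Ns Fs [_ Ls]]] := sP j.
have Nsj : N (s j) <= N w + 1.
  rewrite -(subrK w (s j)); apply: (le_trans (qnormD HQ (EB (Es j) Ew) Ew)).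
  rewrite addrC lerD2l; apply: (le_trans Ns).
  by rewrite invf_le1 ?ltr0n// ler1n.
split.
  have := h2 k (leq_trans jk2 jk) _ (Es j) Nsj; have := h1 k (leq_trans jk1 jk).
  rewrite Fs => A1 A2.
  rewrite (_ : _ - _ = (c k - c 0%N) - (c k - F 0%N (s j))); last by ring.
  by apply: (le_trans (ler_normB _ _)); lra.
move=> h Eh; have := h3 k (leq_trans jk3 jk) _ _ (Es j) Eh Nsj.
by rewrite Ls// sub0r normrN.
Qed.

(** At a critical point [F_AR] reads c1 N^2 <= p F + C1, so a bound on the levels bounds the norms
    and the Palais-Smale condition applies, whatever the indices are. *)
Lemma critical_compact (K : R) (kk : nat -> nat) (w : nat -> V) :
  (forall j, critical (kk j) (w j)) -> (forall j, F (kk j) (w j) <= K) ->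
  exists (sigma : nat -> nat) (l : V), [/\ {homo sigma : i j / (i < j)%N}, E l &
    N (w (sigma j) - l) @[j --> \oo] --> (0 : R)].
Proof.
move=> crit FK; apply: (@PS kk w ((`|p * K| + C1) / c1 + 1)).
  move=> j; have [Ew Lw] := crit j; split => //.
  have := F_AR (kk j) Ew; rewrite Lw// => h.
  have h2 : p * F (kk j) (w j) <= p * K by rewrite ler_wpM2l// ltW.
  have h3 : N (w j) ^+ 2 <= (`|p * K| + C1) / c1.
    rewrite ler_pdivlMr// mulrC; have := ler_norm (p * K); lra.
  have q0 := le_trans (sqr_ge0 _) h3.
  have [Nl|Ng] := leP (N (w j)) 1; first by apply: (le_trans Nl); rewrite lerDr.
  apply: (@le_trans _ _ (N (w j) ^+ 2)); last by apply: (le_trans h3); rewrite lerDl.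
  by rewrite expr2 ler_peMl// ltW.
move=> e e0; exists 0%N => j _ h Eh; have [_ Lw] := crit j.
by rewrite Lw// normr0 mulr_ge0// ltW.
Qed.

End mountain_pass.

(** * Superquadratic nonlinearities *)

Section powR_lemmas.
Variable R : realType.
Implicit Types x y z e : R.

Lemma powR_mono (q : R) x y : 0 <= q -> 0 <= x -> x <= y -> x `^ q <= y `^ q.
Proof.
by move=> q0 x0 xy; apply: ge0_ler_powR => //; rewrite nnegrE// (le_trans x0).
Qed.

Lemma powR_absorb (q1 q2 e : R) : 0 <= q1 -> q1 < q2 -> 0 < e ->
  exists2 C : R, 0 <= C & forall y, 0 <= y -> y `^ q1 <= e * y `^ q2 + C.
Proof.
move=> q10 q12 e0; have q0 : 0 < q2 - q1 by rewrite subr_gt0.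
pose Y := (e^-1) `^ (q2 - q1)^-1.
have Y0 : 0 < Y by rewrite powR_gt0// invr_gt0.
have YE : Y `^ (q2 - q1) = e^-1.
  by rewrite /Y -powRrM mulVf ?gt_eqF// powRr1// invr_ge0 ltW.
exists (Y `^ q1 + 1); first by rewrite addr_ge0// powR_ge0.
move=> y y0; have [yY|Yy] := leP y Y.
  have := powR_mono q10 y0 yY; have := mulr_ge0 (ltW e0) (powR_ge0 y q2); lra.
have yp : 0 < y by exact: lt_trans Yy.
have -> : y `^ q2 = y `^ q1 * y `^ (q2 - q1).
  by rewrite -powRD ?(gt_eqF yp) ?implybT// addrC subrK.
have h : e^-1 <= y `^ (q2 - q1) by rewrite -YE powR_mono// ltW.
have : y `^ q1 <= e * (y `^ q1 * y `^ (q2 - q1)).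
  rewrite mulrCA ler_peMr ?powR_ge0//.
  by rewrite mulrC -ler_pdivrMr// mul1r.
by have := powR_ge0 Y q1; lra.
Qed.

Lemma powR_le1D (q1 q2 : R) y : 0 <= q1 -> q1 <= q2 -> 0 <= y ->
  y `^ q1 <= 1 + y `^ q2.
Proof.
move=> q10 q12 y0; have [y1|y1] := leP y 1.
  have := powR_mono q10 y0 y1; rewrite powR1 => h.
  by apply: (le_trans h); rewrite lerDl powR_ge0.
have := ler_powR (ltW y1) q12 => h; apply: (le_trans h); rewrite lerDr; exact: ler01.
Qed.

Lemma sqr_powR y : 0 <= y -> y ^+ 2 = y `^ 2.
Proof. by move=> y0; rewrite -powR_mulrn. Qed.

Lemma sqr_le1D (q : R) y : 2 <= q -> 0 <= y -> y ^+ 2 <= 1 + y `^ q.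
Proof. by move=> q2 y0; rewrite sqr_powR// powR_le1D. Qed.

Lemma id_le1D (q : R) y : 1 <= q -> 0 <= y -> y <= 1 + y `^ q.
Proof. by move=> q2 y0; rewrite -{1}(powRr1 y0) powR_le1D. Qed.

Lemma young_powR (q : R) x y : 1 <= q -> 0 <= x -> 0 <= y ->
  x `^ (q - 1) * y <= x `^ q + y `^ q.
Proof.
move=> q1 x0 y0; have q0 : 0 < q by exact: lt_le_trans q1.
have q10 : 0 <= q - 1 by rewrite subr_ge0.
have [xy|yx] := leP x y.
  apply: (@le_trans _ _ (y `^ q)); last by rewrite lerDr powR_ge0.
  rewrite -(mulr_powRB1 y0 q0) mulrC ler_wpM2l//; exact: powR_mono.
apply: (@le_trans _ _ (x `^ q)); last by rewrite lerDl powR_ge0.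
by rewrite -(mulr_powRB1 x0 q0) mulrC ler_wpM2r ?powR_ge0// ltW.
Qed.

Lemma powRD_le (q : R) x y : 0 <= q -> 0 <= x -> 0 <= y ->
  (x + y) `^ q <= 2 `^ q * (x `^ q + y `^ q).
Proof.
move=> q0; wlog xy : x y / x <= y.
  move=> H x0 y0; have [xy|yx] := leP x y; first exact: H.
  by rewrite addrC (addrC (x `^ q)); apply: H => //; exact: ltW.
move=> x0 y0; apply: (@le_trans _ _ ((2 * y) `^ q)).
  by apply: powR_mono => //; [exact: addr_ge0|lra].
by rewrite powRM// ler_wpM2l ?powR_ge0// lerDr powR_ge0.
Qed.

Lemma young2 (e : R) x y : 0 < e -> x * y <= e * y ^+ 2 + x ^+ 2 / e.
Proof.
move=> e0; have := sqr_ge0 (e * y - x / 2).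
have xe : 0 <= x ^+ 2 / e by rewrite divr_ge0 ?sqr_ge0 ?ltW.
move=> h.
have : 0 <= e * (e * y ^+ 2 + x ^+ 2 / e - x * y).
  rewrite mulrBr mulrDr (_ : e * (x ^+ 2 / e) = x ^+ 2); last by field; rewrite gt_eqF.
  have := sqr_ge0 x; move: h; rewrite !expr2; lra.
by rewrite pmulr_rge0// subr_ge0.
Qed.

(** The place where the gap between s and s1 pays: x^(s-1) is absorbed into a small multiple of
    x^(s1-1), which is paired with y by Young's inequality; the remaining constant times y goes into
    y^2. *)
Lemma subcritical_young (s s1 e : R) : 2 <= s -> s < s1 -> 0 < e ->
  exists2 C : R, 0 <= C & forall x y, 0 <= x -> 0 <= y ->
    (1 + x `^ (s - 1)) * y <= e * (1 + x `^ s1 + y `^ s1) + C * y ^+ 2.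
Proof.
move=> s2 ss1 e0.
have s10 : 0 <= s - 1 by lra.
have ss11 : s - 1 < s1 - 1 by lra.
have [A A0 hA] := powR_absorb s10 ss11 e0.
exists ((1 + A) ^+ 2 / e); first by rewrite divr_ge0 ?sqr_ge0 ?ltW.
move=> x y x0 y0.
apply: (@le_trans _ _ (e * (x `^ (s1 - 1) * y) + (1 + A) * y)).
  rewrite mulrA -mulrDl ler_wpM2r//; have := hA x x0; lra.
have s11 : 1 <= s1 by lra.
have h1 : e * (x `^ (s1 - 1) * y) <= e * (x `^ s1 + y `^ s1).
  by rewrite ler_wpM2l ?(ltW e0)// young_powR.
have ei : 0 < e^-1 by rewrite invr_gt0.
have h2 : (1 + A) * y <= e + (1 + A) ^+ 2 / e * y ^+ 2.
  have := young2 1 ((1 + A) * y) ei; rewrite mul1r expr1n exprMn invrK.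
  by rewrite (mulrC e^-1) mul1r mulrAC => h; lra.
by move: h1 h2; rewrite !mulrDr mulr1; lra.
Qed.

(** For n > 0 take l = 1 / n. For n = 0, which a seminorm allows for a nonzero vector, every l is
    admissible and x must vanish. *)
Lemma scale_bound (x n e : R) : 0 <= x -> 0 <= n -> 0 <= e ->
  (forall l, 0 < l -> l * n <= 1 -> l * x <= e) -> x <= e * n.
Proof.
move=> x0 n0 e0 H; have [nE|nn0] := eqVneq n 0.
  rewrite nE mulr0 leNgt; apply/negP => xp.
  have := H ((e + 1) / x); rewrite nE mulr0 divfK ?gt_eqF// ler01.
  move=> /(_ _ isT); rewrite divr_gt0// ?ltr_wpDl// => /(_ isT); lra.
have np : 0 < n by rewrite lt0r nn0.
by have := H n^-1; rewrite invr_gt0 mulVf// lexx mulrC ler_pdivrMr// => /(_ np isT).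
Qed.

Lemma MVT_abs (f df : R -> R) (a b : R) : (forall z, is_derive z (1 : R) f (df z)) ->
  exists2 xi, `|xi - a| <= `|b - a| & f b - f a = df xi * (b - a).
Proof.
move=> dfP.
have cf : continuous f.
  by move=> x; apply: differentiable_continuous; apply/derivable1_diffP; case: (dfP x).
have [ab|ba|->] := ltgtP a b; last by exists b; rewrite ?subrr ?mulr0.
  have [c] := @MVT _ f df a b ab (fun x _ => dfP x) (continuous_subspaceT cf).
  rewrite in_itv/= => /andP[c1 c2] e; exists c => //.
  by rewrite (@ger0_norm _ (c - a)) ?(@ger0_norm _ (b - a)); lra.
have [c] := @MVT _ f df b a ba (fun x _ => dfP x) (continuous_subspaceT cf).
rewrite in_itv/= => /andP[c1 c2] e; exists c => //.
  by rewrite (@ler0_norm _ (c - a)) ?(@ler0_norm _ (b - a)); lra.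
by rewrite -opprB e; ring.
Qed.

End powR_lemmas.

(* AR stands for Ambrosetti-Rabinowitz *)
Section pointwise.
Variables (R : realType) (s Cg p a r : R).
Hypotheses (s2 : 2 < s) (Cg0 : 0 <= Cg) (p2 : 2 < p) (a0 : 0 < a) (r0 : 0 < r).

Definition AR_nonlinearity (g gz : R -> R) :=
  [/\ forall z, is_derive z (1 : R) g (gz z),
      forall z, `|g z| <= Cg * (1 + `|z| `^ s),
      forall z, `|gz z| <= Cg * (1 + `|z| `^ (s - 1)) &
      forall z, r <= `|z| -> a < p * g z /\ p * g z <= z * gz z].

Lemma AR_nonlinearity_opp g gz : AR_nonlinearity g gz ->
  AR_nonlinearity (fun z => g (- z)) (fun z => - gz (- z)).
Proof.
move=> [h1 h2 h3 h4]; split => z.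
- have h : is_derive z (1 : R) (fun z : R => - z) (-1).
    by have := is_deriveN (is_derive_id z (1 : R)).
  by have := is_derive1_comp (h1 (- z)) h; rewrite mulrN1.
- by rewrite -(normrN z).
- by rewrite normrN -(normrN z).
- by rewrite -(normrN z) => /h4; rewrite mulNr mulrN.
Qed.

(** Integration of the logarithmic derivative: beyond r the condition makes ln g - p ln
    nondecreasing, and g r exceeds a / p. *)
Lemma AR_power_growth g gz : AR_nonlinearity g gz -> forall z, r <= z ->
  a / p * (z / r) `^ p <= g z.
Proof.
move=> [dg _ _ AR] z rz.
have hs2 := s2; have hp2 := p2; have hr0 := r0; have ha0 := a0; have hCg := Cg0.
have p0 : 0 < p by lra.
have gpos t : r <= t -> a / p < g t.
  move=> rt; have t0 : 0 < t by lra.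
  have [] := AR t; first by rewrite ger0_norm// ltW.
  by rewrite ltr_pdivrMr// mulrC.
have ap0 : 0 < a / p by rewrite divr_gt0.
pose H t := ln (g t) - p * ln t.
have dH t : r <= t -> is_derive t (1 : R) H (gz t / g t - p / t).
  move=> rt; have t0 : 0 < t by lra.
  have g0 : 0 < g t by apply: lt_trans (gpos t rt).
  have d1 : is_derive t (1 : R) (@ln R \o g) ((g t)^-1 * gz t).
    by apply: is_derive1_comp => //; exact: is_derive1_ln.
  have d2 : is_derive t (1 : R) (fun t => p * ln t) (p * t^-1).
    have := @is_deriveZ _ _ _ (@ln R) p t (1 : R) t^-1 (is_derive1_ln t0).
    exact.
  by have := is_deriveB d1 d2; rewrite mulrC.
have Hle : H r <= H z.
  move: rz; rewrite le_eqVlt => /predU1P[->//|rz].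
  have [||c] := @MVT _ H (fun t => gz t / g t - p / t) r z rz.
  - by move=> x; rewrite in_itv/= => /andP[/ltW rx _]; exact: dH.
  - apply: derivable_within_continuous => x; rewrite in_itv/= => /andP[rx _].
    by case: (dH x rx).
  rewrite in_itv/= => /andP[/ltW rc _] e.
  rewrite -subr_ge0 e mulr_ge0//; last by rewrite subr_ge0 ltW.
  have c0 : 0 < c by lra.
  have [_ ARc] := AR c (le_trans rc (ler_norm c)).
  have gc0 : 0 < g c by apply: lt_trans (gpos c rc).
  by rewrite subr_ge0 ler_pdivrMr// mulrAC ler_pdivlMr// (mulrC (gz c)).
have z0 : 0 < z by lra.
have gz0 : 0 < g z by apply: lt_trans (gpos z rz).
have gr0 : 0 < g r by apply: lt_trans (gpos r (lexx r)).
have zr0 : 0 < z / r by rewrite divr_gt0.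
apply: (@le_trans _ _ (g r * (z / r) `^ p)).
  by rewrite ler_wpM2r ?powR_ge0// ltW// gpos.
rewrite -ler_ln ?posrE ?mulr_gt0 ?powR_gt0//.
rewrite lnM ?posrE ?powR_gt0// ln_powR ln_div ?posrE//.
by move: Hle; rewrite /H; lra.
Qed.

(** Power growth with exponent p > 2 beats any quadratic; negative z follow by reflection. The
    constant is chosen before g, so it is the same for all k and all points of the domain. *)
Lemma AR_superquadratic M : exists2 C : R, 0 <= C & forall g gz,
  AR_nonlinearity g gz -> forall z, M * z ^+ 2 - C <= g z.
Proof.
have hs2 := s2; have hp2 := p2; have hr0 := r0; have ha0 := a0; have hCg := Cg0.
have p0 : 0 < p by lra.
have ap0 : 0 < a / p by rewrite divr_gt0.
pose K := a / p * (r^-1) `^ p.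
have K0 : 0 < K by rewrite mulr_gt0// powR_gt0// invr_gt0.
have M0 : 0 < `|M| + 1 by rewrite ltr_wpDl.
have [C C0 hC] := powR_absorb (ler0n R 2) p2 (divr_gt0 K0 M0).
exists ((`|M| + 1) * C + Cg * (1 + r `^ s) + (`|M| + 1) * r ^+ 2).
  by rewrite !addr_ge0// mulr_ge0 ?(ltW M0) ?sqr_ge0// addr_ge0// powR_ge0.
move=> g gz AR z.
have MM x : 0 <= x -> M * x <= (`|M| + 1) * x.
  by move=> x0; rewrite ler_wpM2r//; have := ler_norm M; lra.
have c1 : 0 <= Cg * (1 + r `^ s) by rewrite mulr_ge0// addr_ge0// powR_ge0.
have c2 : 0 <= (`|M| + 1) * r ^+ 2 by rewrite mulr_ge0 ?(ltW M0) ?sqr_ge0.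
have c3 : 0 <= (`|M| + 1) * C by rewrite mulr_ge0 ?(ltW M0).
have [zr|zr] := leP `|z| r.
  have [_ h _ _] := AR.
  have h1 : `|g z| <= Cg * (1 + r `^ s).
    apply: (le_trans (h z)); rewrite ler_wpM2l// lerD2l powR_mono//; lra.
  have h2 : (`|M| + 1) * z ^+ 2 <= (`|M| + 1) * r ^+ 2.
    rewrite ler_wpM2l ?(ltW M0)// -(real_normK (num_real z)).
    by rewrite ler_sqr ?nnegrE ?(ltW r0).
  have := MM _ (sqr_ge0 z); move: h1; rewrite ler_norml => /andP[h1 _]; lra.
have big : a / p * (`|z| / r) `^ p <= g z.
  have [z0|z0] := leP 0 z.
    by rewrite ger0_norm//; apply: (AR_power_growth AR); move: zr; rewrite ger0_norm// => /ltW.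
  have := AR_power_growth (AR_nonlinearity_opp AR) (z := - z); rewrite opprK ltr0_norm//.
  by apply; move: zr; rewrite ltr0_norm// => /ltW.
have := hC `|z| (normr_ge0 z); rewrite -sqr_powR// real_normK ?num_real// => h.
have e1 : (`|M| + 1) * (K / (`|M| + 1) * `|z| `^ p) = a / p * (`|z| / r) `^ p.
  rewrite powRM ?invr_ge0 ?(ltW r0)// /K; field.
  by rewrite !gt_eqF.
have h1 : (`|M| + 1) * z ^+ 2 <= a / p * (`|z| / r) `^ p + (`|M| + 1) * C.
  by rewrite -e1 -mulrDr ler_wpM2l ?(ltW M0).
by have := MM _ (sqr_ge0 z); lra.
Qed.

(** The nonlinearity is evaluated at z = w + v but tested with w = z - v, so the
    Ambrosetti-Rabinowitz condition has to survive a shift. If |v| <= e |z| the loss is the fraction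
    e of z g'(z), paid by lowering p to p' = p (1 - e) > 2; if |v| is larger, the growth bounds give
    an error in v alone. *)
Lemma AR_shift : exists p' C : R, [/\ 2 < p', 0 <= C & forall g gz,
  AR_nonlinearity g gz -> forall z v,
  - (C * (1 + `|v| `^ s)) <= gz z * (z - v) - p' * g z].
Proof.
have hs2 := s2; have hp2 := p2; have hr0 := r0; have ha0 := a0; have hCg := Cg0.
have p0 : 0 < p by lra.
pose e := (p - 2) / (2 * p); have e0 : 0 < e by rewrite divr_gt0 ?mulr_gt0//; lra.
pose p' := (p + 2) / 2.
have pe : p * (1 - e) = p' by rewrite /e /p'; field; rewrite gt_eqF.
have s1 : 1 <= s by lra. have s10 : 0 <= s - 1 by lra. have s0 : 0 < s by lra.
pose k1 := Cg * (1 + r `^ (s - 1)) * (r + 1) + p' * (Cg * (1 + r `^ s)).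
pose k2 := Cg * (1 + (e^-1) `^ (s - 1)).
have p'0 : 0 < p' by rewrite /p'; lra.
have k10 : 0 <= k1.
  by rewrite addr_ge0 ?mulr_ge0 ?addr_ge0 ?powR_ge0// ltW.
have k20 : 0 <= k2 by rewrite mulr_ge0 ?addr_ge0 ?powR_ge0.
exists p', (2 * k1 + k2 * 2); split; [by rewrite /p'; lra|lra|].
move=> g gz [_ gb gzb AR] z v.
have vs := powR_ge0 `|v| s.
have v1 : `|v| <= 1 + `|v| `^ s by exact: id_le1D.
have [zr|zr] := leP `|z| r.
  have h1 : `|gz z| <= Cg * (1 + r `^ (s - 1)).
    by apply: (le_trans (gzb z)); rewrite ler_wpM2l// lerD2l powR_mono.
  have h2 : `|g z| <= Cg * (1 + r `^ s).
    by apply: (le_trans (gb z)); rewrite ler_wpM2l// lerD2l powR_mono// ltW.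
  have h3 : `|z - v| <= (r + 1) * (2 * (1 + `|v| `^ s)).
    apply: (le_trans (ler_normB _ _)).
    have : 0 <= r * `|v| `^ s by rewrite mulr_ge0// ltW.
    by lra.
  have h4 : `|gz z * (z - v) - p' * g z| <= k1 * (2 * (1 + `|v| `^ s)).
    apply: (le_trans (ler_normB _ _)); rewrite (normrM (gz z)) (normrM p') (ger0_norm (ltW p'0)) mulrDl.
    apply: lerD; first by rewrite -mulrA ler_pM.
    rewrite -mulrA ler_wpM2l ?(ltW p'0)//; apply: (le_trans h2).
    by rewrite ler_peMr//; [rewrite mulr_ge0// addr_ge0// powR_ge0|lra].
  move: h4; rewrite ler_norml => /andP[h4 _]; apply: le_trans h4.
  have := mulr_ge0 k20 vs; rewrite lerN2; lra.
have [ARa ARz] := AR z (ltW zr).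
have gp : 0 < g z by rewrite -(pmulr_rgt0 _ p0); lra.
have zgz : 0 < z * gz z by lra.
have rhs0 : - ((2 * k1 + k2 * 2) * (1 + `|v| `^ s)) <= 0.
  by rewrite oppr_le0 mulr_ge0//; lra.
have [ve|ve] := leP `|v| (e * `|z|).
  apply: (le_trans rhs0).
  have h1 : `|gz z * v| <= e * (z * gz z).
    rewrite normrM mulrC -(ger0_norm (ltW zgz)) normrM mulrA.
    by rewrite ler_wpM2r.
  have h2 : gz z * v <= e * (z * gz z) by apply: le_trans h1; exact: ler_norm.
  have h3 : (1 - e) * (p * g z) <= (1 - e) * (z * gz z).
    by rewrite ler_wpM2l// -(pmulr_rge0 _ p0) pe ltW.
  have h4 : p' * g z = (1 - e) * (p * g z) by rewrite -pe; ring.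
  by rewrite mulrBr h4; lra.
have zv : `|z| <= `|v| * e^-1 by rewrite ler_pdivlMr// mulrC ltW.
have h1 : `|gz z * v| <= k2 * (2 * (1 + `|v| `^ s)).
  rewrite normrM.
  apply: (@le_trans _ _ (Cg * (1 + (`|v| * e^-1) `^ (s - 1)) * `|v|)).
    rewrite ler_wpM2r//; apply: (le_trans (gzb z)).
    by rewrite ler_wpM2l// lerD2l powR_mono.
  rewrite powRM ?invr_ge0 ?(ltW e0)//.
  have h2 : `|v| `^ (s - 1) * `|v| = `|v| `^ s by rewrite mulrC mulr_powRB1.
  rewrite /k2 -!mulrA ler_wpM2l// mulrDl mul1r mulrAC h2.
  have h3 := powR_ge0 e^-1 (s - 1).
  have := mulr_ge0 h3 vs.
  by move: (e^-1 `^ _) h3 => x; lra.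
have h2 : - `|gz z * v| <= - (gz z * v) by rewrite lerN2 ler_norm.
have h3 : p' * g z <= p * g z by rewrite ler_wpM2r ?(ltW gp)// /p'; lra.
have := mulr_ge0 k10 (addr_ge0 ler01 vs).
by rewrite mulrBr (mulrC (gz z) z); lra.
Qed.

End pointwise.

(** At z = v0 the hypothesis forces g v0 = - c/2 v0^2. For |w + v0| <= zeta the quadratic terms then
    combine to at most -(c - b)/2 w^2 <= 0. Otherwise |w| >= zeta - zeta' > 0, and every term is
    dominated by a multiple of |w|^s. *)
Lemma near_zero_bound (R : realType) (s Cg c b zeta zeta' : R) :
  2 < s -> 0 <= Cg -> 0 < c -> 0 < b -> b < c / 2 -> 0 < zeta -> zeta' < zeta ->
  exists2 C : R, 0 <= C & forall (g : R -> R) (v0 : R), `|v0| <= zeta' ->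
  (forall z, `|g z| <= Cg * (1 + `|z| `^ s)) ->
  (forall z, `|z| <= zeta -> `|g z + c / 2 * z ^+ 2| <= b / 2 * `|z - v0| ^+ 2) ->
  forall w, g (w + v0) - g v0 + c * v0 * w <= C * `|w| `^ s.
Proof.
move=> s2 Cg0 c0 b0 bc z0 zz; pose d := zeta - zeta'.
have d0 : 0 < d by rewrite subr_gt0.
have s0 : 0 <= s by lra.
pose k := (1 + zeta / d) `^ s.
pose ds := d^-1 `^ s.
have k0 : 0 <= k by exact: powR_ge0.
have ds0 : 0 <= ds by exact: powR_ge0.
exists (Cg * (ds + k) + c * (zeta ^+ 2 * ds) + c * zeta * (d * ds)).
  have c00 := ltW c0; have z00 := ltW z0; have d00 := ltW d0.
  by rewrite !addr_ge0// !mulr_ge0// ?addr_ge0// sqr_ge0.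
move=> g v0 v0z gb gn w.
have gv0 : g v0 = - (c / 2 * v0 ^+ 2).
  have := gn v0; rewrite subrr normr0 expr0n mulr0 normr_le0 => /(_ _)/wrap[]; first lra.
  by move=> /eqP; lra.
have ws := powR_ge0 `|w| s.
have [small|big] := leP `|w + v0| zeta.
  have := gn _ small; rewrite addrK ler_norml real_normK ?num_real// => /andP[_ h].
  have w0 : 0 <= (c - b) * w ^+ 2 by rewrite mulr_ge0 ?sqr_ge0//; lra.
  have : 0 <= (Cg * (ds + k) + c * (zeta ^+ 2 * ds) + c * zeta * (d * ds)) * `|w| `^ s.
    have c00 := ltW c0; have z00 := ltW z0; have d00 := ltW d0.
    by rewrite mulr_ge0// !addr_ge0// !mulr_ge0// ?addr_ge0// sqr_ge0.
  rewrite gv0; move: h w0; rewrite !expr2; lra.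
have dw : d <= `|w|.
  by have := ler_normD w v0; rewrite /d; lra.
have w0 : 0 < `|w| by apply: lt_le_trans dw.
have one : 1 <= ds * `|w| `^ s.
  rewrite /ds -powRM ?invr_ge0 ?(ltW d0)//.
  have h : 1 <= d^-1 * `|w| by rewrite mulrC ler_pdivlMr// mul1r.
  by have := powR_mono s0 ler01 h; rewrite powR1.
have wle : `|w| <= d * ds * `|w| `^ s.
  have e1 : `|w| `^ s = `|w| * `|w| `^ (s - 1) by rewrite mulr_powRB1//; lra.
  have e2 : ds = d^-1 * d^-1 `^ (s - 1) by rewrite /ds mulr_powRB1// ?invr_ge0 ?(ltW d0)//; lra.
  rewrite e1 e2 (_ : d * _ * _ = `|w| * (d^-1 `^ (s - 1) * `|w| `^ (s - 1))); last first.
    by field; rewrite gt_eqF.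
  rewrite ler_peMr// -powRM ?invr_ge0 ?(ltW d0)//.
  have h : 1 <= d^-1 * `|w| by rewrite mulrC ler_pdivlMr// mul1r.
  have s10 : 0 <= s - 1 by lra.
  by have := powR_mono s10 ler01 h; rewrite powR1.
have v0zeta : `|v0| <= zeta by lra.
have h1 : `|g (w + v0)| <= Cg * (ds + k) * `|w| `^ s.
  apply: (le_trans (gb _)); rewrite -mulrA ler_wpM2l// mulrDl lerD//.
  rewrite /k -powRM//; last by rewrite addr_ge0// divr_ge0 ?ltW.
  apply: powR_mono => //; apply: (le_trans (ler_normD _ _)).
  rewrite mulrDl mul1r lerD2l; apply: (le_trans v0zeta).
  by rewrite mulrAC -mulrA ler_peMr ?(ltW z0)// ler_pdivlMr// mul1r.
have h2 : - g v0 <= c * (zeta ^+ 2 * ds) * `|w| `^ s.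
  rewrite gv0 opprK -!mulrA ler_wpM2l ?(ltW c0)//.
  have : v0 ^+ 2 <= zeta ^+ 2.
    by rewrite -(real_normK (num_real v0)) ler_sqr ?nnegrE// ltW.
  have : zeta ^+ 2 <= zeta ^+ 2 * (ds * `|w| `^ s) by rewrite ler_peMr// sqr_ge0.
  by have := sqr_ge0 v0; lra.
have h3 : c * v0 * w <= c * zeta * (d * ds) * `|w| `^ s.
  apply: (le_trans (ler_norm _)); rewrite !normrM (ger0_norm (ltW c0)) -[leRHS]mulrA.
  by rewrite ler_pM ?mulr_ge0 ?(ltW c0)// ler_wpM2l// ltW.
by have := ler_norm (g (w + v0)); lra.
Qed.

(** * Integral bounds and Nemytskii operators *)

Section integral_bounds.
Context d (T : measurableType d) (R : realType).
Variables (mu : {measure set T -> \bar R}) (D : set T).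
Hypotheses (mD : measurable D) (fD : (mu D < +oo)%E).
Implicit Types f g e w : T -> R.

Definition itg f := mu.-integrable D (EFin \o f).
(** Integrability is bundled with the bound because the real-valued integral alone says nothing
    about a function that is not integrable. *)
Definition IB f (k : R) := itg f /\ \int[mu]_(x in D) f x <= k.

Lemma itg_le e f : measurable_fun D e -> itg f ->
  (forall x, D x -> `|e x| <= f x) -> itg e.
Proof.
move=> me fi h; apply: (le_integrable mD _ _ fi); first exact/measurable_EFinP.
move=> x Dx /=; rewrite lee_fin; apply: (le_trans (h x Dx)); exact: ler_norm.
Qed.

Lemma itg_abs f : itg f -> itg (fun x => `|f x|).
Proof. by move=> /integrable_norm. Qed.

Lemma itgD f g : itg f -> itg g -> itg (fun x => f x + g x).
Proof. by move=> fi gi; apply: eq_integrable (integrableD mD fi gi). Qed.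

Lemma itgZ (c : R) f : itg f -> itg (fun x => c * f x).
Proof. by move=> fi; apply: eq_integrable (integrableZl mD c fi). Qed.

Lemma itgN f : itg f -> itg (fun x => - f x).
Proof. by move=> fi; apply: eq_integrable (integrableN fi). Qed.

Lemma itgB f g : itg f -> itg g -> itg (fun x => f x - g x).
Proof. by move=> fi gi; apply: itgD => //; exact: itgN. Qed.

Lemma itg_cst (c : R) : itg (fun=> c).
Proof.
apply/integrableP; split; first exact/measurable_EFinP/measurable_cst.
by rewrite /= integral_cst// lte_mul_pinfty.
Qed.

Lemma IB_D f g (a b : R) : IB f a -> IB g b -> IB (fun x => f x + g x) (a + b).
Proof. by move=> [fi fa] [gi gb]; split; [exact: itgD|rewrite RintegralD// lerD]. Qed.

Lemma IB_Z (c : R) f (a : R) : 0 <= c -> IB f a -> IB (fun x => c * f x) (c * a).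
Proof. by move=> c0 [fi fa]; split; [exact: itgZ|rewrite RintegralZl// ler_wpM2l]. Qed.

Lemma IB_cst (c : R) : IB (fun=> c) (c * fine (mu D)).
Proof. by split; [exact: itg_cst|rewrite Rintegral_cst]. Qed.

Lemma IB_weak f (a b : R) : a <= b -> IB f a -> IB f b.
Proof. by move=> ab [fi fa]; split => //; exact: le_trans ab. Qed.

Lemma IB_le e f (a : R) : measurable_fun D e -> IB f a ->
  (forall x, D x -> `|e x| <= f x) -> IB (fun x => `|e x|) a.
Proof.
move=> me [fi fa] h; have ei := itg_le me fi h; have aei := itg_abs ei.
split => //; apply: le_trans fa; exact: le_Rintegral.
Qed.

Lemma IB_abs f (a : R) : IB (fun x => `|f x|) a -> measurable_fun D f ->
  itg f /\ `|\int[mu]_(x in D) f x| <= a.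
Proof.
move=> [fi fa] mf; have fi' : itg f by apply: (itg_le mf fi).
by split => //; apply: le_trans fa; exact: le_normr_Rintegral.
Qed.

Lemma IB_eq f g (a : R) : (forall x, D x -> f x = g x) -> IB f a -> IB g a.
Proof.
move=> fg [fi fa]; split.
  by apply: eq_integrable fi => // x /set_mem Dx /=; rewrite fg.
by rewrite (@eq_Rintegral _ _ _ _ _ f)// => x /set_mem Dx; rewrite fg.
Qed.

Lemma IB_ge0 f (a : R) : (forall x, D x -> 0 <= f x) -> IB f a -> 0 <= a.
Proof. by move=> f0 [_ fa]; apply: le_trans fa; exact: Rintegral_ge0. Qed.

Lemma itg_indic S : measurable S -> itg (\1_S : T -> R).
Proof.
move=> mS; apply: (itg_le _ (itg_cst 1)); first exact: measurable_indic.
by move=> x _; rewrite indicE; case: (x \in S); rewrite /= ?normr1 ?normr0.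
Qed.

Lemma IB_indic S (k : R) : measurable S -> S `<=` D -> (mu S <= k%:E)%E ->
  IB (\1_S : T -> R) k.
Proof.
move=> mS SD Sk; split; first exact: itg_indic.
rewrite /Rintegral integral_indic// (setIidl SD).
by rewrite -lee_fin fineK// ge0_fin_numE//; apply: le_lt_trans Sk _; exact: ltry.
Qed.

(** * Continuity of superposition operators *)

Section modulus.
Variables (s s1 C : R) (f : T -> R -> R).
Hypotheses (s2 : 2 < s) (ss1 : s < s1) (C0 : 0 <= C).
Hypothesis cf : forall x, D x -> continuous (f x).
Hypothesis mf : forall w, measurable_fun D w -> measurable_fun D (fun x => f x (w x)).
Hypothesis fb : forall x z, D x -> `|f x z| <= C * (1 + `|z| `^ (s - 1)).

(** Testing rational pairs only makes this a countable union of measurable sets; by continuity in z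
    nothing is lost, up to strict inequalities ([oscillationP]). *)
Definition oscillation (M e del : R) : set T := \bigcup_(q in [set q : rat * rat |
   `|ratr q.1| <= M /\ `|ratr q.1 - ratr q.2| <= del])
   (D `&` [set x | e < `|f x (ratr q.2) - f x (ratr q.1)|]).

Lemma oscillation_measurable (M e del : R) : measurable (oscillation M e del).
Proof.
rewrite /oscillation bigcup_mkcond; apply: countable_bigcupT_measurable; first exact: countableP.
move=> q; case: ifP => // _.
have mz z : measurable_fun D (fun x => f x z) by apply: mf; exact: measurable_cst.
have -> : [set x | e < `|f x (ratr q.2) - f x (ratr q.1)|] =
  (fun x => `|f x (ratr q.2) - f x (ratr q.1)|) @^-1` `]e, +oo[%classic.
  by apply/seteqP; split => x /=; rewrite in_itv/= andbT.
have mh : measurable_fun D (fun x => `|f x (ratr q.2) - f x (ratr q.1)|).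
  by apply: measurableT_comp => //; apply: measurable_funB.
exact: mh.
Qed.

Lemma oscillation_sub (M e del : R) : oscillation M e del `<=` D.
Proof. by move=> x [q _ []]. Qed.

Lemma near_rat (h : R -> R) (x e : R) : {for x, continuous h} -> 0 < e ->
  exists q : rat, `|ratr q - x| < e /\ `|h (ratr q) - h x| < e.
Proof.
move=> /cvgrPdist_lt/(_ e) ch e0; have [d0 /= dp dh] := ch e0.
pose m := Num.min d0 e; have m0 : 0 < m by rewrite lt_min dp.
have [|q] := @rat_in_itvoo R (x - m) (x + m); first lra.
rewrite in_itv/= => /andP[q1 q2]; exists q.
have qm : `|ratr q - x| < m by rewrite ltr_distl; apply/andP; split; lra.
have md : m <= d0 by rewrite ge_min lexx.
have me : m <= e by rewrite ge_min lexx orbT.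
split; first exact: lt_le_trans me.
by rewrite distrC; apply: dh; rewrite /= distrC; exact: lt_le_trans md.
Qed.

Lemma oscillationP (M e del : R) x a b : D x -> ~ oscillation M e del x ->
  `|a| < M -> `|a - b| < del -> `|f x b - f x a| <= e.
Proof.
move=> Dx nx aM abd; rewrite leNgt; apply/negP => h.
pose gap := Num.min (Num.min ((`|f x b - f x a| - e) / 2) (M - `|a|)) ((del - `|a - b|) / 2).
have gap0 : 0 < gap by rewrite !lt_min !divr_gt0// !subr_gt0// aM.
have g1 : gap <= (`|f x b - f x a| - e) / 2 by rewrite /gap !ge_min lexx.
have g2 : gap <= M - `|a| by rewrite /gap !ge_min lexx orbT.
have g3 : gap <= (del - `|a - b|) / 2 by rewrite /gap !ge_min lexx orbT.
have [qa [qa1 qa2]] := near_rat (@cf x Dx a) gap0.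
have [qb [qb1 qb2]] := near_rat (@cf x Dx b) gap0.
apply: nx; exists (qa, qb) => /=; split => //.
- have := ler_normD (ratr qa - a) a; rewrite subrK; lra.
- have := ler_normD (ratr qa - a) (a - ratr qb); rewrite addrA subrK.
  have := ler_normD (a - b) (b - ratr qb); rewrite addrA subrK (distrC b); lra.
- have h1 := ler_normD (f x b - f x (ratr qb)) (f x (ratr qb) - f x a).
  have h2 := ler_normD (f x (ratr qb) - f x (ratr qa)) (f x (ratr qa) - f x a).
  move: h1 h2; rewrite !addrA !subrK (distrC (f x b) (f x (ratr qb))); lra.
Qed.

(** Uniform continuity of [f x] on a compact interval: a point in all these sets would give pairs at
    distance tending to 0 which, near a cluster point, contradict continuity. *)
Lemma oscillation_cap (M e : R) : 0 < e ->
  \bigcap_j oscillation M e (j.+1%:R^-1) = set0.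
Proof.
move=> e0; rewrite -subset0 => x xO.
have Dx : D x by exact: (oscillation_sub (xO 0%N I)).
have /choice[q qP] : forall j : nat, exists q : rat * rat,
    [/\ `|ratr q.1| <= M, `|ratr q.1 - ratr q.2 : R| <= j.+1%:R^-1 &
      e < `|f x (ratr q.2) - f x (ratr q.1)|].
  by move=> j; have [q [h1 h2] [_ h3]] := xO j I; exists q.
pose u j : R := ratr (q j).1.
have uM j : `[- M, M]%classic (u j) by rewrite /= in_itv/= -ler_norml; have [] := qP j.
have : exists l, cluster (u @ \oo) l.
  have [|l [_ hl]] := @segment_compact R (- M) M (u @ \oo).
    by exists 0%N => // j _; exact: uM.
  by exists l.
move=> [l hl].
have e2 : 0 < e / 2 by rewrite divr_gt0.
have /cvgrPdist_lt/(_ _ e2)[d0 /= dp dh] := @cf x Dx l.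
have d2 : 0 < d0 / 2 by rewrite divr_gt0.
have A1 : (u @ \oo) [set y | exists2 j, j.+1%:R^-1 < d0 / 2 & y = u j].
  have : \forall j \near \oo, (j.+1%:R^-1 : R) < d0 / 2.
    by apply: (@cvgr_lt _ _ _ _ _ (0 : R)) d2; exact: cvg_harmonic.
  by apply: filterS => j h; exists j.
have [y [[j hj ->]]] := hl _ _ A1 (nbhsx_ballx l _ d2).
rewrite /ball/= => lu.
have [_ h1 h2] := qP j.
have a1 : `|f x l - f x (u j)| < e / 2 by apply: dh => /=; lra.
have a2 : `|f x l - f x (ratr (q j).2)| < e / 2.
  apply: dh => /=; have := ler_normD (l - u j) (u j - ratr (q j).2).
  by rewrite addrA subrK; move: h1; rewrite -/(u j); move: (j.+1%:R^-1) hj => k; lra.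
move: h2; rewrite -/(u j).
have := ler_normD (f x (ratr (q j).2) - f x l) (f x l - f x (u j)).
by rewrite addrA subrK (distrC _ (f x l)); lra.
Unshelve. all: by end_near. Qed.

(** Continuity of the finite measure from above. This plays the role of a Scorza-Dragoni theorem:
    off a small set, f is uniformly continuous in z uniformly in x. *)
Lemma oscillation_small (M e e2 : R) : 0 < e -> 0 < e2 ->
  exists2 del : R, 0 < del & (mu (oscillation M e del) <= e2%:E)%E.
Proof.
move=> e0 e20.
pose S j := oscillation M e (j.+1%:R^-1).
have mS j : measurable (S j) by exact: oscillation_measurable.
have : (mu \o S) x @[x --> \oo] --> mu (\bigcap_n S n).
  apply: nonincreasing_cvg_mu => //.
  - apply: le_lt_trans fD; apply: le_measure; rewrite ?inE//.
    exact: oscillation_sub.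
  - by rewrite oscillation_cap.
  - move=> i j ij; apply/subsetPset => x [q [q1 q2] qx]; exists q => //; split => //.
    by apply: (le_trans q2); rewrite lef_pV2 ?posrE ?ltr0n// ler_nat ltnS.
rewrite oscillation_cap// measure0 => /fine_cvgP[fn /cvgrPdist_le/(_ e2 e20) h].
have [j [/= h1 h2]] := filter_ex (filterI fn h).
exists (j.+1%:R^-1); first by rewrite invr_gt0 ltr0n.
move: h2; rewrite sub0r normrN => h2.
by rewrite -(fineK h1) lee_fin; apply: le_trans h2; exact: ler_norm.
Qed.

Let s1q : s - 1 < s1 - 1.
Proof. by rewrite ltrD2r. Qed.

(** Large z are covered by the gap between the exponents s - 1 and s1 - 1, large y by A' |y|, the
    small exceptional set by the crude bound A, and the rest by uniform continuity. The order of
    quantifiers matters: A is fixed before the size e2 of the exceptional set, so A times its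
    measure can still be made small. *)
Lemma pointwise_modulus (e : R) : 0 < e -> exists2 A : R, 0 <= A &
  forall e2 : R, 0 < e2 -> exists S : set T, exists2 A' : R, 0 <= A' &
  [/\ measurable S, S `<=` D, (mu S <= e2%:E)%E &
  forall x z y, D x ->
  `|f x (z + y) - f x z| <= e * (1 + `|z| `^ (s1 - 1) + `|y| `^ (s1 - 1)) +
     A * \1_S x + A' * `|y|].
Proof.
move=> e0; have hs2 := s2; have hss1 := ss1; have hC0 := C0.
have q0 : 0 <= s - 1 by lra.
have q20 : 0 < s1 - 1 by lra.
pose C2 := C * 2 `^ (s - 1) + C.
have p20 : 0 <= 2 `^ (s - 1) :> R by exact: powR_ge0.
have C20 : 0 <= C2 by rewrite addr_ge0// mulr_ge0.
pose kk := e / 2 / (C2 + 1).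
have e'0 : 0 < kk by rewrite !divr_gt0// ltr_wpDl.
have [A A0 hA] := powR_absorb q0 s1q e'0.
pose B := 2 * C2 * A + 2 * C.
have B0 : 0 <= B by rewrite addr_ge0// !mulr_ge0.
have crude x z y : D x -> `|f x (z + y) - f x z| <=
    e / 2 * (`|z| `^ (s1 - 1) + `|y| `^ (s1 - 1)) + B.
  move=> Dx; apply: (le_trans (ler_normB _ _)).
  have h1 := fb (z + y) Dx; have h2 := fb z Dx.
  have h3 : `|z + y| `^ (s - 1) <= 2 `^ (s - 1) * (`|z| `^ (s - 1) + `|y| `^ (s - 1)).
    by apply: le_trans (powRD_le q0 _ _) => //; apply: powR_mono => //; exact: ler_normD.
  have h4 := hA `|z| (normr_ge0 z); have h5 := hA `|y| (normr_ge0 y).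
  have zp := powR_ge0 `|z| (s - 1); have yp := powR_ge0 `|y| (s - 1).
  have zq := powR_ge0 `|z| (s1 - 1); have yq := powR_ge0 `|y| (s1 - 1).
  have h6 : C * `|z + y| `^ (s - 1) <= C * (2 `^ (s - 1) * (`|z| `^ (s - 1) + `|y| `^ (s - 1))).
    by rewrite ler_wpM2l.
  set Z := `|z| `^ (s - 1) in h1 h2 h3 h4 h5 h6 zp *.
  set Y := `|y| `^ (s - 1) in h1 h2 h3 h4 h5 h6 yp *.
  have h7 : C * (2 `^ (s - 1) * (Z + Y)) + C * Z <= C2 * (Z + Y).
    by rewrite /C2 mulrDl -mulrA lerD2l ler_wpM2l// lerDl.
  have h8 : C2 * (Z + Y) <= C2 * (kk * (`|z| `^ (s1 - 1) + `|y| `^ (s1 - 1)) + 2 * A).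
    by rewrite ler_wpM2l//; lra.
  have h9 : C2 * (kk * (`|z| `^ (s1 - 1) + `|y| `^ (s1 - 1))) <=
            e / 2 * (`|z| `^ (s1 - 1) + `|y| `^ (s1 - 1)).
    rewrite mulrA ler_wpM2r ?addr_ge0// /kk.
    by rewrite mulrA ler_pdivrMr ?ltr_wpDl// mulrC ler_wpM2l ?lerDl// divr_ge0// ltW.
  rewrite /B; move: h1 h2 h6 h7 h8 h9; clearbody kk; lra.
(* Beyond M the term e/2 |z|^(s1-1) alone exceeds the crude constant B. *)
pose M := (2 * B / e) `^ (s1 - 1)^-1.
have BM : B <= e / 2 * M `^ (s1 - 1).
  rewrite /M -powRrM mulVf ?gt_eqF// powRr1; last by rewrite divr_ge0 ?mulr_ge0// ltW.
  by rewrite (_ : e / 2 * _ = B)//; field; rewrite gt_eqF.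
have M0 : 0 <= M by exact: powR_ge0.
exists B => // e2 e20.
have [del del0 hdel] := oscillation_small (M + 1) e0 e20.
exists (oscillation (M + 1) e del), (B / del); first by rewrite divr_ge0// ltW.
split => //; [exact: oscillation_measurable|exact: oscillation_sub|].
move=> x z y Dx.
have zq := powR_ge0 `|z| (s1 - 1); have yq := powR_ge0 `|y| (s1 - 1).
have By : 0 <= B / del * `|y| by rewrite mulr_ge0// divr_ge0// ltW.
have ez : 0 <= e * `|z| `^ (s1 - 1) by rewrite mulr_ge0// ltW.
have ey : 0 <= e * `|y| `^ (s1 - 1) by rewrite mulr_ge0// ltW.
have h := crude x z y Dx; rewrite indicE.
have [xS|xS] := boolP (x \in oscillation (M + 1) e del).
  by rewrite mulr1; lra.
have xS' : ~ oscillation (M + 1) e del x by move: xS; rewrite notin_setE.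
rewrite mulr0 addr0; have [zM|Mz] := leP `|z| M; last first.
  have h1 : e / 2 * M `^ (s1 - 1) <= e / 2 * `|z| `^ (s1 - 1).
    by rewrite ler_wpM2l ?divr_ge0 ?(ltW e0)// powR_mono ?(ltW q20)// ltW.
  by lra.
have [yd|dy] := ltP `|y| del; last first.
  have : B <= B / del * `|y| by rewrite mulrAC ler_pdivlMr// ler_wpM2l.
  by lra.
have : `|f x (z + y) - f x z| <= e.
  apply: (oscillationP Dx xS'); first by lra.
  by rewrite opprD addrA subrr sub0r normrN.
by lra.
Qed.

Definition PB w (K : R) := measurable_fun D w /\ IB (fun x => `|w x| `^ s1) K.

(** The pointwise modulus times |t|, integrated with Young's inequality. The arguments z' and y' are
    chosen separately at each x and need not be measurable in x: they will be intermediate points of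
    the mean value theorem, and only r, dominated by a measurable function, is integrated. *)
Lemma nemytskii_modulus (K e : R) : 0 <= K -> 0 < e -> exists2 del : R, 0 < del &
  forall (z y t r dd : T -> R) (k : R), PB z K -> PB y K -> PB t K ->
  IB (fun x => y x ^+ 2) del -> measurable_fun D r -> IB dd k ->
  (forall x, D x -> exists z' y', [/\ `|z'| <= `|z x|, `|y'| <= `|y x| &
     `|r x| <= dd x + `|f x (z' + y') - f x z'| * `|t x|]) ->
  IB (fun x => `|r x|) (k + e).
Proof.
move=> K0 e0; have hs2 := s2; have hss1 := ss1.
pose m := fine (mu D); have m0 : 0 <= m by exact: fine_ge0.
have den : 0 < 3 * m + 7 * K + 3 by lra.
(* The denominator counts the integral of [Dom] in units of e': 3 m + 7 K from the powers and two
   more from the indicator and from y^2. *)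
pose e' := e / (3 * m + 7 * K + 3).
have e'0 : 0 < e' by rewrite divr_gt0.
have [A A0 hA] := pointwise_modulus e'0.
(* Weight in Young's inequality for the indicator times |t|, small enough for A kap <= e'; the large
   factor A / kap falls on the measure of S, which is chosen afterwards. *)
pose kap := e' / (A + 1).
have kap0 : 0 < kap by rewrite divr_gt0// ltr_wpDl.
have A1 : 0 < A + 1 by rewrite ltr_wpDl.
have e20 : 0 < e' * kap / (A + 1) by apply: divr_gt0 => //; exact: mulr_gt0.
have [S [A' A'0 [mS SD muS hS]]] := hA _ e20.
have q0 : 0 <= s1 - 1 by lra.
pose del := e' * e' / (A' ^+ 2 + 1).
have A'2 : 0 < A' ^+ 2 + 1 by rewrite ltr_wpDl// sqr_ge0.
exists del; first by rewrite divr_gt0// mulr_gt0.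
move=> z y t r dd k [mz zK] [my yK] [mt tK] yd mr ddk hr.
pose Dom := fun x => dd x + (e' * (3 * (1 + `|t x| `^ s1) +
   (`|z x| `^ s1 + `|t x| `^ s1) + (`|y x| `^ s1 + `|t x| `^ s1)) +
   A / kap * \1_S x + A' ^+ 2 / e' * y x ^+ 2).
have HD : IB Dom (k + e).
  have i1 := IB_D (IB_cst 1) tK; have i2 := IB_D zK tK; have i3 := IB_D yK tK.
  have i4 := IB_Z (ltW e'0) (IB_D (IB_D (IB_Z (ler0n R 3) i1) i2) i3).
  have Ak : 0 <= A / kap by rewrite divr_ge0// ltW.
  have i5 := IB_Z Ak (IB_indic mS SD muS).
  have Ae : 0 <= A' ^+ 2 / e' by rewrite divr_ge0 ?sqr_ge0// ltW.
  have i6 := IB_Z Ae yd.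
  apply: IB_weak (IB_D ddk (IB_D (IB_D i4 i5) i6)).
  rewrite lerD2l mul1r -/m.
  have h1 : A / kap * (e' * kap / (A + 1)) <= e'.
    rewrite (_ : _ * _ = e' * (A / (A + 1))); last by field; rewrite !gt_eqF// ltr_wpDl.
    by rewrite ler_piMr ?(ltW e'0)// ler_pdivrMr ?ltr_wpDl// mul1r lerDl.
  have h2 : A' ^+ 2 / e' * del <= e'.
    rewrite /del (_ : _ * _ = e' * (A' ^+ 2 / (A' ^+ 2 + 1))); last by field; rewrite !gt_eqF.
    by rewrite ler_piMr ?(ltW e'0)// ler_pdivrMr// mul1r lerDl.
  have h3 : e' * (3 * m + 7 * K + 3) = e by rewrite divfK// gt_eqF.
  by rewrite -h3; move: h1 h2; have := mulr_ge0 (ltW e'0) K0; have := mulr_ge0 (ltW e'0) m0; lra.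
apply: (IB_le mr HD) => x Dx; have [z' [y' [zz yy h]]] := hr x Dx.
apply: (le_trans h); rewrite /Dom lerD2l.
have h0 := hS x z' y' Dx.
have tt : 0 <= `|t x| by [].
apply: (le_trans (ler_wpM2r tt h0)).
have zz' : `|z'| `^ (s1 - 1) <= `|z x| `^ (s1 - 1) by exact: powR_mono.
have yy' : `|y'| `^ (s1 - 1) <= `|y x| `^ (s1 - 1) by exact: powR_mono.
have s11 : 1 <= s1 by lra.
have yz := young_powR s11 (normr_ge0 (z x)) tt.
have yy2 := young_powR s11 (normr_ge0 (y x)) tt.
have t1 := id_le1D s11 tt.
have s12 : 2 <= s1 by lra.
have t2 := sqr_le1D s12 tt.
have p1 : `|z'| `^ (s1 - 1) * `|t x| <= `|z x| `^ s1 + `|t x| `^ s1.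
  by apply: le_trans yz; rewrite ler_wpM2r.
have p2 : `|y'| `^ (s1 - 1) * `|t x| <= `|y x| `^ s1 + `|t x| `^ s1.
  by apply: le_trans yy2; rewrite ler_wpM2r.
have p3 : A * \1_S x * `|t x| <= e' * (1 + `|t x| `^ s1) + A / kap * \1_S x.
  have i0 : 0 <= \1_S x :> R by rewrite indicE ler0n.
  have i2 : \1_S x ^+ 2 = \1_S x :> R by rewrite indicE; case: (_ \in _); rewrite ?expr1n ?expr0n.
  have y2 := young2 (\1_S x) `|t x| kap0; rewrite i2 in y2.
  have ak : A * kap <= e'.
    by rewrite /kap mulrA ler_pdivrMr ?ltr_wpDl// mulrC ler_wpM2l ?(ltW e'0)// lerDl.
  rewrite -mulrA; apply: (le_trans (ler_wpM2l A0 y2)).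
  rewrite mulrDr (_ : A * (\1_S x / kap) = A / kap * \1_S x); last by rewrite mulrA mulrAC.
  by rewrite lerD2r mulrA ler_pM// ?sqr_ge0// mulr_ge0// ltW.
have p4 : A' * `|y'| * `|t x| <= e' * (1 + `|t x| `^ s1) + A' ^+ 2 / e' * y x ^+ 2.
  have y2 := young2 (A' * `|y x|) `|t x| e'0.
  apply: (@le_trans _ _ (A' * `|y x| * `|t x|)).
    by rewrite ler_wpM2r// ler_wpM2l.
  have ye : (A' * `|y x|) ^+ 2 / e' = A' ^+ 2 / e' * y x ^+ 2.
    by rewrite exprMn real_normK ?num_real// mulrAC.
  by apply: (le_trans y2); rewrite ye lerD2r ler_wpM2l// ltW.
have e'0' := ltW e'0.
have p0 : e' * `|t x| <= e' * (1 + `|t x| `^ s1) by rewrite ler_wpM2l.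
have p1' := ler_wpM2l e'0' p1; have p2' := ler_wpM2l e'0' p2.
by move: p0 p1' p2' p3 p4; rewrite !mulrDr !mulrDl !mulr1 !mulrA; lra.
Qed.

End modulus.
End integral_bounds.

(** * The variational functionals *)

Section variational.
Context d (T : measurableType d) (R : realType).
Variables (mu : {measure set T -> \bar R}) (D : set T).
Hypotheses (mD : measurable D) (fD : (mu D < +oo)%E).
Local Notation itg := (itg mu D).
Local Notation IB := (IB mu D).
Variables (c s s1 Cg p a r : R).
Hypotheses (c0 : 0 < c) (s2 : 2 < s) (ss1 : s < s1) (Cg0 : 0 <= Cg) (p2 : 2 < p)
  (a0 : 0 < a) (r0 : 0 < r).
Local Notation PB := (PB mu D s1).
Variables (v : nat -> T -> R) (g gz : nat -> T -> R -> R) (ee : nat -> R).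
Hypothesis gAR : forall k x, D x -> AR_nonlinearity s Cg p a r (g k x) (gz k x).
Hypothesis gzc : forall k x, D x -> continuous (gz k x).
Hypothesis gm : forall k w, measurable_fun D w -> measurable_fun D (fun x => g k x (w x)).
Hypothesis gzm : forall k w, measurable_fun D w -> measurable_fun D (fun x => gz k x (w x)).
Hypothesis gzk : forall k x z, D x -> `|gz k x z - gz 0%N x z| <= ee k * (1 + `|z|).
Hypothesis ee0 : forall k, 0 <= ee k.
Hypothesis eecv : forall e : R, 0 < e -> exists k0, forall k, (k0 <= k)%N -> ee k <= e.
Variable Kv : R.
Hypothesis vP : forall k, PB (v k) Kv.
Hypothesis vcv : forall e : R, 0 < e -> exists k0, forall k, (k0 <= k)%N ->
  IB (fun x => (v k x - v 0%N x) ^+ 2) e.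
Variables (b zeta zeta' : R).
Hypotheses (b0 : 0 < b) (bc : b < c / 2) (zeta0 : 0 < zeta) (zz : zeta' < zeta).
Hypothesis v0z : forall x, D x -> `|v 0%N x| <= zeta'.
Hypothesis g0near : forall x z, D x -> `|z| <= zeta ->
  `|g 0%N x z + c / 2 * z ^+ 2| <= b / 2 * `|z - v 0%N x| ^+ 2.
Variables (E : set (T -> R)) (Q : (T -> R) -> (T -> R) -> R).
Hypothesis HQ : psd_form E Q.
Local Notation N := (qnorm Q).
Hypothesis Em : forall w, E w -> measurable_fun D w.
Variables (CP CS : R).
Hypotheses (CP0 : 0 <= CP) (CS0 : 0 <= CS).
Hypothesis poincare : forall w, E w -> IB (fun x => w x ^+ 2) (CP * Q w w).
Hypothesis sobolev : forall w, E w -> N w <= 1 -> IB (fun x => `|w x| `^ s1) CS.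
Hypothesis complete : qcomplete E Q.
Hypothesis compactE : forall (w : nat -> T -> R) (K : R),
  (forall j, E (w j) /\ N (w j) <= K) ->
  exists2 sigma : nat -> nat, {homo sigma : i j / (i < j)%N} &
    forall e : R, 0 < e -> exists j0, forall i j, (j0 <= i)%N -> (j0 <= j)%N ->
      IB (fun x => (w (sigma i) x - w (sigma j) x) ^+ 2) e.

Let m := fine (mu D).
Let m0 : 0 <= m. Proof. exact: fine_ge0. Qed.
Let s12 : 2 <= s1. Proof. by have := s2; have := ss1; lra. Qed.
Let s11 : 1 <= s1. Proof. by have := s12; lra. Qed.
Let s10 : 0 <= s1. Proof. by have := s12; lra. Qed.
Let s0 : 0 <= s. Proof. by have := s2; lra. Qed.
Let Kv0 : 0 <= Kv.
Proof. by have [_] := vP 0; apply: IB_ge0 => x _; exact: powR_ge0. Qed.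
Let vm k : measurable_fun D (v k). Proof. by have [] := vP k. Qed.
Let mnorm (f : T -> R) : measurable_fun D f -> measurable_fun D (fun x => `|f x|).
Proof. by move=> mf; apply: measurableT_comp => //; exact: measurable_normr. Qed.

(* v k is orthogonal to E for the sum of the L2 form and Q, so that Q (v k) w is minus the
   integral of v k * w and the coupling term of the functional is of lower order. *)
Definition upp k w x := c * v k x * w x + (g k x (w x + v k x) - g k x (v k x)).
Definition low k w (h : T -> R) x := (c * v k x + gz k x (w x + v k x)) * h x.
Definition Jf k w : R := c / 2 * Q w w - \int[mu]_(x in D) upp k w x.
Definition dJf k w h : R := c * Q w h - \int[mu]_(x in D) low k w h x.

Lemma upp_measurable k w : measurable_fun D w -> measurable_fun D (upp k w).
Proof.
move=> mw; apply: measurable_funD.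
  by apply: measurable_funM => //; apply: measurable_funM => //; exact: measurable_cst.
by apply: measurable_funB; apply: gm => //; exact: measurable_funD.
Qed.

Lemma low_measurable k w h : measurable_fun D w -> measurable_fun D h ->
  measurable_fun D (low k w h).
Proof.
move=> mw mh; apply: measurable_funM => //; apply: measurable_funD.
  by apply: measurable_funM => //; exact: measurable_cst.
by apply: gzm; exact: measurable_funD.
Qed.

Lemma IB_dom (f h : T -> R) (k : R) : measurable_fun D f -> IB h k ->
  (forall x, D x -> 0 <= f x <= h x) -> IB f k.
Proof.
move=> mf hk fh; have H : forall x, D x -> `|f x| <= h x.
  by move=> x /fh /andP[f0 f1]; rewrite ger0_norm.
apply: (IB_eq mD) (IB_le mD mf hk H) => x /fh /andP[f0 _].
by rewrite ger0_norm.
Qed.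

Lemma PB_weak w (K K' : R) : K <= K' -> PB w K -> PB w K'.
Proof. by move=> KK [mw h]; split => //; exact: IB_weak h. Qed.

Lemma PB_abs w (K : R) : PB w K -> PB (fun x => `|w x|) K.
Proof.
move=> [mw h]; split; first exact: mnorm.
by apply: (IB_eq mD) h => x _; rewrite normr_id.
Qed.

Lemma PB_D w z (K K' : R) : PB w K -> PB z K' ->
  PB (fun x => w x + z x) (2 `^ s1 * (K + K')).
Proof.
move=> [mw h] [mz h']; have mwz : measurable_fun D (fun x => w x + z x) by exact: measurable_funD.
split => //.
have H := IB_Z mD (powR_ge0 2 s1) (IB_D mD h h').
apply: IB_dom H _ => [|x Dx].
  apply: (@measurableT_comp _ _ _ _ _ _ (fun y : R => y `^ s1)); first exact: measurable_powR.
  exact: mnorm.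
rewrite powR_ge0/=; apply: (@le_trans _ _ ((`|w x| + `|z x|) `^ s1)).
  by apply: powR_mono => //; exact: ler_normD.
exact: powRD_le.
Qed.

Lemma PB_E (rho : R) : exists2 K : R, 0 <= K & forall w, E w -> N w <= rho -> PB w K.
Proof.
pose q := Num.max rho 1; have q1 : 1 <= q by rewrite le_max lexx orbT.
have q0 : 0 < q by lra.
exists (q `^ s1 * CS); first by rewrite mulr_ge0// powR_ge0.
move=> w Ew Nw; split; first exact: Em.
have Ew' := psd_EZ HQ q^-1 Ew.
have Nw' : N (q^-1 *: w) <= 1.
  rewrite (qnormZ HQ)// ger0_norm ?invr_ge0 ?(ltW q0)// ler_pdivrMl// mulr1.
  by rewrite le_max Nw.
have := IB_Z mD (powR_ge0 q s1) (sobolev Ew' Nw').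
apply: (IB_eq mD) => x _ /=.
rewrite -[(_ *: w) x]/(q^-1 * w x) normrM ger0_norm ?invr_ge0 ?(ltW q0)//.
by rewrite -powRM ?(ltW q0)// ?mulr_ge0 ?invr_ge0 ?(ltW q0)// mulrA mulfV ?gt_eqF// mul1r.
Qed.

Lemma sqr_E w (e : R) : E w -> CP * N w ^+ 2 <= e -> IB (fun x => w x ^+ 2) e.
Proof. by move=> Ew h; apply: IB_weak (poincare Ew); rewrite -(qnorm_sqr HQ). Qed.

Lemma PB_sqr w (K : R) : PB w K -> IB (fun x => w x ^+ 2) (m + K).
Proof.
move=> [mw h]; have H := IB_D mD (IB_cst mD fD 1) h; rewrite mul1r in H.
apply: IB_dom H _ => [|x Dx]; first exact: measurable_funX.
by rewrite sqr_ge0/= -real_normK ?num_real// sqr_le1D.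
Qed.

Lemma growth_small (K e : R) : 0 <= K -> 0 < e -> exists2 C : R, 0 <= C &
  forall (z y f : T -> R) (del : R), PB z K -> PB y K -> IB (fun x => y x ^+ 2) del ->
  measurable_fun D f -> (forall x, D x -> `|f x| <= (1 + `|z x| `^ (s - 1)) * `|y x|) ->
  IB (fun x => `|f x|) (e + C * del).
Proof.
move=> K0 e0; have hm := m0.
have den : 0 < m + 2 * K + 1 by lra.
have e'0 : 0 < e / (m + 2 * K + 1) by rewrite divr_gt0.
have [C C0 hC] := subcritical_young (ltW s2) ss1 e'0.
exists C => // z y f del [mz zK] [my yK] yd mf hf.
have H1 := IB_Z mD (ltW e'0) (IB_D mD (IB_D mD (IB_cst mD fD 1) zK) yK).
have H := IB_D mD H1 (IB_Z mD C0 yd).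
apply: IB_weak (IB_le mD mf H _).
  rewrite lerD2r mul1r -/m -{2}(divfK (lt0r_neq0 den) e).
  by rewrite ler_wpM2l// ?(ltW e'0)//; lra.
move=> x Dx /=; apply: (le_trans (hf x Dx)).
by have := hC _ _ (normr_ge0 (z x)) (normr_ge0 (y x)); rewrite (real_normK (num_real (y x))).
Qed.

Lemma low_bound k w h x : D x ->
  `|low k w h x| <= (c + Cg) * ((1 + (`|w x| + `|v k x|) `^ (s - 1)) * `|h x|).
Proof.
move=> Dx; rewrite /low normrM mulrA ler_wpM2r//.
have hs2 := s2; have q0 : 0 <= s - 1 by lra. have q1 : 1 <= s - 1 by lra.
apply: (le_trans (ler_normD _ _)); rewrite mulrDl lerD//.
  rewrite normrM (ger0_norm (ltW c0)) ler_wpM2l ?(ltW c0)//.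
  apply: (le_trans (id_le1D q1 (normr_ge0 _))).
  by rewrite lerD2l powR_mono// lerDr.
have [_ _ gb _] := gAR k Dx; apply: (le_trans (gb _)).
by rewrite ler_wpM2l// lerD2l powR_mono// ler_normD.
Qed.

Lemma PB_wv (K : R) : exists2 K' : R, K <= K' & forall k w, PB w K ->
  PB (fun x => `|w x| + `|v k x|) K' /\ PB (fun x => w x + v k x) K'.
Proof.
exists (Num.max K (2 `^ s1 * (K + Kv))); first by rewrite le_max lexx.
move=> k w Pw; split; apply: (@PB_weak _ (2 `^ s1 * (K + Kv))).
- by rewrite le_max lexx orbT.
- by apply: PB_D; apply: PB_abs.
- by rewrite le_max lexx orbT.
- exact: PB_D.
Qed.

(* The part of the derivative without the leading quadratic form is small when the
   direction is bounded and small in L2; this is what subcriticality gives. *)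
Lemma low_small (K e : R) : 0 <= K -> 0 < e -> exists2 C : R, 0 <= C &
  forall k w h (del : R), PB w K -> PB h K -> IB (fun x => h x ^+ 2) del ->
  IB (fun x => `|low k w h x|) (e + C * del).
Proof.
move=> K0 e0; have [K' KK' hK'] := PB_wv K.
have cCg : 0 < c + Cg + 1 by have := c0; have := Cg0; lra.
have [C C0 hC] := growth_small (le_trans K0 KK') (divr_gt0 e0 cCg).
exists ((c + Cg + 1) * C); first by rewrite mulr_ge0// ltW.
move=> k w h del Pw Ph hd; have [Pz _] := hK' k w Pw.
have Ph' := PB_weak KK' Ph.
have [mw _] := Pw; have [mh _] := Ph.
have cn0 : c + Cg + 1 != 0 by exact: lt0r_neq0.
have H := hC _ _ (fun x => (c + Cg + 1)^-1 * low k w h x) del Pz Ph' hd.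
have H' := IB_Z mD (ltW cCg) (H _ _).
have -> : e + (c + Cg + 1) * C * del = (c + Cg + 1) * (e / (c + Cg + 1) + C * del).
  by field.
apply: (IB_eq mD) (H' _ _) => [x Dx||].
- by rewrite normrM normfV (ger0_norm (ltW cCg)) mulrA mulfV// mul1r.
- by apply: measurable_funM; [exact: measurable_cst|exact: low_measurable].
- move=> x Dx; rewrite normrM normfV (ger0_norm (ltW cCg)) ler_pdivrMl//.
  have wv0 : 0 <= `|w x| + `|v k x| by rewrite addr_ge0.
  rewrite (ger0_norm wv0); apply: (le_trans (low_bound _ _ _ Dx)); by rewrite ler_wpM2r ?lerDl// mulr_ge0// addr_ge0// powR_ge0.
Qed.

Lemma low_itg k w h (K : R) : PB w K -> PB h K -> itg (low k w h).
Proof.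
move=> Pw Ph; have K0 : 0 <= K.
  by case: Pw => _; apply: IB_ge0 => x _; exact: powR_ge0.
have [C C0 hC] := low_small K0 ltr01.
have [mw _] := Pw; have [mh _] := Ph.
by have [] := IB_abs mD (hC k _ _ _ Pw Ph (PB_sqr Ph)) (low_measurable k mw mh).
Qed.

Lemma g_itg k w (K : R) : PB w K -> itg (fun x => g k x (w x)).
Proof.
move=> [mw wK]; have [H _] := IB_Z mD Cg0 (IB_D mD (IB_cst mD fD 2) wK).
apply: (itg_le mD (gm k mw) H) => x Dx; have [_ gb _ _] := gAR k Dx.
apply: (le_trans (gb _)); rewrite ler_wpM2l//.
by have := powR_le1D s0 (ltW ss1) (normr_ge0 (w x)); lra.
Qed.

Lemma mul_itg w z (K K' : R) : PB w K -> PB z K' -> itg (fun x => w x * z x).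
Proof.
move=> Pw Pz; have [H _] := IB_D mD (PB_sqr Pw) (PB_sqr Pz).
have [mw _] := Pw; have [mz _] := Pz.
apply: (itg_le mD (measurable_funM mw mz) H) => x Dx /=.
have := sqr_ge0 (`|w x| - `|z x|); rewrite normrM.
rewrite -(real_normK (num_real (w x))) -(real_normK (num_real (z x))).
have := sqr_ge0 `|w x|; have := sqr_ge0 `|z x|.
by rewrite !expr2; move: (`|w x|) (`|z x|) => x1 x2; lra.
Qed.

Lemma upp_itg k w (K : R) : PB w K -> itg (upp k w).
Proof.
move=> Pw; apply: itgD => //.
  have := itgZ mD c (mul_itg (vP k) Pw); apply: eq_integrable => // x _ /=.
  by rewrite mulrA.
apply: itgB => //; last exact: g_itg (vP k).
exact: g_itg (PB_D Pw (vP k)).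
Qed.

Lemma IB_lower (f h : T -> R) (k : R) : itg f -> IB h k ->
  (forall x, D x -> - h x <= f x) -> - k <= \int[mu]_(x in D) f x.
Proof.
move=> fi [hi hk] fh; have Nhi := itgZ mD (-1) hi.
apply: (@le_trans _ _ (\int[mu]_(x in D) (-1 * h x))).
  by rewrite RintegralZl// mulN1r lerN2.
by apply: le_Rintegral => // x Dx; rewrite mulN1r fh.
Qed.

Lemma IB_upper (f h : T -> R) (k : R) : itg f -> IB h k ->
  (forall x, D x -> f x <= h x) -> \int[mu]_(x in D) f x <= k.
Proof. by move=> fi [hi hk] fh; apply: le_trans hk; exact: le_Rintegral. Qed.

Lemma E_PB w : E w -> exists2 K : R, 0 <= K & PB w K.
Proof. by move=> Ew; have [K K0 hK] := PB_E (N w); exists K => //; exact: hK. Qed.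

Lemma PB_pair w z (K K' : R) : PB w K -> PB z K' -> 0 <= K -> 0 <= K' ->
  PB w (K + K') /\ PB z (K + K').
Proof.
move=> h h' K0 K'0; split; first by apply: PB_weak h; rewrite lerDl.
by apply: PB_weak h'; rewrite lerDr.
Qed.

Lemma low_itgE k w h : E w -> E h -> itg (low k w h).
Proof.
move=> /E_PB[K K0 Pw] /E_PB[K' K'0 Ph].
have [h1 h2] := PB_pair Pw Ph K0 K'0.
exact: low_itg h1 h2.
Qed.

Lemma upp_itgE k w : E w -> itg (upp k w).
Proof. by move=> /E_PB[K K0 Pw]; exact: upp_itg Pw. Qed.

Lemma low_linear k w : E w -> linear_on E (fun h => \int[mu]_(x in D) low k w h x).
Proof.
move=> Ew l h1 h2 E1 E2.
have i1 := low_itgE k Ew E1; have i2 := low_itgE k Ew E2.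
rewrite -(RintegralZl l mD i1) -(RintegralD mD (itgZ mD l i1) i2).
apply: eq_Rintegral => x _; rewrite /low.
by rewrite -[(_ + _) x]/(l * h1 x + h2 x); ring.
Qed.

Lemma L_linear k w : E w -> linear_on E (dJf k w).
Proof.
move=> Ew l h1 h2 E1 E2; rewrite /dJf (low_linear k Ew l E1 E2).
by rewrite (psd_linDr HQ (psd_EZ HQ l E1) E2 Ew) (psd_linZr HQ l E1 Ew); ring.
Qed.

Lemma low_Z k w h (l : R) x : low k w (fun x => l * h x) x = l * low k w h x.
Proof. by rewrite /low; ring. Qed.

(* Reduces an estimate homogeneous in the test function to unit test functions. *)
Lemma unit_estimate (f : T -> R) t (e : R) : 0 <= e -> E t -> measurable_fun D f ->
  (forall l : R, 0 < l -> N (l *: t) <= 1 -> IB (fun x => `|l * f x|) e) ->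
  `|\int[mu]_(x in D) f x| <= e * N t.
Proof.
move=> e0 Et mf H.
have Nt0 := qnorm_ge0 Q t.
apply: scale_bound => // l l0 lN.
have [|fi le] := IB_abs mD (H l l0 _) (measurable_funM (measurable_cst _) mf).
  by rewrite (qnormZ HQ)// gtr0_norm.
have fi' : itg f.
  have := itgZ mD l^-1 fi; apply: eq_integrable => // x _ /=.
  by rewrite mulrA mulVf ?gt_eqF// mul1r.
by move: le; rewrite RintegralZl// normrM gtr0_norm.
Qed.

Lemma L_bounded k (rho : R) : exists C : R, forall w h, E w -> E h -> N w <= rho ->
  `|dJf k w h| <= C * N h.
Proof.
have [K K0 hK] := PB_E (Num.max rho 1).
have [C C0 hC] := low_small K0 ltr01.
exists (c * `|rho| + (1 + C * CP)) => w h Ew Eh Nw.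
have Pw : PB w K by apply: hK => //; rewrite le_max Nw.
have Nw' : N w <= `|rho| by apply: (le_trans Nw); exact: ler_norm.
rewrite mulrDl; apply: (le_trans (ler_normB _ _)); apply: lerD.
  rewrite normrM (ger0_norm (ltW c0)) -mulrA ler_wpM2l ?(ltW c0)//.
  apply: (le_trans (psd_CS HQ Ew Eh)); rewrite ler_wpM2r//; exact: qnorm_ge0.
apply: unit_estimate => //; first by rewrite addr_ge0// mulr_ge0.
  by apply: low_measurable; exact: Em.
move=> l l0 Nl; have El := psd_EZ HQ l Eh.
have Ph : PB (l *: h) K by apply: hK => //; rewrite le_max Nl orbT.
apply: (IB_eq mD) (hC k w (l *: h) CP Pw Ph _) => [x _|].
  by congr (`|_|); rewrite -low_Z.
apply: sqr_E => //; rewrite ler_piMr//.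
by rewrite exprn_ile1// qnorm_ge0.
Qed.

Let gz0c x : D x -> continuous (gz 0%N x). Proof. exact: gzc. Qed.

Let gzb k x z : D x -> `|gz k x z| <= Cg * (1 + `|z| `^ (s - 1)).
Proof. by move=> Dx; have [_ _ h _] := gAR k Dx. Qed.

Lemma nemytskii k (K e : R) : 0 <= K -> 0 < e -> exists2 del : R, 0 < del &
  forall (z y t f dd : T -> R) (q : R), PB z K -> PB y K -> PB t K ->
  IB (fun x => y x ^+ 2) del -> measurable_fun D f -> IB dd q ->
  (forall x, D x -> exists z' y', [/\ `|z'| <= `|z x|, `|y'| <= `|y x| &
     `|f x| <= dd x + `|gz k x (z' + y') - gz k x z'| * `|t x|]) ->
  IB (fun x => `|f x|) (q + e).
Proof.
exact: (nemytskii_modulus mD fD s2 ss1 Cg0 (@gzc k) (@gzm k) (@gzb k)).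
Qed.

Let IB0 : IB (fun=> 0) 0.
Proof. by have := IB_cst mD fD 0; rewrite mul0r. Qed.

Lemma L_uniform k (rho e : R) : 0 < e -> exists2 del : R, 0 < del &
  forall w w' h, E w -> E w' -> E h -> N w <= rho -> N (w' - w) <= del ->
  `|dJf k w' h - dJf k w h| <= e * N h.
Proof.
move=> e0; have [K K0 hK] := PB_E (Num.max rho 1).
have [K' KK' hK'] := PB_wv K; have K'0 := le_trans K0 KK'.
have e2 : 0 < e / 2 by rewrite divr_gt0.
have [del del0 hdel] := nemytskii k K'0 e2.
have CP1 : 0 < CP + 1 by rewrite ltr_wpDl.
pose d1 := Num.min (Num.min 1 (e / 2 / c)) (Num.min 1 (del / (CP + 1))).
have d10 : 0 < d1 by rewrite !lt_min ltr01/= !divr_gt0.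
have d11 : d1 <= 1 by rewrite /d1 !ge_min lexx.
have d1c : d1 <= e / 2 / c by rewrite /d1 !ge_min lexx !orbT.
have d1d : d1 <= del / (CP + 1) by rewrite /d1 !ge_min lexx !orbT.
exists d1 => // w w' h Ew Ew' Eh Nw Nd.
have Ed := psd_EB HQ Ew' Ew; have Nd0 := qnorm_ge0 Q (w' - w).
have Nh0 := qnorm_ge0 Q h.
pose f x := (gz k x (w' x + v k x) - gz k x (w x + v k x)) * h x.
have mf : measurable_fun D f.
  apply: measurable_funM; last exact: Em.
  by apply: measurable_funB; apply: gzm; apply: measurable_funD => //; exact: Em.
have LE : dJf k w' h - dJf k w h = c * Q (w' - w) h - \int[mu]_(x in D) f x.
  rewrite /dJf (psd_linB HQ Ew' Ew Eh).
  have i1 := low_itgE k Ew' Eh; have i2 := low_itgE k Ew Eh.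
  rewrite (_ : \int[mu]_(x in D) f x = \int[mu]_(x in D) low k w' h x -
    \int[mu]_(x in D) low k w h x); first by ring.
  by rewrite -RintegralB//; apply: eq_Rintegral => x _; rewrite /f /low; ring.
rewrite LE {1}(splitr e) mulrDl; apply: (le_trans (ler_normB _ _)); apply: lerD.
  rewrite normrM (ger0_norm (ltW c0)).
  apply: (@le_trans _ _ (c * (N (w' - w) * N h))).
    by rewrite ler_wpM2l ?(ltW c0)// (psd_CS HQ).
  rewrite mulrA ler_wpM2r// mulrC -ler_pdivlMr//; exact: le_trans Nd d1c.
apply: unit_estimate => //; first exact: ltW.
move=> l l0 Nl; have El := psd_EZ HQ l Eh.
have Pw : PB w K by apply: hK => //; rewrite le_max Nw.
have [_ Pz] := hK' k w Pw.
have Pd : PB (w' - w) K' by apply: PB_weak KK' _; apply: hK => //; rewrite le_max (le_trans Nd d11) orbT.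
have Pt : PB (l *: h) K' by apply: PB_weak KK' _; apply: hK => //; rewrite le_max Nl orbT.
rewrite -[e / 2]add0r; apply: (hdel _ _ _ _ _ _ Pz Pd Pt _ _ IB0).
- apply: sqr_E => //; apply: (@le_trans _ _ (CP * d1)).
    rewrite ler_wpM2l// expr2 (le_trans _ Nd)// ler_piMl//; exact: le_trans Nd d11.
  apply: (@le_trans _ _ ((CP + 1) * d1)); first by rewrite ler_wpM2r ?(ltW d10)// lerDl.
  by rewrite mulrC -ler_pdivlMr.
- by apply: measurable_funM => //; exact: measurable_cst.
- move=> x Dx; exists (w x + v k x), ((w' - w) x); split => //.
  rewrite add0r /f mulrCA normrM -[(l *: h) x]/(l * h x).
  by rewrite -[(w' - w) x]/(w' x - w x) (_ : w x + v k x + _ = w' x + v k x)//; ring.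
Qed.

(** The quadratic part leaves c/2 Q h h, of second order. By the mean value theorem the integrand of
    the rest is a difference of values of [gz] at points at most |h| apart, times h, which is what
    [nemytskii] estimates. *)
Lemma F_differentiable k (rho e : R) : 0 < e -> exists2 del : R, 0 < del &
  forall w h, E w -> E h -> N w <= rho -> N h <= del ->
  `|Jf k (w + h) - Jf k w - dJf k w h| <= e * N h.
Proof.
move=> e0; have [K K0 hK] := PB_E (Num.max rho 1).
have [K' KK' hK'] := PB_wv K; have K'0 := le_trans K0 KK'.
have e2 : 0 < e / 2 by rewrite divr_gt0.
have [del del0 hdel] := nemytskii k K'0 e2.
have CP1 : 0 < CP + 1 by rewrite ltr_wpDl.
pose d1 := Num.min (Num.min 1 (e / c)) (Num.min 1 (del / (CP + 1))).
have d10 : 0 < d1 by rewrite !lt_min ltr01/= !divr_gt0.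
have d11 : d1 <= 1 by rewrite /d1 !ge_min lexx.
have d1c : d1 <= e / c by rewrite /d1 !ge_min lexx !orbT.
have d1d : d1 <= del / (CP + 1) by rewrite /d1 !ge_min lexx !orbT.
exists d1 => // w h Ew Eh Nw Nh.
have Ewh := psd_ED HQ Ew Eh; have Nh0 := qnorm_ge0 Q h.
pose f x := g k x (w x + h x + v k x) - g k x (w x + v k x) - gz k x (w x + v k x) * h x.
have mwv : measurable_fun D (fun x => w x + v k x) by apply: measurable_funD => //; exact: Em.
have mf : measurable_fun D f.
  apply: measurable_funB; last by apply: measurable_funM; [exact: gzm|exact: Em].
  apply: measurable_funB; last exact: gm.
  by apply: gm; apply: measurable_funD => //; apply: measurable_funD; exact: Em.
have FE : Jf k (w + h) - Jf k w - dJf k w h = c / 2 * Q h h - \int[mu]_(x in D) f x.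
  have i1 := upp_itgE k Ewh; have i2 := upp_itgE k Ew; have i3 := low_itgE k Ew Eh.
  have q := psd_sqrD HQ 1 1 Ew Eh; rewrite !scale1r in q.
  rewrite (_ : \int[mu]_(x in D) f x = \int[mu]_(x in D) upp k (w + h) x -
    \int[mu]_(x in D) upp k w x - \int[mu]_(x in D) low k w h x).
    by rewrite /Jf /dJf q; field.
  rewrite -RintegralB// -RintegralB//; last exact: itgB.
  by apply: eq_Rintegral => x _; rewrite /f /low /upp -[(w + h) x]/(w x + h x); ring.
rewrite FE {1}(splitr e) mulrDl; apply: (le_trans (ler_normB _ _)); apply: lerD.
  rewrite ger0_norm; last by rewrite mulr_ge0 ?(psd_ge0 HQ)// divr_ge0 ?(ltW c0).
  rewrite -(qnorm_sqr HQ)// expr2 mulrA ler_wpM2r//.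
  rewrite mulrAC ler_wpM2r// mulrC -ler_pdivlMr//; exact: le_trans Nh d1c.
apply: unit_estimate => //; first exact: ltW.
move=> l l0 Nl; have El := psd_EZ HQ l Eh.
have Pw : PB w K by apply: hK => //; rewrite le_max Nw.
have [_ Pz] := hK' k w Pw.
have Pd : PB h K' by apply: PB_weak KK' _; apply: hK => //; rewrite le_max (le_trans Nh d11) orbT.
have Pt : PB (l *: h) K' by apply: PB_weak KK' _; apply: hK => //; rewrite le_max Nl orbT.
rewrite -[e / 2]add0r; apply: (hdel _ _ _ _ _ _ Pz Pd Pt _ _ IB0).
- apply: sqr_E => //; apply: (@le_trans _ _ (CP * d1)).
    rewrite ler_wpM2l// expr2 (le_trans _ Nh)// ler_piMl//; exact: le_trans Nh d11.
  apply: (@le_trans _ _ ((CP + 1) * d1)); first by rewrite ler_wpM2r ?(ltW d10)// lerDl.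
  by rewrite mulrC -ler_pdivlMr.
- by apply: measurable_funM => //; exact: measurable_cst.
- move=> x Dx; have [dg _ _ _] := gAR k Dx.
  have [xi xi1 xi2] := MVT_abs (w x + v k x) (w x + h x + v k x) dg.
  have e1 : w x + h x + v k x - (w x + v k x) = h x by ring.
  rewrite e1 in xi1 xi2.
  exists (w x + v k x), (xi - (w x + v k x)); split => //.
  rewrite add0r (addrC _ (xi - _)) subrK /f xi2 -mulrBl mulrCA normrM.
  by rewrite -[(l *: h) x]/(l * h x).
Qed.

Lemma v_pow k x : 1 + `|v k x| `^ s <= 2 + `|v k x| `^ s1.
Proof. by have := powR_le1D s0 (ltW ss1) (normr_ge0 (v k x)); lra. Qed.

Lemma IB_vpow k (C : R) : 0 <= C ->
  IB (fun x => C * (2 + `|v k x| `^ s1)) (C * (2 * m + Kv)).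
Proof. by move=> C0; apply: IB_Z => //; apply: IB_D => //; [exact: IB_cst|case: (vP k)]. Qed.

(** In dJf - q Jf the quadratic form appears with the negative factor - c (q/2 - 1), because q > 2;
    the shifted Ambrosetti-Rabinowitz inequality bounds the rest, except for the cross term of v k
    and w. *)
Lemma F_AR_bound : exists q c1 C1 : R, [/\ 0 < q, 0 < c1, 0 <= C1 &
  forall k w, E w -> dJf k w w <= q * Jf k w - c1 * N w ^+ 2 + C1].
Proof.
have [q [C [q2 C0 hC]]] := AR_shift s2 Cg0 p2 a0 r0.
(* Half of the available coefficient; the other half absorbs the cross term c (q - 1) v w through
   the Poincare inequality. *)
pose c1 := c * (q / 2 - 1) / 2.
have c10 : 0 < c1 by rewrite !(mulr_gt0, divr_gt0)//; lra.
pose ka := c1 / (CP + 1).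
have CP1 : 0 < CP + 1 by rewrite ltr_wpDl.
have ka0 : 0 < ka by rewrite divr_gt0.
have cq0 : 0 <= c * (q - 1) by rewrite mulr_ge0 ?(ltW c0)//; lra.
pose A := C + q * Cg; have A0 : 0 <= A by rewrite addr_ge0// mulr_ge0//; lra.
pose Bv := (c * (q - 1)) ^+ 2 / ka; have Bv0 : 0 <= Bv by rewrite divr_ge0 ?sqr_ge0// ltW.
pose C1 := A * (2 * m + Kv) + Bv * (m + Kv).
have C10 : 0 <= C1.
  have hm := m0; have hK := Kv0.
  by rewrite addr_ge0// mulr_ge0//; lra.
exists q, c1, C1; split => //; first lra.
move=> k w Ew.
have i1 := low_itgE k Ew Ew; have i2 := upp_itgE k Ew.
have Hdom := IB_D mD (IB_D mD (IB_vpow k A0) (IB_Z mD (ltW ka0) (poincare Ew)))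
  (IB_Z mD Bv0 (PB_sqr (vP k))).
have H := IB_lower (itgB mD i1 (itgZ mD q i2)) Hdom.
have pw x : D x -> - (A * (2 + `|v k x| `^ s1) + ka * w x ^+ 2 + Bv * v k x ^+ 2) <=
    low k w w x - q * upp k w x.
  move=> Dx; have := hC _ _ (gAR k Dx) (w x + v k x) (v k x); rewrite addrK => h.
  have [_ gb _ _] := gAR k Dx.
  have h2 : `|g k x (v k x)| <= Cg * (2 + `|v k x| `^ s1).
    by apply: (le_trans (gb _)); rewrite ler_wpM2l// v_pow.
  have h3 : C * (1 + `|v k x| `^ s) <= C * (2 + `|v k x| `^ s1).
    by rewrite ler_wpM2l// v_pow.
  have h4 : q * `|g k x (v k x)| <= q * (Cg * (2 + `|v k x| `^ s1)).
    by rewrite ler_wpM2l//; lra.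
  have h5 : - (q * `|g k x (v k x)|) <= q * g k x (v k x).
    by rewrite -mulrN ler_wpM2l//; [lra|rewrite lerNl -normrN ler_norm].
  have h6 := young2 (c * (q - 1) * v k x) (w x) ka0.
  have e6 : (c * (q - 1) * v k x) ^+ 2 / ka = Bv * v k x ^+ 2 by rewrite exprMn /Bv mulrAC.
  rewrite e6 in h6.
  rewrite /low /upp /A; move: h h2 h3 h4 h5 h6.
  move: (gz k x _) (g k x (w x + _)) (g k x (v k x)) (`|g k x (v k x)|) (`|v k x| `^ s) (`|v k x| `^ s1) => y1 y2 y3 y4 y5 y6.
  lra.
have {}H := H pw.
rewrite (RintegralB mD i1 (itgZ mD q i2)) (RintegralZl q mD i2) in H.
rewrite /dJf /Jf (qnorm_sqr HQ)//.
have kap : ka * (CP * Q w w) <= c1 * Q w w.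
  rewrite mulrA ler_wpM2r ?(psd_ge0 HQ)//.
  by rewrite /ka mulrAC ler_pdivrMr// ler_wpM2l ?(ltW c10)// lerDl.
have e1 : q * (c / 2 * Q w w) - c * Q w w = 2 * c1 * Q w w by rewrite /c1; field.
by move: H kap e1; rewrite -/m /C1; move: (Q w w) => y; lra.
Qed.

Lemma F_superquadratic M : exists C : R, forall k w, E w ->
  Jf k w <= c / 2 * N w ^+ 2 + C - M * \int[mu]_(x in D) (w x * w x).
Proof.
pose M' := 2 * `|M| + c.
have [C C0 hC] := AR_superquadratic s2 Cg0 p2 a0 r0 M'.
have M'0 : 0 <= M' by rewrite addr_ge0 ?mulr_ge0// ltW.
pose A := M' + c; have A0 : 0 <= A by rewrite addr_ge0// ltW.
exists (C * m + A * (m + Kv) + Cg * (2 * m + Kv)) => k w Ew.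
have i2 := upp_itgE k Ew.
have iw : itg (fun x => w x * w x).
  by have [h _] := poincare Ew; apply: eq_integrable h.
have Hdom := IB_D mD (IB_D mD (IB_cst mD fD C) (IB_Z mD A0 (PB_sqr (vP k)))) (IB_vpow k Cg0).
have H := IB_lower (itgB mD i2 (itgZ mD `|M| iw)) Hdom.
have pw x : D x -> - (C + A * v k x ^+ 2 + Cg * (2 + `|v k x| `^ s1)) <=
    upp k w x - `|M| * (w x * w x).
  move=> Dx; have h := hC _ _ (gAR k Dx) (w x + v k x).
  have [_ gb _ _] := gAR k Dx.
  have h2 : `|g k x (v k x)| <= Cg * (2 + `|v k x| `^ s1).
    by apply: (le_trans (gb _)); rewrite ler_wpM2l// v_pow.
  have h3 := ler_norm (g k x (v k x)).
  (* M' (w + v)^2 + c v w - |M| w^2 is split into its |M| part and its c part and the squares are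
     completed; the leftover multiple of v^2 is covered by [A]. *)
  have h4 : 0 <= `|M| * (w x + 2 * v k x) ^+ 2 by rewrite mulr_ge0// sqr_ge0.
  have h5 : 0 <= c * (w x + 3 / 2 * v k x) ^+ 2 by rewrite mulr_ge0 ?sqr_ge0// ltW.
  have h6 : 0 <= c * v k x ^+ 2 by rewrite mulr_ge0 ?sqr_ge0// ltW.
  rewrite /upp; move: h h2 h3 h4 h5 h6; rewrite /A /M'.
  by rewrite !expr2; lra.
have {}H := H pw.
rewrite (RintegralB mD i2 (itgZ mD _ iw)) (RintegralZl _ mD iw) in H.
rewrite /Jf (qnorm_sqr HQ)//.
have w20 : 0 <= \int[mu]_(x in D) (w x * w x).
  by apply: Rintegral_ge0 => x _; rewrite -expr2 sqr_ge0.
have : M * \int[mu]_(x in D) (w x * w x) <= `|M| * \int[mu]_(x in D) (w x * w x).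
  by rewrite ler_wpM2r// ler_norm.
by move: H; rewrite -/m; lra.
Qed.

(** Integrating [near_zero_bound] over the normalised function gives an error of order N^s with s >
    2, which is below c/4 N^2 for small N. The bound is for index 0, where hypothesis (4) involves
    the right v 0; large k follow by convergence. *)
Lemma F_near_zero : exists2 rr : R, 0 < rr & forall w, E w -> 0 < N w -> N w <= rr ->
  c / 4 * N w ^+ 2 <= Jf 0%N w.
Proof.
have [C C0 hC] := near_zero_bound s2 Cg0 c0 b0 bc zeta0 zz.
pose K := C * (m + CS); have K0 : 0 <= K by rewrite mulr_ge0// addr_ge0.
have hs2 : 0 < s - 2 by rewrite subr_gt0.
(* Solves (K + 1) rr^(s-2) = c / 4. *)
pose rr := (c / 4 / (K + 1)) `^ (s - 2)^-1.
have q0 : 0 < c / 4 / (K + 1) by rewrite !divr_gt0// ltr_wpDl.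
exists rr; first by rewrite powR_gt0.
move=> w Ew Nw Nr.
have i2 := upp_itgE 0%N Ew.
have Et := psd_EZ HQ (N w)^-1 Ew.
have Nt : N ((N w)^-1 *: w) <= 1.
  by rewrite (qnormZ HQ)// gtr0_norm ?invr_gt0// mulVf// gt_eqF.
have HS := IB_D mD (IB_cst mD fD 1) (sobolev Et Nt).
have Cs : 0 <= C * N w `^ s by rewrite mulr_ge0// powR_ge0.
have H := IB_upper i2 (IB_Z mD Cs HS).
have pw x : D x -> upp 0%N w x <= C * N w `^ s * (1 + `|((N w)^-1 *: w) x| `^ s1).
  move=> Dx; have [_ gb _ _] := gAR 0%N Dx.
  have h := hC (g 0%N x) (v 0%N x) (v0z Dx) gb (fun z => g0near Dx) (w x).
  have h1 := powR_le1D s0 (ltW ss1) (normr_ge0 (((N w)^-1 *: w) x)).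
  have h2 : `|w x| `^ s = N w `^ s * `|((N w)^-1 *: w) x| `^ s.
    rewrite -powRM ?(ltW Nw)//; congr (_ `^ _).
    rewrite -[(_ *: w) x]/((N w)^-1 * w x) normrM gtr0_norm ?invr_gt0//.
    by rewrite mulrA mulfV ?mul1r// gt_eqF.
  have h3 : C * `|w x| `^ s <= C * N w `^ s * (1 + `|((N w)^-1 *: w) x| `^ s1).
    by rewrite h2 mulrA ler_wpM2l.
  by apply: le_trans h3; apply: le_trans h; rewrite /upp; lra.
have {}H := H pw.
rewrite /Jf -(qnorm_sqr HQ)//.
have h1 : N w `^ (s - 2) <= c / 4 / (K + 1).
  have h := powR_mono (ltW hs2) (ltW Nw) Nr; apply: (le_trans h).
  by rewrite /rr -powRrM mulVf ?gt_eqF// powRr1// ltW.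
have h2 : N w `^ s = N w ^+ 2 * N w `^ (s - 2).
  rewrite sqr_powR ?(ltW Nw)// -powRD; last by apply/implyP => _; rewrite gt_eqF.
  by congr (_ `^ _); ring.
have h3 : C * N w `^ s * (1 * m + CS) <= c / 4 * N w ^+ 2.
  rewrite h2 mul1r (_ : _ * _ = N w ^+ 2 * (N w `^ (s - 2) * K)); last by rewrite /K; ring.
  rewrite [leRHS]mulrC ler_wpM2l ?sqr_ge0//.
  apply: (@le_trans _ _ (c / 4 / (K + 1) * K)); first by rewrite ler_wpM2r.
  rewrite mulrAC ler_pdivrMr ?ltr_wpDl// ler_wpM2l ?lerDl//; have := c0; lra.
by move: H h3; rewrite -/m; lra.
Qed.

Lemma dv_P k : PB (fun x => v k x - v 0%N x) (2 `^ s1 * (Kv + Kv)).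
Proof.
apply: PB_D => //; have [mv h] := vP 0%N; split; first exact: measurable_funN.
by apply: (IB_eq mD) h => x _; rewrite normrN.
Qed.

(** Common source of the convergence of values and of derivatives, with th an intermediate point or
    w itself. Three errors occur: v k - v 0 in the linear term, the change of [gz] with k at a fixed
    argument, and the shift of the argument of [gz 0] by v k - v 0. The first two form [dd], the
    third is left to [nemytskii]. *)
Lemma convergence_core (rho e : R) : 0 < e -> exists k0, forall k, (k0 <= k)%N ->
  forall w t (f : T -> R), E w -> E t -> N w <= rho -> N t <= rho -> measurable_fun D f ->
  (forall x, D x -> exists2 th : R, `|th| <= `|w x| &
     `|f x| <= `|c * (v k x - v 0%N x) +
       (gz k x (th + v k x) - gz 0%N x (th + v 0%N x))| * `|t x|) ->
  IB (fun x => `|f x|) e.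
Proof.
move=> e0; have [K0 K00 hK0] := PB_E rho.
have [K1 K01 hK1] := PB_wv K0; have K10 := le_trans K00 K01.
pose K := K1 + 2 `^ s1 * (Kv + Kv).
have KK : 0 <= 2 `^ s1 * (Kv + Kv) by rewrite mulr_ge0 ?powR_ge0// addr_ge0.
have Kge0 : 0 <= K by rewrite addr_ge0.
have e3 : 0 < e / 3 by rewrite divr_gt0.
have [del del0 hdel] := nemytskii 0%N Kge0 e3.
have hm := m0.
have mK0 : 0 < m + K + 1 by lra.
pose ka := e / 3 / (m + K + 1); have ka0 : 0 < ka by rewrite !divr_gt0.
pose e1 := Num.min del (e / 6 / (c ^+ 2 / ka + 1)).
have cka : 0 < c ^+ 2 / ka + 1 by rewrite ltr_wpDl// divr_ge0 ?sqr_ge0// ltW.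
have e10 : 0 < e1 by rewrite lt_min del0 !divr_gt0.
have [kA hA] := vcv e10.
have mK3 : 0 < 3 * (m + K) + 1 by lra.
have e20 : 0 < e / 6 / (3 * (m + K) + 1) by rewrite !divr_gt0.
have [kB hB] := eecv e20.
exists (maxn kA kB) => k; rewrite geq_max => /andP[kkA kkB] w t f Ew Et Nw Nt mf hf.
have Pw := hK0 w Ew Nw; have Pt := hK0 t Et Nt.
have le01 : K0 <= K by rewrite /K; lra.
have [P1 _] := hK1 k w Pw; have [P2 _] := hK1 0%N w Pw.
have PtK := PB_weak le01 Pt; have le1K : K1 <= K by rewrite /K lerDl.
have PyK : PB (fun x => v k x - v 0%N x) K by apply: PB_weak (dv_P k); rewrite /K lerDr.
have dvs := hA k kkA.
pose dd x := ka * t x ^+ 2 + c ^+ 2 / ka * (v k x - v 0%N x) ^+ 2 +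
  ee k * ((1 + (`|w x| + `|v k x|) ^+ 2) + t x ^+ 2).
have IBdd : IB dd (2 * (e / 3)).
  have ts := PB_sqr PtK.
  have zs := PB_sqr (PB_weak le1K P1).
  have H1 := IB_Z mD (ltW ka0) ts.
  have H2 := IB_Z mD (divr_ge0 (sqr_ge0 c) (ltW ka0)) dvs.
  have H3 := IB_Z mD (ee0 k) (IB_D mD (IB_D mD (IB_cst mD fD 1) zs) ts).
  apply: IB_weak (IB_D mD (IB_D mD H1 H2) H3).
  have b1 : ka * (m + K) <= e / 3.
    by rewrite /ka mulrAC ler_pdivrMr// ler_wpM2l ?(ltW e3)//; lra.
  have b2 : c ^+ 2 / ka * e1 <= e / 6.
    have ck0 : 0 <= c ^+ 2 / ka by rewrite divr_ge0 ?sqr_ge0// ltW.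
    have e1e : e1 <= e / 6 / (c ^+ 2 / ka + 1) by rewrite /e1 ge_min lexx orbT.
    apply: (le_trans (ler_wpM2l ck0 e1e)).
    rewrite mulrCA ler_piMr ?divr_ge0 ?(ltW e0)//.
    by rewrite ler_pdivrMr// mul1r lerDl.
  have b3 : ee k * (1 * fine (mu D) + (m + K) + (m + K)) <= e / 6.
    have hK := hB k kkB.
    rewrite -[leRHS](divfK (lt0r_neq0 mK3)); apply: ler_pM => //; rewrite -/m; lra.
  by lra.
have -> : e = 2 * (e / 3) + e / 3 by field.
apply: (hdel _ _ _ _ _ _ (PB_weak le1K P2) PyK PtK _ mf IBdd).
  by apply: IB_weak dvs; rewrite ge_min lexx.
move=> x Dx; have [th thw hfx] := hf x Dx.
exists (th + v 0%N x), (v k x - v 0%N x); split => //.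
  rewrite (@ger0_norm _ (`|w x| + _)) ?addr_ge0//; apply: (le_trans (ler_normD _ _)).
  by rewrite lerD2r.
apply: (le_trans hfx).
have tz := gzk k (th + v k x) Dx.
rewrite (_ : th + v 0%N x + (v k x - v 0%N x) = th + v k x); last by ring.
set G0 := gz 0%N x (th + v k x) - gz 0%N x (th + v 0%N x).
have h1 : `|c * (v k x - v 0%N x) + (gz k x (th + v k x) - gz 0%N x (th + v 0%N x))| <=
    c * `|v k x - v 0%N x| + ee k * (1 + (`|w x| + `|v k x|)) + `|G0|.
  rewrite (_ : _ + _ = c * (v k x - v 0%N x) +
    (gz k x (th + v k x) - gz 0%N x (th + v k x)) + G0); last by rewrite /G0; ring.
  apply: (le_trans (ler_normD _ _)); rewrite lerD2r.
  apply: (le_trans (ler_normD _ _)); rewrite normrM (ger0_norm (ltW c0)) lerD2l.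
  apply: (le_trans tz); rewrite ler_wpM2l// lerD2l; apply: (le_trans (ler_normD _ _)).
  by rewrite lerD2r.
apply: (le_trans (ler_wpM2r (normr_ge0 (t x)) h1)); rewrite mulrDl lerD2r.
rewrite /dd mulrDl.
have h2 := young2 (c * `|v k x - v 0%N x|) `|t x| ka0.
have e2 : (c * `|v k x - v 0%N x|) ^+ 2 / ka = c ^+ 2 / ka * (v k x - v 0%N x) ^+ 2.
  by rewrite exprMn real_normK ?num_real// mulrAC.
rewrite e2 (real_normK (num_real (t x))) in h2.
have h3 : (1 + (`|w x| + `|v k x|)) * `|t x| <= 1 + (`|w x| + `|v k x|) ^+ 2 + t x ^+ 2.
  rewrite -(real_normK (num_real (t x))).
  have := sqr_ge0 (1 - `|t x|); have := sqr_ge0 ((`|w x| + `|v k x|) - `|t x|).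
  have := sqr_ge0 (`|w x| + `|v k x|); have := sqr_ge0 `|t x|.
  move: (`|w x| + `|v k x|) (`|t x|) => y1 y2; rewrite !expr2; lra.
have h4 : ee k * ((1 + (`|w x| + `|v k x|)) * `|t x|) <=
  ee k * (1 + (`|w x| + `|v k x|) ^+ 2 + t x ^+ 2) by rewrite ler_wpM2l.
by rewrite -[X in _ + X <= _]mulrA; apply: lerD.
Qed.

Lemma is_derive_shift (h dh : R -> R) (z q : R) :
  (forall z, is_derive z (1 : R) h (dh z)) ->
  is_derive z (1 : R) (fun z => h (z + q)) (dh (z + q)).
Proof.
move=> H.
have sh : is_derive z (1 : R) (fun z : R => z + q) 1.
  have := is_deriveD (is_derive_id z (1 : R)) (is_derive_cst q z (1 : R)).
  by rewrite addr0.
by have := @is_derive1_comp _ h (fun z => z + q) z _ _ (H (z + q)) sh; rewrite mulr1.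
Qed.

Lemma F_converges (rho e : R) : 0 < e -> exists k0, forall k, (k0 <= k)%N ->
  forall w, E w -> N w <= rho -> `|Jf k w - Jf 0%N w| <= e.
Proof.
move=> e0; have [k0 hk0] := convergence_core rho e0; exists k0 => k kk0 w Ew Nw.
have i1 := upp_itgE k Ew; have i2 := upp_itgE 0%N Ew.
have mf : measurable_fun D (fun x => upp k w x - upp 0%N w x).
  by apply: measurable_funB; apply: upp_measurable; exact: Em.
rewrite (_ : Jf k w - Jf 0%N w = - \int[mu]_(x in D) (upp k w x - upp 0%N w x)); last first.
  by rewrite RintegralB// /Jf; ring.
rewrite normrN; apply: (IB_abs mD _ mf).2.
apply: (hk0 k kk0 w w) => // x Dx.
have [d1 _ _ _] := gAR k Dx; have [d2 _ _ _] := gAR 0%N Dx.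
(* The difference of the integrands is ph (w x) - ph 0, so the mean value theorem reduces values to
   derivatives. *)
pose ph z := (g k x (z + v k x) - g 0%N x (z + v 0%N x)) + c * (v k x - v 0%N x) * z.
have dph z : is_derive z (1 : R) ph
    (gz k x (z + v k x) - gz 0%N x (z + v 0%N x) + c * (v k x - v 0%N x)).
  apply: is_deriveD.
    by apply: is_deriveB; exact: is_derive_shift.
  have := is_deriveZ (c * (v k x - v 0%N x)) (is_derive_id z (1 : R)).
  by rewrite /GRing.scale /= mulr1.
have [xi xi1 xi2] := MVT_abs 0 (w x) dph.
rewrite !subr0 in xi1 xi2; exists xi => //.
rewrite (_ : upp k w x - upp 0%N w x = ph (w x) - ph 0); last first.
  by rewrite /upp /ph !add0r mulr0 addr0; ring.
by rewrite xi2 normrM addrC.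
Qed.

Lemma L_converges (rho e : R) : 0 < e -> exists k0, forall k, (k0 <= k)%N ->
  forall w h, E w -> E h -> N w <= rho -> `|dJf k w h - dJf 0%N w h| <= e * N h.
Proof.
move=> e0; have [k0 hk0] := convergence_core (Num.max rho 1) e0.
exists k0 => k kk0 w h Ew Eh Nw.
have i1 := low_itgE k Ew Eh; have i2 := low_itgE 0%N Ew Eh.
have mf : measurable_fun D (fun x => low k w h x - low 0%N w h x).
  by apply: measurable_funB; apply: low_measurable; exact: Em.
rewrite (_ : dJf k w h - dJf 0%N w h = - \int[mu]_(x in D) (low k w h x - low 0%N w h x)); last first.
  by rewrite RintegralB// /dJf; ring.
rewrite normrN; apply: unit_estimate => //; first exact: ltW.
move=> l l0 Nl; apply: (hk0 k kk0 w (l *: h)) => //.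
- exact: (psd_EZ HQ).
- by rewrite le_max Nw.
- by rewrite le_max Nl orbT.
- by apply: measurable_funM => //; exact: measurable_cst.
- move=> x Dx; exists (w x) => //.
  rewrite -[(l *: h) x]/(l * h x) -normrM.
  rewrite (_ : l * (low k w h x - low 0%N w h x) = (c * (v k x - v 0%N x) +
    (gz k x (w x + v k x) - gz 0%N x (w x + v 0%N x))) * (l * h x))//.
  by rewrite /low; ring.
Qed.

(** After extraction the sequence is Cauchy in L2. Testing the derivatives at two members with their
    difference isolates the seminorm of that difference, since the lower-order terms are small by
    [low_small]. The indices [kk] are arbitrary, and this is the uniformity in k. *)
Lemma palais_smale (kk : nat -> nat) (w : nat -> T -> R) (K : R) :
  (forall j, E (w j) /\ N (w j) <= K) ->
  (forall e : R, 0 < e -> exists j0, forall j, (j0 <= j)%N ->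
     forall h, E h -> `|dJf (kk j) (w j) h| <= e * N h) ->
  exists (sigma : nat -> nat) (l : T -> R), [/\ {homo sigma : i j / (i < j)%N}, E l &
    N (w (sigma j) - l) @[j --> \oo] --> (0 : R)].
Proof.
move=> wK Lw; have [sg hsg sgP] := compactE wK.
exists sg; suff [l El hl] : exists2 l, E l & N (w (sg j) - l) @[j --> \oo] --> (0 : R).
  by exists l.
have Ew j : E (w j) by have [] := wK j.
have Nw j : N (w j) <= K by have [] := wK j.
have K0 : 0 <= K by apply: le_trans (Nw 0%N); exact: qnorm_ge0.
apply: (complete (fun j => Ew (sg j))) => e e0.
have [A A0 hA] := PB_E (2 * K + 1).
have ce : 0 < c * e ^+ 2 by rewrite mulr_gt0// exprn_gt0.
have ce8 : 0 < c * e ^+ 2 / 8 by rewrite divr_gt0.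
have [C C0 hC] := low_small A0 ce8.
have [j1 hj1] := Lw (c * e ^+ 2 / (16 * (K + 1))) (divr_gt0 ce (mulr_gt0 (ltr0n R 16) (ltr_wpDl K0 ltr01))).
have [j2 hj2] := sgP (c * e ^+ 2 / 8 / (C + 1)) (divr_gt0 ce8 (ltr_wpDl C0 ltr01)).
exists (maxn j1 j2) => i j; rewrite !geq_max => /andP[ij1 ij2] /andP[jj1 jj2].
pose dd := w (sg i) - w (sg j); have Ed : E dd by exact: (psd_EB HQ).
have Nd : N dd <= 2 * K.
  by apply: (le_trans (qnormB HQ (Ew _) (Ew _))); have := Nw (sg i); have := Nw (sg j); lra.
have sgi := leq_trans ij1 (mono_ge hsg i); have sgj := leq_trans jj1 (mono_ge hsg j).
have Pd : PB dd A by apply: hA => //; lra.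
have Pw q : PB (w q) A by apply: hA => //; have := Nw q; lra.
have d2 := hj2 i j ij2 jj2.
have Hi := (IB_abs mD (hC (kk (sg i)) _ _ _ (Pw (sg i)) Pd d2)
  (low_measurable _ (Em (Ew _)) (Em Ed))).2.
have Hj := (IB_abs mD (hC (kk (sg j)) _ _ _ (Pw (sg j)) Pd d2)
  (low_measurable _ (Em (Ew _)) (Em Ed))).2.
have Li := hj1 _ sgi dd Ed; have Lj := hj1 _ sgj dd Ed.
(* The leading forms of the two derivatives subtract to c Q dd dd; every other term on the right is
   small. *)
have cN : c * N dd ^+ 2 = (dJf (kk (sg i)) (w (sg i)) dd + \int[mu]_(x in D) low (kk (sg i)) (w (sg i)) dd x)
   - (dJf (kk (sg j)) (w (sg j)) dd + \int[mu]_(x in D) low (kk (sg j)) (w (sg j)) dd x).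
  by rewrite /dJf !subrK (qnorm_sqr HQ)// {1}/dd (psd_linB HQ)// -mulrBr.
have b1 : c * e ^+ 2 / (16 * (K + 1)) * N dd <= c * e ^+ 2 / 8.
  apply: (@le_trans _ _ (c * e ^+ 2 / (16 * (K + 1)) * (2 * (K + 1)))).
    by rewrite ler_wpM2l ?divr_ge0 ?(ltW ce)// ?mulr_ge0//; lra.
  rewrite (_ : _ * _ = c * e ^+ 2 / 8)//; field.
  by rewrite gt_eqF// ltr_wpDl.
have b2 : C * (c * e ^+ 2 / 8 / (C + 1)) <= c * e ^+ 2 / 8.
  by rewrite mulrCA ler_piMr ?(ltW ce8)// ler_pdivrMr ?ltr_wpDl// mul1r lerDl.
have {}cN : c * N dd ^+ 2 <= c * e ^+ 2.
  rewrite cN; move: Hi Hj Li Lj; rewrite !ler_norml => /andP[a1 a2] /andP[a3 a4] /andP[a5 a6] /andP[a7 a8].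
  have := ltW ce; lra.
by rewrite -ler_sqr ?nnegrE ?qnorm_ge0 ?(ltW e0)// -(ler_pM2l c0).
Qed.

Definition L2form (w z : T -> R) : R := \int[mu]_(x in D) (w x * z x).

Lemma mul_itgE w z : E w -> E z -> itg (fun x => w x * z x).
Proof.
by move=> /E_PB[K K0 Pw] /E_PB[K' K'0 Pz]; exact: mul_itg Pw Pz.
Qed.

Lemma L2form_psd : psd_form E L2form.
Proof.
split; [exact: psd_E0 HQ|exact: psd_ED HQ|exact: psd_EZ HQ| | |].
- by move=> w z _ _; apply: eq_Rintegral => x _; rewrite mulrC.
- move=> l w z t Ew Ez Et; rewrite /L2form.
  have i1 := mul_itgE Ew Et; have i2 := mul_itgE Ez Et.
  rewrite -(RintegralZl l mD i1) -(RintegralD mD (itgZ mD l i1) i2).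
  apply: eq_Rintegral => x _.
  by rewrite -[(_ + _) x]/(l * w x + z x); ring.
- by move=> w Ew; apply: Rintegral_ge0 => x _; rewrite -expr2 sqr_ge0.
Qed.

Lemma F_at0 k : Jf k 0 = 0.
Proof.
rewrite /Jf (psd_0l HQ (psd_E0 HQ)) mulr0 sub0r.
rewrite (_ : \int[mu]_(x in D) upp k 0 x = 0) ?oppr0//.
rewrite (@eq_Rintegral _ _ _ _ _ (fun=> 0)) ?Rintegral_cst ?mul0r// => x _.
by rewrite /upp -[(0 : T -> R) x]/(0 : R) mulr0 !add0r subrr.
Qed.

Hypothesis L2_definite : forall w, E w -> L2form w w = 0 -> N w = 0.
Variables (NY : (T -> R) -> R) (CY : R).
Hypothesis CY0 : 0 < CY.
Hypothesis NY_ge : forall w, E w -> N w <= NY w.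
Hypothesis NY_le : forall w, E w -> NY w <= CY * N w.
Hypothesis NY_dist : forall w z, E w -> E z -> `|NY w - NY z| <= CY * N (w - z).
Variables (phi psi : T -> R).
Hypotheses (Ephi : E phi) (Epsi : E psi).
Hypothesis indep : forall x y : R,
  L2form (x *: phi + y *: psi) (x *: phi + y *: psi) = 0 -> x = 0 /\ y = 0.

Lemma L2form_phi_neq0 : L2form phi phi != 0.
Proof.
apply/eqP => h; have [] := @indep 1 0; first by rewrite scale1r scale0r addr0.
by move/eqP; rewrite oner_eq0.
Qed.

(** Collects what the passage to the sets W_k consumes. [NY] stands for the norm of Y, in which the
    balls of the mountain pass geometry are measured; it is equivalent to N on E. *)
Lemma mountain_pass_structure : exists (w1 : T -> R) (eta be K : R) (k0 : nat),
  [/\ E w1, 0 < eta, eta < NY w1 & 0 < be] /\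
  [/\ forall k, k = 0%N \/ (k0 <= k)%N ->
       [/\ Jf k w1 < 0, forall w, E w -> NY w = eta -> be <= Jf k w &
         exists2 l : R, be <= l & islevel E Q Jf w1 k l /\
           exists2 w, Jf k w = l & critical E dJf k w],
      forall k (t : R), 0 <= t <= 1 -> Jf k (t *: w1) <= K,
      forall (kk : nat -> nat) (w : nat -> T -> R),
        (forall j, critical E dJf (kk j) (w j)) -> (forall j, Jf (kk j) (w j) <= K) ->
        exists (sigma : nat -> nat) (l : T -> R), [/\ {homo sigma : i j / (i < j)%N}, E l &
          N (w (sigma j) - l) @[j --> \oo] --> (0 : R)] &
      forall (l : nat -> R) w, (forall k, k = 0%N \/ (k0 <= k)%N -> islevel E Q Jf w1 k (l k)) ->
        E w -> (forall e : R, 0 < e -> forall j, exists k z, [/\ (j <= k)%N, N (z - w) <= e,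
          Jf k z = l k & critical E dJf k z]) ->
        Jf 0%N w = l 0%N /\ critical E dJf 0%N w].
Proof.
have HB := L2form_psd.
have c2 : 0 <= c / 2 by rewrite divr_ge0// ltW.
have [T1 T10 hT1] := far_negative HQ HB F_superquadratic Ephi L2form_phi_neq0.
have [rr rr0 hrr] := F_near_zero.
pose eta := rr / 2; have eta0 : 0 < eta by rewrite divr_gt0.
have phiN : 0 < NY phi.
  apply: lt_le_trans (NY_ge Ephi).
  rewrite lt0r qnorm_ge0 andbT; apply/eqP => N0.
  have [h1 h2] := poincare Ephi; rewrite -(qnorm_sqr HQ Ephi) N0 expr0n mulr0 in h2.
  have := L2form_phi_neq0; rewrite /L2form.
  rewrite (@eq_Rintegral _ _ _ _ _ (fun x => phi x ^+ 2)) => [|x _]; last by rewrite expr2.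
  by apply/negP; rewrite negbK eq_le h2 Rintegral_ge0// => x _; exact: sqr_ge0.
have Nphi : 0 < N phi.
  by have := lt_le_trans phiN (NY_le Ephi); rewrite pmulr_rgt0.
(* Far enough for all functionals to be negative from there on, and for the endpoint to have norm
   greater than [eta]. *)
pose TT := Num.max T1 ((eta + 1) / N phi).
have TT0 : 0 < TT by rewrite lt_max T10.
pose w1 := TT *: phi; have Ew1 : E w1 by exact: (psd_EZ HQ).
have w1eta : eta < NY w1.
  apply: (@lt_le_trans _ _ (N w1)); last exact: NY_ge.
  rewrite (qnormZ HQ)// gtr0_norm//; apply: (@lt_le_trans _ _ (eta + 1)); first by rewrite ltrDl.
  by rewrite -ler_pdivrMr// le_max lexx orbT.
have w1neg k (t : R) : 1 <= t -> Jf k (t *: w1) < 0.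
  move=> t1; rewrite /w1 scalerA; apply: hT1.
  apply: (@le_trans _ _ TT); first by rewrite le_max lexx.
  by rewrite ler_peMl// ltW.
have w1indep x y : L2form (x *: w1 + y *: psi) (x *: w1 + y *: psi) = 0 -> x = 0 /\ y = 0.
  rewrite scalerA => /indep[/eqP]; rewrite mulf_eq0 (gt_eqF TT0) orbF => /eqP.
  by [].
have [q [c1 [C1 [q0 c10 C10 AR]]]] := F_AR_bound.
have Fneg k : Jf k w1 < 0 by have := w1neg k 1 (lexx 1); rewrite scale1r.
pose be0 := c / 4 * (eta / CY) ^+ 2.
have be00 : 0 < be0 by rewrite mulr_gt0 ?divr_gt0// exprn_gt0// divr_gt0.
have F0eta w : E w -> NY w = eta -> be0 <= Jf 0%N w.
  move=> Ew Nw.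
  have h1 : eta / CY <= N w by rewrite ler_pdivrMr// mulrC -Nw; exact: NY_le.
  have ec : 0 < eta / CY by rewrite divr_gt0.
  apply: le_trans (hrr w Ew _ _); last 2 first.
  - exact: lt_le_trans h1.
  - apply: (le_trans (NY_ge Ew)); rewrite Nw /eta; lra.
  by rewrite ler_wpM2l ?divr_ge0 ?(ltW c0)// ler_sqr ?nnegrE ?qnorm_ge0 ?(ltW ec).
have [k0 hk0] := F_converges eta (divr_gt0 be00 (ltr0n R 2)).
(* Half of the positive bound on the sphere is given up to the distance between F k and F 0. *)
pose be := be0 / 2; have bep : 0 < be by rewrite divr_gt0.
have Feta k : k = 0%N \/ (k0 <= k)%N -> forall w, E w -> NY w = eta -> be <= Jf k w.
  move=> hk w Ew Nw; have h := F0eta w Ew Nw.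
  case: hk => [->|kk]; first by rewrite /be; lra.
  have := hk0 k kk w Ew; rewrite -Nw => /(_ (NY_ge Ew)).
  by move=> /ler_normlP[h1 h2]; rewrite /be; lra.
have cross k : k = 0%N \/ (k0 <= k)%N -> forall g, mpath E Q w1 g ->
    exists2 t : R, 0 <= t <= 1 & be <= Jf k (g t).
  move=> hk g' [cg g0 g1]; have Eg := cg.1.
  have cNY : continuous (NY \o g').
    move=> t; apply: (@cvg_dist_le _ (NY \o g') (fun s => N (g' s - g' t)) CY); first exact: cg.2.
    by near=> s'; exact: NY_dist.
  have NY0 : NY (g' 0) < eta.
    by apply: (le_lt_trans (NY_le (Eg 0))); rewrite g0 mulr0.
  have NY1 : eta <= NY (g' 1).
    have := NY_dist (Eg 1) Ew1; rewrite g1 mulr0 normr_le0 subr_eq0 => /eqP ->; exact: ltW.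
  have [t [t0 t1 ht _]] := first_hitting_time (@ler01 R) cNY NY0 NY1.
  by exists t; [rewrite (ltW t0)|apply: Feta].
(* With M = 0 this bounds every F k by the norm alone, so K bounds all functionals on the segment
   from 0 to w1, hence all levels. *)
have [Cu hCu] := F_superquadratic 0.
pose K := c / 2 * N w1 ^+ 2 + Cu.
exists w1, eta, be, K, k0; split; first by split.
have lev k : k = 0%N \/ (k0 <= k)%N -> exists2 l : R, be <= l & islevel E Q Jf w1 k l.
  by move=> hk; exact: (level_exists HQ F_differentiable L_bounded Ew1 (cross k hk)).
split.
- move=> k hk; split => //; first exact: Feta.
  have [l bl hl] := lev k hk; exists l => //; split => //.
  have l0 : 0 < l by exact: lt_le_trans bl.
  exact: (mountain_pass_critical HQ HB complete L_linear F_differentiable L_uniform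
    L_bounded q0 c10 C10 AR palais_smale c2 F_superquadratic L2_definite Ew1 Epsi w1indep w1neg F_at0 l0 hl).
- move=> k t /andP[t0 t1]; apply: (le_trans (hCu k _ (psd_EZ HQ t Ew1))).
  rewrite mul0r subr0 lerD2r ler_wpM2l// (qnormZ HQ)// exprMn ger0_norm//.
  by rewrite ler_piMl ?sqr_ge0// exprn_ile1.
- move=> kk w crit FK.
  exact: (critical_compact q0 c10 AR palais_smale crit FK).
- move=> l w hl Ew cl.
  apply: (critical_cluster HQ F_differentiable L_uniform L_bounded F_converges L_converges Ew _ cl).
  have lnn k : k = 0%N \/ (k0 <= k)%N -> islevel E Q Jf w1 k (l k) /\ 0 <= l k; last first.
    exact: (levels_converge HQ HB L_linear F_differentiable q0 c10 C10 AR F_converges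
      c2 F_superquadratic L2_definite Ew1 Epsi w1indep w1neg lnn).
  move=> hk; split; first exact: hl.
  apply/ler_addgt0Pr => e e0; have [g' mg gP] := (hl k hk).2 e e0.
  have [t ti bt] := cross k hk g' mg.
  by apply: le_trans (gP t ti); exact: le_trans (ltW bep) bt.
Unshelve. all: by end_near. Qed.

End variational.

(** * Energies of nonnegative kernels *)

Section nonneg_integral.
Context d (T : measurableType d) (R : realType).
Variables (mu : {measure set T -> \bar R}) (D : set T).
Hypothesis mD : measurable D.
Implicit Types f g : T -> R.

Lemma ge0_int_le f g : measurable_fun D f -> measurable_fun D g ->
  (forall x, D x -> 0 <= f x) -> (forall x, D x -> f x <= g x) ->
  (\int[mu]_(x in D) (f x)%:E <= \int[mu]_(x in D) (g x)%:E)%E.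
Proof.
move=> mf mg f0 fg; apply: ge0_le_integral => //=.
- exact/measurable_EFinP.
- exact/measurable_EFinP.
Qed.

Lemma ge0_int_lin (a b : R) f g : 0 <= a -> 0 <= b -> measurable_fun D f -> measurable_fun D g ->
  (forall x, D x -> 0 <= f x) -> (forall x, D x -> 0 <= g x) ->
  (\int[mu]_(x in D) (a * f x + b * g x)%:E =
   a%:E * \int[mu]_(x in D) (f x)%:E + b%:E * \int[mu]_(x in D) (g x)%:E)%E.
Proof.
move=> a0 b0 /measurable_EFinP mf /measurable_EFinP mg f0 g0.
under eq_integral => x _ do rewrite EFinD !EFinM.
rewrite ge0_integralD//.
- by rewrite !ge0_integralZl_EFin.
- by move=> x Dx; rewrite -EFinM lee_fin mulr_ge0// f0.
- exact: emeasurable_funM.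
- by move=> x Dx; rewrite -EFinM lee_fin mulr_ge0// g0.
- exact: emeasurable_funM.
Qed.

Lemma ge0_IBP f (k : R) : measurable_fun D f -> (forall x, D x -> 0 <= f x) ->
  (\int[mu]_(x in D) (f x)%:E <= k%:E)%E <-> IB mu D f k.
Proof.
move=> mf f0; split=> [h|[fi fk]].
  have fi : itg mu D f.
    apply/integrableP; split; first exact/measurable_EFinP.
    under eq_integral => x /set_mem Dx do rewrite gee0_abs ?lee_fin ?f0//.
    exact: le_lt_trans h (ltry _).
  split => //; rewrite /Rintegral -lee_fin fineK//; exact: integrable_fin_num fi.
by move: fk; rewrite /Rintegral -lee_fin fineK//; exact: integrable_fin_num fi.
Qed.

End nonneg_integral.

(** * Sobolev and Poincare inequalities for nonnegative kernels *)

Section kernel_energy.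
Context d (T : measurableType d) (R : realType).
Variables (mu : {sigma_finite_measure set T -> \bar R}) (D : set T).
Hypothesis mD : measurable D.
Variable K : T * T -> R.
Hypotheses (mK : measurable_fun setT K) (K0 : forall p, 0 <= K p).
Implicit Types (u w : T -> R) (x y : T) (C : set T).

Definition quot u (p : T * T) : R := (u p.1 - u p.2) ^+ 2 * K p.

Lemma quot_ge0 u p : 0 <= quot u p.
Proof. by rewrite mulr_ge0// sqr_ge0. Qed.

Lemma measurable_quot u : measurable_fun setT u -> measurable_fun setT (quot u).
Proof.
move=> mu_; apply: measurable_funM => //; apply: measurable_funX.
apply: measurable_funB; exact: measurableT_comp.
Qed.

Lemma measurable_quot1 u x : measurable_fun setT u ->
  measurable_fun setT (fun y => quot u (x, y)).
Proof.
by move=> mu_; apply: (measurableT_comp (measurable_quot mu_)); exact: pair1_measurable.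
Qed.

(** Integrate u(x)^2 <= 2 (u(x) - u(y))^2 + 2 u(y)^2 over y in C and insert the lower bound on the
    kernel in the first term. The diagonal is exempted because a singular kernel is given a default
    value there. *)
Lemma local_average u x C (m rho : R) : measurable_fun setT u -> measurable C ->
  mu C = m%:E -> 0 <= rho -> (forall y, C y -> x <> y -> 1 <= rho * K (x, y)) ->
  ((u x ^+ 2 * m)%:E <= (2 * rho)%:E * \int[mu]_(y in C) (quot u (x, y))%:E +
     2%:E * \int[mu]_(y in C) (u y ^+ 2)%:E)%E.
Proof.
move=> mu_ mC Cm r0 hC.
have mq := measurable_funTS (D := C) (measurable_quot1 x mu_).
have ms : measurable_fun C (fun y => u y ^+ 2).
  by apply: measurable_funX; exact: measurable_funTS.
rewrite -ge0_int_lin//; last 3 first.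
- exact: mulr_ge0.
- by move=> y _; exact: quot_ge0.
- by move=> y _; exact: sqr_ge0.
have -> : (u x ^+ 2 * m)%:E = (\int[mu]_(y in C) (u x ^+ 2)%:E)%E.
  by rewrite integral_cst// EFinM; congr (_ * _)%E.
apply: ge0_int_le => //.
- by apply: measurable_funD; apply: measurable_funM.
- by move=> y _; exact: sqr_ge0.
move=> y Cy; have [<-|/eqP xy] := eqVneq x y.
  by rewrite /quot /= subrr expr0n/= mul0r mulr0 add0r ler_peMl ?sqr_ge0// ler1n.
have h1 := hC y Cy xy; rewrite /quot /=.
have := sqr_ge0 (u x - 2 * u y); have := ler_wpM2l (sqr_ge0 (u x - u y)) h1.
by rewrite mulr1 => a b; rewrite mulrCA -mulrA; nra.
Qed.

Definition inner_quot C u x : \bar R := (\int[mu]_(y in C) (quot u (x, y))%:E)%E.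

(** The set [Qset], in a general measure space. *)
Definition off_diag : set (T * T) := ~` (~` D `*` ~` D).

Lemma measurable_off_diag : measurable off_diag.
Proof. by apply: measurableC; apply: measurableX; exact: measurableC. Qed.

(** Extended real counterpart of the quadratic form, meaningful before finiteness is known;
    [energyE] links it to [Qform]. *)
Definition energy u : \bar R := (\int[mu \x mu]_(p in off_diag) (quot u p)%:E)%E.

Lemma inner_quot_ge0 C u x : (0 <= inner_quot C u x)%E.
Proof. by apply: integral_ge0 => y _; rewrite lee_fin quot_ge0. Qed.

Lemma inner_quotE C u x : inner_quot C u x = (\int[mu]_y ((quot u (x, y))%:E * (\1_C y)%:E))%E.
Proof.
rewrite /inner_quot integral_mkcond; apply: eq_integral => y _.
by rewrite patchE indicE; case: (y \in C); rewrite ?mule1 ?mule0.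
Qed.

Lemma measurable_inner_quot C u : measurable C -> measurable_fun setT u ->
  measurable_fun setT (inner_quot C u).
Proof.
move=> mC mu_; rewrite (_ : inner_quot C u = fubini_F mu (fun p => ((quot u p)%:E * (\1_C p.2)%:E)%E)).
  apply: measurable_fun_fubini_tonelli_F.
    apply: emeasurable_funM; apply/measurable_EFinP; first exact: measurable_quot.
    by apply: measurableT_comp => //; exact: measurable_indic.
  by move=> p; rewrite -EFinM lee_fin mulr_ge0 ?quot_ge0.
by apply/funext => x; rewrite inner_quotE.
Qed.

(** Tonelli on a rectangle. It is applied to D x D for the Sobolev and compactness estimates and to
    D times an exterior set for Poincare. *)
Lemma inner_quot_energy A C u : measurable A -> measurable C -> A `*` C `<=` off_diag ->
  measurable_fun setT u -> (\int[mu]_(x in A) inner_quot C u x <= energy u)%E.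
Proof.
move=> mA mC AC mu_.
have mq : measurable_fun setT (fun p => (quot u p)%:E) by apply/measurable_EFinP; exact: measurable_quot.
apply: (@le_trans _ _ (\int[mu \x mu]_(p in A `*` C) (quot u p)%:E)%E); last first.
  apply: ge0_subset_integral => //.
  - exact: measurableX.
  - exact: measurable_off_diag.
  - exact: measurable_funTS.
  - by move=> p _; rewrite lee_fin quot_ge0.
rewrite integral_mkcond (integral_mkcond (A `*` C)) fubini_tonelli1; last 2 first.
- apply/(measurable_restrictT _ _).1; first exact: measurableX.
  exact: measurable_funTS.
- by move=> p; apply: erestrict_ge0 => q _; rewrite lee_fin quot_ge0.
apply: ge0_le_integral => //.
- by move=> x _; apply: erestrict_ge0 => y _; exact: inner_quot_ge0.
- by apply/(measurable_restrictT _ _).1 => //; apply: measurable_funTS; exact: measurable_inner_quot.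
- apply: measurable_fun_fubini_tonelli_F.
    apply/(measurable_restrictT _ _).1; first exact: measurableX.
    exact: measurable_funTS.
  by move=> p; apply: erestrict_ge0 => q _; rewrite lee_fin quot_ge0.
move=> x _; rewrite patchE; case: ifPn => xA; last first.
  by apply: integral_ge0 => y _; apply: erestrict_ge0 => q _; rewrite lee_fin quot_ge0.
rewrite /inner_quot integral_mkcond /fubini_F; apply: ge0_le_integral => //.
- by move=> y _; apply: erestrict_ge0 => z _; rewrite lee_fin quot_ge0.
- apply/(measurable_restrictT _ _).1 => //; apply/measurable_EFinP.
  by apply: measurable_funTS; exact: measurable_quot1.
- apply: (measurableT_comp _ (pair1_measurable x)).
  apply/(measurable_restrictT _ _).1; first exact: measurableX.
  exact: measurable_funTS.
move=> y _; rewrite !patchE; case: ifPn => yC; last by case: ifPn => // _; rewrite lee_fin quot_ge0.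
by rewrite mem_set//; split; exact: set_mem.
Qed.

(* For the Gagliardo kernel on a Lipschitz domain N is the dimension and beta = N + alpha. *)
Definition kernel_dense (N beta kappa r0 : R) := forall x (r : R), D x -> 0 < r -> r <= r0 ->
  exists C, [/\ measurable C, C `<=` D, mu C = (kappa * r `^ N)%:E &
    forall y, C y -> x <> y -> 1 <= r `^ beta * K (x, y)].

(* By Chebyshev's inequality, on a piece around x of measure of order |u(x)|^-q, |u| is at
   most |u(x)| / 2 on at least half of the piece. *)
Lemma sobolev_step (N beta kappa r0 q M : R) : 0 < N -> N < beta -> 0 < kappa -> 0 < r0 ->
  kernel_dense N beta kappa r0 -> 2 <= q -> 0 < M ->
  exists A B : R, [/\ 0 <= A, 0 <= B &
    forall u, measurable_fun setT u -> (\int[mu]_(x in D) (`|u x| `^ q)%:E <= M%:E)%E ->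
    forall x, D x ->
      ((`|u x| `^ (2 + (beta - N) * q / N))%:E <= A%:E * inner_quot D u x + B%:E)%E].
Proof.
move=> N0 Nb k0 r00 dens q2 M0.
have q0 : 0 < q by apply: lt_le_trans q2.
(* With this constant a piece of radius A1 l^(-q/N) has measure m = M 8^(q/2) l^(-q), see [rN],
   which makes the two error terms l^2 m / 8 and e M below equal. *)
pose A1 := (M * 8 `^ (q / 2) / kappa) `^ N^-1.
have A10 : 0 < A1 by rewrite powR_gt0// divr_gt0// mulr_gt0// powR_gt0.
(* For |u x| above [lam0] the radius stays below r0; for smaller values the constant B alone
   suffices. *)
pose lam0 := (A1 / r0) `^ (N / q).
have lam00 : 0 < lam0 by rewrite powR_gt0// divr_gt0.
pose q' := 2 + (beta - N) * q / N.
have q'0 : 0 <= q'.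
  by rewrite addr_ge0// mulr_ge0 ?invr_ge0 ?ltW// mulr_gt0// subr_gt0.
exists (4 / kappa * A1 `^ (beta - N)), (lam0 `^ q'); split; rewrite ?powR_ge0//.
  by rewrite mulr_ge0 ?powR_ge0// divr_ge0// ltW.
move=> u mu_ uM x Dx.
have A0 : 0 <= 4 / kappa * A1 `^ (beta - N) by rewrite mulr_ge0 ?powR_ge0// divr_ge0// ltW.
have [small|big] := leP `|u x| lam0.
  apply: (@le_trans _ _ (lam0 `^ q')%:E); first by rewrite lee_fin powR_mono.
  by rewrite leeDr// mule_ge0 ?inner_quot_ge0// lee_fin.
pose l := `|u x|; have l0 : 0 < l by exact: lt_trans big.
pose r := A1 * l `^ (- (q / N)).
have r_gt0 : 0 < r by rewrite mulr_gt0// powR_gt0.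
have rr0 : r <= r0.
  rewrite /r powRN ler_pdivrMr ?powR_gt0// mulrC -ler_pdivrMr//.
  have -> : A1 / r0 = lam0 `^ (q / N).
    rewrite /lam0 -powRrM (_ : N / q * (q / N) = 1) ?powRr1//; first by rewrite divr_ge0// ltW.
    by field; rewrite ?gt_eqF.
  apply: powR_mono; [by rewrite divr_ge0// ltW|exact: ltW|exact: ltW].
have [C [mC CD Cm hC]] := dens x r Dx r_gt0 rr0.
have rN : kappa * r `^ N = M * 8 `^ (q / 2) * l `^ (- q).
  rewrite /r powRM ?powR_ge0//.
  rewrite -!powRrM mulVf ?gt_eqF// powRr1; last first.
    by rewrite divr_ge0 ?(ltW k0)// mulr_ge0 ?powR_ge0// ltW.
  rewrite mulrA; congr (_ * _); first by field; rewrite gt_eqF.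
  by congr (_ `^ _); field; rewrite gt_eqF.
pose m := kappa * r `^ N.
have m0 : 0 < m by rewrite mulr_gt0// powR_gt0.
(* Where u(y)^2 exceeds l^2 / 8 this factor makes e |u(y)|^q at least u(y)^2. *)
pose e := (8 / l ^+ 2) `^ ((q - 2) / 2).
have e0 : 0 <= e by exact: powR_ge0.
have pw y : u y ^+ 2 <= l ^+ 2 / 8 * 1 + e * `|u y| `^ q.
  rewrite mulr1; have [h|h] := leP (u y ^+ 2) (l ^+ 2 / 8).
    by rewrite ler_wpDr// mulr_ge0 ?powR_ge0.
  rewrite ler_wpDl ?divr_ge0 ?sqr_ge0//.
  have t0 : 0 < u y ^+ 2 by apply: le_lt_trans h; rewrite divr_ge0// sqr_ge0.
  have -> : `|u y| `^ q = u y ^+ 2 * (u y ^+ 2) `^ ((q - 2) / 2).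
    rewrite -(real_normK (num_real (u y))) -powR_mulrn// -powRrM -powRD; last first.
      by apply/implyP => /eqP qq; rewrite normr_eq0; apply/eqP => z; rewrite z expr0n ltxx in t0.
    by congr (_ `^ _); field.
  rewrite mulrCA ler_peMr ?(ltW t0)// /e -powRM ?divr_ge0 ?sqr_ge0 ?(ltW t0)//.
  apply: (@le_trans _ _ (1 `^ ((q - 2) / 2))); first by rewrite powR1.
  apply: powR_mono => //; first by rewrite divr_ge0// subr_ge0.
  have l20 : 0 < l ^+ 2 by rewrite exprn_gt0.
  rewrite mulrAC ler_pdivlMr// mul1r.
  by move: h; rewrite ltr_pdivrMr// mulrC => /ltW; rewrite mulrC.
have mpq : measurable_fun setT (fun y => `|u y| `^ q).
  by apply: (measurableT_comp (measurable_powR _)); apply: measurableT_comp.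
have h2 : (\int[mu]_(y in C) (u y ^+ 2)%:E <= (l ^+ 2 / 8 * m + e * M)%:E)%E.
  apply: (@le_trans _ _ (\int[mu]_(y in C) (l ^+ 2 / 8 * (fun=> 1) y + e * `|u y| `^ q)%:E)%E).
    apply: ge0_int_le => //.
    - by apply: measurable_funX; exact: measurable_funTS.
    - by apply: measurable_funD => //; apply: measurable_funM => //; exact: measurable_funTS.
    - by move=> y _; exact: sqr_ge0.
  rewrite ge0_int_lin//; last 2 first.
  - by rewrite divr_ge0// sqr_ge0.
  - exact: measurable_funTS.
  rewrite EFinD leeD//; first by rewrite integral_cst// mul1e [leRHS]EFinM /m -Cm.
  rewrite EFinM; apply: lee_wpmul2l; first by rewrite lee_fin.
  apply: le_trans uM; apply: ge0_subset_integral => //.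
  by apply/measurable_EFinP; exact: measurable_funTS.
have lE : l ^+ 2 = u x ^+ 2 by rewrite real_normK// num_real.
have := local_average mu_ mC Cm (powR_ge0 r beta) hC.
move=> h1; have {h1 h2} h3 : ((l ^+ 2 * m)%:E <= (2 * r `^ beta)%:E * inner_quot D u x +
    (2 * (l ^+ 2 / 8 * m + e * M))%:E)%E.
  rewrite [in leLHS]lE; apply: (le_trans h1); apply: leeD.
    apply: lee_wpmul2l; first by rewrite lee_fin mulr_ge0// powR_ge0.
    apply: ge0_subset_integral => //.
    - by apply/measurable_EFinP; apply: measurable_funTS; exact: measurable_quot1.
    - by move=> y _; rewrite lee_fin quot_ge0.
  by rewrite [leRHS]EFinM; apply: lee_wpmul2l => //; rewrite lee_fin.
(* Both error terms equal l^2 m / 8; the factor 2 of [local_average] turns their sum into half of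
   the left-hand side, which can be absorbed. *)
have eM : e * M = l ^+ 2 * m / 8.
  rewrite /m rN /e powRM ?invr_ge0 ?sqr_ge0// -[(l ^+ 2)^-1]powR_inv1 ?sqr_ge0//.
  rewrite -[l ^+ 2]powR_mulrn ?(ltW l0)// -!powRrM.
  have -> : 8 `^ (q / 2) = 8 * 8 `^ ((q - 2) / 2) :> R.
    rewrite -{2}[8]powRr1// -powRD; last by apply/implyP => _; rewrite pnatr_eq0.
    by congr (_ `^ _); field.
  have -> : l `^ (2 * (-1 * ((q - 2) / 2))) = l `^ 2%:R * l `^ (- q).
    rewrite -powRD; last by apply/implyP => _; rewrite gt_eqF.
    by congr (_ `^ _); field.
  by field.
move: h3; rewrite eM (_ : 2 * (l ^+ 2 / 8 * m + l ^+ 2 * m / 8) = l ^+ 2 * m / 2); last by field.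
have := inner_quot_ge0 D u x; case: (inner_quot D u x) => [D2|_ _|//]; last first.
  rewrite gt0_muley; first by rewrite addye// leey.
  by rewrite lte_fin mulr_gt0 ?divr_gt0// powR_gt0.
rewrite lee_fin => D20; rewrite -EFinM -!EFinD lee_fin => h.
have {}h : l ^+ 2 * m <= 4 * r `^ beta * D2 by lra.
rewrite lee_fin ler_wpDr ?powR_ge0//.
have rb : r `^ beta = r `^ N * (A1 `^ (beta - N) * l `^ (- ((beta - N) * q / N))).
  have -> : l `^ (- ((beta - N) * q / N)) = (l `^ (- (q / N))) `^ (beta - N).
    by rewrite -powRrM; congr (_ `^ _); field; rewrite gt_eqF.
  rewrite -powRM ?powR_ge0 ?(ltW A10)// -/r -powRD; last by apply/implyP => _; rewrite gt_eqF.
  by congr (_ `^ _); ring.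
have rNp : 0 < r `^ N by rewrite powR_gt0.
have lp : 0 < l `^ ((beta - N) * q / N) by rewrite powR_gt0.
have h4 : l ^+ 2 * kappa * l `^ ((beta - N) * q / N) <= 4 * A1 `^ (beta - N) * D2.
  rewrite -(ler_pM2r rNp) -(ler_pM2r (powR_gt0 (- ((beta - N) * q / N)) l0)).
  move: h; rewrite rb /m powRN.
  set L := l `^ _; set P := A1 `^ _ => h.
  have -> : l ^+ 2 * kappa * L * r `^ N / L = l ^+ 2 * (kappa * r `^ N) by field; rewrite gt_eqF.
  by apply: (le_trans h); rewrite le_eqVlt; apply/orP; left; apply/eqP; ring.
have -> : l `^ q' = l ^+ 2 * l `^ ((beta - N) * q / N).
  rewrite /q' powRD; last by apply/implyP => _; rewrite gt_eqF.
  by rewrite powR_mulrn// ltW.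
rewrite -(ler_pM2l k0).
have -> : kappa * (4 / kappa * A1 `^ (beta - N) * D2) = 4 * A1 `^ (beta - N) * D2.
  by field; rewrite gt_eqF.
by apply: le_trans h4; rewrite mulrA [kappa * _]mulrC.
Qed.

Lemma DD_off_diag : D `*` D `<=` off_diag.
Proof. by move=> [x y] [/= Dx Dy] []. Qed.

(* Iterating the previous lemma from q = 2, the exponents converge to the fixed point of
   q -> 2 + (beta - N) q / N, which is the critical exponent 2 N / (2 N - beta). *)
Lemma sobolev_embedding (N beta kappa r0 q M Ke : R) : (mu D < +oo)%E ->
  0 < N -> N < beta -> beta < 2 * N -> 0 < kappa -> 0 < r0 ->
  kernel_dense N beta kappa r0 -> 0 <= q -> q < 2 * N / (2 * N - beta) -> 0 <= Ke ->
  exists2 C : R, 0 < C & forall u, measurable_fun setT u ->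
    (\int[mu]_(x in D) (u x ^+ 2)%:E <= M%:E)%E -> (energy u <= Ke%:E)%E ->
    (\int[mu]_(x in D) (`|u x| `^ q)%:E <= C%:E)%E.
Proof.
move=> fD N0 Nb bN k0 r00 dens q0 qq Ke0.
pose a := (beta - N) / N; have a0 : 0 < a by rewrite divr_gt0// subr_gt0.
have a1 : a < 1 by rewrite ltr_pdivrMr// mul1r; lra.
pose qs := 2 / (1 - a).
have qsE : 2 * N / (2 * N - beta) = qs by rewrite /qs /a; field; rewrite !gt_eqF//; lra.
have qs2 : 2 <= qs by rewrite ler_pdivlMr ?subr_gt0//; nra.
(* Closed form of the j-th exponent starting from 2; each step multiplies the distance to the fixed
   point by a < 1. *)
pose qn j := qs - (qs - 2) * a ^+ j.
have qnS j : qn j.+1 = 2 + a * qn j.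
  by rewrite /qn exprS /qs; field; rewrite subr_eq0 gt_eqF.
have qn2 j : 2 <= qn j.
  rewrite /qn; have : a ^+ j <= 1 by rewrite exprn_ile1// ltW.
  have : 0 <= a ^+ j by rewrite exprn_ge0// ltW.
  have : 0 <= qs - 2 by rewrite subr_ge0.
  by nra.
pose md := fine (mu D); have mD0 : 0 <= md by rewrite fine_ge0.
have fDE : mu D = md%:E by rewrite fineK// ge0_fin_numE.
have H j : exists2 C : R, 0 < C & forall u, measurable_fun setT u ->
    (\int[mu]_(x in D) (u x ^+ 2)%:E <= M%:E)%E -> (energy u <= Ke%:E)%E ->
    (\int[mu]_(x in D) (`|u x| `^ (qn j))%:E <= C%:E)%E.
  elim: j => [|j [C C0 hC]].
    exists (`|M| + 1); first by rewrite ltr_wpDl.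
    move=> u mu_ uM _; rewrite /qn expr0 mulr1 opprB addrCA subrr addr0.
    apply: (@le_trans _ _ M%:E); last by rewrite lee_fin (le_trans (ler_norm M))// lerDl.
    apply: le_trans uM; rewrite le_eqVlt; apply/orP; left; apply/eqP.
    by apply: eq_integral => x _; rewrite powR_mulrn// real_normK// num_real.
  have [A [B [A0 B0 hAB]]] := sobolev_step N0 Nb k0 r00 dens (qn2 j) C0.
  exists (A * Ke + B * md + 1); first by rewrite ltr_wpDl// addr_ge0// mulr_ge0.
  move=> u mu_ uM uK.
  apply: (@le_trans _ _ (\int[mu]_(x in D) (A%:E * inner_quot D u x + B%:E))%E).
    apply: ge0_le_integral => //.
    - by apply/measurable_EFinP; apply: (measurableT_comp (measurable_powR _)); apply: measurableT_comp => //; exact: measurable_funTS.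
    - apply: emeasurable_funD => //; apply: emeasurable_funM => //; apply: measurable_funTS.
      exact: measurable_inner_quot.
    - move=> x Dx; have := hAB u mu_ (hC u mu_ uM uK) x Dx.
      by rewrite qnS (_ : (beta - N) * qn j / N = a * qn j)// /a; field; rewrite gt_eqF.
  rewrite ge0_integralD//; last 2 first.
  - by move=> x _; rewrite mule_ge0 ?inner_quot_ge0// lee_fin.
  - by apply: emeasurable_funM => //; apply: measurable_funTS; exact: measurable_inner_quot.
  rewrite integral_cst// ge0_integralZl_EFin//; last 2 first.
  - by move=> x _; exact: inner_quot_ge0.
  - by apply: measurable_funTS; exact: measurable_inner_quot.
  rewrite [X in (B%:E * X)%E]fDE -EFinM.
  apply: (@le_trans _ _ ((A * Ke)%:E + (B * md)%:E)%E); last by rewrite -EFinD lee_fin lerDl.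
  rewrite leeD2r// EFinM lee_wpmul2l ?lee_fin//.
  exact: le_trans (inner_quot_energy mD mD DD_off_diag mu_) uK.
have [j qj] : exists j, q <= qn j.
  have h : a ^+ j @[j --> \oo] --> (0 : R) by apply: cvg_expr; rewrite ger0_norm// ltW.
  have [E0|E0] := eqVneq qs 2.
    by exists 0%N; rewrite /qn E0 subrr mul0r subr0; rewrite qsE E0 in qq; exact: ltW.
  have s0 : 0 < qs - 2 by rewrite subr_gt0 lt_neqAle eq_sym E0.
  have d0 : 0 < (qs - q) / (qs - 2) by rewrite divr_gt0// subr_gt0 -qsE.
  have /cvgrPdist_le/(_ _ d0)[j _ /(_ j (leqnn j))] := h.
  rewrite sub0r normrN ger0_norm ?exprn_ge0 ?(ltW a0)// => hj; exists j.
  by move: hj; rewrite ler_pdivlMr// /qn; lra.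
have [C C0 hC] := H j; exists (md + C); first by rewrite ltr_wpDl.
move=> u mu_ uM uK.
apply: (@le_trans _ _ (\int[mu]_(x in D) (1 * (fun=> 1) x + 1 * `|u x| `^ qn j)%:E)%E).
  apply: ge0_int_le => //.
  - by apply: (measurableT_comp (measurable_powR _)); apply: measurableT_comp => //; exact: measurable_funTS.
  - by apply: measurable_funD => //; apply: measurable_funM => //;
      apply: (measurableT_comp (measurable_powR _)); apply: measurableT_comp => //; exact: measurable_funTS.
  - by move=> x _; rewrite !mul1r powR_le1D.
rewrite ge0_int_lin//; last first.
  by apply: (measurableT_comp (measurable_powR _)); apply: measurableT_comp => //; exact: measurable_funTS.
rewrite !mul1e integral_cst// mul1e EFinD [X in (X + _ <= _)%E]fDE leeD2l//.
exact: hC.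
Qed.

(** Average over a set A outside D: u vanishes there, so [local_average] loses its second term and
    only the energy between D and A remains. *)
Lemma poincare_exterior A (m rho : R) u : measurable A -> D `&` A = set0 -> mu A = m%:E -> 0 < m ->
  0 <= rho -> (forall x y, D x -> A y -> 1 <= rho * K (x, y)) -> measurable_fun setT u ->
  {ae mu, forall x, ~ D x -> u x = 0} ->
  (\int[mu]_(x in D) (u x ^+ 2)%:E <= (2 * rho / m)%:E * energy u)%E.
Proof.
move=> mA DA Am m0 r0 hK mu_ u0.
have nA x : A x -> ~ D x by move=> Ax Dx; have : (D `&` A) x by []; rewrite DA.
have i0 : (\int[mu]_(y in A) (u y ^+ 2)%:E = 0)%E.
  rewrite (@ge0_ae_eq_integral _ _ _ _ _ _ (fun=> 0%E))//.
  - by rewrite integral0.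
  - by apply/measurable_EFinP; apply: measurable_funX; exact: measurable_funTS.
  - by move=> x _; rewrite lee_fin sqr_ge0.
  - by apply: filterS u0 => x h Ax; rewrite h ?expr0n//; exact: nA.
have pw x : D x -> ((u x ^+ 2)%:E <= (2 * rho / m)%:E * inner_quot A u x)%E.
  move=> Dx; have := local_average mu_ mA Am r0 (fun y Ay _ => hK x y Dx Ay).
  rewrite i0 mule0 adde0 => h.
  rewrite (_ : 2 * rho / m = m^-1 * (2 * rho)); last by field; rewrite gt_eqF.
  rewrite [X in (_ <= X * _)%E]EFinM -muleA lee_pdivlMl// -EFinM mulrC; exact: h.
apply: (@le_trans _ _ (\int[mu]_(x in D) ((2 * rho / m)%:E * inner_quot A u x))%E).
  apply: ge0_le_integral => //.
  - by move=> x _; rewrite lee_fin sqr_ge0.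
  - by apply/measurable_EFinP; apply: measurable_funX; exact: measurable_funTS.
  - by apply: emeasurable_funM => //; apply: measurable_funTS; exact: measurable_inner_quot.
have rm : 0 <= 2 * rho / m by rewrite divr_ge0 ?(ltW m0)// mulr_ge0.
rewrite ge0_integralZl_EFin//; last 2 first.
- by move=> x _; exact: inner_quot_ge0.
- by apply: measurable_funTS; exact: measurable_inner_quot.
apply: lee_wpmul2l; first by rewrite lee_fin.
by apply: inner_quot_energy => // -[x y] [/= Dx Ay] [].
Qed.

End kernel_energy.

(** * Compactness and completeness in energy *)

Section ultrafilters.
Variables (R : realType) (U : set_system nat).
Hypotheses (UU : UltraFilter U) (Uoo : \oo `<=` U).

(** Compactness of an interval. All averages over finitely many pieces converge along the same
    ultrafilter, without extracting one subsequence per piece. *)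
Lemma ultra_bounded_limit (a : nat -> R) (B : R) : (forall j, `|a j| <= B) ->
  exists l : R, forall e : R, 0 < e -> U [set j | `|a j - l| < e].
Proof.
move=> aB.
have [|p [_ clp]] := @segment_compact R (- B) B (a @ U) _.
  apply: (@filterS _ U _ setT) => [j _|]; last exact: filterT.
  rewrite /= in_itv/= -ler_norml.
  exact: aB.
exists p => e e0.
have [//|nS] := in_ultra_setVsetC [set j | `|a j - p| < e] UU.
have [y [Sy py]] : [set y : R | e <= `|y - p|] `&` ball p e !=set0.
  apply: clp; last exact: nbhsx_ballx.
  apply: (@filterS _ U _ _ _ _ nS) => j /= /negP.
  by rewrite -leNgt.
by move: Sy py; rewrite /ball/= distrC => /le_lt_trans h /h; rewrite ltxx.
Qed.

(** Back from the ultrafilter to an ordinary subsequence: the m-th index is taken in the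
    intersection of the first m + 1 sets and beyond the previous index, which is possible because
    the ultrafilter refines the filter at infinity. *)
Lemma ultra_cauchy_subsequence (P : R -> nat -> nat -> Prop) :
  (forall (e e' : R) i j, e <= e' -> P e i j -> P e' i j) ->
  (forall e : R, 0 < e -> exists2 A, U A & forall i j, A i -> A j -> P e i j) ->
  exists2 sigma : nat -> nat, {homo sigma : i j / (i < j)%N} &
    forall e : R, 0 < e -> exists k0, forall i j, (k0 <= i)%N -> (k0 <= j)%N ->
      P e (sigma i) (sigma j).
Proof.
move=> Pmono HA.
have HA' m : exists A, U A /\ forall i j, A i -> A j -> P m.+1%:R^-1 i j.
  by have [|A UA hA] := HA m.+1%:R^-1; [rewrite invr_gt0|exists A].
have [A hA] := choice HA'.
pose B m := \bigcap_(l in [set l | (l <= m)%N]) A l.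
have UB m : U (B m).
  have : U [set j | forall i : 'I_m.+1, A i j].
    by apply: filter_forall => i; exact: (hA i).1.
  apply: filterS => j hj l /= lm.
  by have := hj (Ordinal (lm : (l < m.+1)%N)).
have Bk m k : exists i, B m i /\ (k < i)%N.
  have : U (B m `&` [set i | (k < i)%N]).
    by apply: filterI => //; apply: Uoo; exists k.+1.
  by move=> /filter_ex[i [? ?]]; exists i.
have [f hf] : exists f : nat -> nat -> nat, forall m k, B m (f m k) /\ (k < f m k)%N.
  have /choice[f hf] : forall q : nat * nat, exists i, B q.1 i /\ (q.2 < i)%N by move=> q; exact: Bk.
  by exists (fun m k => f (m, k)) => m k; exact: (hf (m, k)).
pose sigma := fix s m := if m is m'.+1 then f m'.+1 (s m') else f 0%N 0%N.
have sB m : B m (sigma m) by case: m => [|m]; exact: (hf _ _).1.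
have sS m : (sigma m < sigma m.+1)%N by exact: (hf _ _).2.
exists sigma; first by apply: homo_ltn => //; exact: ltn_trans.
move=> e e0; have [m hm] : exists m, m.+1%:R^-1 <= e.
  exists (Num.truncn e^-1); rewrite -[leRHS]invrK lef_pV2 ?posrE ?invr_gt0//.
  by apply/ltW/truncnS_gt.
exists m => i j mi mj; apply: (Pmono _ _ _ _ hm).
by apply: (hA m).2; [exact: (sB i)|exact: (sB j)].
Qed.

End ultrafilters.

Section fatou_bound.
Context d (T : measurableType d) (R : realType).
Variables (mu : {measure set T -> \bar R}) (D : set T).
Hypothesis mD : measurable D.

Lemma fatou_bound (f : nat -> T -> R) (g : T -> R) (e : \bar R) k :
  (forall j, measurable_fun D (f j)) -> (forall j x, D x -> 0 <= f j x) ->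
  (forall x, D x -> f j x @[j --> \oo] --> g x) ->
  (forall j, (k <= j)%N -> (\int[mu]_(x in D) (f j x)%:E <= e)%E) ->
  (\int[mu]_(x in D) (g x)%:E <= e)%E.
Proof.
move=> mf f0 fg fe.
have mfE j : measurable_fun D (fun x => (f j x)%:E) by apply/measurable_EFinP.
have := fatou mu mD mfE (fun j x Dx => f0 j x Dx).
have -> : (\int[mu]_(x in D) limn_einf (fun j => (f j x)%:E) = \int[mu]_(x in D) (g x)%:E)%E.
  apply: eq_integral => x /set_mem Dx; rewrite limn_einf_lim; apply/cvg_lim => //.
  by apply: cvg_einfs; apply/fine_cvgP; split; [near=> j|exact: fg].
move=> h; apply: (le_trans h); rewrite limn_einf_lim; apply: lime_le; first exact: is_cvg_einfs.
near=> j; apply: (@le_trans _ _ (\int[mu]_(x in D) (f j x)%:E)%E).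
  by apply: ereal_inf_lbound; exists j => //=.
by apply: fe; near: j; exists k.
Unshelve. all: by end_near. Qed.

(* A series with terms of square integral at most 8^-j converges a.e.: |t| <= 2^-j + 2^j t^2. *)
Lemma fast_L2_cvg_ae (f : nat -> T -> R) : (forall j, measurable_fun D (f j)) ->
  (forall j, (\int[mu]_(x in D) ((f j.+1 x - f j x) ^+ 2)%:E <= ((8^-1) ^+ j)%:E)%E) ->
  {ae mu, forall x, D x -> cvgn (fun j => f j x)}.
Proof.
move=> mf hf.
pose h j x := 2 ^+ j * (f j.+1 x - f j x) ^+ 2.
have mh j : measurable_fun D (h j).
  by apply: measurable_funM => //; apply: measurable_funX; exact: measurable_funB.
have h0 j x : 0 <= h j x by rewrite mulr_ge0 ?sqr_ge0// exprn_ge0.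
have mhE j : measurable_fun D (fun x => (h j x)%:E) by apply/measurable_EFinP.
pose g x := (\sum_(j <oo) (h j x)%:E)%E.
have mg : measurable_fun D g by apply: ge0_emeasurable_sum => // j x _ _; rewrite lee_fin.
have g0 x : D x -> (0 <= g x)%E by move=> _; apply: nneseries_ge0 => j _ _; rewrite lee_fin.
have gfin : (\int[mu]_(x in D) g x <= 2%:E)%E.
  rewrite integral_nneseries//; last by move=> j x _; rewrite lee_fin.
  have le j : (\int[mu]_(x in D) (h j x)%:E <= ((4^-1) ^+ j)%:E)%E.
    rewrite /h (eq_integral (fun x => (2 ^+ j)%:E * ((f j.+1 x - f j x) ^+ 2)%:E))%E => [|x _]; last by rewrite EFinM.
    rewrite ge0_integralZl_EFin//.
    - rewrite (_ : (4^-1) ^+ j = 2 ^+ j * (8^-1) ^+ j :> R); last by rewrite -exprMn; congr (_ ^+ _); field.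
      by rewrite EFinM lee_wpmul2l// lee_fin exprn_ge0.
    - by move=> x _; rewrite lee_fin sqr_ge0.
    - by apply/measurable_EFinP; apply: measurable_funX; exact: measurable_funB.
  apply: (@le_trans _ _ (\sum_(j <oo) ((4^-1) ^+ j)%:E)%E).
    by apply: lee_nneseries => [j _ _|j _]; [apply: integral_ge0 => x _; rewrite lee_fin|exact: le].
  apply: lime_le; first by apply: is_cvg_nneseries => j _ _; rewrite lee_fin exprn_ge0.
  near=> k; rewrite sumEFin lee_fin.
  have -> : \sum_(0 <= i < k) 4^-1 ^+ i = 4 / 3 * (1 - 4^-1 ^+ k) :> R.
    elim: (k) => [|k' IH]; first by rewrite big_geq// expr0 subrr mulr0.
    by rewrite big_nat_recr//= IH exprS; lra.
  have : 0 <= 4^-1 ^+ k :> R by rewrite exprn_ge0.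
  lra.
have gi : mu.-integrable D g.
  apply/integrableP; split => //.
  under eq_integral => x /set_mem Dx do rewrite gee0_abs ?g0//.
  exact: le_lt_trans gfin (ltry _).
apply: filterS (integrable_ae mD gi) => x gx Dx.
have gf := gx Dx.
have cs : cvgn [normed series (fun j => f j.+1 x - f j x)].
  apply: nondecreasing_is_cvgn.
    by apply: (@nondecreasing_series R _ xpredT 0%N) => j _ _; exact: normr_ge0.
  exists (2 + fine (g x)) => _ [k _ <-].
  apply: (@le_trans _ _ (\sum_(0 <= j < k) ((2^-1) ^+ j + h j x))).
    rewrite /series/=; apply: ler_sum => j _; rewrite /h.
    set t := f j.+1 x - f j x.
    have e0 : 0 < 2^-1 ^+ j :> R by rewrite exprn_gt0.
    have -> : 2 ^+ j = (2^-1 ^+ j)^-1 :> R by rewrite exprVn invrK.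
    have [ts|ts] := leP `|t| (2^-1 ^+ j).
      by rewrite ler_wpDr// mulr_ge0 ?sqr_ge0// invr_ge0 ltW.
    rewrite ler_wpDl ?(ltW e0)// -(real_normK (num_real t)) mulrC ler_pdivlMr// expr2.
    by rewrite ler_wpM2l// ltW.
  rewrite big_split/= lerD//.
    rewrite (_ : \sum_(0 <= i < k) 2^-1 ^+ i = 2 - 2 * 2^-1 ^+ k :> R); last first.
      elim: k => [|k IH]; first by rewrite big_geq// expr0; lra.
      by rewrite big_nat_recr//= IH exprS; lra.
    by rewrite gerBl mulr_ge0// exprn_ge0.
  rewrite -lee_fin fineK// -sumEFin; apply: nneseries_lim_ge => j _ _; by rewrite lee_fin.
have := normed_cvg cs.
have -> : series (fun j => f j.+1 x - f j x) = (fun j => f j x - f 0%N x).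
  by rewrite -[LHS]/(series (telescope (fun j => f j x))) telescopeK.
move=> cf; rewrite (_ : (fun j => f j x) = (fun j => (f j x - f 0%N x) + f 0%N x)).
  by apply: is_cvgD => //; exact: is_cvg_cst.
by apply/funext => j; rewrite subrK.
Unshelve. all: by end_near. Qed.

End fatou_bound.

(** * L2 compactness and completeness in energy *)

Section energy_space.
Context d (T : measurableType d) (R : realType).
Variables (mu : {sigma_finite_measure set T -> \bar R}) (D : set T).
Hypothesis mD : measurable D.
Variable K : T * T -> R.
Hypotheses (mK : measurable_fun setT K) (K0 : forall p, 0 <= K p).
Implicit Types (u w : T -> R) (x y : T) (C : set T).
Local Notation energy := (energy mu D K).

Lemma mquotE u (C : set (T * T)) : measurable_fun setT u -> measurable_fun C (fun p : T * T => (quot K u p)%:E).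
Proof. by move=> mu_; apply/measurable_EFinP; apply: measurable_funTS; exact: measurable_quot. Qed.

Lemma energyB_le u w : measurable_fun setT u -> measurable_fun setT w ->
  (energy (fun x => (u x - w x)%R) <= 2%:E * energy u + 2%:E * energy w)%E.
Proof.
move=> mu_ mw; rewrite -ge0_int_lin//; last 5 first.
- exact: measurable_off_diag.
- by apply: measurable_funTS; exact: measurable_quot.
- by apply: measurable_funTS; exact: measurable_quot.
- by move=> p _; exact: quot_ge0.
- by move=> p _; exact: quot_ge0.
apply: ge0_int_le.
- exact: measurable_off_diag.
- by apply: measurable_funTS; apply: measurable_quot => //; exact: measurable_funB.
- by apply: measurable_funD; apply: measurable_funM => //; apply: measurable_funTS; exact: measurable_quot.
- by move=> p _; exact: quot_ge0.
move=> p _; rewrite /quot !mulrA -mulrDl ler_wpM2r//.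
by have := sqr_ge0 ((u p.1 - u p.2) + (w p.1 - w p.2)); nra.
Qed.

Lemma ae_prod_eq u w : ae_eq mu setT u w ->
  {ae (mu \x mu)%E, forall p, u p.1 = w p.1 /\ u p.2 = w p.2}.
Proof.
move=> [N [mN N0 subN]].
have nul A B : measurable A -> measurable B -> mu A = 0 \/ mu B = 0 -> ((mu \x mu) (A `*` B) = 0)%E.
  move=> mA mB h; rewrite product_measure1E//; case: h => h; first by rewrite [X in (X * _)%E]h mul0e.
  by rewrite [X in (_ * X)%E]h mule0.
exists (N `*` setT `|` setT `*` N); split.
- by apply: measurableU; apply: measurableX.
- apply: null_set_setU; [exact: measurableX|exact: measurableX|..]; apply: nul => //; [by left|by right].
move=> [x y] /=; rewrite not_andP => -[h|h]; [left|right]; split => //=.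
- by apply: subN => /= /(_ I).
- by apply: subN => /= /(_ I).
Qed.

Lemma energy_ae u w : measurable_fun setT u -> measurable_fun setT w -> ae_eq mu setT u w ->
  energy u = energy w.
Proof.
move=> mu_ mw uw; apply: ge0_ae_eq_integral.
- exact: measurable_off_diag.
- exact: mquotE.
- exact: mquotE.
- by move=> p _; rewrite lee_fin quot_ge0.
- by move=> p _; rewrite lee_fin quot_ge0.
by apply: filterS (ae_prod_eq uw) => p [h1 h2] _; rewrite /quot h1 h2.
Qed.

(** Sharper than [local_average]: the mean square over C is replaced by the square of the mean,
    which is what converges along the ultrafilter. With t the difference of u(x) and the mean, the
    bound 2 t (u(x) - u(y)) - t^2 <= (u(x) - u(y))^2 is affine in u(y), and its integral over C is
    at least m t^2. *)
Lemma local_variance u x C (m rho : R) : measurable_fun setT u -> measurable C ->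
  mu C = m%:E -> 0 < m -> 0 < rho -> itg mu C u ->
  (forall y, C y -> x <> y -> 1 <= rho * K (x, y)) ->
  ((u x ^+ 2)%:E <= (2 * rho / m)%:E * inner_quot mu K C u x +
     (2 * (\int[mu]_(y in C) u y / m) ^+ 2)%:E)%E.
Proof.
move=> mu_ mC Cm m0 r0 iu hC.
set a := \int[mu]_(y in C) u y / m.
have fC : (mu C < +oo)%E by rewrite [X in (X < _)%E]Cm ltry.
have c0 : 0 < 2 * rho / m by rewrite divr_gt0// mulr_gt0.
have := inner_quot_ge0 mu K0 C u x.
case E : (inner_quot mu K C u x) => [k||//] k0; last first.
  by rewrite gt0_muley ?lte_fin// addye// leey.
rewrite lee_fin in k0.
have qk : IB mu C (fun y => (u x - u y) ^+ 2) (rho * k).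
  apply/ge0_IBP => //.
  - by apply: measurable_funX; apply: measurable_funB => //; exact: measurable_funTS.
  - by move=> y _; exact: sqr_ge0.
  rewrite EFinM -E /inner_quot -ge0_integralZl_EFin//; last 3 first.
  - by move=> y _; rewrite lee_fin quot_ge0.
  - by apply/measurable_EFinP; apply: measurable_funTS; exact: measurable_quot1.
  - exact: ltW.
  apply: ge0_le_integral => //.
  - by move=> y _; rewrite lee_fin sqr_ge0.
  - apply/measurable_EFinP; apply: measurable_funX; apply: measurable_funB => //; exact: measurable_funTS.
  - apply: emeasurable_funM => //; apply/measurable_EFinP; apply: measurable_funTS; exact: measurable_quot1.
  move=> y Cy; rewrite -EFinM lee_fin /quot/=; have [<-|/eqP xy] := eqVneq x y.
    by rewrite subrr expr0n/= mul0r mulr0.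
  by rewrite mulrCA ler_peMr ?sqr_ge0//; exact: hC.
pose t := u x - a.
have i1 : itg mu C (fun y => (2 * t * u x - t ^+ 2) - 2 * t * u y).
  by apply: itgB => //; [exact: itg_cst|exact: itgZ].
have : \int[mu]_(y in C) ((2 * t * u x - t ^+ 2) - 2 * t * u y) <= rho * k.
  apply: le_trans qk.2; apply: le_Rintegral => //; first exact: qk.1.
  by move=> y _; have := sqr_ge0 (u x - u y - t); nra.
rewrite RintegralB//; [|exact: itg_cst|exact: itgZ].
rewrite RintegralZl// Rintegral_cst//.
rewrite (_ : fine _ = m); last by rewrite [X in fine X]Cm.
have -> : \int[mu]_(y in C) u y = m * a by rewrite /a; field; rewrite gt_eqF.
move=> h; have {}h : m * t ^+ 2 <= rho * k by move: h; rewrite /t; nra.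
rewrite -EFinM -EFinD lee_fin.
have h2 : u x ^+ 2 <= 2 * t ^+ 2 + 2 * a ^+ 2.
  by rewrite /t; have := sqr_ge0 (u x - 2 * a); nra.
apply: (le_trans h2); rewrite lerD2r.
have -> : 2 * rho / m * k = 2 * (rho * k / m) by ring.
by rewrite ler_pM2l// ler_pdivlMr// mulrC.
Qed.

Lemma L2_integrable u C (M : R) : measurable C -> C `<=` D -> (mu D < +oo)%E -> measurable_fun setT u ->
  (\int[mu]_(x in D) (u x ^+ 2)%:E <= M%:E)%E ->
  itg mu C u /\ `|\int[mu]_(x in C) u x| <= fine (mu D) + M.
Proof.
move=> mC CD fD mu_ uM.
have fC : (mu C < +oo)%E by apply: le_lt_trans fD; rewrite le_measure ?inE.
have i2 : IB mu C (fun x => u x ^+ 2) M.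
  apply/ge0_IBP => //.
  - by apply: measurable_funX; exact: measurable_funTS.
  - by move=> y _; exact: sqr_ge0.
  apply: le_trans uM; apply: ge0_subset_integral => //.
  - by apply/measurable_EFinP; apply: measurable_funX; exact: measurable_funTS.
  - by move=> y _; rewrite lee_fin sqr_ge0.
have i3 : IB mu C (fun x => 1 + u x ^+ 2) (1 * fine (mu C) + M).
  by apply: IB_D => //; exact: IB_cst.
have h x : C x -> `|u x| <= 1 + u x ^+ 2.
  by move=> _; rewrite -(real_normK (num_real (u x))); have := sqr_ge0 (`|u x| - 1); nra.
have i4 := IB_le mC (measurable_funTS mu_) i3 h.
have [i5 h5] := IB_abs mC i4 (measurable_funTS mu_); split => //.
apply: (le_trans h5); rewrite mul1r lerD2r fine_le ?ge0_fin_numE//.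
by rewrite le_measure ?inE.
Qed.

(** The number of pieces may depend on the scale rho; the lower bound on their measures has a
    uniform constant. *)
Definition kernel_cover (N beta kappa r0 : R) := forall rho : R, 0 < rho -> rho <= r0 ->
  exists (k : nat) (C : nat -> set T),
    (forall i, (i < k)%N -> [/\ measurable (C i), C i `<=` D &
       exists2 m : R, kappa * rho `^ N <= m & mu (C i) = m%:E]) /\
    forall x, D x -> exists2 i, (i < k)%N & forall y, C i y -> x <> y -> 1 <= rho `^ beta * K (x, y).

(* At scale rho, the L2 norm is bounded by the averages over the finitely many pieces up to
   rho^(beta - N) times the energy; along an ultrafilter all averages converge. *)
Lemma L2_compactness (N beta kappa r0 M Ke : R) (w : nat -> T -> R) : (mu D < +oo)%E ->
  0 < N -> N < beta -> 0 < kappa -> 0 < r0 -> kernel_cover N beta kappa r0 -> 0 <= Ke ->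
  (forall j, measurable_fun setT (w j)) ->
  (forall j, (\int[mu]_(x in D) (w j x ^+ 2)%:E <= M%:E)%E) ->
  (forall j, (energy (w j) <= Ke%:E)%E) ->
  exists2 sigma : nat -> nat, {homo sigma : i j / (i < j)%N} &
    forall e : R, 0 < e -> exists k0, forall i j, (k0 <= i)%N -> (k0 <= j)%N ->
      (\int[mu]_(x in D) ((w (sigma i) x - w (sigma j) x) ^+ 2)%:E <= e%:E)%E.
Proof.
move=> fD N0 Nb kp r00 cov Ke0 mw wM wK.
pose md := fine (mu D); have md0 : 0 <= md by rewrite fine_ge0.
have fDE : mu D = md%:E by rewrite fineK// ge0_fin_numE.
have [U [UU Uoo]] := @ultraFilterLemma nat \oo _.
apply: (@ultra_cauchy_subsequence R U UU Uoo (fun e i j =>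
  (\int[mu]_(x in D) ((w i x - w j x) ^+ 2)%:E <= e%:E)%E)) => [e e' i j ee h|e e0].
  by apply: (le_trans h); rewrite lee_fin.
pose al := beta - N; have al0 : 0 < al by rewrite subr_gt0.
(* Chosen so that the energy contribution, 2 / kappa * rho^al * 4 Ke, is at most e / 2 as soon as
   rho^al <= q. *)
pose q := (e * kappa / (16 * (Ke + 1))).
have q0 : 0 < q by rewrite divr_gt0 ?mulr_gt0// ltr_wpDl.
pose rho := Num.min r0 (q `^ al^-1).
have rho0 : 0 < rho by rewrite lt_min r00 powR_gt0.
have rr0 : rho <= r0 by rewrite ge_min lexx.
have rq : rho `^ al <= q.
  apply: (@le_trans _ _ ((q `^ al^-1) `^ al)).
    by apply: powR_mono; [exact: ltW|exact: ltW|rewrite ge_min lexx orbT].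
  by rewrite -powRrM mulVf ?gt_eqF// powRr1// ltW.
have [k [C [hC1 hC2]]] := cov rho rho0 rr0.
pose kk := kappa * rho `^ N; have kk0 : 0 < kk by rewrite mulr_gt0// powR_gt0.
(* Tolerance for the averages: their contribution 2 dd^2 md is at most e / 2. *)
pose dd := Num.sqrt (e / (4 * (md + 1))).
have dd0 : 0 < dd by rewrite sqrtr_gt0 divr_gt0// mulr_gt0// ltr_wpDl.
pose e' := kk / 2 * dd; have e'0 : 0 < e' by rewrite mulr_gt0// divr_gt0.
pose S (i : 'I_k) j := \int[mu]_(x in C i) w j x.
have HS i : exists l : R, U [set j | `|S i j - l| < e'].
  have [mC CD _] := hC1 i (ltn_ord i).
  have [|l hl] := @ultra_bounded_limit R U UU (S i) (md + M).
    by move=> j; exact: (L2_integrable mC CD fD (mw j) (wM j)).2.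
  by exists l; exact: hl.
have [l hl] := choice HS.
exists [set j | forall i, `|S i j - l i| < e']; first exact: filter_forall.
move=> i j hi hj; pose u x := w i x - w j x.
have mu_ : measurable_fun setT u by exact: measurable_funB.
have Eu : (energy u <= (4 * Ke)%:E)%E.
  apply: (le_trans (energyB_le (mw i) (mw j))).
  rewrite (_ : 4 * Ke = 2 * Ke + 2 * Ke); last by ring.
  by rewrite [leRHS]EFinD (EFinM 2 Ke); apply: leeD; apply: lee_wpmul2l.
pose c1 := 2 * rho `^ beta / kk; pose c2 := 2 * (2 * e' / kk) ^+ 2.
have c10 : 0 <= c1 by rewrite divr_ge0 ?(ltW kk0)// mulr_ge0// powR_ge0.
have pw x : D x -> ((u x ^+ 2)%:E <= c1%:E * inner_quot mu K D u x + c2%:E)%E.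
  move=> Dx; have [p pk hp] := hC2 x Dx; have [mC CD [m km Cm]] := hC1 p pk.
  have m0 : 0 < m by exact: lt_le_trans km.
  have [ii _] := L2_integrable mC CD fD (mw i) (wM i).
  have [ij _] := L2_integrable mC CD fD (mw j) (wM j).
  have := local_variance mu_ mC Cm m0 (powR_gt0 beta rho0) (itgB mC ii ij) hp.
  move=> h; apply: (le_trans h); apply: leeD.
    apply: (@le_trans _ _ (c1%:E * inner_quot mu K (C p) u x)%E).
      apply: lee_wpmul2r; first exact: inner_quot_ge0.
      rewrite lee_fin /c1 ler_wpM2l ?mulr_ge0 ?powR_ge0// lef_pV2 ?posrE//.
    apply: lee_wpmul2l; first by rewrite lee_fin.
    apply: ge0_subset_integral => //.
    - by apply/measurable_EFinP; apply: measurable_funTS; exact: measurable_quot1.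
    - by move=> y _; rewrite lee_fin quot_ge0.
  rewrite lee_fin ler_wpM2l// RintegralB//.
  have h1 := hi (Ordinal pk); have h2 := hj (Ordinal pk).
  rewrite -(real_normK (num_real (_ / m))) ler_sqr ?nnegrE//; last first.
    by rewrite divr_ge0 ?(ltW kk0)// mulr_ge0// ltW.
  rewrite normrM normfV (gtr0_norm m0).
  apply: ler_pM => //; first by rewrite invr_ge0 ltW.
    rewrite -[X in `|X - _|]/(S (Ordinal pk) i) -[X in `|_ - X|]/(S (Ordinal pk) j).
    rewrite (_ : S _ i - S _ j = (S (Ordinal pk) i - l (Ordinal pk)) - (S (Ordinal pk) j - l (Ordinal pk))); last by ring.
    by apply: (le_trans (ler_normB _ _)); rewrite mulr_natl mulr2n lerD// ltW.
  by rewrite lef_pV2 ?posrE.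
apply: (@le_trans _ _ (\int[mu]_(x in D) (c1%:E * inner_quot mu K D u x + c2%:E))%E).
  apply: ge0_le_integral => //.
  - by move=> x _; rewrite lee_fin sqr_ge0.
  - by apply/measurable_EFinP; apply: measurable_funX; exact: measurable_funTS.
  - apply: emeasurable_funD => //; apply: emeasurable_funM => //; apply: measurable_funTS.
    exact: measurable_inner_quot.
have c20 : 0 <= c2 by rewrite mulr_ge0// sqr_ge0.
rewrite ge0_integralD//; last 2 first.
- by move=> x _; rewrite mule_ge0 ?inner_quot_ge0// lee_fin.
- by apply: emeasurable_funM => //; apply: measurable_funTS; exact: measurable_inner_quot.
rewrite integral_cst// ge0_integralZl_EFin//; last 2 first.
- by move=> x _; exact: inner_quot_ge0.
- by apply: measurable_funTS; exact: measurable_inner_quot.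
rewrite [X in (c2%:E * X)%E]fDE -EFinM.
apply: (@le_trans _ _ ((c1 * (4 * Ke))%:E + (c2 * md)%:E)%E).
  rewrite leeD2r// (EFinM c1) lee_wpmul2l ?lee_fin//.
  have DDQ := @DD_off_diag _ T D.
  have H := inner_quot_energy mu mD mK K0 mD mD DDQ mu_.
  exact: (le_trans H Eu).
rewrite -EFinD lee_fin (splitr e); apply: lerD.
  have -> : c1 = 2 / kappa * rho `^ al.
    rewrite /c1 /kk /al powRD; last by apply/implyP => _; rewrite gt_eqF.
    rewrite powRN; field; rewrite ?gt_eqF//.
    by rewrite powR_gt0.
  have K1 : 0 < Ke + 1 by rewrite ltr_wpDl.
  have h : 2 / kappa * rho `^ al <= 2 / kappa * q by rewrite ler_wpM2l// divr_ge0// ltW.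
  apply: (@le_trans _ _ (2 / kappa * q * (4 * Ke))); first by rewrite ler_wpM2r// mulr_ge0.
  have -> : 2 / kappa * q * (4 * Ke) = e / 2 * (Ke / (Ke + 1)).
    by rewrite /q; field; rewrite !gt_eqF.
  by rewrite ler_piMr ?divr_ge0 ?(ltW e0)// ler_pdivrMr// mul1r lerDl.
have -> : c2 = 2 * dd ^+ 2 by rewrite /c2 /e'; field; rewrite gt_eqF.
have m1 : 0 < md + 1 by rewrite ltr_wpDl.
rewrite /dd sqr_sqrtr; last by rewrite divr_ge0 ?(ltW e0)// mulr_ge0// ltW.
have -> : 2 * (e / (4 * (md + 1))) * md = e / 2 * (md / (md + 1)) by field; rewrite gt_eqF.
by rewrite ler_piMr ?divr_ge0 ?(ltW e0)// ler_pdivrMr// mul1r lerDl.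
Qed.

(** By Poincare a Cauchy sequence in energy is Cauchy in L2, so a fast subsequence converges almost
    everywhere. Fatou's lemma, applied to the quotients of w i minus the subsequence, then bounds
    the energy of w i minus the limit. *)
Lemma energy_complete (CP : R) (w : nat -> T -> R) : 0 <= CP ->
  (forall u, measurable_fun setT u -> {ae mu, forall x, ~ D x -> u x = 0} ->
     (\int[mu]_(x in D) (u x ^+ 2)%:E <= CP%:E * energy u)%E) ->
  (forall j, measurable_fun setT (w j)) ->
  (forall j, {ae mu, forall x, ~ D x -> w j x = 0}) ->
  (forall e : R, 0 < e -> exists k0, forall i j, (k0 <= i)%N -> (k0 <= j)%N ->
     (energy (fun x => w i x - w j x)%R <= e%:E)%E) ->
  exists l : T -> R, [/\ measurable_fun setT l, {ae mu, forall x, ~ D x -> l x = 0} &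
    forall e : R, 0 < e -> exists k0, forall j, (k0 <= j)%N ->
      (energy (fun x => w j x - l x)%R <= e%:E)%E].
Proof.
move=> CP0 poin mw w0 cau.
have CP1 : 0 < CP + 1 by rewrite ltr_wpDl.
have /choice[k0 hk0] : forall m : nat, exists k0, forall i j, (k0 <= i)%N -> (k0 <= j)%N ->
    (energy (fun x => w i x - w j x)%R <= ((8^-1) ^+ m / (CP + 1))%:E)%E.
  by move=> m; apply: cau; rewrite divr_gt0// exprn_gt0.
(* The indices run past every [k0 j], so consecutive terms differ by energy at most 8^-j / (CP + 1);
   Poincare turns this into the rate required by [fast_L2_cvg_ae]. *)
pose s := fix s j := if j is j'.+1 then (s j' + k0 j).+1 else k0 0%N.
have sk j : (k0 j <= s j)%N by case: j => //= j; rewrite ltnW// ltnS leq_addl.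
have sj j : (j <= s j)%N by elim: j => //= j IH; rewrite ltnS (leq_trans IH)// leq_addr.
have sS j : (s j <= s j.+1)%N by rewrite /= ltnW// ltnS leq_addr.
pose f j := w (s j).
have mf j : measurable_fun setT (f j) by exact: mw.
have fae : {ae mu, forall x, D x -> cvgn (fun j => f j x)}.
  apply: fast_L2_cvg_ae => // [j|j]; first exact: measurable_funTS.
  have mB : measurable_fun setT (fun x => f j.+1 x - f j x) by exact: measurable_funB.
  apply: (le_trans (poin _ mB _)).
    have w1 := w0 (s j.+1); have w2 := w0 (s j).
    near=> x; move=> nDx; rewrite /f (near w1 x)// (near w2 x)// ?subrr//.
  apply: (@le_trans _ _ (CP%:E * ((8^-1) ^+ j / (CP + 1))%:E)%E).
    by apply: lee_wpmul2l => //; apply: hk0; [exact: leq_trans (sk j) (sS j)|exact: sk].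
  rewrite -EFinM lee_fin mulrCA ler_piMr ?exprn_ge0//.
  by rewrite ler_pdivrMr// mul1r lerDl.
have f0 : {ae mu, forall x, forall j, ~ D x -> f j x = 0}.
  by apply: ae_foralln => j; exact: w0.
have [N [mN N0 subN]] : {ae mu, forall x, (D x -> cvgn (fun j => f j x)) /\ (forall j, ~ D x -> f j x = 0)}.
  by near=> x; split; [near: x|near: x].
have okN x : ~ N x -> (D x -> cvgn (fun j => f j x)) /\ (forall j, ~ D x -> f j x = 0).
  by move=> nN; apply: contrapT => h; apply: nN; exact: subN.
(* Killing the null set makes the sequence converge at every point, so that the limit is a genuine
   measurable function. *)
pose h j x := f j x * \1_(~` N) x.
have mh j : measurable_fun setT (h j).
  by apply: measurable_funM => //; apply: measurable_indic; exact: measurableC.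
have ch x : cvgn (fun j => h j x).
  have [Nx|nNx] := pselect (N x).
    rewrite (_ : (fun j => h j x) = fun=> 0); first exact: is_cvg_cst.
    by apply/funext => j; rewrite /h indicE memNset ?mulr0// => /(_ Nx).
  rewrite (_ : (fun j => h j x) = fun j => f j x); last first.
    by apply/funext => j; rewrite /h indicE mem_set ?mulr1.
  have [h1 h2] := okN x nNx; have [Dx|nDx] := pselect (D x); first exact: h1.
  rewrite (_ : (fun j => f j x) = fun=> 0); first exact: is_cvg_cst.
  by apply/funext => j; exact: h2.
pose l x := limn (fun j => h j x).
have hl x : h j x @[j --> \oo] --> l x by exact: ch.
have ml : measurable_fun setT l by apply: (measurable_fun_cvg mh) => x _; exact: hl.
have hf j : ae_eq mu setT (h j) (f j).
  exists N; split => // x /= nh; apply: contrapT => nN; apply: nh => _.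
  by rewrite /h indicE mem_set ?mulr1.
exists l; split => //.
  exists N; split => // x /= nh; apply: contrapT => nN; apply: nh => nDx.
  rewrite /l (_ : (fun j => h j x) = fun=> 0) ?lim_cst//.
  by apply/funext => j; rewrite /h (okN x nN).2// mul0r.
move=> e e0; have [k hk] := cau e e0; exists k => i ki.
apply: (@fatou_bound _ _ _ (mu \x mu)%E _ _ (fun j => quot K (fun x => w i x - h j x)) _ _ k).
- exact: measurable_off_diag.
- move=> j; apply: measurable_funTS; apply: measurable_quot => //; exact: measurable_funB.
- by move=> j p _; exact: quot_ge0.
- move=> p _; rewrite /quot/=; apply: cvgM; last exact: cvg_cst.
  have c1 : (w i p.1 - h j p.1 - (w i p.2 - h j p.2)) @[j --> \oo] --> (w i p.1 - l p.1 - (w i p.2 - l p.2)).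
    by apply: cvgB; apply: cvgB; [exact: cvg_cst|exact: hl|exact: cvg_cst|exact: hl].
  by rewrite expr2; under eq_fun do rewrite expr2; exact: cvgM.
- move=> j kj; rewrite -[X in (X <= _)%E]/(energy (fun x => w i x - h j x)).
  rewrite (@energy_ae _ (fun x => w i x - f j x)).
  + by apply: hk => //; exact: leq_trans kj (sj j).
  + exact: measurable_funB.
  + exact: measurable_funB.
  + by apply: filterS (hf j) => x hx _; rewrite hx.
Unshelve. all: by end_near. Qed.

End energy_space.

(** * Cubes and Lipschitz domains *)

Section cubes.
Variables (R : realType).

Definition cube n (c : 'rV[R]_n) (r : R) : set 'rV[R]_n :=
  [set y | forall i, `|y ord0 i - c ord0 i| <= r].

Lemma rv_norm_leP n (x : 'rV[R]_n) (r : R) : 0 <= r ->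
  `|x| <= r <-> forall i, `|x ord0 i| <= r.
Proof.
move=> r0; rewrite -[`|x|]/(mx_norm x) mx_normrE; split.
  move=> /bigmax_leP[_ h] i; exact: (h (ord0, i)).
by move=> h; apply/bigmax_leP; split => // -[i j] _ /=; rewrite (ord1 i).
Qed.

Lemma rv_coord_le n (x : 'rV[R]_n) i : `|x ord0 i| <= `|x|.
Proof. by have /rv_norm_leP := lexx `|x|; apply. Qed.

Lemma cubeP n (c y : 'rV[R]_n) (r : R) : 0 <= r -> cube c r y <-> `|y - c| <= r.
Proof. by move=> r0; rewrite rv_norm_leP//; split => h i; have := h i; rewrite !mxE. Qed.

Lemma measurable_cube n (c : 'rV[R]_n) (r : R) : measurable (cube c r).
Proof.
rewrite (_ : cube c r = \bigcap_(i in setT) (@rv_coord R n i @^-1` `[c ord0 i - r, c ord0 i + r]%classic)).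
  apply: fin_bigcap_measurable; first exact: finite_finset.
  move=> i _; rewrite -[X in measurable X]setTI; exact: measurable_rv_coord.
apply/seteqP; split => [y h i _|y h i].
  by rewrite /= /rv_coord in_itv/= -ler_distl; exact: h.
by have := h i I; rewrite /= /rv_coord in_itv/= -ler_distl.
Qed.

Lemma rv_cons_ord0 n t (y : 'rV[R]_n) : rv_cons (t, y) ord0 ord0 = t.
Proof.
have -> : ord0 = lshift n (ord0 : 'I_1) :> 'I_n.+1 by exact/val_inj.
by transitivity ((const_mx t : 'rV_1) ord0 ord0); [exact: (@row_mxEl R 1 1 n)|rewrite mxE].
Qed.

Lemma rv_cons_rshift n t (y : 'rV[R]_n) i : rv_cons (t, y) ord0 (rshift 1 i) = y ord0 i.
Proof. exact: (@row_mxEr R 1 1 n). Qed.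

Lemma lebesgue_rv_cube n (c : 'rV[R]_n) (r : R) : 0 <= r ->
  @lebesgue_rv R n (cube c r) = ((2 * r) ^+ n)%:E.
Proof.
move=> r0; elim: n c => [|n IH] c.
  by rewrite /= diracE mem_set// => -[].
rewrite /=.
transitivity (\int[@lebesgue_measure R]_t ((((2 * r) ^+ n)%:E) * (\1_(`[c ord0 ord0 - r, c ord0 ord0 + r]%classic) t)%:E))%E.
  apply: eq_integral => t _.
  have [h|h] := pselect (`|t - c ord0 ord0| <= r); rewrite indicE; last first.
    rewrite memNset; last by rewrite /= in_itv/= -ler_distl.
    rewrite mule0; rewrite (_ : [set _ | _] = set0) ?measure0//.
    by rewrite -subset0 => y /= /(_ ord0); rewrite rv_cons_ord0.
  rewrite mem_set; last by rewrite /= in_itv/= -ler_distl.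
  rewrite mule1 -(IH (rv_uncons c).2); congr (lebesgue_rv _); apply/seteqP; split => y /= hy.
    move=> i; have := hy (rshift 1 i); rewrite rv_cons_rshift.
    by rewrite mxE.
  move=> i; case: (@split_ordP 1 n i) => j ->.
    rewrite (_ : lshift n j = ord0 :> 'I_n.+1); last by rewrite (ord1 j); exact/val_inj.
    by rewrite rv_cons_ord0.
  by rewrite rv_cons_rshift; have := hy j; rewrite mxE.
rewrite ge0_integralZl_EFin//; last 2 first.
- by apply/measurable_EFinP; exact: measurable_indic.
- by rewrite exprn_ge0// mulr_ge0.
rewrite integral_indic// setIT /= lebesgue_measure_itv/= lte_fin.
have [rp|] := ltP (c ord0 ord0 - r) (c ord0 ord0 + r).
  by rewrite -EFinB -EFinM exprSr; congr (_ * _)%:E; ring.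
rewrite -subr_ge0 => h; have -> : r = 0 by lra.
by rewrite mule0 exprS mulr0 mul0r.
Qed.

(** The sigma-algebra comes from the coordinates and the topology from the sup norm; they meet
    because an open set is a union of cubes with rational centres and radii 1 / (k + 1). *)
Lemma open_rv_measurable n (A : set 'rV[R]_n) : open A -> measurable A.
Proof.
move=> oA.
pose C (p : 'rV[rat]_n * nat) := cube (map_mx ratr p.1 : 'rV[R]_n) p.2.+1%:R^-1.
rewrite (_ : A = \bigcup_(p in [set p | C p `<=` A]) C p).
  rewrite bigcup_mkcond; apply: countable_bigcupT_measurable; first exact: countableP.
  by move=> p; case: ifP => // _; exact: measurable_cube.
apply/seteqP; split => [x Ax|x [p]]; last by move=> /= h; exact: h.
have /nbhs_ballP[e /= e0 he] := oA x Ax.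
have [k hk] : exists k : nat, 2 * k.+1%:R^-1 < e.
  exists (Num.truncn (2 / e)); rewrite ltr_pdivrMr// mulrC -ltr_pdivrMr//.
  exact: truncnS_gt.
pose d : R := k.+1%:R^-1; have d0 : 0 < d by rewrite invr_gt0.
have hq i : exists q : rat, `|x ord0 i - ratr q| < d.
  have [] := @dense_rat R (ball (x ord0 i) d); first by exists (x ord0 i); exact: ballxx.
    exact: ball_open.
  by move=> z [h [q _ qz]]; exists q; rewrite qz.
have [q qP] := choice hq.
have Cx : C (\row_i q i, k) x by move=> i; rewrite /= !mxE; exact/ltW/qP.
exists (\row_i q i, k) => //= y Cy; apply: he.
rewrite -ball_normE /ball_/= (@le_lt_trans _ _ (2 * d))//.
apply/rv_norm_leP; first by rewrite mulr_ge0// ltW.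
move=> i; have := Cx i; have := Cy i; rewrite !mxE /= -/d => h1 h2.
rewrite (_ : x ord0 i - y ord0 i = (x ord0 i - ratr (q i)) - (y ord0 i - ratr (q i))); last by ring.
by apply: (le_trans (ler_normB _ _)); rewrite mulr_natl mulr2n lerD.
Qed.

Lemma continuous_rv_measurable n (f : 'rV[R]_n -> R) : continuous f -> measurable_fun setT f.
Proof.
move=> cf; apply: (measurability _ (RGenOpens.measurableE R)) => //.
move=> _ [_ [a [b ->] <-]]; rewrite setTI; apply: open_rv_measurable.
by apply: open_comp => // x _; exact: cf.
Qed.

End cubes.

Section euclid.
Variables (R : realType) (n : nat).
Implicit Types x y h : 'rV[R]_n.
Local Notation N := (n%:R : R).

Lemma dotDl x y h : dot (x + y) h = dot x h + dot y h.
Proof. by rewrite /dot -big_split/=; apply: eq_bigr => i _; rewrite mxE mulrDl. Qed.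

Lemma dotZl (a : R) x h : dot (a *: x) h = a * dot x h.
Proof. by rewrite /dot mulr_sumr; apply: eq_bigr => i _; rewrite mxE mulrA. Qed.

Lemma dot_ge0 x : 0 <= dot x x.
Proof. by apply: sumr_ge0 => i _; rewrite -expr2 sqr_ge0. Qed.

Lemma dot_le x y : `|dot x y| <= N * (`|x| * `|y|).
Proof.
apply: (le_trans (ler_norm_sum _ _ _)).
apply: (@le_trans _ _ (\sum_(i < n) `|x| * `|y|)); last by rewrite sumr_const card_ord mulr_natl.
by apply: ler_sum => i _; rewrite normrM ler_pM// rv_coord_le.
Qed.

Lemma norm_le_enorm x : `|x| <= enorm x.
Proof.
apply/rv_norm_leP => [|i]; first exact: sqrtr_ge0.
rewrite -sqrtr_sqr ler_wsqrtr// /dot (bigD1 i)//= expr2 lerDl.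
by apply: sumr_ge0 => j _; rewrite -expr2 sqr_ge0.
Qed.

Lemma enorm_le x : (0 < n)%N -> enorm x <= N * `|x|.
Proof.
move=> n0; rewrite -[leRHS]ger0_norm ?mulr_ge0// -sqrtr_sqr ler_wsqrtr//.
apply: (le_trans (ler_norm _)); apply: (le_trans (dot_le x x)).
rewrite exprMn -expr2 ler_wpM2r ?sqr_ge0// expr2 ler_peMl// ler1n//.
Qed.

Lemma enorm_gt0 x : x != 0 -> 0 < enorm x.
Proof. by move=> x0; apply: lt_le_trans (norm_le_enorm x); rewrite normr_gt0. Qed.

Lemma measurable_rvB : measurable_fun setT (fun p : 'rV[R]_n * 'rV[R]_n => p.1 - p.2).
Proof.
apply: measurable_fun_rv => i.
rewrite (_ : _ \o _ = fun p : 'rV[R]_n * 'rV[R]_n => rv_coord i p.1 - rv_coord i p.2).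
  by apply: measurable_funB; apply: measurableT_comp => //; exact: measurable_rv_coord.
by apply/funext => p; rewrite /rv_coord /= !mxE.
Qed.

Lemma measurable_enorm : measurable_fun setT (@enorm R n).
Proof.
apply: measurableT_comp; first by apply: continuous_measurable_fun; exact: sqrt_continuous.
apply: (@measurable_sum _ _ _ _ _ _ (fun i (x : 'rV[R]_n) => x ord0 i * x ord0 i)) => i.
by apply: measurable_funM; exact: measurable_rv_coord.
Qed.

(** For beta > 0 the value on the diagonal is 0, the inverse of 0 by convention; hence the condition
    x <> y in all lower bounds. It is used with beta = n + alpha. *)
Definition gag_kernel (beta : R) (p : 'rV[R]_n * 'rV[R]_n) : R := (enorm (p.1 - p.2) `^ beta)^-1.

Lemma gag_kernel_ge0 beta p : 0 <= gag_kernel beta p.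
Proof. by rewrite invr_ge0 powR_ge0. Qed.

Lemma measurable_gag_kernel beta : measurable_fun setT (gag_kernel beta).
Proof.
apply: measurable_funTS.
rewrite (_ : gag_kernel beta = fun p => enorm (p.1 - p.2) `^ (- beta)); last first.
  by apply/funext => p; rewrite powRN.
apply: (measurableT_comp (measurable_powR _)).
by apply: (measurableT_comp measurable_enorm); exact: measurable_rvB.
Qed.

Lemma gag_kernel_lower (beta s : R) x y : (0 < n)%N -> 0 <= beta -> x <> y -> N * `|x - y| <= s ->
  1 <= s `^ beta * gag_kernel beta (x, y).
Proof.
move=> n0 b0 xy hs; have e0 : 0 < enorm (x - y) by apply: enorm_gt0; rewrite subr_eq0; apply/eqP.
rewrite /gag_kernel/= ler_pdivlMr ?powR_gt0// mul1r powR_mono ?(ltW e0)//.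
exact: le_trans (enorm_le _ n0) hs.
Qed.

Lemma gag_kernel_upper (beta : R) x y : 0 <= beta -> x <> y ->
  gag_kernel beta (x, y) <= (`|x - y| `^ beta)^-1.
Proof.
move=> b0 xy; have n0 : 0 < `|x - y| by rewrite normr_gt0 subr_eq0; apply/eqP.
rewrite /gag_kernel/= lef_pV2 ?posrE ?powR_gt0//; first by rewrite powR_mono// norm_le_enorm.
exact: lt_le_trans (norm_le_enorm _).
Qed.

End euclid.

(** * Interior cubes near every point of a Lipschitz domain *)

Section density.
Variables (R : realType) (n : nat) (Omega : set 'rV[R]_n).
Hypothesis n0 : (0 < n)%N.
Hypotheses (BD : bounded_domain Omega) (LB : lipschitz_boundary Omega).
Local Notation N := (n%:R : R).

Let N1 : 1 <= N. Proof. by rewrite ler1n. Qed.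

(** An interior corkscrew condition: at every small scale the domain contains a cube of comparable
    size near x. It yields both the measure density for Sobolev and the pieces for Rellich. *)
Definition cube_dense_at (d : R) (x : 'rV[R]_n) := Omega x -> forall r : R, 0 < r -> r <= d ->
  exists2 c, cube c (d * r) `<=` Omega & `|c - x| <= r.

Lemma cube_dense_interior x0 : Omega x0 -> exists d : R, [/\ 0 < d, d <= 1 &
  forall x, `|x - x0| < d -> cube_dense_at d x].
Proof.
case: BD => oO _ _ _ Ox0; have /nbhs_ballP[e /= e0 he] := oO _ Ox0.
pose d := Num.min (e / 4) 1; have d0 : 0 < d by rewrite lt_min ltr01 divr_gt0.
have d1 : d <= 1 by rewrite ge_min lexx orbT.
have de : d <= e / 4 by rewrite ge_min lexx.
exists d; split => // x xd _ r r0 rd; exists x; last by rewrite subrr normr0 ltW.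
move=> y /cubeP hy; apply: he; rewrite -ball_normE/ball_/= distrC.
rewrite (_ : y - x0 = (y - x) + (x - x0)); last by rewrite addrA subrK.
apply: le_lt_trans (ler_normD _ _) _; have := hy (mulr_ge0 (ltW d0) (ltW r0)).
have : d * r <= d by rewrite ler_piMr ?(ltW d0)// (le_trans rd).
lra.
Qed.

(** Moving x by r along [nu] lifts it by r above the graph, and a cube of size d r around the new
    point stays above the graph when d is small compared with the Lipschitz constant. *)
Lemma cube_dense_boundary x0 : (closure Omega `\` interior Omega) x0 -> exists d : R, [/\ 0 < d, d <= 1 &
  forall x, `|x - x0| < d -> cube_dense_at d x].
Proof.
move=> /LB [r1 [nu [gamma [r10 nu1 gL hO]]]].
have [L L0 hL] : exists2 L : R, 0 <= L & forall x y, `|gamma x - gamma y| <= L * `|x - y|.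
  move: gL => [M [_ hM]]; exists (Num.max M 0 + 1); first by rewrite addr_ge0// le_max lexx orbT.
  move=> x y; apply: (hM _ _ (x, y) (conj I I)); apply: (@le_lt_trans _ _ (Num.max M 0)).
    by rewrite le_max lexx.
  by rewrite ltrDl.
(* The condition d B <= 1 leaves exactly the room required: L (N + 1) d r for the change of [gamma],
   N d r for the change of height, and d r for strictness. *)
pose B := L * (N + 1) + N + 1; have B0 : 1 <= B.
  by have := ler0n R n; rewrite /B; have := mulr_ge0 L0 (addr_ge0 (ler0n R n) ler01); lra.
(* All points involved lie within 3 d of x0 in the sup norm, hence within r1 in the Euclidean norm,
   which is at most N times larger. *)
pose d := Num.min (r1 / (4 * N)) B^-1.
have N0 : 0 < N by exact: lt_le_trans N1.
have d0 : 0 < d by rewrite lt_min invr_gt0 divr_gt0 ?mulr_gt0//= (lt_le_trans _ B0).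
have dB : d * B <= 1 by rewrite -ler_pdivlMr ?(lt_le_trans _ B0)// mul1r ge_min lexx orbT.
have d1 : d <= 1 by rewrite (le_trans _ dB)// ler_peMr// ltW.
have dr : 4 * N * d <= r1 by rewrite mulrC -ler_pdivlMr ?mulr_gt0// ge_min lexx.
have nus : `|nu| <= 1 by rewrite -nu1 norm_le_enorm.
have nn : dot nu nu = 1.
  by rewrite -[dot nu nu]sqr_sqrtr ?dot_ge0// -[Num.sqrt _]/(enorm nu) nu1 expr1n.
exists d; split => // x xd Ox r r0 rd.
have dr0 : 0 <= d * r by rewrite mulr_ge0 ?ltW.
have close y : `|y - x0| <= 3 * d -> enorm (y - x0) < r1.
  move=> h; apply: (le_lt_trans (enorm_le _ n0)); apply: lt_le_trans dr.
  apply: (@le_lt_trans _ _ (N * (3 * d))); first by rewrite ler_wpM2l// ltW.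
  by have := mulr_gt0 N0 d0; lra.
have gx : gamma (x - dot x nu *: nu) < dot x nu.
  by apply/hO => //; apply: close; have := ltW xd; lra.
exists (x + r *: nu); last first.
  by rewrite addrAC subrr add0r normrZ gtr0_norm// ler_piMr// ltW.
move=> y /(cubeP _ _ dr0); set h := y - _ => hh.
have yE : y = x + r *: nu + h by rewrite /h addrC subrK.
have dh : `|dot h nu| <= N * (d * r).
  apply: (le_trans (dot_le _ _)); rewrite ler_wpM2l ?(ltW N0)//.
  by rewrite -[leRHS]mulr1 ler_pM.
apply/hO.
  apply: close; rewrite yE (_ : _ - x0 = (x - x0) + (r *: nu + h)); last by apply/rowP => i; rewrite !mxE; ring.
  apply: (le_trans (ler_normD _ _)); have := ltW xd; have := ler_normD (r *: nu) h.
  have : `|r *: nu| <= r by rewrite normrZ gtr0_norm// ler_piMr// ltW.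
  have : d * r <= d by rewrite ler_piMr ?(ltW d0)// (le_trans rd).
  lra.
have dy : dot y nu = dot x nu + r + dot h nu by rewrite yE !dotDl dotZl nn mulr1.
have pE : y - dot y nu *: nu = (x - dot x nu *: nu) + (h - dot h nu *: nu).
  by rewrite dy yE; apply/rowP => i; rewrite !mxE; ring.
have := hL (y - dot y nu *: nu) (x - dot x nu *: nu).
rewrite {2}pE addrAC subrr add0r.
have h2 : `|h - dot h nu *: nu| <= d * r + N * (d * r).
  apply: (le_trans (ler_normB _ _)); rewrite lerD// normrZ.
  by apply: le_trans dh; rewrite ler_piMr.
move=> /(fun X => le_trans X (ler_wpM2l L0 h2)) /ler_normlP[_ h3].
have h4 : L * (d * r + N * (d * r)) + N * (d * r) <= r - d * r.
  have := ler_wpM2r (ltW r0) dB; rewrite mul1r /B; lra.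
have : 0 < d * r by rewrite mulr_gt0.
move/ler_normlP: dh => [h5 h6]; move=> h7; rewrite [X in _ < X]dy; lra.
Unshelve. all: by end_near. Qed.

Lemma compact_closure_bounded (A : set 'rV[R]_n) : bounded_set A -> compact (closure A).
Proof.
move=> [M [Mr hM]]; apply: bounded_closed_compact; last exact: closed_closure.
exists M; split => // M' /hM h x.
suff : closure A `<=` [set x | `|x| <= M'] by apply.
rewrite [X in _ `<=` X](closure_id _).1; first exact: closureS.
by apply: (@closed_comp _ _ (fun x : 'rV[R]_n => `|x|) [set x | x <= M']); [move=> ? _; exact: norm_continuous|exact: closed_le].
Qed.

(** Near each point of the closure some d works, and a smaller d only weakens the condition;
    compactness of the closure gives a single d. *)
Lemma cube_dense : exists d : R, [/\ 0 < d, d <= 1 & forall x, cube_dense_at d x].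
Proof.
have cO : compact (closure Omega).
  by case: BD => _ _ _; exact: compact_closure_bounded.
have H : \forall d \near (0 : R)^'+, closure Omega `<=` cube_dense_at d.
  apply: (compact_near_coveringP _).1 => // x0 Cx0.
  have [d [d0 d1 hd]] : exists d : R, [/\ 0 < d, d <= 1 & forall x, `|x - x0| < d -> cube_dense_at d x].
    have [i|i] := pselect (Omega x0); first exact: cube_dense_interior.
    by apply: cube_dense_boundary; split => // /interior_subset.
  exists (ball x0 d, [set e : R | 0 < e < d]).
    split; first exact: nbhsx_ballx.
    by near=> e; rewrite /=; apply/andP; split; near: e; [exact: nbhs_right_gt|exact: nbhs_right_lt].
  move=> [x e] /= [xd /andP[e0 ed]] Ox r r0 re.
  have [||c hc cx] := hd x _ Ox r r0 _.
  - by move: xd; rewrite -ball_normE/ball_/= distrC.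
  - exact: le_trans re (ltW ed).
  exists c => // y yc; apply: hc => i; apply: (le_trans (yc i)).
  by rewrite ler_wpM2r// ltW.
near (0 : R)^'+ => d.
have hd : closure Omega `<=` cube_dense_at d by near: d.
exists d; split => //.
- by near: d; exact: nbhs_right_le.
- by move=> x Ox; apply: hd => //; exact: subset_closure.
Unshelve. all: by end_near. Qed.

End density.

(** * The Gagliardo kernel on a Lipschitz domain *)

Section domain_kernel.
Variables (R : realType) (n : nat) (Omega : set 'rV[R]_n).
Hypothesis n0 : (0 < n)%N.
Hypotheses (BD : bounded_domain Omega) (LB : lipschitz_boundary Omega).
Variable beta : R.
Hypothesis b0 : 0 <= beta.
Local Notation N := (n%:R : R).
Local Notation mu := (@lebesgue_rv R n).
Local Notation K := (@gag_kernel R n beta).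

Let N0 : 0 < N. Proof. by rewrite ltr0n. Qed.

Lemma measurable_domain : measurable Omega.
Proof. by case: BD => oO _ _ _; exact: open_rv_measurable. Qed.

Lemma domain_in_cube : exists2 M : R, 1 <= M & forall x, Omega x -> `|x| <= M.
Proof.
case: BD => _ _ _ [M [Mr hM]]; exists (Num.max (M + 1) 1); first by rewrite le_max lexx orbT.
by apply: hM; rewrite lt_max ltrDl ltr01.
Qed.

Lemma domain_finite : (mu Omega < +oo)%E.
Proof.
have [M M1 hM] := domain_in_cube.
have M0 : 0 <= M by exact: le_trans M1.
apply: (@le_lt_trans _ _ (mu (cube 0 M))); last by rewrite lebesgue_rv_cube// ltry.
apply: le_measure; rewrite ?inE; [exact: measurable_domain|exact: measurable_cube|].
by move=> x /hM h; apply/cubeP => //; rewrite subr0.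
Qed.

Lemma domain_kernel_dense : exists kappa r0 : R, [/\ 0 < kappa, 0 < r0 &
  kernel_dense mu Omega K N beta kappa r0].
Proof.
have [d [d0 d1 hd]] := cube_dense n0 BD LB.
have N2 : 0 < 2 * N by rewrite mulr_gt0.
exists ((d / N) ^+ n), (d * (2 * N)); split.
- by rewrite exprn_gt0// divr_gt0.
- by rewrite mulr_gt0.
move=> x r Ox r0 rr.
(* The factor 2 accounts for passing from x to y through the centre of the cube, and N for the
   Euclidean norm against the sup norm. *)
pose s := r / (2 * N); have s0 : 0 < s by rewrite divr_gt0.
have sd : s <= d by rewrite ler_pdivrMr.
have [c cO cx] := hd x Ox s s0 sd.
exists (cube c (d * s)); split => //.
- exact: measurable_cube.
- rewrite [LHS]lebesgue_rv_cube; last by rewrite mulr_ge0// ltW.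
  rewrite (powR_mulrn _ (ltW r0)) -exprMn.
  by congr (_ ^+ _)%:E; rewrite /s; field; rewrite gt_eqF.
move=> y /cubeP yc xy; apply: gag_kernel_lower => //.
have -> : r = N * (2 * s) by rewrite /s; field; rewrite gt_eqF.
rewrite ler_wpM2l ?(ltW N0)// (_ : x - y = (x - c) - (y - c)); last by rewrite opprB addrA subrK.
apply: (le_trans (ler_normB _ _)); rewrite distrC mulr_natl mulr2n lerD//.
apply: (le_trans (yc _)); first by rewrite mulr_ge0// ltW.
by rewrite ler_piMl// ltW.
Qed.

(** Finitely many balls of radius s cover the closure. Their centres may lie outside Omega, so a
    piece is the part of Omega in the cube of radius 3 s: it contains the interior cube of a point
    of Omega within s of the centre. *)
Lemma domain_kernel_cover : exists kappa r0 : R, [/\ 0 < kappa, 0 < r0 &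
  kernel_cover mu Omega K N beta kappa r0].
Proof.
have [d [d0 d1 hd]] := cube_dense n0 BD LB.
have N4 : 0 < 4 * N by rewrite mulr_gt0.
exists ((d / (2 * N)) ^+ n), (4 * N * d); split.
- by rewrite exprn_gt0// divr_gt0// mulr_gt0.
- by rewrite mulr_gt0.
move=> rho rho0 rr.
pose s := rho / (4 * N); have s0 : 0 < s by rewrite divr_gt0.
have sd : s <= d by rewrite ler_pdivrMr// mulrC.
have cO : compact (closure Omega).
  by case: BD => _ _ _; exact: compact_closure_bounded.
move: cO; rewrite compact_cover => /(_ 'rV[R]_n (closure Omega) (fun z => ball z s)).
case=> [z _|x Cx|D' D'C cov]; first exact: ball_open.
  by exists x => //; exact: ballxx.
have [M M1 hM] := domain_in_cube.
pose C i := Omega `&` cube (nth 0 (finmap.enum_fset D') i) (3 * s).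
exists (size (finmap.enum_fset D')), C; split=> [i iD|x Ox].
  set z := nth 0 (finmap.enum_fset D') i.
  have zC : closure Omega z by have := D'C z; rewrite inE; apply; exact: mem_nth.
  have [x0 [Ox0 zx0]] := zC _ (nbhsx_ballx z s s0).
  have [c cO cx] := hd x0 Ox0 s s0 sd.
  have ds0 : 0 <= d * s by rewrite mulr_ge0// ltW.
  have mC : measurable (C i) by apply: measurableI; [exact: measurable_domain|exact: measurable_cube].
  have fC : (mu (C i) < +oo)%E.
    apply: le_lt_trans domain_finite; apply: le_measure; rewrite ?inE; [exact: mC|exact: measurable_domain|by move=> y []].
  split => //; first by move=> y [].
  exists (fine (mu (C i))); last by rewrite fineK// ge0_fin_numE.
  rewrite -lee_fin fineK ?ge0_fin_numE//.
  apply: (@le_trans _ _ (mu (cube c (d * s)))).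
    rewrite [X in (_ <= X)%E]lebesgue_rv_cube// powR_mulrn ?(ltW rho0)// -exprMn lee_fin le_eqVlt; apply/orP; left.
    by apply/eqP; congr (_ ^+ _); rewrite /s; field; rewrite gt_eqF.
  apply: le_measure; rewrite ?inE//; first exact: measurable_cube.
  move=> y yc; split; first exact: cO.
  apply/cubeP; first by rewrite mulr_ge0// ltW.
  move: yc => /(cubeP _ _ ds0) yc.
  rewrite (_ : y - z = (y - c) + (c - x0) + (x0 - z)); last by apply/rowP => j; rewrite !mxE; ring.
  apply: (le_trans (ler_normD _ _)); have := ler_normD (y - c) (c - x0).
  move: zx0; rewrite -ball_normE/ball_/= distrC.
  have : d * s <= s by rewrite ler_piMl// ltW.
  lra.
have [z zD' xz] := cov x (@subset_closure _ Omega x Ox).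
exists (index z (finmap.enum_fset D')); first by rewrite index_mem.
move=> y [Oy /cubeP]; rewrite nth_index// => yz xy.
apply: gag_kernel_lower => //.
have -> : rho = N * (4 * s) by rewrite /s; field; rewrite gt_eqF.
rewrite ler_wpM2l ?(ltW N0)// (_ : x - y = (x - z) - (y - z)); last by rewrite opprB addrA subrK.
apply: (le_trans (ler_normB _ _)).
have := yz (mulr_ge0 (ler0n _ _) (ltW s0)).
move: xz; rewrite -ball_normE/ball_/= distrC; lra.
Qed.

Lemma domain_poincare : exists2 CP : R, 0 <= CP & forall u : 'rV[R]_n -> R, measurable_fun setT u ->
  {ae mu, forall x, ~ Omega x -> u x = 0} ->
  (\int[mu]_(x in Omega) (u x ^+ 2)%:E <= CP%:E * energy mu Omega K u)%E.
Proof.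
have [M M1 hM] := domain_in_cube.
(* A unit cube just beyond the cube of radius M that contains Omega serves as the exterior set. *)
pose e : 'rV[R]_n := const_mx (M + 2).
have mA := measurable_cube e 1.
have far y : cube e 1 y -> M + 1 <= `|y| /\ `|y| <= M + 3.
  move=> ye; split.
    apply: le_trans (rv_coord_le y (Ordinal n0)); apply: le_trans (ler_norm _).
    have := ye (Ordinal n0); rewrite mxE => /ler_normlP[h1 h2]; lra.
  apply/rv_norm_leP => [|i]; first lra.
  have := ye i; rewrite mxE => /ler_normlP[h1 h2]; apply/ler_normlP; split; lra.
have A2 : mu (cube e 1) = (2 ^+ n)%:E by rewrite lebesgue_rv_cube// mulr1.
have two : 0 < 2 ^+ n :> R by rewrite exprn_gt0.
pose rho := (N * (2 * M + 3)) `^ beta.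
have hK x y : Omega x -> cube e 1 y -> 1 <= rho * K (x, y).
  move=> /hM h1 /far[h2 h3]; apply: gag_kernel_lower => // [xy|].
    by move: h1; rewrite xy; lra.
  rewrite ler_wpM2l ?(ltW N0)//; apply: (le_trans (ler_normB _ _)); lra.
exists (2 * rho / 2 ^+ n); first by rewrite divr_ge0 ?(ltW two)// mulr_ge0// powR_ge0.
move=> u mu_ u0; apply: (poincare_exterior measurable_domain _ _ mA _ A2) => //.
- exact: measurable_gag_kernel.
- exact: gag_kernel_ge0.
- rewrite -subset0 => x [/hM h1 /far[h2 _]]; lra.
- exact: powR_ge0.
Qed.

End domain_kernel.

(** * Bump functions of finite energy *)

Section bump.
Variables (R : realType) (n : nat) (Omega : set 'rV[R]_n).
Hypothesis n0 : (0 < n)%N.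
Hypothesis mO : measurable Omega.
Variable beta : R.
Hypotheses (b2 : 2 <= beta) (nb : n%:R < beta) (bn : beta < n%:R + 2).
Local Notation N := (n%:R : R).
Local Notation mu := (@lebesgue_rv R n).
Local Notation K := (@gag_kernel R n beta).

Let b0 : 0 <= beta. Proof. exact: le_trans b2. Qed.

(* Sum over dyadic cubes around x: each has integral a k (2 rho k)^n <= A th^k. *)
Lemma dyadic_integral (x : 'rV[R]_n) (a rho : nat -> R) (A th : R) (f : 'rV[R]_n -> R) (B : set 'rV[R]_n) :
  measurable B -> measurable_fun B f -> (forall y, B y -> 0 <= f y) ->
  (forall k, 0 <= a k) -> (forall k, 0 <= rho k) -> 0 <= th -> th < 1 ->
  (forall k, a k * (2 * rho k) ^+ n <= A * th ^+ k) ->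
  (forall y, B y -> f y != 0 -> exists2 k, `|y - x| <= rho k & f y <= a k) ->
  (\int[mu]_(y in B) (f y)%:E <= (A / (1 - th))%:E)%E.
Proof.
move=> mB mf f0 a0 r0 th0 th1 hA hf.
pose h k y := a k * \1_(cube x (rho k)) y.
have h0 k y : 0 <= h k y by rewrite mulr_ge0.
have mh k : measurable_fun setT (h k).
  by apply: measurable_funM => //; apply: measurable_indic; exact: measurable_cube.
have A0 : 0 <= A.
  have := hA 0%N; rewrite expr0 mulr1; apply: le_trans.
  by rewrite mulr_ge0// exprn_ge0// mulr_ge0.
apply: (@le_trans _ _ (\int[mu]_(y in B) (\sum_(k <oo) (h k y)%:E))%E).
  apply: ge0_le_integral => //.
  - exact/measurable_EFinP.
  - apply: ge0_emeasurable_sum => [k y _ _|k _]; first by rewrite lee_fin.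
    by apply/measurable_EFinP; exact: measurable_funTS.
  move=> y By; have [->|fy] := eqVneq (f y) 0.
    by apply: nneseries_ge0 => k _ _; rewrite lee_fin.
  have [k yk fk] := hf y By fy.
  apply: (@le_trans _ _ (\sum_(0 <= i < k.+1) (h i y)%:E)%E); last first.
    by apply: nneseries_lim_ge => i _ _; rewrite lee_fin.
  rewrite sumEFin lee_fin big_nat_recr//= ler_wpDl//.
    by apply: sumr_ge0 => i _.
  by rewrite /h indicE mem_set ?mulr1//; exact/cubeP.
rewrite integral_nneseries//; last 2 first.
- by move=> k; apply/measurable_EFinP; exact: measurable_funTS.
- by move=> k y _; rewrite lee_fin.
have le k : (\int[mu]_(y in B) (h k y)%:E <= (A * th ^+ k)%:E)%E.
  apply: (@le_trans _ _ ((a k * (2 * rho k) ^+ n)%:E)%E); last by rewrite lee_fin.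
  rewrite /h (eq_integral (fun y => (a k)%:E * (\1_(cube x (rho k)) y)%:E))%E => [|y _]; last by rewrite EFinM.
  rewrite ge0_integralZl_EFin//; last 1 first.
  - by apply/measurable_EFinP; apply: measurable_indic; exact: measurable_cube.
  rewrite EFinM lee_wpmul2l ?lee_fin// integral_indic//; last exact: measurable_cube.
  rewrite -(lebesgue_rv_cube x (r0 k)); apply: le_measure; rewrite ?inE.
  - by apply: measurableI => //; exact: measurable_cube.
  - exact: measurable_cube.
  - by move=> y [].
apply: (@le_trans _ _ (\sum_(k <oo) (A * th ^+ k)%:E)%E).
  apply: lee_nneseries => [k _ _|k _]; last exact: le.
  by apply: integral_ge0 => y _; rewrite lee_fin.
apply: lime_le; first by apply: is_cvg_nneseries => k _ _; rewrite lee_fin mulr_ge0// exprn_ge0.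
near=> m; rewrite sumEFin lee_fin.
have t1 : 0 < 1 - th by rewrite subr_gt0.
have -> : \sum_(0 <= k < m) A * th ^+ k = A / (1 - th) * (1 - th ^+ m).
  elim: (m) => [|m' IH]; first by rewrite big_geq// expr0 subrr mulr0.
  by rewrite big_nat_recr//= IH exprS; field; rewrite gt_eqF.
by rewrite ler_piMr ?divr_ge0 ?(ltW t1)// gerBl exprn_ge0.
Unshelve. all: by end_near. Qed.

(** Bounds the difference quotient of any function that is 1-Lipschitz for the sup norm and takes
    values in an interval of length at most 1. *)
Definition trunc_kernel (p : 'rV[R]_n * 'rV[R]_n) : R := Num.min (`|p.1 - p.2| ^+ 2) 1 * K p.

Lemma trunc_kernel_ge0 p : 0 <= trunc_kernel p.
Proof. by rewrite mulr_ge0 ?gag_kernel_ge0// le_min sqr_ge0 ler01. Qed.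

Lemma measurable_trunc_kernel : measurable_fun setT trunc_kernel.
Proof.
apply: measurable_funM; last exact: measurable_gag_kernel.
apply: measurable_minr => //; apply: measurable_funX.
have mn : measurable_fun setT (fun x : 'rV[R]_n => `|x|).
  by apply: continuous_rv_measurable; exact: norm_continuous.
apply: (measurableT_comp mn); exact: measurable_rvB.
Qed.

Lemma trunc_kernel_sym x y : trunc_kernel (x, y) = trunc_kernel (y, x).
Proof.
have E : enorm (x - y) = enorm (y - x).
  rewrite /enorm; congr Num.sqrt; apply: eq_bigr => i _; rewrite !mxE; ring.
by rewrite /trunc_kernel /gag_kernel/= E distrC.
Qed.

Lemma trunc_kernel_near x y : x <> y -> `|x - y| <= 1 ->
  exists2 k : nat, `|y - x| <= 2^-1 ^+ k & trunc_kernel (x, y) <= (2 * 2 ^+ k) `^ (beta - 2).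
Proof.
move=> xy; set t := `|x - y| => t1; have t0 : 0 < t by rewrite normr_gt0 subr_eq0; apply/eqP.
have ex : exists k, 2^-1 ^+ k.+1 < t.
  have h : (2^-1 : R) ^+ j @[j --> \oo] --> (0 : R) by apply: cvg_expr; rewrite ger0_norm//; lra.
  have /cvgrPdist_lt/(_ _ t0)[j _ /(_ j (leqnn j))] := h.
  rewrite sub0r normrN ger0_norm ?exprn_ge0// => hj; exists j.
  by apply: le_lt_trans hj; rewrite exprS ler_piMl ?exprn_ge0//; lra.
case: (ex_minnP ex) => k hk kmin; exists k.
  rewrite distrC -/t; case: k hk kmin => [|k] hk kmin; first by rewrite expr0.
  by rewrite leNgt; apply/negP => /kmin; rewrite ltnn.
have tk : t^-1 <= 2 * 2 ^+ k.
  rewrite -exprS -[leRHS]invrK lef_pV2 ?posrE ?invr_gt0 ?exprn_gt0// -exprVn; exact: ltW.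
have := gag_kernel_upper b0 xy; rewrite -/t => hK.
rewrite /trunc_kernel/= -/t.
apply: (@le_trans _ _ (t ^+ 2 * (t `^ beta)^-1)).
  by rewrite ler_pM ?gag_kernel_ge0 ?le_min ?sqr_ge0 ?ler01// ge_min lexx.
have -> : t ^+ 2 * (t `^ beta)^-1 = t^-1 `^ (beta - 2).
  rewrite -(powR_inv1 (ltW t0)) -powRrM -powR_mulrn ?(ltW t0)// -powRN -powRD; last by apply/implyP => _; rewrite gt_eqF.
  by congr (_ `^ _); ring.
by rewrite powR_mono ?subr_ge0// invr_ge0 ltW.
Qed.

Lemma trunc_kernel_far x y : 1 < `|x - y| ->
  exists2 k : nat, `|y - x| <= 2 ^+ k.+1 & trunc_kernel (x, y) <= (2^-1 ^+ k) `^ beta.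
Proof.
set t := `|x - y| => t1; have t0 : 0 < t by exact: lt_trans t1.
have xy : x <> y by move=> xy; move: t0; rewrite /t xy subrr normr0 ltxx.
have ex : exists k, t <= 2 ^+ k.+1.
  exists (Num.truncn t); apply: (le_trans (ltW (truncnS_gt _))).
  rewrite -natrX ler_nat; exact/ltnW/ltn_expl.
case: (ex_minnP ex) => k hk kmin; exists k; first by rewrite distrC.
have tk : t^-1 <= 2^-1 ^+ k.
  rewrite exprVn lef_pV2 ?posrE ?exprn_gt0//.
  case: k hk kmin => [|k] hk kmin; first by rewrite expr0 ltW.
  by rewrite leNgt; apply/negP => /ltW/kmin; rewrite ltnn.
rewrite /trunc_kernel/= -/t.
apply: (@le_trans _ _ (1 * (t `^ beta)^-1)).
  by rewrite ler_pM ?gag_kernel_ge0 ?le_min ?sqr_ge0 ?ler01 ?gag_kernel_upper// ge_min lexx orbT.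
rewrite mul1r (_ : (t `^ beta)^-1 = t^-1 `^ beta); last by rewrite -(powR_inv1 (ltW t0)) -powRrM mulN1r powRN.
by rewrite powR_mono// invr_ge0 ltW.
Qed.

Lemma powR_exprn k (t e : R) : 0 <= t -> (t ^+ k) `^ e = (t `^ e) ^+ k.
Proof. by move=> t0; rewrite -(powR_mulrn k t0) -(powR_mulrn k (powR_ge0 t e)) powRAC. Qed.

Lemma two_powR_lt (e e' : R) : e < e' -> 2 `^ e < 2 `^ e'.
Proof.
move=> ee; have d0 : 0 < e' - e by rewrite subr_gt0.
have -> : 2 `^ e' = 2 `^ (e' - e) * 2 `^ e :> R.
  by rewrite -powRD ?subrK//; apply/implyP => _; rewrite pnatr_eq0.
rewrite ltr_pMl ?powR_gt0//.
have := gt0_ltr_powR d0 (x := 1) (y := 2); rewrite powR1; apply; rewrite ?nnegrE//.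
by rewrite ltr1n.
Qed.

(** Two geometric series over dyadic cubes: near the diagonal the ratio is 2^(beta - 2 - n), less
    than 1 because beta < n + 2; away from it the ratio is 2^(n - beta), less than 1 because n <
    beta. *)
Lemma trunc_kernel_integral : exists2 I : R, 0 <= I & forall x,
  (\int[mu]_y (trunc_kernel (x, y))%:E <= I%:E)%E.
Proof.
pose E1 := (2 : R) `^ (beta - 2); pose E2 := (2 : R) `^ beta; pose P := (2 : R) ^+ n.
have E10 : 0 < E1 by rewrite powR_gt0.
have E20 : 0 < E2 by rewrite powR_gt0.
have P0 : 0 < P by rewrite exprn_gt0.
have PE : P = 2 `^ N by rewrite powR_mulrn.
have th1 : E1 / P < 1 by rewrite ltr_pdivrMr// mul1r PE two_powR_lt//; have := nb; have := bn; lra.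
have th2 : P / E2 < 1 by rewrite ltr_pdivrMr// mul1r PE two_powR_lt//; have := nb; have := bn; lra.
have pk k (e : R) := @powR_exprn k 2 e (ler0n R 2).
have pw x : trunc_kernel (x, x) = 0.
  by rewrite /trunc_kernel/= subrr normr0 expr0n/= (min_idPl ler01) mul0r.
exists (E1 * P / (1 - E1 / P) + 4 ^+ n / (1 - P / E2)).
  by rewrite addr_ge0// divr_ge0 ?subr_ge0 ?exprn_ge0 ?mulr_ge0 ?(ltW E10) ?(ltW P0) ?(ltW th1) ?(ltW th2)//.
move=> x; pose B := cube x 1.
have mB : measurable B by exact: measurable_cube.
have mt : measurable_fun setT (fun y => trunc_kernel (x, y)).
  by apply: (measurableT_comp measurable_trunc_kernel); exact: pair1_measurable.
rewrite -(setUv B) ge0_integral_setU//; last 4 first.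
- exact: measurableC.
- by apply/measurable_EFinP; exact: measurable_funTS.
- by move=> y _; rewrite lee_fin trunc_kernel_ge0.
- by apply/disj_setPCl.
rewrite EFinD; apply: leeD.
  apply: (@dyadic_integral x (fun k => (2 * 2 ^+ k) `^ (beta - 2)) (fun k => 2^-1 ^+ k)) => //.
  - exact: measurable_funTS.
  - by move=> y _; exact: trunc_kernel_ge0.
  - by rewrite divr_ge0 ?ltW.
  - move=> k; rewrite powRM// pk -/E1 exprMn -/P exprAC exprVn -/P exprMn exprVn.
    by rewrite le_eqVlt; apply/orP; left; apply/eqP; ring.
  - move=> y /cubeP yB ny; apply: trunc_kernel_near; last by rewrite distrC yB.
    by move=> xy; move: ny; rewrite -xy pw eqxx.
apply: (@dyadic_integral x (fun k => (2^-1 ^+ k) `^ beta) (fun k => 2 ^+ k.+1)) => //.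
- exact: measurableC.
- exact: measurable_funTS.
- by move=> y _; exact: trunc_kernel_ge0.
- by rewrite divr_ge0 ?ltW.
- move=> k.
  have -> : (2^-1 ^+ k) `^ beta = (E2 ^+ k)^-1.
    by rewrite exprVn -(powR_inv1 (exprn_ge0 _ _))// -powRrM mulN1r powRN pk.
  have -> : 2 * 2 ^+ k.+1 = 4 * 2 ^+ k :> R by rewrite exprS; ring.
  rewrite [(4 * _) ^+ n]exprMn [(2 ^+ k) ^+ n]exprAC -/P [(P / E2) ^+ k]exprMn exprVn.
  by rewrite le_eqVlt; apply/orP; left; apply/eqP; ring.
- move=> y yB ny; apply: trunc_kernel_far.
  by rewrite ltNge; apply/negP => h; apply: yB; apply/cubeP => //; rewrite distrC.
Qed.

(* The slack r <= 1 makes the quotient of the bump at most the truncated kernel. *)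
Lemma bump_energy c (r : R) : 0 < r -> r <= 1 ->
  (energy mu Omega K (fun x => Num.max 0 (r - `|x - c|))%R < +oo)%E.
Proof.
move=> r0 r1; have [I I0 hI] := trunc_kernel_integral.
pose u x := Num.max 0 (r - `|x - c|); pose B := cube c r.
have mn : measurable_fun setT (fun x : 'rV[R]_n => `|x - c|).
  apply: continuous_rv_measurable => x; apply: continuous_comp; last exact: norm_continuous.
  by apply: continuousB; [exact: cvg_id|exact: cst_continuous].
have mu_ : measurable_fun setT u.
  by apply: measurable_maxr => //; apply: measurable_funB.
have u0 x : ~ B x -> u x = 0.
  move=> nB; apply/max_idPl; rewrite subr_le0 leNgt; apply/negP => h; apply: nB.
  by apply/cubeP; exact: ltW.
have ur x : 0 <= u x <= r.
  by rewrite le_max lexx/= ge_max (ltW r0) gerBl normr_ge0.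
have ul x y : `|u x - u y| <= `|x - y|.
  have h : `| `|x - c| - `|y - c| | <= `|x - y|.
    apply: (le_trans (ler_dist_dist _ _)); rewrite (_ : x - c - (y - c) = x - y)//.
    by rewrite opprB addrA subrK.
  move: h => /ler_normlP[h1 h2]; rewrite /u /Num.max; apply/ler_normlP.
  by case: ltP => h3; case: ltP => h4; split; have := normr_ge0 (x - y); lra.
have mB : measurable B by exact: measurable_cube.
have ms : measurable_fun setT (fun p : 'rV[R]_n * 'rV[R]_n => \1_B p.1 + \1_B p.2 : R).
  by apply: measurable_funD; apply: measurableT_comp => //; exact: measurable_indic.
have pw p : quot K u p <= (\1_B p.1 + \1_B p.2) * trunc_kernel p.
  have m0 := trunc_kernel_ge0 p.
  have h : (u p.1 - u p.2) ^+ 2 <= Num.min (`|p.1 - p.2| ^+ 2) 1.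
    rewrite -(real_normK (num_real (u p.1 - u p.2))) le_min ler_sqr ?nnegrE// ul/= expr_le1//.
    have /andP[a1 a2] := ur p.1; have /andP[a3 a4] := ur p.2.
    by apply/ler_normlP; split; lra.
  have h2 : quot K u p <= trunc_kernel p by rewrite ler_wpM2r// gag_kernel_ge0.
  rewrite !indicE; have [B1|B1] := pselect (B p.1).
    by rewrite (mem_set B1) mulrDl mul1r ler_wpDr// mulr_ge0.
  have [B2|B2] := pselect (B p.2).
    by rewrite (mem_set B2) (memNset B1) add0r mul1r.
  by rewrite (memNset B1) (memNset B2) addr0 mul0r /quot !u0// subrr expr0n/= mul0r.
(* Once one variable is confined to the cube B, Tonelli leaves the uniform bound I times the measure
   of B. *)
have half f : (forall p, 0 <= f p :> R) -> measurable_fun setT f ->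
    (forall x, (\int[mu]_y (f (x, y))%:E <= (I * \1_B x)%:E)%E) ->
    (\int[mu \x mu]_p (f p)%:E <= (I * (2 * r) ^+ n)%:E)%E.
  move=> f0 mf hf; rewrite fubini_tonelli1; last 2 first.
  - exact/measurable_EFinP.
  - by move=> p; rewrite lee_fin.
  apply: (@le_trans _ _ (\int[mu]_x (I%:E * (\1_B x)%:E))%E).
    apply: ge0_le_integral => //.
    - by move=> x _; apply: integral_ge0 => y _; rewrite lee_fin.
    - apply: measurable_fun_fubini_tonelli_F; [exact/measurable_EFinP|by move=> p; rewrite lee_fin].
    - by apply: emeasurable_funM => //; apply/measurable_EFinP; exact: measurable_indic.
    - by move=> x _; rewrite -EFinM; exact: hf.
  rewrite ge0_integralZl_EFin//; last by apply/measurable_EFinP; exact: measurable_indic.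
  rewrite integral_indic// setIT EFinM [X in (I%:E * X <= _)%E]lebesgue_rv_cube//.
  exact: ltW.
have mtk := measurable_trunc_kernel.
apply: (@le_lt_trans _ _ (\int[mu \x mu]_p (1 * (\1_B p.1 * trunc_kernel p) + 1 * (\1_B p.2 * trunc_kernel p))%:E)%E).
  apply: (@le_trans _ _ (\int[mu \x mu]_p (quot K u p)%:E)%E).
    apply: ge0_subset_integral => //.
    - exact: measurable_off_diag.
    - by apply/measurable_EFinP; apply: measurable_quot => //; exact: measurable_gag_kernel.
    - by move=> p _; rewrite lee_fin quot_ge0//; exact: gag_kernel_ge0.
  apply: ge0_int_le => //.
  - by apply: measurable_quot => //; exact: measurable_gag_kernel.
  - apply: measurable_funD; apply: measurable_funM => //; apply: measurable_funM => //;
      by apply: measurableT_comp => //; exact: measurable_indic.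
  - by move=> p _; apply: quot_ge0; exact: gag_kernel_ge0.
  - by move=> p _; rewrite !mul1r -mulrDl.
have mt1 : measurable_fun setT (fun p : 'rV[R]_n * 'rV[R]_n => \1_B p.1 * trunc_kernel p).
  by apply: measurable_funM => //; apply: measurableT_comp => //; exact: measurable_indic.
have mt2 : measurable_fun setT (fun p : 'rV[R]_n * 'rV[R]_n => \1_B p.2 * trunc_kernel p).
  by apply: measurable_funM => //; apply: measurableT_comp => //; exact: measurable_indic.
have p1 p : 0 <= \1_B p.1 * trunc_kernel p by rewrite mulr_ge0// trunc_kernel_ge0.
have p2 p : 0 <= \1_B p.2 * trunc_kernel p by rewrite mulr_ge0// trunc_kernel_ge0.
have H1 : (\int[mu \x mu]_p (\1_B p.1 * trunc_kernel p)%:E <= (I * (2 * r) ^+ n)%:E)%E.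
  apply: half => // x.
  rewrite /= (eq_integral (fun y => (\1_B x)%:E * (trunc_kernel (x, y))%:E)%E) => [|y _]; last by rewrite EFinM.
  rewrite ge0_integralZl_EFin//; last 2 first.
  - by move=> y _; rewrite lee_fin trunc_kernel_ge0.
  - by apply/measurable_EFinP; apply: (measurableT_comp mtk); exact: pair1_measurable.
  by rewrite mulrC EFinM lee_wpmul2l// lee_fin.
have H2 : (\int[mu \x mu]_p (\1_B p.2 * trunc_kernel p)%:E <= (I * (2 * r) ^+ n)%:E)%E.
  rewrite fubini_tonelli2; last 2 first.
  - exact/measurable_EFinP.
  - by move=> p; rewrite lee_fin.
  rewrite (eq_integral (fubini_F mu (fun p => (\1_B p.1 * trunc_kernel p)%:E))) => [|y _]; last first.
    by rewrite /fubini_G /fubini_F; apply: eq_integral => x _ /=; rewrite trunc_kernel_sym.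
  rewrite -fubini_tonelli1//; exact/measurable_EFinP.
rewrite ge0_int_lin//.
by rewrite !mul1e; apply: (le_lt_trans (leeD H1 H2)); rewrite -EFinD ltry.
Qed.

End bump.

(** * The spaces of the statement *)

Section generic.
Context d (T : measurableType d) (R : realType).
Variable mu : {measure set T -> \bar R}.

Lemma Lfun2P (f : T -> R) : f \in Lfun mu 2%:E <->
  measurable_fun setT f /\ (\int[mu]_x (f x ^+ 2)%:E < +oo)%E.
Proof.
split=> [h|[mf h]].
  split; first by move: h; rewrite inE => /andP[+ _]; rewrite inE.
  have /integrableP[_] := Lfun2_integrable_sqr h.
  by under eq_integral => x _ do rewrite gee0_abs ?lee_fin ?sqr_ge0//.
rewrite inE; apply/andP; split; first by rewrite inE.
rewrite inE/= /finite_norm unlock poweR_lty//.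
rewrite (eq_integral (fun x => (f x ^+ 2)%:E)) // => x _ /=.
by rewrite powR_mulrn// real_normK// num_real.
Qed.

Lemma sqr_lin_finite (D : set T) (a b : R) (f g K : T -> R) : measurable D ->
  measurable_fun D f -> measurable_fun D g -> measurable_fun D K -> (forall x, 0 <= K x) ->
  (\int[mu]_(x in D) (f x ^+ 2 * K x)%:E < +oo)%E -> (\int[mu]_(x in D) (g x ^+ 2 * K x)%:E < +oo)%E ->
  (\int[mu]_(x in D) ((a * f x + b * g x) ^+ 2 * K x)%:E < +oo)%E.
Proof.
move=> mD mf mg mK K0 hf hg.
have mm (h : T -> R) : measurable_fun D h -> measurable_fun D (fun x => h x ^+ 2 * K x).
  by move=> mh; apply: measurable_funM => //; exact: measurable_funX.
apply: (@le_lt_trans _ _ (\int[mu]_(x in D) (2 * a ^+ 2 * (f x ^+ 2 * K x) + 2 * b ^+ 2 * (g x ^+ 2 * K x))%:E)%E).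
  apply: ge0_int_le => //.
  - by apply: mm; apply: measurable_funD; apply: measurable_funM.
  - by apply: measurable_funD; apply: measurable_funM => //; exact: mm.
  - by move=> x _; rewrite mulr_ge0// sqr_ge0.
  - move=> x _; rewrite !mulrA -mulrDl ler_wpM2r//.
    by have := sqr_ge0 (a * f x - b * g x); nra.
rewrite ge0_int_lin//; last 6 first.
- by rewrite mulr_ge0// sqr_ge0.
- by rewrite mulr_ge0// sqr_ge0.
- exact: mm.
- exact: mm.
- by move=> x _; rewrite mulr_ge0// sqr_ge0.
- by move=> x _; rewrite mulr_ge0// sqr_ge0.
have fin (h : T -> R) : (\int[mu]_(x in D) (h x ^+ 2 * K x)%:E < +oo)%E ->
    (\int[mu]_(x in D) (h x ^+ 2 * K x)%:E \is a fin_num)%E.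
  by move=> hh; rewrite ge0_fin_numE// integral_ge0// => x _; rewrite lee_fin mulr_ge0// sqr_ge0.
by rewrite -(fineK (fin _ hf)) -(fineK (fin _ hg)) -!EFinM -EFinD ltry.
Qed.

Lemma Rintegral_support (D : set T) (f : T -> R) : measurable D -> measurable_fun setT f ->
  {ae mu, forall x, ~ D x -> f x = 0} -> \int[mu]_x f x = \int[mu]_(x in D) f x.
Proof.
move=> mD mf f0; rewrite /Rintegral; congr fine.
rewrite [RHS]integral_mkcond; apply: ae_eq_integral => //.
- exact/measurable_EFinP.
- by apply/(measurable_restrictT _ _).1 => //; apply: measurable_funTS; exact/measurable_EFinP.
- apply: filterS f0 => x h _; rewrite patchE; case: ifPn => // /negP nD.
  by rewrite /= h// => Dx; apply: nD; exact: mem_set.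
Qed.

Lemma ge0_IB_finite (D : set T) (f : T -> R) : measurable D -> measurable_fun D f -> (forall x, D x -> 0 <= f x) ->
  (\int[mu]_(x in D) (f x)%:E < +oo)%E -> (\int[mu]_(x in D) (f x)%:E = (\int[mu]_(x in D) f x)%:E)%E.
Proof.
move=> mD mf f0 h; rewrite /Rintegral fineK// ge0_fin_numE//.
by apply: integral_ge0 => x Dx; rewrite lee_fin f0.
Qed.

End generic.

Section space_theory.
Variables (R : realType) (n : nat) (Omega : set 'rV[R]_n) (alpha : R).
Hypotheses (n1 : (1 < n)%N) (al1 : 1 < alpha) (al2 : alpha < 2).
Hypotheses (BD : bounded_domain Omega) (LB : lipschitz_boundary Omega).
Local Notation beta := (n%:R + alpha).
Local Notation mu := (@lebesgue_rv R n).
Local Notation mu2 := (@lebesgue_rv R n \x @lebesgue_rv R n)%E.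
Local Notation K := (@gag_kernel R n beta).
Local Notation X := (Xspace Omega alpha).
Local Notation X0 := (X0space Omega alpha).
Local Notation Q := (Qform Omega alpha).
Local Notation fT := ('rV[R]_n -> R).
Implicit Types (u v w z : fT).

Let n0 : (0 < n)%N. Proof. exact: ltnW. Qed.
Let mO : measurable Omega. Proof. exact: measurable_domain. Qed.
Let mQ : measurable (Qset Omega). Proof. exact: (measurable_off_diag mO). Qed.
Let mK := @measurable_gag_kernel R n beta.
Let K0 := @gag_kernel_ge0 R n beta.

Definition bquot (z1 z2 : fT) (p : 'rV[R]_n * 'rV[R]_n) : R :=
  (z1 p.1 - z1 p.2) * (z2 p.1 - z2 p.2) / enorm (p.1 - p.2) `^ beta.

Lemma bquot_quot z p : bquot z z p = quot K z p.
Proof. by rewrite /bquot -expr2. Qed.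

Lemma measurable_bquot z1 z2 : measurable_fun setT z1 -> measurable_fun setT z2 ->
  measurable_fun setT (bquot z1 z2).
Proof.
move=> m1 m2; apply: measurable_funM; last exact: mK.
by apply: measurable_funM; apply: measurable_funB; exact: measurableT_comp.
Qed.

Lemma sqr_restrict d (T : measurableType d) (nu : {measure set T -> \bar R}) (D : set T) (f : T -> R) :
  (\int[nu]_x (((f \_ D) x) ^+ 2)%:E = \int[nu]_(x in D) (f x ^+ 2)%:E)%E.
Proof.
rewrite [RHS]integral_mkcond; apply: eq_integral => x _; rewrite !patchE.
by case: ifP => // _; rewrite expr0n.
Qed.

Lemma XspaceP z : X z <-> [/\ measurable_fun setT z,
  (\int[mu]_(x in Omega) (z x ^+ 2)%:E < +oo)%E & (energy mu Omega K z < +oo)%E].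
Proof.
pose f (p : 'rV[R]_n * 'rV[R]_n) := (z p.1 - z p.2) / enorm (p.1 - p.2) `^ (beta / 2).
have fE p : f p ^+ 2 = quot K z p.
  rewrite /f /quot /gag_kernel exprMn exprVn; congr (_ * _^-1).
  by rewrite -powR_mulrn ?powR_ge0// -powRrM; congr (_ `^ _); field.
have eE : (\int[mu2]_x (((f \_ (Qset Omega)) x) ^+ 2)%:E = energy mu Omega K z)%E.
  by rewrite sqr_restrict; apply: eq_integral => p _; rewrite fE.
split=> [[mz /Lfun2P[_ h2] /Lfun2P[_ h3]]|[mz h2 h3]].
  split => //; first by rewrite -sqr_restrict.
  by rewrite -eE.
split => //; apply/Lfun2P; split.
- by apply/(measurable_restrictT _ _).1 => //; exact: measurable_funTS.
- by rewrite sqr_restrict.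
- apply/(measurable_restrictT _ _).1 => //; apply: measurable_funTS.
  apply: measurable_funM; first by apply: measurable_funB; exact: measurableT_comp.
  exact: (@measurable_gag_kernel R n (beta / 2)).
- by rewrite eE.
Qed.

Lemma Xspace_measurable z : X z -> measurable_fun setT z. Proof. by case/XspaceP. Qed.

Lemma itg_quot z : X z -> itg mu2 (Qset Omega) (quot K z).
Proof.
case/XspaceP => mz _ h; apply/integrableP; split.
  by apply/measurable_EFinP; apply: measurable_funTS; exact: measurable_quot.
by under eq_integral => p _ do rewrite gee0_abs ?lee_fin ?quot_ge0//.
Qed.

Lemma itg_bquot z1 z2 : X z1 -> X z2 -> itg mu2 (Qset Omega) (bquot z1 z2).
Proof.
move=> X1 X2; apply: (itg_le mQ _ (itgD mQ (itg_quot X1) (itg_quot X2))).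
  by apply: measurable_funTS; apply: measurable_bquot; exact: Xspace_measurable.
move=> p _; rewrite /bquot -[_^-1]/(K p) /quot normrM (ger0_norm (K0 p)) -mulrDl ler_wpM2r// normrM.
rewrite -(real_normK (num_real (z1 p.1 - z1 p.2))) -(real_normK (num_real (z2 p.1 - z2 p.2))).
have h (a b : R) : 0 <= a -> 0 <= b -> a * b <= a ^+ 2 + b ^+ 2.
  by move=> a0 b0; have := sqr_ge0 (a - b); have := mulr_ge0 a0 b0; nra.
exact: h.
Qed.

Lemma energyE z : X z -> energy mu Omega K z = (Q z z)%:E.
Proof.
move=> Xz; case/XspaceP: (Xz) => mz _ h.
rewrite /energy (ge0_IB_finite mQ)//.
- by apply: measurable_funTS; exact: measurable_quot.
- by move=> p _; exact: quot_ge0.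
Qed.

Lemma Xspace_lin (a b : R) z1 z2 : X z1 -> X z2 -> X (a *: z1 + b *: z2).
Proof.
move=> /XspaceP[m1 h1 e1] /XspaceP[m2 h2 e2].
have mz : measurable_fun setT (a *: z1 + b *: z2).
  by apply: measurable_funD; apply: measurable_funM.
apply/XspaceP; split => //.
  have e (f : fT) : (\int[mu]_(x in Omega) (f x ^+ 2)%:E = \int[mu]_(x in Omega) (f x ^+ 2 * 1)%:E)%E.
    by apply: eq_integral => x _; rewrite mulr1.
  rewrite e; apply: (@sqr_lin_finite _ _ R mu Omega a b z1 z2 (fun=> 1)) => //.
  - exact: measurable_funTS.
  - exact: measurable_funTS.
  - by rewrite -e.
  - by rewrite -e.
pose dz z (p : 'rV[R]_n * 'rV[R]_n) := z p.1 - z p.2.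
have md z : measurable_fun setT z -> measurable_fun (Qset Omega) (dz z).
  by move=> mz'; apply: measurable_funTS; apply: measurable_funB; exact: measurableT_comp.
have := @sqr_lin_finite _ _ R mu2 (Qset Omega) a b (dz z1) (dz z2) K mQ (md _ m1) (md _ m2)
  (measurable_funTS mK) K0 e1 e2.
apply: le_lt_trans; rewrite le_eqVlt; apply/orP; left; apply/eqP; apply: eq_integral => p _.
rewrite /quot /dz -![(_ + _ : fT) _]/(a * _ + b * _); congr (_%:E); ring.
Qed.

Lemma X0_lin (a b : R) z1 z2 : X0 z1 -> X0 z2 -> X0 (a *: z1 + b *: z2).
Proof.
move=> [X1 h1] [X2 h2]; split; first exact: Xspace_lin.
near=> x; move=> nO; have e1 := near h1 x; have e2 := near h2 x.
rewrite -[LHS]/(a * z1 x + b * z2 x) e1// ?e2// ?mulr0 ?addr0//.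
Unshelve. all: by end_near. Qed.

Lemma X0_0 : X0 0.
Proof.
split; last by apply: aeW.
apply/XspaceP; split; first exact: measurable_cst.
  by rewrite (eq_integral (fun=> 0%E)) ?integral0// => x _; rewrite expr0n.
rewrite /energy (eq_integral (fun=> 0%E)) ?integral0// => p _.
by rewrite /quot subrr expr0n/= mul0r.
Qed.

Lemma X0_psd : psd_form X0 Q.
Proof.
split.
- exact: X0_0.
- by move=> a b Xa Xb; have := X0_lin 1 1 Xa Xb; rewrite !scale1r.
- by move=> r a Xa; have := X0_lin r 0 Xa Xa; rewrite scale0r addr0.
- by move=> a b _ _; apply: eq_Rintegral => p _; rewrite [X in X / _]mulrC.
- move=> r a b c [Xa _] [Xb _] [Xc _].
  rewrite /Qform -(RintegralZl _ mQ (itg_bquot Xa Xc)) -(RintegralD mQ (itgZ mQ r (itg_bquot Xa Xc)) (itg_bquot Xb Xc)).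
  apply: eq_Rintegral => p _; rewrite /bquot -![(_ + _ : fT) _]/(r * _ + _); ring.
- by move=> a _; apply: Rintegral_ge0 => p _; rewrite -/(bquot a a p) bquot_quot quot_ge0.
Qed.

Lemma X0_L2 w (D : set 'rV[R]_n) : measurable D -> X0 w -> {ae mu, forall x, Omega x -> D x} ->
  itg mu setT (fun x => w x ^+ 2) /\ \int[mu]_x w x ^+ 2 = \int[mu]_(x in D) w x ^+ 2.
Proof.
move=> mD [Xw w0] aD; have /XspaceP[mw h2 _] := Xw.
have ms : measurable_fun setT (fun x => w x ^+ 2) by exact: measurable_funX.
have E : (\int[mu]_x (w x ^+ 2)%:E = \int[mu]_(x in Omega) (w x ^+ 2)%:E)%E.
  rewrite [RHS]integral_mkcond; apply: ae_eq_integral => //.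
  - exact/measurable_EFinP.
  - by apply/(measurable_restrictT _ _).1 => //; apply: measurable_funTS; exact/measurable_EFinP.
  - apply: filterS w0 => x h _; rewrite patchE; case: ifPn => // /negP nD.
    by rewrite h ?expr0n// => Dx; apply: nD; exact: mem_set.
split.
  apply/integrableP; split; first exact/measurable_EFinP.
  by under eq_integral => x _ do rewrite gee0_abs ?lee_fin ?sqr_ge0//; rewrite E.
apply: Rintegral_support => //; near=> x; move=> nD.
have h1 := near w0 x; have h2' := near aD x.
by rewrite h1 ?expr0n// => Ox; apply: nD; apply: h2'.
Unshelve. all: by end_near. Qed.

Section conull_subset.
Variable D : set 'rV[R]_n.
Hypotheses (mD : measurable D) (DO : D `<=` Omega) (aD : {ae mu, forall x, Omega x -> D x}).

Let b0 : 0 <= beta. Proof. by have := ler0n R n; have := al1; lra. Qed.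
Let Nb : n%:R < beta. Proof. by have := al1; lra. Qed.
Let N0 : 0 < n%:R :> R. Proof. by rewrite ltr0n. Qed.

Lemma IB_domain (f : fT) (k : R) : measurable_fun Omega f -> (forall x, 0 <= f x) ->
  (\int[mu]_(x in Omega) (f x)%:E <= k%:E)%E -> IB mu D f k.
Proof.
move=> mf f0 h; apply/ge0_IBP => //; first exact: measurable_funS mf.
by apply: le_trans h; apply: ge0_subset_integral => //; try exact/measurable_EFinP;
  move=> x _; rewrite lee_fin.
Qed.

Lemma X0_poincare : exists2 CP : R, 0 <= CP & forall w, X0 w ->
  (\int[mu]_(x in Omega) (w x ^+ 2)%:E <= (CP * Q w w)%:E)%E.
Proof.
have [CP CP0 h] := domain_poincare n0 BD b0; exists CP => // w [Xw w0].
by rewrite EFinM -energyE//; apply: h => //; exact: Xspace_measurable.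
Qed.

Lemma measurable_sqr w : X w -> measurable_fun Omega (fun x => w x ^+ 2).
Proof. by move=> /Xspace_measurable mw; apply: measurable_funX; exact: measurable_funTS. Qed.

Lemma X_sobolev (s1 M Ke : R) : 0 <= s1 -> s1 < 2 * n%:R / (n%:R - alpha) -> 0 <= Ke ->
  exists2 C : R, 0 < C & forall u, X u -> (\int[mu]_(x in Omega) (u x ^+ 2)%:E <= M%:E)%E ->
    Q u u <= Ke -> IB mu D (fun x => `|u x| `^ s1) C.
Proof.
move=> s0 s1n Ke0; have [kappa [r0 [k0 r00 dens]]] := domain_kernel_dense n0 BD LB b0.
have n2 : 2 <= n%:R :> R by rewrite ler_nat.
have bN : beta < 2 * n%:R by have := al2; lra.
have s1b : s1 < 2 * n%:R / (2 * n%:R - beta).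
  by rewrite (_ : 2 * n%:R - beta = n%:R - alpha)//; ring.
have [C C0 hC] := @sobolev_embedding _ _ R mu Omega mO K mK K0 _ _ _ _ _ M _
  (domain_finite BD) N0 Nb bN k0 r00 dens s0 s1b Ke0.
exists C => // u Xu uM uK; have mu_ := Xspace_measurable Xu.
apply: IB_domain.
- by apply: (measurableT_comp (measurable_powR _)); apply: measurableT_comp => //; exact: measurable_funTS.
- by move=> x; exact: powR_ge0.
- by apply: hC => //; rewrite energyE// lee_fin.
Qed.

Lemma X0_complete : qcomplete X0 Q.
Proof.
move=> s Es cau; have HQ := X0_psd.
have [CP CP0 poin] := domain_poincare n0 BD b0.
have NE w : X0 w -> energy mu Omega K w = (qnorm Q w ^+ 2)%:E.
  by move=> Xw; rewrite energyE ?(qnorm_sqr HQ)//; case: Xw.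
have Xm w : X0 w -> measurable_fun setT w by case=> /Xspace_measurable.
have [|||l [ml l0 hl]] := @energy_complete _ _ R mu Omega mO K mK K0 CP s CP0 poin _ _ _.
- by move=> j; apply: Xm.
- by move=> j; case: (Es j).
- move=> e e0; have [k hk] := cau (Num.sqrt e) ltac:(by rewrite sqrtr_gt0); exists k => i j ki kj.
  rewrite -[X in energy _ _ _ X]/(s i - s j) NE; last exact: (psd_EB HQ).
  by rewrite lee_fin -[leRHS]sqr_sqrtr ?(ltW e0)// ler_sqr ?nnegrE ?qnorm_ge0 ?sqrtr_ge0//; exact: hk.
have El : (energy mu Omega K l < +oo)%E.
  have [k hk] := hl 1 ltr01; have h1 := hk k (leqnn k).
  have := energyB_le mu mO mK K0 (Xm _ (Es k)) (measurable_funB (Xm _ (Es k)) ml).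
  rewrite (_ : (fun x => (s k x - (s k x - l x))%R) = l); last by apply/funext => x; rewrite opprB addrC subrK.
  move=> h; apply: (le_lt_trans h); rewrite NE//.
  apply: (@le_lt_trans _ _ (2%:E * (qnorm Q (s k) ^+ 2)%:E + 2%:E * 1%:E)%E).
    by apply: leeD => //; apply: lee_wpmul2l.
  by rewrite -!EFinM -EFinD ltry.
have X0l : X0 l.
  split=> //; apply/XspaceP; split => //.
  apply: (le_lt_trans (poin l ml l0)).
  have Ef : (energy mu Omega K l \is a fin_num)%E.
    by rewrite ge0_fin_numE//; apply: integral_ge0 => p _; rewrite lee_fin quot_ge0.
  by rewrite -(fineK Ef) -EFinM ltry.
exists l => //; apply/cvgrPdist_le => e e0.
have [k hk] := hl (e ^+ 2) ltac:(by rewrite exprn_gt0).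
exists k => // j kj /=; rewrite sub0r normrN ger0_norm ?qnorm_ge0//.
rewrite -ler_sqr ?nnegrE ?qnorm_ge0 ?(ltW e0)// -lee_fin -NE; last exact: (psd_EB HQ).
exact: hk.
Qed.

Lemma X0_compact (w : nat -> fT) (B : R) : (forall j, X0 (w j) /\ qnorm Q (w j) <= B) ->
  exists2 sigma : nat -> nat, {homo sigma : i j / (i < j)%N} &
    forall e : R, 0 < e -> exists j0, forall i j, (j0 <= i)%N -> (j0 <= j)%N ->
      IB mu D (fun x => (w (sigma i) x - w (sigma j) x) ^+ 2) e.
Proof.
move=> hw; have HQ := X0_psd.
have [CP CP0 poin] := X0_poincare.
have [kappa [r0 [k0 r00 cov]]] := domain_kernel_cover n0 BD LB b0.
have B0 : 0 <= B by apply: le_trans (hw 0%N).2; exact: qnorm_ge0.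
have QB j : Q (w j) (w j) <= B ^+ 2.
  by have [Xw wB] := hw j; rewrite -(qnorm_sqr HQ Xw) ler_sqr ?nnegrE ?qnorm_ge0.
have Xw j : X (w j) by case: (hw j) => -[].
have [||||sigma sm hs] := @L2_compactness _ _ R mu Omega mO K mK K0 _ _ _ _ (CP * B ^+ 2) (B ^+ 2) w
  (domain_finite BD) N0 Nb k0 r00 cov _ _ _ _.
- exact: sqr_ge0.
- by move=> j; exact: Xspace_measurable.
- move=> j; apply: (le_trans (poin _ (hw j).1)); rewrite lee_fin ler_wpM2l//.
- by move=> j; rewrite energyE// lee_fin.
exists sigma => // e e0; have [j0 h] := hs e e0; exists j0 => i j ij jj.
apply: IB_domain => [|x|]; [|exact: sqr_ge0|exact: h].
apply: measurable_funX; apply: measurable_funTS; apply: measurable_funB; exact: Xspace_measurable.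
Qed.

Lemma X0_L2_zero w : X0 w -> \int[mu]_(x in D) (w x * w x) = 0 -> {ae mu, forall x, Omega x -> w x = 0}.
Proof.
move=> X0w w0; have [CP CP0 poin] := X0_poincare.
have Xw : X w by case: X0w.
have mw := Xspace_measurable Xw.
have [iw _] : IB mu D (fun x => w x ^+ 2) (CP * Q w w).
  by apply: IB_domain => [|x|]; [exact: measurable_sqr|exact: sqr_ge0|exact: poin].
have mwD : measurable_fun D (fun x => (w x ^+ 2)%:E) by exact: measurable_int iw.
have : (\int[mu]_(x in D) `|(w x ^+ 2)%:E| = 0)%E.
  under eq_integral => x _ do rewrite gee0_abs ?lee_fin ?sqr_ge0//.
  rewrite -(fineK (integrable_fin_num mD iw)); congr (_%:E); rewrite -w0.
  by apply: eq_Rintegral => x _; rewrite expr2.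
move/(ae_eq_integral_abs mu mD mwD) => h.
near=> x; move=> Ox; have h1 := near h x; have h2 := near aD x.
have /= : (w x ^+ 2)%:E = 0%E by apply: h1 => //; apply: h2.
by move=> [] /eqP; rewrite sqrf_eq0 => /eqP.
Unshelve. all: by end_near. Qed.

Lemma X0_definite w : X0 w -> \int[mu]_(x in D) (w x * w x) = 0 -> qnorm Q w = 0.
Proof.
move=> X0w w0; have h := X0_L2_zero X0w w0; have [Xw w1] := X0w.
have := energyE Xw; rewrite (@energy_ae _ _ R mu Omega mO K mK K0 w (fun=> 0)).
- rewrite /energy (eq_integral (fun=> 0%E)) ?integral0 => [|p _]; last by rewrite /quot subrr expr0n/= mul0r.
  by move=> []; rewrite /qnorm => <-; rewrite sqrtr0.
- exact: Xspace_measurable.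
- exact: measurable_cst.
- near=> x; move=> _; have h1 := near h x; have h2 := near w1 x.
  by have [Ox|nO] := pselect (Omega x); [apply: h1|apply: h2].
Unshelve. all: by end_near. Qed.

Lemma X0_bump c (r : R) : 0 < r -> r <= 1 -> cube c r `<=` Omega -> X0 (fun x => Num.max 0 (r - `|x - c|)).
Proof.
move=> r0 r1 cO.
have mn : measurable_fun setT (fun x : 'rV[R]_n => `|x - c|).
  apply: continuous_rv_measurable => x; apply: continuous_comp; last exact: norm_continuous.
  by apply: continuousB; [exact: cvg_id|exact: cst_continuous].
have mu_ : measurable_fun setT (fun x : 'rV[R]_n => Num.max 0 (r - `|x - c|)).
  by apply: measurable_maxr => //; apply: measurable_funB.
split; last first.
  apply: aeW => x nO; apply/max_idPl; rewrite subr_le0 leNgt; apply/negP => h; apply: nO; apply: cO.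
  by apply/cubeP; exact: ltW.
apply/XspaceP; split => //; last first.
  apply: bump_energy => //.
  - by have := ler_nat R 2 n; rewrite n1 => h; have := al1; lra.
  - by have := al2; lra.
apply: (@le_lt_trans _ _ (\int[mu]_(x in Omega) (r ^+ 2)%:E)%E).
  apply: ge0_int_le => //.
  - by apply: measurable_funX; exact: measurable_funTS.
  - by move=> x _; exact: sqr_ge0.
  - move=> x _; rewrite ler_sqr ?nnegrE ?(ltW r0) ?le_max ?lexx//.
    by rewrite ge_max (ltW r0) gerBl normr_ge0.
rewrite integral_cst// lte_mul_pinfty ?lee_fin ?sqr_ge0//; exact: (domain_finite BD).
Qed.

(** Two bumps with disjoint supports: each coefficient is read off on a cube of positive measure
    where the other bump vanishes. *)
Lemma X0_independent : exists phi psi : fT, [/\ X0 phi, X0 psi & forall x y : R,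
  \int[mu]_(t in D) ((x *: phi + y *: psi) t * (x *: phi + y *: psi) t) = 0 -> x = 0 /\ y = 0].
Proof.
case: (BD) => oO _ [c0 Oc0] _; have /nbhs_ballP[e /= e0 he] := oO _ Oc0.
(* The centres are e / 2 apart, so cubes of radius at most e / 8 are disjoint and stay inside the
   ball of radius e about c0; r <= 1 is required by [bump_energy]. *)
pose r := Num.min (e / 8) 1; have r0 : 0 < r by rewrite lt_min ltr01 divr_gt0.
have r1 : r <= 1 by rewrite ge_min lexx orbT.
have re : r <= e / 8 by rewrite ge_min lexx.
pose c1 : 'rV[R]_n := c0 + const_mx (e / 2).
have dc : e / 2 <= `|c1 - c0|.
  apply: le_trans (rv_coord_le _ (Ordinal n0)); apply: le_trans (ler_norm _).
  by rewrite !mxE addrAC subrr add0r.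
have cd : `|c1 - c0| <= e / 2.
  apply/rv_norm_leP => [|i]; first by rewrite divr_ge0// ltW.
  by rewrite !mxE addrAC subrr add0r ger0_norm// divr_ge0// ltW.
have sub0 : cube c0 r `<=` Omega.
  move=> y /(cubeP _ _ (ltW r0)) h; apply: he; rewrite -ball_normE/ball_/= distrC; lra.
have sub1 : cube c1 r `<=` Omega.
  move=> y /(cubeP _ _ (ltW r0)) h; apply: he; rewrite -ball_normE/ball_/= distrC.
  rewrite (_ : y - c0 = (y - c1) + (c1 - c0)); last by rewrite addrA subrK.
  by apply: (le_lt_trans (ler_normD _ _)); lra.
pose bump c (t : 'rV[R]_n) : R := Num.max 0 (r - `|t - c|).
have X00 : X0 (bump c0) by exact: X0_bump.
have X01 : X0 (bump c1) by exact: X0_bump.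
have key (f : fT) c c' (a : R) : cube c r `<=` Omega -> e / 2 <= `|c - c'| ->
    (forall t, `|t - c'| <= r \/ f t = a * bump c t) -> {ae mu, forall t, Omega t -> f t = 0} -> a = 0.
  move=> cO cc' fE f0; apply/eqP/negPn/negP => an0.
  move: f0 => [A [mA A0 subA]].
  have : (mu (cube c (r / 2)) <= mu A)%E.
    apply: le_measure; rewrite ?inE//; first exact: measurable_cube.
    move=> t /(cubeP _ _ (divr_ge0 (ltW r0) (ler0n R 2))) tc; apply: subA => /= h.
    have Ot : Omega t by apply: cO; apply/cubeP => //; [exact: ltW|lra].
    have := h Ot; case: (fE t) => [tc'|->]; last first.
      move/eqP; rewrite mulf_eq0 (negbTE an0)/= => /eqP.
      have : r / 2 <= bump c t by rewrite /bump le_max; apply/orP; right; lra.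
      lra.
    have : `|c - c'| <= `|t - c| + `|t - c'|.
      by rewrite (distrC t c) (_ : c - c' = (c - t) + (t - c')) ?ler_normD// addrA subrK.
    lra.
  rewrite A0 [X in (X <= _)%E]lebesgue_rv_cube; last by rewrite divr_ge0// ltW.
  rewrite lee_fin; apply/negP; rewrite -ltNge exprn_gt0// mulr_gt0// divr_gt0//.
exists (bump c0), (bump c1); split => // x y h.
have XX : X0 (x *: bump c0 + y *: bump c1) by exact: X0_lin.
have f0 := X0_L2_zero XX h.
have b0' c t : r < `|t - c| -> bump c t = 0.
  by move=> h'; apply/max_idPl; rewrite subr_le0 ltW.
split.
- apply: (key _ c0 c1 x sub0 _ _ f0); first by rewrite distrC.
  move=> t; have [?|h'] := leP `|t - c1| r; [by left|right].
  by rewrite -[LHS]/(x * bump c0 t + y * bump c1 t) (b0' c1 t h') mulr0 addr0.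
- apply: (key _ c1 c0 y sub1 _ _ f0) => //.
  move=> t; have [?|h'] := leP `|t - c0| r; [by left|right].
  by rewrite -[LHS]/(x * bump c0 t + y * bump c1 t) (b0' c0 t h') mulr0 add0r.
Qed.

Definition L2all w z : R := \int[mu]_x (w x * z x).

Lemma itg_mul_L2 w z : measurable_fun setT w -> measurable_fun setT z ->
  itg mu setT (fun x => w x ^+ 2) -> itg mu setT (fun x => z x ^+ 2) -> itg mu setT (fun x => w x * z x).
Proof.
move=> mw mz iw iz; apply: (itg_le measurableT _ (itgD measurableT iw iz)).
  exact: measurable_funM.
move=> x _; rewrite normrM -(real_normK (num_real (w x))) -(real_normK (num_real (z x))).
have h (a b : R) : 0 <= a -> 0 <= b -> a * b <= a ^+ 2 + b ^+ 2.
  by move=> a0 b0'; have := sqr_ge0 (a - b); have := mulr_ge0 a0 b0'; nra.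
exact: h.
Qed.

Lemma L2all_psd : psd_form X0 L2all.
Proof.
have HQ := X0_psd.
have im w z : X0 w -> X0 z -> itg mu setT (fun x => w x * z x).
  move=> Xw Xz; apply: itg_mul_L2.
  - by case: Xw => /Xspace_measurable.
  - by case: Xz => /Xspace_measurable.
  - exact: (X0_L2 mD Xw aD).1.
  - exact: (X0_L2 mD Xz aD).1.
split; [exact: psd_E0 HQ|exact: psd_ED HQ|exact: psd_EZ HQ| | |].
- by move=> w z _ _; apply: eq_Rintegral => x _; rewrite mulrC.
- move=> l w z t Ew Ez Et; have i1 := im _ _ Ew Et; have i2 := im _ _ Ez Et.
  rewrite /L2all -(RintegralZl l measurableT i1) -(RintegralD measurableT (itgZ measurableT l i1) i2).
  apply: eq_Rintegral => x _; rewrite -[(_ + _ : fT) x]/(l * w x + z x); ring.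
- by move=> w Ew; apply: Rintegral_ge0 => x _; rewrite -expr2 sqr_ge0.
Qed.

Lemma normYE w : normY Omega alpha w = qnorm L2all w + qnorm Q w.
Proof.
by rewrite /normY /qnorm /L2all; congr (Num.sqrt _ + _); apply: eq_Rintegral => x _; rewrite expr2.
Qed.

(** Poincare bounds the L2 part by the energy part. Balls are measured in the norm of Y while the
    topology is that of [normX0]; the last clause makes the former continuous for the latter. *)
Lemma normY_equiv : exists CY : R, [/\ 0 < CY,
  forall w, X0 w -> qnorm Q w <= normY Omega alpha w,
  forall w, X0 w -> normY Omega alpha w <= CY * qnorm Q w &
  forall w z, X0 w -> X0 z -> `|normY Omega alpha w - normY Omega alpha z| <= CY * qnorm Q (w - z)].
Proof.
have HQ := X0_psd; have HL := L2all_psd; have [CP CP0 poin] := X0_poincare.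
have h w : X0 w -> qnorm L2all w <= Num.sqrt CP * qnorm Q w.
  move=> Xw; rewrite -sqrtrM// ler_wsqrtr//.
  have [_] : IB mu D (fun x => w x ^+ 2) (CP * Q w w).
    by apply: IB_domain => [|x|]; [apply: measurable_sqr; case: Xw|exact: sqr_ge0|exact: poin].
  rewrite -(X0_L2 mD Xw aD).2; apply: le_trans; rewrite le_eqVlt; apply/orP; left; apply/eqP.
  by apply: eq_Rintegral => x _; rewrite expr2.
exists (Num.sqrt CP + 1); split.
- by rewrite ltr_wpDl// sqrtr_ge0.
- by move=> w Xw; rewrite normYE lerDr qnorm_ge0.
- by move=> w Xw; rewrite normYE mulrDl mul1r lerD// h.
- move=> w z Xw Xz; rewrite !normYE opprD addrACA.
  apply: (le_trans (ler_normD _ _)); rewrite mulrDl mul1r lerD//; last exact: qnorm_dist HQ _ _ Xw Xz.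
  by apply: (le_trans (qnorm_dist HL Xw Xz)); apply: h; exact: (psd_EB HQ).
Qed.

Lemma Yspace_L2 z : Yspace Omega alpha z -> itg mu setT (fun x => z x ^+ 2).
Proof. by case=> _ /Lfun2_integrable_sqr. Qed.

Lemma orth_Qform v w : X0orth Omega alpha v -> X0 w -> Q v w = - \int[mu]_(x in D) (v x * w x).
Proof.
move=> [Yv ov] Xw; have [Xv _] := Yv; have := ov w Xw; rewrite /innerY.
have mv := Xspace_measurable Xv; have mw : measurable_fun setT w by case: Xw => /Xspace_measurable.
rewrite (Rintegral_support mD); first by move=> h; apply/eqP; rewrite -addr_eq0 addrC h.
  exact: measurable_funM.
have w0 := Xw.2; near=> x; move=> nD; have h1 := near w0 x; have h2 := near aD x.
by rewrite h1 ?mulr0// => Ox; apply: nD; apply: h2.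
Unshelve. all: by end_near. Qed.

Lemma Yspace_close v w (l : R) : Yspace Omega alpha v -> Yspace Omega alpha w ->
  normY Omega alpha (v - w) <= l ->
  (\int[mu]_(x in Omega) ((v x - w x) ^+ 2)%:E <= (l ^+ 2)%:E)%E /\ Q (v - w) (v - w) <= l ^+ 2.
Proof.
move=> Yv Yw h; have [Xv _] := Yv; have [Xw _] := Yw.
have := h; rewrite /normY -/(qnorm Q _) => h'.
have s0 := sqrtr_ge0 (\int[mu]_x (v - w) x ^+ 2); have q0 := qnorm_ge0 Q (v - w).
have Xd : X (v - w) by have := Xspace_lin 1 (- 1) Xv Xw; rewrite scale1r scaleN1r.
have Q0 : 0 <= Q (v - w) (v - w).
  by apply: Rintegral_ge0 => p _; rewrite -/(bquot _ _ p) bquot_quot quot_ge0.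
have l0 : 0 <= l by apply: le_trans h'; rewrite addr_ge0.
split; last first.
  rewrite -[leLHS]sqr_sqrtr// ler_sqr ?nnegrE ?sqrtr_ge0//.
  by apply: le_trans h'; rewrite lerDr.
have mv := Xspace_measurable Xv; have mw := Xspace_measurable Xw.
have md : measurable_fun setT (fun x => (v x - w x) ^+ 2) by apply: measurable_funX; exact: measurable_funB.
have i1 : itg mu setT (fun x => (v x - w x) ^+ 2).
  apply: (itg_le measurableT md (itgZ measurableT 2 (itgD measurableT (Yspace_L2 Yv) (Yspace_L2 Yw)))).
  by move=> x _; rewrite ger0_norm ?sqr_ge0//; have := sqr_ge0 (v x + w x); nra.
apply: (@le_trans _ _ (\int[mu]_x ((v x - w x) ^+ 2)%:E)%E).
  apply: ge0_subset_integral => //; first exact/measurable_EFinP.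
  by move=> x _; rewrite lee_fin sqr_ge0.
rewrite -(fineK (integrable_fin_num measurableT i1)) lee_fin.
rewrite -[leLHS]sqr_sqrtr ?ler_sqr ?nnegrE ?sqrtr_ge0//; last by apply: Rintegral_ge0 => x _; exact: sqr_ge0.
by apply: le_trans h'; rewrite lerDl qnorm_ge0.
Qed.

End conull_subset.

End space_theory.

(** * Measurability and null sets *)

Section conull_integral.
Context d (T : measurableType d) (R : realType).
Variable mu : {measure set T -> \bar R}.
Import HBNNSimple.

(* The integral of a nonnegative function is the supremum over simple functions below it,
   whether or not it is measurable, so it does not see null sets. *)
Lemma ge0_integral_le_conull (f g : T -> \bar R) (A : set T) : measurable A -> mu A = 0%E ->
  (forall x, 0 <= f x)%E -> (forall x, 0 <= g x)%E -> (forall x, ~ A x -> f x <= g x)%E ->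
  (\int[mu]_x f x <= \int[mu]_x g x)%E.
Proof.
move=> mA A0 f0 g0 fg; rewrite !ge0_integralTE//; apply: ge_ereal_sup => _ [h /= hf <-].
pose h' := proj_nnsfun h (measurableC mA).
have hE : sintegral mu h = sintegral mu h'.
  have := integral_nnsfun mu measurableT h; rewrite patch_setT => <-.
  rewrite (ge0_negligible_integral mA)//.
  - rewrite integral_nnsfun; last exact: measurableD.
    apply: eq_sintegral => x; rewrite /h' /= patchE mindicE setTD.
    by case: (x \in ~` A); rewrite ?mulr1 ?mulr0.
  - by apply/measurable_EFinP; exact: measurable_funPT.
  - by move=> x _; rewrite lee_fin; exact: fun_ge0.
rewrite hE; apply: ereal_sup_ubound; exists h' => //= x; rewrite mindicE.
have [Ax|nAx] := pselect (A x).
  by rewrite memNset ?mulr0//; apply.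
by rewrite mem_set// mulr1; apply: le_trans (fg x nAx); exact: hf.
Qed.

(** No measurability of f is assumed: the integrand of the functional over Omega need not be Borel,
    and only its restriction to D minus A will be. Positive and negative parts are treated
    separately. *)
Lemma Rintegral_conull (f : T -> R) (D A : set T) : measurable A -> mu A = 0%E ->
  \int[mu]_(x in D) f x = \int[mu]_(x in D `\` A) f x.
Proof.
move=> mA A0; rewrite /Rintegral; congr fine.
have key (g : T -> \bar R) : (forall x, 0 <= g x)%E ->
    (\int[mu]_(x in D) g x = \int[mu]_(x in D `\` A) g x)%E.
  move=> g0; rewrite integral_mkcond [RHS]integral_mkcond.
  have p0 (B : set T) x : (0 <= (g \_ B) x)%E by apply: erestrict_ge0 => y _.
  have e x : ~ A x -> ((g \_ D) x = (g \_ (D `\` A)) x)%E.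
    move=> nA; rewrite !patchE; case: ifPn => h; case: ifPn => h'//.
      by move: h'; rewrite notin_setE => h'; exfalso; apply: h'; split => //; exact: set_mem.
    by move: h h'; rewrite notin_setE inE => h [].
  by apply/eqP; rewrite eq_le; apply/andP; split; apply: (ge0_integral_le_conull mA A0) => // x nA; rewrite e.
by rewrite integralE [RHS]integralE; congr (_ - _)%E; apply: key => x; rewrite ?funepos_ge0 ?funeneg_ge0.
Qed.

End conull_integral.

Lemma measurable_glue d (T : measurableType d) d' (S : measurableType d') (I : countType)
    (D : set T) (e : T -> I) (F : I -> T -> S) : measurable D ->
  (forall i, measurable (D `&` e @^-1` [set i])) -> (forall i, measurable_fun D (F i)) ->
  measurable_fun D (fun x => F (e x) x).
Proof.
move=> mD me mF _ Y mY.
rewrite (_ : _ `&` _ = \bigcup_i ((D `&` e @^-1` [set i]) `&` (D `&` F i @^-1` Y))).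
  apply: countable_bigcupT_measurable; first exact: countableP.
  by move=> i; apply: measurableI => //; exact: mF.
apply/seteqP; split => [x [Dx Yx]|x [i _ [[Dx ei] [_ Yx]]]]; first by exists (e x).
by split => //=; rewrite ei.
Qed.

(** * Borel measurability of Caratheodory compositions *)

Section caratheodory.
Context d (T : measurableType d) (R : realType) (m : nat).
Variables (D : set T) (F : T -> R -> 'rV[R]_m -> R).
Hypothesis mD : measurable D.

Definition dyadic (j : nat) (i : int) : R := i%:~R / 2 ^+ j.
Definition dyadic_rv (j : nat) (q : 'rV[int]_m) : 'rV[R]_m := map_mx (dyadic j) q.
Definition dyadic_floor (j : nat) (x : R) : int := Num.floor (x * 2 ^+ j).

Lemma dyadic_floorP j x : `|x - dyadic j (dyadic_floor j x)| <= 2^-1 ^+ j.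
Proof.
have t0 : 0 < 2 ^+ j :> R by rewrite exprn_gt0.
have := floor_le (x * 2 ^+ j); have := floorD1_gt (x * 2 ^+ j).
rewrite -/(dyadic_floor j x); set f := dyadic_floor j x; rewrite intrD => h1 h2.
have -> : x - dyadic j f = (x * 2 ^+ j - f%:~R) / 2 ^+ j by rewrite /dyadic; field; rewrite gt_eqF.
rewrite normrM normfV (gtr0_norm t0) exprVn ler_piMl ?invr_ge0 ?(ltW t0)//.
by rewrite ger0_norm; lra.
Qed.

Lemma dyadic_floor_preimage j (i : int) :
  (dyadic_floor j) @^-1` [set i] = `[dyadic j i, dyadic j (i + 1)[%classic.
Proof.
have t0 : 0 < 2 ^+ j :> R by rewrite exprn_gt0.
apply/seteqP; split => x /=; rewrite in_itv/= /dyadic ler_pdivrMr// ltr_pdivlMr// /dyadic_floor.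
  by move=> <-; rewrite floor_le floorD1_gt.
by move=> h; apply/eqP; rewrite floor_eq//.
Qed.

Lemma exp_half_cvg : (2^-1 : R) ^+ j @[j --> \oo] --> (0 : R).
Proof. by apply: cvg_expr; rewrite ger0_norm//; lra. Qed.

Lemma cvg_exp_half (V : normedModType R) (a : nat -> V) (l : V) :
  (forall j, `|l - a j| <= 2^-1 ^+ j) -> a j @[j --> \oo] --> l.
Proof.
move=> h; apply/cvgrPdist_le => e e0.
have /cvgrPdist_le/(_ _ e0)[k _ hk] := exp_half_cvg; exists k => // j kj /=.
apply: (le_trans (h j)); have := hk j kj; rewrite /= sub0r normrN ger0_norm ?exprn_ge0//.
Qed.

(** Dyadic approximations of w and u take countably many values, so the approximating compositions
    are glued from countably many measurable functions; continuity in (z, u) gives the limit.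
    Measurability in x thus matters only at countably many arguments. *)
Lemma measurable_caratheodory_comp (w : T -> R) (u : T -> 'rV[R]_m) :
  (forall j i q, measurable_fun D (fun x => F x (dyadic j i) (dyadic_rv j q))) ->
  (forall x, D x -> continuous (fun p : R * 'rV[R]_m => F x p.1 p.2)) ->
  measurable_fun D w -> measurable_fun D u -> measurable_fun D (fun x => F x (w x) (u x)).
Proof.
move=> mF cF mw mu_.
pose qf j (q : 'rV[R]_m) : 'rV[int]_m := \row_i dyadic_floor j (q ord0 i).
pose e j (x : T) := (dyadic_floor j (w x), qf j (u x)).
apply: (@measurable_fun_cvg _ T R D (fun j x => F x (dyadic j (e j x).1) (dyadic_rv j (e j x).2))) => [j|x Dx].
  apply: (@measurable_glue _ T _ _ _ D (e j) (fun i x => F x (dyadic j i.1) (dyadic_rv j i.2))) => //.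
  move=> [i q]; rewrite (_ : e j @^-1` [set (i, q)] =
     w @^-1` (dyadic_floor j @^-1` [set i]) `&`
     \bigcap_(k in [set: 'I_m]) ((@rv_coord R m k \o u) @^-1` (dyadic_floor j @^-1` [set q ord0 k]))).
    rewrite setIA [D `&` _ `&` _](_ : _ = (D `&` w @^-1` (dyadic_floor j @^-1` [set i])) `&`
       \bigcap_(k in [set: 'I_m]) (D `&` (@rv_coord R m k \o u) @^-1` (dyadic_floor j @^-1` [set q ord0 k]))).
      apply: measurableI.
        by apply: mw => //; rewrite dyadic_floor_preimage.
      apply: fin_bigcap_measurable; first exact: finite_finset.
      move=> k _; apply: (measurableT_comp (measurable_rv_coord k) mu_) => //.
      by rewrite dyadic_floor_preimage.
    apply/seteqP; split => x [[Dx h1] h2]; split => // k _; last by have [] := h2 k I.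
    by split => //; exact: h2.
  apply/seteqP; split => x /=; rewrite /e/=.
    by move=> [<- <-]; split => // k _; rewrite /qf /= mxE.
  move=> [-> h]; congr pair; apply/rowP => k; rewrite /qf mxE; exact: h k I.
have c1 : dyadic j (e j x).1 @[j --> \oo] --> w x.
  by apply: (@cvg_exp_half R^o) => j; exact: dyadic_floorP.
have c2 : dyadic_rv j (e j x).2 @[j --> \oo] --> u x.
  apply: cvg_exp_half => j; apply/rv_norm_leP; first by rewrite exprn_ge0.
  by move=> k; rewrite !mxE; exact: dyadic_floorP.
exact: (cvg_comp _ (fun p : R * 'rV[R]_m => F x p.1 p.2) (cvg_pair c1 c2) (cF x Dx (w x, u x))).
Qed.

End caratheodory.

Lemma negligible_bigcup_countType d (T : measurableType d) (R : realType)
    (mu : {measure set T -> \bar R}) (I : countType) (F : I -> set T) :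
  (forall i, mu.-negligible (F i)) -> mu.-negligible (\bigcup_i F i).
Proof.
move=> nF; pose F' k := if unpickle k is Some i then F i else set0.
have H : mu.-negligible (\bigcup_k F' k).
  by apply: negligible_bigcup => k; rewrite /F'; case: unpickle => [i|]; [exact: nF|exact: negligible_set0].
apply: negligibleS H.
by move=> x [i _ Fx]; exists (pickle i) => //; rewrite /F' pickleK.
Qed.

Section lebesgue_borel.
Variables (R : realType) (n : nat) (Omega : set 'rV[R]_n).
Local Notation mu := (@lebesgue_rv R n).

(** One null set collects the defects of the level sets at rational heights, and these determine all
    the others. *)
Lemma lebesgue_measurable_borel (f : 'rV[R]_n -> R) : lebesgue_measurable_fun Omega f ->
  exists A, [/\ measurable A, mu A = 0%E &
    forall D, measurable D -> D `<=` Omega `\` A -> measurable_fun D f].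
Proof.
move=> mf.
have /choice[B hB] : forall q : rat, exists B, measurable B /\
    mu.-negligible (((Omega `&` f @^-1` `]ratr q, +oo[%classic) `\` B) `|`
      (B `\` (Omega `&` f @^-1` `]ratr q, +oo[%classic))).
  by move=> q; have [|B mB hB] := mf `](ratr q), +oo[%classic; [exact: measurable_itv|exists B].
pose bad (q : rat) := (((Omega `&` f @^-1` `]ratr q, +oo[%classic) `\` B q) `|`
      (B q `\` (Omega `&` f @^-1` `]ratr q, +oo[%classic))).
have [A [mA A0 hA]] : mu.-negligible (\bigcup_q bad q).
  by apply: negligible_bigcup_countType => q; exact: (hB q).2.
exists A; split => // D mD DA; apply: (measurability _ (RGenOInfty.measurableE R)) => //.
move=> _ [_ [r ->] <-].
have Eq (q : rat) : D `&` f @^-1` `]ratr q, +oo[%classic = D `&` B q.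
  apply/seteqP; split => x [Dx h]; split => //; have [Ox nA] := DA x Dx; apply: contrapT => h'; apply: nA; apply: hA; exists q => //.
  - by left; split.
  - by right; split => // -[].
rewrite (_ : _ `&` _ = \bigcup_(q : rat) (if (r <= ratr q) then D `&` B q else set0)).
  apply: bigcupT_measurable_rat => q; case: ifP => // _; apply: measurableI => //; exact: (hB q).1.
apply/seteqP; split => [x [Dx]|x [q _]].
  rewrite /= in_itv/= andbT => rf.
  have [q /andP[q1 q2]] : exists q : rat, (r < ratr q) && (ratr q < f x).
    by have [q] := rat_in_itvoo rf; rewrite in_itv/= => h; exists q.
  exists q => //; rewrite (ltW q1) -Eq; split => //=.
  by rewrite in_itv/= andbT.
case: ifP => // rq; rewrite -Eq => -[Dx /=]; rewrite in_itv/= andbT => h; split => //=.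
by rewrite in_itv/= andbT; exact: le_lt_trans h.
Qed.

End lebesgue_borel.

(** * From abstract critical levels to the mountain pass sets *)

Section translation.
Variables (R : realType) (n : nat) (Omega : set 'rV[R]_n) (alpha : R).
Local Notation mu := (@lebesgue_rv R n).
Local Notation fT := ('rV[R]_n -> R).
Local Notation X0 := (X0space Omega alpha).
Local Notation Q := (Qform Omega alpha).
Local Notation N0 := (normX0 Omega alpha).
Local Notation NY := (normY Omega alpha).
Variables (F : nat -> fT -> R) (L : nat -> fT -> fT -> R).
Hypothesis HQ : psd_form X0 Q.
Hypothesis N0_ae : forall w, X0 w -> N0 w = 0 <-> {ae mu, forall x, w x = 0}.
Hypothesis L_linear : forall k w, X0 w -> linear_on X0 (L k w).
Hypothesis L_bounded : forall k (rho : R), exists C : R, forall w h, X0 w -> X0 h -> N0 w <= rho ->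
  `|L k w h| <= C * N0 h.
Hypothesis F_differentiable : forall k (rho e : R), 0 < e -> exists2 d : R, 0 < d &
  forall w h, X0 w -> X0 h -> N0 w <= rho -> N0 h <= d ->
  `|F k (w + h) - F k w - L k w h| <= e * N0 h.
Hypothesis F_at0 : forall k, F k 0 = 0.

Let N0Z (a : R) w : X0 w -> N0 (a *: w) = `|a| * N0 w. Proof. exact: (qnormZ HQ). Qed.
Let N0_ge0 w : 0 <= N0 w. Proof. exact: qnorm_ge0. Qed.

(** Uniqueness of the derivative: zero and [L k w] both approximate the increment of F along t h to
    first order, so their values at h differ by less than any e. *)
Lemma frechet_zeroP k w : X0 w ->
  is_frechet_derivative X0 N0 (F k) w (fun=> 0) <-> critical X0 L k w.
Proof.
move=> Xw; split=> [[_ _ hF]|[_ L0]]; last first.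
  split.
  - by move=> a h1 h2 _ _; rewrite mulr0 addr0.
  - by exists 0 => h _; rewrite mul0r normr0.
  - move=> e e0; have [d d0 hd] := F_differentiable k (N0 w) e0; exists d => // h Xh hN.
    by have := hd w h Xw Xh (lexx _) (ltW hN); rewrite (L0 h Xh).
split => // h Xh.
apply/eqP; rewrite -normr_le0; apply/ler_addgt0Pr => e e0; rewrite add0r.
pose e' := e / (2 * (N0 h + 1)); have N1 : 0 < N0 h + 1 by rewrite ltr_wpDl.
have e'0 : 0 < e' by rewrite divr_gt0// mulr_gt0.
have [d1 d10 h1] := hF e' e'0.
have [d2 d20 h2] := F_differentiable k (N0 w) e'0.
(* The half is for the strict inequality in [is_frechet_derivative]; the extra 1 is for directions
   of seminorm zero. *)
pose t := Num.min (d1 / 2) d2 / (N0 h + 1).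
have m0 : 0 < Num.min (d1 / 2) d2 by rewrite lt_min d20 divr_gt0.
have t0 : 0 < t by rewrite divr_gt0.
have Nt : N0 (t *: h) <= Num.min (d1 / 2) d2.
  rewrite N0Z// gtr0_norm// /t mulrAC ler_pdivrMr// ler_wpM2l ?(ltW m0)// lerDl//.
have Xt : X0 (t *: h) by exact: (psd_EZ HQ).
have a1 := h1 _ Xt ltac:(apply: (le_lt_trans Nt); rewrite gt_min; apply/orP; left; lra).
have a2 := h2 w _ Xw Xt (lexx _) ltac:(apply: (le_trans Nt); rewrite ge_min lexx orbT //).
have Lt : L k w (t *: h) = t * L k w h.
  have := L_linear k Xw t Xh (psd_E0 HQ); rewrite addr0 => ->.
  by rewrite (linear_on0 HQ (L_linear k Xw)) addr0.
rewrite subr0 in a1.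
have h3 : t * `|L k w h| <= t * (2 * e' * N0 h).
  rewrite -(gtr0_norm t0) -normrM (gtr0_norm t0) -Lt.
  rewrite N0Z// (gtr0_norm t0) in a1 a2.
  move/ler_normlP: a1 => [b1 b2]; move/ler_normlP: a2 => [b3 b4].
  by apply/ler_normlP; split; lra.
rewrite ler_pM2l// in h3; apply: (le_trans h3).
rewrite /e' (_ : 2 * _ * _ = e * (N0 h / (N0 h + 1))); last by field; rewrite gt_eqF.
by rewrite ler_piMr ?(ltW e0)// ler_pdivrMr// mul1r lerDl.
Qed.

Lemma F_null k w : X0 w -> N0 w = 0 -> F k w = 0.
Proof.
move=> Xw w0; have [d d0 hd] := F_differentiable k (N0 0) ltr01.
have := hd 0 w (psd_E0 HQ) Xw (lexx _); rewrite w0 mulr0 add0r F_at0 subr0 => /(_ (ltW d0)).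
have [C hC] := L_bounded k (N0 0); have := hC 0 w (psd_E0 HQ) Xw (lexx _); rewrite w0 mulr0.
rewrite !normr_le0 => /eqP ->; rewrite subr0 => /eqP; exact.
Qed.

Lemma mp_path_mpath w1 g : X0 w1 -> mp_paths Omega alpha w1 g -> mpath X0 Q w1 (g \o @clamp01 R).
Proof.
move=> X1 [[gX gc] g0 g1].
have I01 (t : R) : `[0, 1]%classic (clamp01 t) by rewrite /= in_itv/=; exact: clamp01_itv.
split.
- split=> [t|t]; first exact: gX (I01 t).
  apply/cvgrPdist_le => e e0.
  have /cvgrPdist_le/(_ e e0) hg := gc _ (I01 t).
  have hc : {for t, continuous (@clamp01 R)} := @continuous_clamp01 R t.
  have h2 : nbhs (clamp01 t) (fun s => (`[0, 1]%classic : set R) s -> `|0 - N0 (g s - g (clamp01 t))| <= e) by exact: hg.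
  have h3 : nbhs t (@clamp01 R @^-1` [set s | (`[0, 1]%classic : set R) s -> `|0 - N0 (g s - g (clamp01 t))| <= e]) by exact: hc h2.
  by apply: filterS h3 => s hs; exact: hs (I01 s).
- have X00 : X0 (g 0) by apply: gX; rewrite /= in_itv/= lexx ler01.
  have /(N0_ae X00) : {ae mu, forall x, g 0 x = 0} by apply: filterS g0 => x hx; exact: hx.
  by rewrite /comp clamp01_id ?ler01.
- have X01 : X0 (g 1) by apply: gX; rewrite /= in_itv/= lexx ler01.
  have /(N0_ae (psd_EB HQ X01 X1)) : {ae mu, forall x, (g 1 - w1) x = 0}.
    by apply: filterS g1 => x hx; rewrite -[LHS]/(g 1 x - w1 x) hx ?subrr.
  by rewrite /comp clamp01_id ?ler01.
Qed.

Lemma mpath_mp_path w1 g : X0 w1 -> mpath X0 Q w1 g -> mp_paths Omega alpha w1 g.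
Proof.
move=> X1 [[gX gc] g0 g1]; split.
- split=> t _; first exact: gX.
  by apply: cvg_within_filter; exact: gc.
- by have /(N0_ae (gX 0)) := g0; apply: filterS => x hx _.
- have /(N0_ae (psd_EB HQ (gX 1) X1)) := g1; apply: filterS => x hx _.
  by apply/eqP; rewrite -subr_eq0; apply/eqP; exact: hx.
Qed.

Lemma mp_levelE w1 k l : X0 w1 -> islevel X0 Q F w1 k l -> mp_level Omega alpha F w1 k = l%:E.
Proof.
move=> X1 [lo hi]; apply/eqP; rewrite eq_le; apply/andP; split.
  apply/lee_addgt0Pr => e e0; have [g mg hg] := hi e e0.
  apply: (@le_trans _ _ (ereal_sup [set (F k (g t))%:E | t in `[0, 1]%classic])).
    by apply: ereal_inf_lbound; exists g => //; exact: mpath_mp_path.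
  apply: ge_ereal_sup => _ [t /= ht <-]; rewrite in_itv/= in ht.
  by rewrite -EFinD lee_fin; exact: hg.
apply: le_ereal_inf_tmp => _ [g mg <-].
apply/lee_addgt0Pr => e e0.
have [t ht lt] := lo _ (mp_path_mpath X1 mg) e e0.
have le1 : (l%:E <= (F k (g (clamp01 t)))%:E + e%:E)%E.
  by rewrite -EFinD lee_fin -lerBlDr; exact: ltW.
apply: (le_trans le1); apply: leeD2r; apply: ereal_sup_ubound.
by exists (clamp01 t) => //=; rewrite in_itv/=; exact: clamp01_itv.
Qed.

Variables (CY : R).
Hypothesis CY0 : 0 < CY.
Hypothesis NY_dist : forall w z, X0 w -> X0 z -> `|NY w - NY z| <= CY * N0 (w - z).

Lemma closure_Bball eta w : closure_in X0 N0 (Bball Omega alpha eta) w -> NY w <= eta.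
Proof.
move=> [Xw cl]; apply/ler_addgt0Pr => e e0.
have [a [Xa aeta] aw] := cl (e / CY) ltac:(by rewrite divr_gt0).
have /ler_normlP[h1 _] := NY_dist Xa Xw.
have : CY * N0 (a - w) <= e by rewrite mulrC -ler_pdivlMr// ltW.
lra.
Qed.

Lemma boundary_Bball eta w : boundary_in X0 N0 (Bball Omega alpha eta) w -> X0 w /\ NY w = eta.
Proof.
move=> [c1 [Xw cl]]; split => //; apply/eqP; rewrite eq_le closure_Bball//=.
apply/ler_addgt0Pr => e e0.
have [a [Xa na] aw] := cl (e / CY) ltac:(by rewrite divr_gt0).
have aeta : eta <= NY a by rewrite leNgt; apply/negP => h; apply: na; split.
have /ler_normlP[_ h1] := NY_dist Xa Xw.
have : CY * N0 (a - w) <= e by rewrite mulrC -ler_pdivlMr// ltW.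
lra.
Qed.

Variables (w1 : fT) (eta be K : R) (k0 : nat).
Hypotheses (X1 : X0 w1) (eta0 : 0 < eta) (w1eta : eta < NY w1) (be0 : 0 < be).
Hypothesis struct : forall k, k = 0%N \/ (k0 <= k)%N ->
  [/\ F k w1 < 0, forall w, X0 w -> NY w = eta -> be <= F k w &
    exists2 l : R, be <= l & islevel X0 Q F w1 k l /\ exists2 w, F k w = l & critical X0 L k w].
Hypothesis ray_bound : forall k (t : R), 0 <= t <= 1 -> F k (t *: w1) <= K.
Hypothesis compactness : forall (kk : nat -> nat) (w : nat -> fT),
  (forall j, critical X0 L (kk j) (w j)) -> (forall j, F (kk j) (w j) <= K) ->
  exists (sigma : nat -> nat) (l : fT), [/\ {homo sigma : i j / (i < j)%N}, X0 l &
    N0 (w (sigma j) - l) @[j --> \oo] --> (0 : R)].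
Hypothesis cluster : forall (l : nat -> R) w,
  (forall k, k = 0%N \/ (k0 <= k)%N -> islevel X0 Q F w1 k (l k)) ->
  X0 w -> (forall e : R, 0 < e -> forall j, exists k z, [/\ (j <= k)%N, N0 (z - w) <= e,
    F k z = l k & critical X0 L k z]) ->
  F 0%N w = l 0%N /\ critical X0 L 0%N w.

Lemma endpoint : mountain_pass_endpoint Omega alpha F w1.
Proof.
split => //; exists eta.
have mtn k : k = 0%N \/ (k0 <= k)%N ->
    (0 < ereal_inf [set (F k w)%:E | w in boundary_in X0 N0 (Bball Omega alpha eta)])%E /\ F k w1 < 0.
  move=> hk; have [h1 h2 _] := struct hk; split => //.
  apply: (@lt_le_trans _ _ be%:E); first by rewrite lte_fin.
  apply: le_ereal_inf_tmp => _ [w /boundary_Bball[Xw Nw] <-].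
  by rewrite lee_fin; exact: h2.
split => //.
- by move/closure_Bball; rewrite leNgt w1eta.
- by apply: mtn; left.
- by exists k0 => // k /= kk; apply: mtn; right.
Qed.

(** The straight path bounds the level by K, uniformly in k, so critical points of different
    functionals fall under one compactness statement. *)
Lemma mp_criticalP k w : mp_critical Omega alpha F w1 k w -> critical X0 L k w /\ F k w <= K.
Proof.
move=> [Xw Fl dw]; split; first exact/frechet_zeroP.
have lm := line_mpath HQ X1.
rewrite -lee_fin Fl; apply: (@le_trans _ _ (ereal_sup [set (F k (0 + t *: (w1 - 0)))%:E | t in `[0, 1]%classic])).
  by apply: ereal_inf_lbound; exists (fun t => 0 + t *: (w1 - 0)) => //; exact: mpath_mp_path.
apply: ge_ereal_sup => _ [t /= ht <-]; rewrite in_itv/= in ht.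
by rewrite lee_fin add0r subr0; exact: ray_bound.
Qed.

Lemma translated_conclusion : exists2 w1 : fT,
    mountain_pass_endpoint Omega alpha F w1 &
    let W := mp_critical Omega alpha F w1 in
    [/\ \forall k \near \oo, W k !=set0 /\
          (forall w, W k w -> ~ (w = 0 %[ae mu]) /\ F k w <> 0),
        forall (w : nat -> fT) (k0 : nat),
          (forall k, (k0 <= k)%N -> W k (w k)) ->
          relatively_compact_in X0 N0 [set w k | k in [set k | (k0 <= k)%N]] &
        Limsup_in X0 N0 W `<=` W 0%N].
Proof.
exists w1; first exact: endpoint.
split.
- exists k0 => // k /= kk; have [_ _ [l bl [hl [w Fw cw]]]] := struct (or_intror kk).
  have lE := mp_levelE X1 hl; have Xw := cw.1.
  split; first by exists w; split; [|rewrite lE Fw|exact/frechet_zeroP].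
  move=> z [Xz Fz dz]; have Fzl : F k z = l by move: Fz; rewrite lE => -[].
  have Fz0 : F k z <> 0 by rewrite Fzl => l0; move: bl; rewrite l0 leNgt be0.
  split => // z0; apply: Fz0; apply: F_null => //; apply/(N0_ae Xz).
  by apply: filterS z0 => x hx; apply: hx.
- move=> w k1 hw s hs.
  have /choice[kk hkk] : forall j, exists k, (k1 <= k)%N /\ w k = s j.
    by move=> j; have [k ? ?] := hs j; exists k.
  apply: (compactness (kk := kk)) => j; have [kj <-] := hkk j; have [h1 h2] := mp_criticalP (hw _ kj) => //.
- move=> w [s [k1 _ hs] [Xw cl]].
  (* Levels are known for k = 0 and k >= k0; elsewhere 0 is a placeholder. *)
  have /choice[l hl] : forall k, exists l : R, k = 0%N \/ (k0 <= k)%N -> islevel X0 Q F w1 k l.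
    move=> k; have [hk|nk] := pselect (k = 0%N \/ (k0 <= k)%N); last by exists 0.
    by have [_ _ [l _ [h _]]] := struct hk; exists l.
  have [|F0 c0] := @cluster l w hl Xw.
    move=> e e0 j; have [k kj kw] := cl e e0 (maxn (maxn k0 k1) j).
    move: kj; rewrite !geq_max => /andP[/andP[kk0 kk1] kj].
    have [Xs Fs ds] := hs k kk1; have [cs _] := mp_criticalP (hs k kk1).
    exists k, (s k); split => //; first exact: ltW.
    by move: Fs; rewrite (mp_levelE X1 (hl k (or_intror kk0))) => -[].
  split => //; last exact/frechet_zeroP.
  by rewrite F0 (mp_levelE X1 (hl 0%N (or_introl erefl))).
Qed.

End translation.

(** * Assembly *)

Lemma islevel_eq (R : realType) (V : lmodType R) (E : set V) (Q : V -> V -> R)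
    (f f' : nat -> V -> R) w1 k (l : R) : (forall k w, E w -> f k w = f' k w) ->
  islevel E Q f w1 k l -> islevel E Q f' w1 k l.
Proof.
move=> ff' [lo hi]; split=> [g mg e e0|e e0].
  have [[gE _] _ _] := mg; have [t ht lt] := lo g mg e e0.
  by exists t => //; rewrite -ff'.
have [g mg hg] := hi e e0; have [[gE _] _ _] := mg.
by exists g => // t ht; rewrite -ff'//; exact: hg.
Qed.

Section assembly.
Variables (R : realType) (n m : nat) (alpha : R) (Omega : set 'rV[R]_n).
Hypotheses (n1 : (1 < n)%N) (al1 : 1 < alpha) (al2 : alpha < 2).
Hypotheses (BD : bounded_domain Omega) (LB : lipschitz_boundary Omega).
Local Notation mu := (@lebesgue_rv R n).
Local Notation fT := ('rV[R]_n -> R).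
Local Notation X := (Xspace Omega alpha).
Local Notation X0 := (X0space Omega alpha).
Local Notation Q := (Qform Omega alpha).
Local Notation N0 := (normX0 Omega alpha).
Local Notation NY := (normY Omega alpha).
Variable (A : set 'rV[R]_n).
Hypotheses (mA : measurable A) (A0 : mu A = 0%E).
Let D := Omega `\` A.
Let mO : measurable Omega. Proof. exact: measurable_domain BD. Qed.
Let mD : measurable D. Proof. exact: measurableD. Qed.
Let DO : D `<=` Omega. Proof. by move=> x []. Qed.
Let aD : {ae mu, forall x, Omega x -> D x}.
Proof.
exists A; split => // x /= h; apply: contrapT => nA; apply: h => Ox; split => //.
Qed.
Let fD : (mu D < +oo)%E.
Proof.
apply: le_lt_trans (domain_finite BD); apply: le_measure => //; rewrite ?inE//.
Qed.

Lemma X0_domain_measurable w : X0 w -> measurable_fun D w.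
Proof. by move=> [[mw _ _] _]; apply: measurable_funS mw. Qed.

Lemma normX0_eq0 w : X0 w -> N0 w = 0 <-> {ae mu, forall x, w x = 0}.
Proof.
move=> Xw; have HQ := X0_psd alpha BD; split=> [w0|w0].
  have [CP CP0 hP] := X0_poincare n1 al1 BD.
  have Q0 : Q w w = 0.
    by move/eqP: w0; rewrite sqrtr_eq0 => h; apply/eqP; rewrite eq_le h (psd_ge0 HQ).
  have mw : measurable_fun Omega (fun x => w x ^+ 2).
    by apply: measurable_funX; case: Xw => -[mw _ _] _; apply: measurable_funS mw.
  have [] := IB_domain BD mD DO mw (fun x => sqr_ge0 (w x)) (hP w Xw).
  rewrite Q0 mulr0 => _ le0.
  have e0 : \int[mu]_(x in D) (w x * w x) = 0.
    apply/eqP; rewrite eq_le; apply/andP; split; first exact: le0.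
    by apply: Rintegral_ge0 => x _; exact: sqr_ge0.
  have a1 := X0_L2_zero n1 al1 BD mD DO aD Xw e0.
  have [_ a2] := Xw; apply: filterS2 a1 a2 => x h1 h2.
  by have [/h1|/h2] := pselect (Omega x).
have mw : measurable_fun setT w by case: Xw => -[].
have := X0_definite n1 al1 BD mD DO aD Xw; apply.
rewrite /Rintegral (ae_eq_integral (cst 0%E)) ?integral_cst0 ?integral0//.
  by apply/measurable_EFinP; apply: measurable_funTS; exact: measurable_funM.
by apply: filterS w0 => x /= -> _; rewrite mul0r.
Qed.

Variables (l1 : R) (v : nat -> fT).
Hypothesis vV : forall k, Vset Omega alpha (v 0%N) l1 (v k).
Hypothesis vcv : NY (v k - v 0%N) @[k --> \oo] --> (0 : R).
Let vY k : Yspace Omega alpha (v k). Proof. by case: (vV k) => -[]. Qed.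
Let vX k : X (v k). Proof. by case: (vY k). Qed.
Let vm k : measurable_fun setT (v k). Proof. exact: Xspace_measurable BD _ (vX k). Qed.

Lemma Yspace0 : Yspace Omega alpha 0.
Proof.
split; first exact: (psd_E0 (X0_psd alpha BD)).1.
apply/Lfun2P; split; first exact: measurable_cst.
by under eq_integral do rewrite expr0n/=; rewrite integral0.
Qed.

(** The functions v k need not vanish outside Omega, so the Sobolev bound is used in its form for X,
    which asks for an L2 bound besides the energy. It applies to v 0 and to v k - v 0, the latter
    controlled by l1 for all k. *)
Lemma data_power_bound (s s1 : R) : 2 < s -> s < s1 -> s1 < 2 * n%:R / (n%:R - alpha) ->
  exists Kv, forall k, PB mu D s1 (v k) Kv.
Proof.
move=> s2 ss1 s1c; have s10 : 0 <= s1 by have := s2; have := ss1; lra.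
have XB w z : X w -> X z -> X (w - z).
  by move=> Xw Xz; have := Xspace_lin BD 1 (- 1) Xw Xz; rewrite scale1r scaleN1r.
have h w z l : Yspace Omega alpha w -> Yspace Omega alpha z ->  NY (w - z) <= l ->
   exists2 C : R, 0 < C & forall w', X w' -> (\int[mu]_(x in Omega) (w' x ^+ 2)%:E <= (l ^+ 2)%:E)%E -> Q w' w' <= l ^+ 2 ->
    IB mu D (fun x => `|w' x| `^ s1) C.
  move=> _ _ _; exact: (X_sobolev n1 al1 al2 BD LB mD DO (l ^+ 2) s10 s1c (sqr_ge0 l)).
have [C1 C10 h1] := h _ _ _ (vY 0%N) Yspace0 (lexx _).
have [C2 C20 h2] := h _ _ _ (vY 0%N) (vY 0%N) (vV 0%N).2.
have [a1 a2] := Yspace_close BD (vY 0%N) Yspace0 (lexx (NY (v 0%N - 0))).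
have P1 : PB mu D s1 (v 0%N) C1.
  split; first exact: measurable_funTS.
  apply: h1 => //; first by move: a1; under eq_integral do rewrite subr0.
  by move: a2; rewrite subr0.
have P2 k : PB mu D s1 (v k - v 0%N) C2.
  split; first by apply: measurable_funTS; exact: measurable_funB.
  have [b1 b2] := Yspace_close BD (vY k) (vY 0%N) (vV k).2.
  by apply: h2 => //; exact: XB.
exists (2 `^ s1 * (C2 + C1)) => k.
have := PB_D mD s2 ss1 (P2 k) P1; congr PB; apply/funext => x.
by rewrite -[LHS]/(v k x - v 0%N x + v 0%N x) subrK.
Qed.

Lemma data_L2_cvg (e : R) : 0 < e -> exists k0, forall k, (k0 <= k)%N ->
  IB mu D (fun x => (v k x - v 0%N x) ^+ 2) e.
Proof.
move=> e0; have se : 0 < Num.sqrt e by rewrite sqrtr_gt0.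
have /cvgrPdist_le/(_ _ se)[k0 _ hk] := vcv.
exists k0 => k kk; have := hk k kk; rewrite /= sub0r normrN => /(le_trans (ler_norm _)) h.
have [b1 _] := Yspace_close BD (vY k) (vY 0%N) h.
apply: (IB_domain BD mD DO) => [|x|].
- by apply: measurable_funTS; apply: measurable_funX; exact: measurable_funB.
- exact: sqr_ge0.
- by move: b1; rewrite (sqr_sqrtr (ltW e0)).
Qed.

Variables (c s p a r Cg : R).
Variables (g gz : nat -> 'rV[R]_n -> R -> R) (ee : nat -> R).
Variable Fk : nat -> fT -> R.
Hypothesis FkE : forall k w, X0 w -> Fk k w = c * (Q w w / 2 + Q (v k) w)
  - \int[mu]_(x in Omega) g k x (w x + v k x) + \int[mu]_(x in Omega) g k x (v k x).
Hypotheses (s2 : 2 < s) (sc : s < 2 * n%:R / (n%:R - alpha)) (Cg0 : 0 <= Cg) (p2 : 2 < p)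
  (a0 : 0 < a) (r0 : 0 < r).
Hypothesis gAR : forall k x, D x -> AR_nonlinearity s Cg p a r (g k x) (gz k x).
Hypothesis gzc : forall k x, D x -> continuous (gz k x).
Hypothesis gm : forall k w, measurable_fun D w -> measurable_fun D (fun x => g k x (w x)).
Hypothesis gzm : forall k w, measurable_fun D w -> measurable_fun D (fun x => gz k x (w x)).
Hypothesis gzk : forall k x z, D x -> `|gz k x z - gz 0%N x z| <= ee k * (1 + `|z|).
Hypothesis ee0 : forall k, 0 <= ee k.
Hypothesis eecv : forall e : R, 0 < e -> exists k0, forall k, (k0 <= k)%N -> ee k <= e.
Variables (b zeta zeta' : R).
Hypotheses (b0 : 0 < b) (bc : b < c / 2) (zeta0 : 0 < zeta) (zz : zeta' < zeta).
Hypothesis v0z : forall x, D x -> `|v 0%N x| <= zeta'.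
Hypothesis g0near : forall x z, D x -> `|z| <= zeta ->
  `|g 0%N x z + c / 2 * z ^+ 2| <= b / 2 * `|z - v 0%N x| ^+ 2.

Theorem assembled_conclusion : exists2 w1 : fT,
    mountain_pass_endpoint Omega alpha Fk w1 &
    let W := mp_critical Omega alpha Fk w1 in
    [/\ \forall k \near \oo, W k !=set0 /\
          (forall w, W k w -> ~ (w = 0 %[ae mu]) /\ Fk k w <> 0),
        forall (w : nat -> fT) (k0 : nat),
          (forall k, (k0 <= k)%N -> W k (w k)) ->
          relatively_compact_in X0 N0 [set w k | k in [set k | (k0 <= k)%N]] &
        Limsup_in X0 N0 W `<=` W 0%N].
Proof.
have c0 : 0 < c by have := b0; have := bc; lra.
(* Midpoint between the growth exponent and the critical exponent. *)
pose s1 := (s + 2 * n%:R / (n%:R - alpha)) / 2.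
have ss1 : s < s1 by have := sc; rewrite /s1; lra.
have s1c : s1 < 2 * n%:R / (n%:R - alpha) by have := sc; rewrite /s1; lra.
have s10 : 0 <= s1 by have := s2; have := ss1; lra.
have [Kv vP] := data_power_bound s2 ss1 s1c.
have HQ := X0_psd alpha BD.
have [CP CP0 hP] := X0_poincare n1 al1 BD.
have poin w : X0 w -> IB mu D (fun x => w x ^+ 2) (CP * Q w w).
  move=> Xw; apply: (IB_domain BD mD DO) => [|x|]; [|exact: sqr_ge0|exact: hP].
  by apply: measurable_funTS; apply: measurable_funX; case: Xw => -[].
have [CS CS0 hS] := X_sobolev n1 al1 al2 BD LB mD DO CP s10 s1c ler01.
have sob w : X0 w -> qnorm Q w <= 1 -> IB mu D (fun x => `|w x| `^ s1) CS.
  move=> Xw w1; have Q1 : Q w w <= 1.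
    by move: w1; rewrite /qnorm -[X in _ <= X -> _]sqrtr1 ler_sqrt.
  apply: hS => //; first exact: Xw.1.
  by apply: (le_trans (hP w Xw)); rewrite lee_fin ler_piMr.
have [CY [CY0 NYge NYle NYd]] := normY_equiv n1 al1 BD mD DO aD.
have [phi [psi [Xphi Xpsi indep]]] := X0_independent n1 al1 al2 BD mD DO aD.
have CS0' := ltW CS0.
have [w1 [eta [be [K [k0 [[X1 eta0 w1eta be0] [str ray comp clus]]]]]]] :=
  mountain_pass_structure mD fD c0 s2 ss1 Cg0 p2 a0 r0 gAR gzc gm gzm gzk ee0 eecv vP
    data_L2_cvg b0 bc zeta0 zz v0z g0near HQ X0_domain_measurable CP0 CS0' poin sob
    (X0_complete n1 al1 BD) (X0_compact n1 al1 BD LB mD DO)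
    (X0_definite n1 al1 BD mD DO aD) CY0 NYge NYle NYd Xphi Xpsi indep.
(* Orthogonality turns Q (v k) w into an L2 pairing, and integrals over Omega become integrals over
   the conull set D. The two functionals are compared on [X0] only, so the abstract results are
   transferred through [islevel_eq]. *)
have FE k w : X0 w -> Jf mu D c v g Q k w = Fk k w.
  move=> Xw; rewrite FkE// (orth_Qform BD mD aD (vV k).1 Xw).
  rewrite !(Rintegral_conull _ Omega mA A0) -/D /Jf.
  have [Kw Kw0 Pw] := E_PB mD HQ X0_domain_measurable CS0' sob Xw.
  have i1 := mul_itg mD fD s2 ss1 (vP k) Pw.
  have i2 := g_itg mD fD s2 ss1 Cg0 gAR gm k (PB_D mD s2 ss1 Pw (vP k)).
  have i3 := g_itg mD fD s2 ss1 Cg0 gAR gm k (vP k).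
  have -> : \int[mu]_(x in D) upp c v g k w x = c * (\int[mu]_(x in D) (v k x * w x)) +
     (\int[mu]_(x in D) g k x (w x + v k x) - \int[mu]_(x in D) g k x (v k x)).
    rewrite -RintegralB// -RintegralZl// -RintegralD//.
    - by apply: eq_Rintegral => x _; rewrite /upp mulrA.
    - exact: itgZ.
    - exact: itgB.
  by lra.
apply: (@translated_conclusion R n Omega alpha Fk (dJf mu D c v gz Q) HQ _ _ _ _ _
  CY CY0 NYd w1 eta be K k0 X1 eta0 w1eta be0).
- exact: normX0_eq0.
- exact: (L_linear mD fD c0 s2 ss1 Cg0 gAR gzm vP HQ X0_domain_measurable CS0' sob).
- exact: (L_bounded mD fD c0 s2 ss1 Cg0 gAR gzm vP HQ X0_domain_measurable CP0 CS0' poin sob).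
- move=> k rho e e0.
  have [d d0 hd] := F_differentiable mD fD c0 s2 ss1 Cg0 gAR gzc gm gzm vP HQ X0_domain_measurable CP0 CS0' poin sob k rho e0.
  exists d => // w h Xw Xh wr hr; rewrite -!FE//; last exact: (psd_ED HQ).
  exact: hd.
- by move=> k; rewrite -(FE k 0 (psd_E0 HQ)); exact: (@F_at0 _ _ _ mu D mD c v g X0 Q HQ k).
- move=> k hk; have [h1 h2 [l bl [hl [w Fw cw]]]] := str k hk; split.
  + by rewrite -FE.
  + by move=> z Xz Nz; rewrite -FE//; exact: h2.
  + exists l => //; split; first exact: islevel_eq FE hl.
    by exists w => //; rewrite -FE//; exact: cw.1.
- by move=> k t ht; rewrite -FE ?ray//; exact: (psd_EZ HQ).
- move=> kk w cw Fw; apply: (comp kk w cw) => j; rewrite FE//; exact: (cw j).1.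
- move=> l w hl Xw hw; rewrite -FE//; apply: clus => //.
    by move=> k hk; apply: islevel_eq (hl k hk) => k' z Xz; rewrite FE.
  move=> e e0 j; have [k [z [kj zw Fz cz]]] := hw e e0 j.
  by exists k, z; split => //; rewrite FE//; exact: cz.1.
Qed.
End assembly.

(** * Reduction of the hypotheses on the data *)

Section data_conditions.
Variables (R : realType) (n m : nat) (Omega : set 'rV[R]_n).
Local Notation mu := (@lebesgue_rv R n).

Lemma ae_conull (P : 'rV[R]_n -> Prop) : {ae mu, forall x, Omega x -> P x} ->
  exists A : set 'rV[R]_n, [/\ measurable A, mu A = 0%E & forall x, (Omega `\` A) x -> P x].
Proof.
move=> [A [mA A0 hA]]; exists A; split => // x [Ox nA].
by apply: contrapT => nP; apply: nA; apply: hA => /= h; apply: nP; exact: h.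
Qed.

Lemma normLinf_le (u : 'rV[R]_n -> 'rV[R]_m) (M : R) : (normLinf Omega u <= M%:E)%E ->
  {ae mu, forall x, Omega x -> enorm (u x) <= M}.
Proof.
have mu0 : (0 < mu [set: 'rV[R]_n])%E.
  apply: (@lt_le_trans _ _ (mu (cube 0 1))).
    by rewrite lebesgue_rv_cube// lte_fin exprn_gt0.
  by apply: le_measure => //; rewrite inE//; exact: measurable_cube.
rewrite /normLinf unlock mu0 => /ess_supP; apply: filterS => x /= h Ox.
by move: h; rewrite patchT ?inE// lee_fin ger0_norm// sqrtr_ge0.
Qed.

(** A real number standing for the extended real norm: the norm itself when finite, and otherwise M,
    in which case the last clause is vacuous. *)
Lemma normLinf_bound (u : 'rV[R]_n -> 'rV[R]_m) (M : R) : 0 <= M ->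
  {ae mu, forall x, Omega x -> enorm (u x) <= M} ->
  exists d, [/\ 0 <= d, {ae mu, forall x, Omega x -> enorm (u x) <= d} &
    forall e : R, (normLinf Omega u <= e%:E)%E -> d <= e].
Proof.
move=> M0 uM; case hu : (normLinf Omega u) => [d||].
- exists d; split; last by move=> e; rewrite lee_fin.
  + by rewrite -lee_fin -hu Lnorm_ge0.
  + by apply: normLinf_le; rewrite hu.
- by exists M; split.
- have : (0 <= normLinf Omega u)%E by exact: Lnorm_ge0.
  by rewrite hu.
Qed.

Lemma ess_sup_lt (f : 'rV[R]_n -> R) (zeta : R) :
  (ess_sup mu (EFin \o ((Num.norm \o f) \_ Omega)) < zeta%:E)%E ->
  exists2 zeta' : R, zeta' < zeta & {ae mu, forall x, Omega x -> `|f x| <= zeta'}.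
Proof.
have h (z : R) : (ess_sup mu (EFin \o ((Num.norm \o f) \_ Omega)) <= z%:E)%E ->
    {ae mu, forall x, Omega x -> `|f x| <= z}.
  by move=> /ess_supP; apply: filterS => x /= hx Ox; move: hx; rewrite patchT ?inE// lee_fin.
case he : (ess_sup _ _) => [z||]//.
- by rewrite lte_fin => zz; exists z => //; apply: h; rewrite he.
- move=> _; exists (zeta - 1); first by rewrite ltrBlDr ltrDl.
  by apply: h; rewrite he leNye.
Qed.

(** The radius in the hypothesis is arbitrary, so a single centre in U with a radius large enough
    covers the whole ball of radius l; if U is empty or l negative, nothing is claimed. *)
Lemma lipschitz_on_ball (U : set 'rV[R]_m) (Gz : 'rV[R]_n -> R -> 'rV[R]_m -> R) (l : R) : (0 < m)%N ->
  (forall (qbar : 'rV[R]_m) (eps : R), U qbar -> 0 < eps ->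
     exists2 C : R, 0 < C &
       {ae mu, forall x, Omega x -> forall z q1 q2, U q1 -> U q2 ->
          enorm (q1 - qbar) < eps -> enorm (q2 - qbar) < eps ->
          `|Gz x z q1 - Gz x z q2| <= C * (1 + `|z|) * enorm (q1 - q2)}) ->
  exists2 C : R, 0 <= C & {ae mu, forall x, Omega x -> forall z q1 q2, U q1 -> U q2 ->
    enorm q1 <= l -> enorm q2 <= l -> `|Gz x z q1 - Gz x z q2| <= C * (1 + `|z|) * enorm (q1 - q2)}.
Proof.
move=> m0 hG; have [[qb Uq]|nU] := pselect (exists q, U q); last first.
  by exists 0 => //; apply: nearW => x _ z q1 q2 Uq; case: nU; exists q1.
have [l0|l0] := ltP l 0.
  exists 0 => //; apply: nearW => x _ z q1 q2 _ _ h.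
  by have := le_lt_trans (le_trans (sqrtr_ge0 _) h) l0; rewrite ltxx.
pose eps := m%:R * (l + `|qb|) + 1.
have eps0 : 0 < eps by rewrite ltr_wpDl// mulr_ge0// addr_ge0.
have near_qb q : enorm q <= l -> enorm (q - qb) < eps.
  move=> ql; apply: (le_lt_trans (enorm_le _ m0)); rewrite /eps ltr_pwDr// ler_wpM2l//.
  by apply: (le_trans (ler_normB _ _)); rewrite lerD2r (le_trans (norm_le_enorm _)).
have [C C0 hC] := hG qb eps Uq eps0; exists C; first exact: ltW.
by apply: filterS hC => x hx Ox z q1 q2 U1 U2 n1 n2; apply: hx => //; exact: near_qb.
Qed.

Lemma enorm_bounded (U : set 'rV[R]_m) (l : R) : bounded_set (U `&` [set q | enorm q <= l]).
Proof.
exists l; split; first exact: num_real.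
by move=> M lM q [_ /= ql]; rewrite (le_trans (norm_le_enorm q))// (le_trans ql)// ltW.
Qed.
End data_conditions.

Theorem theorem5p2 (R : realType) (n m : nat) (alpha : R)
    (Omega : set 'rV[R]_n) (U : set 'rV[R]_m) (l1 l2 : R)
    (G Gz : 'rV[R]_n -> R -> 'rV[R]_m -> R)
    (v : nat -> 'rV[R]_n -> R) (u : nat -> 'rV[R]_n -> 'rV[R]_m) :
  let mu : {measure set 'rV[R]_n -> \bar R} := @lebesgue_rv R n in
  let c := frac_const n alpha in
  let X0 := X0space Omega alpha in
  let N0 := normX0 Omega alpha in
  let F k := functional Omega alpha G (v k) (u k) in
  (1 < n)%N -> (0 < m)%N -> 1 < alpha < 2 ->
  bounded_domain Omega -> lipschitz_boundary Omega ->
  0 < l1 -> 0 < l2 ->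
  (forall x (z : R) q, Omega x ->
     is_derive z (1 : R) (fun z' => G x z' q) (Gz x z q)) ->
  (forall z q, lebesgue_measurable_fun Omega (fun x => G x z q) /\
               lebesgue_measurable_fun Omega (fun x => Gz x z q)) ->
  {ae mu, forall x, Omega x ->
     continuous (fun p : R * 'rV[R]_m => G x p.1 p.2) /\
     continuous (fun p : R * 'rV[R]_m => Gz x p.1 p.2)} ->
  (exists2 s : R, 2 < s < 2 * n%:R / (n%:R - alpha) &
     forall U0 : set 'rV[R]_m, U0 `<=` U -> bounded_set U0 ->
     exists2 C : R, 0 < C &
       {ae mu, forall x, Omega x -> forall z q, U0 q ->
          `|G x z q| <= C * (1 + `|z| `^ s) /\
          `|Gz x z q| <= C * (1 + `|z| `^ (s - 1))}) ->
  (exists p a r : R, [/\ 2 < p, 0 < a, 0 < r &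
     {ae mu, forall x, Omega x -> forall z q, U q -> r <= `|z| ->
        a < p * G x z q /\ p * G x z q <= z * Gz x z q}]) ->
  (exists zeta b : R, [/\ 0 < zeta, 0 < b < c / 2,
     {ae mu, forall x, Omega x -> forall z q, U q -> `|z| <= zeta ->
        `|G x z q + c / 2 * z ^+ 2| <= b / 2 * `|z - v 0%N x| ^+ 2} &
     (ess_sup mu (EFin \o ((Num.norm \o v 0%N) \_ Omega)) < zeta%:E)%E]) ->
  (forall (qbar : 'rV[R]_m) (eps : R), U qbar -> 0 < eps ->
     exists2 C : R, 0 < C &
       {ae mu, forall x, Omega x -> forall z q1 q2, U q1 -> U q2 ->
          enorm (q1 - qbar) < eps -> enorm (q2 - qbar) < eps ->
          `|G x z q1 - G x z q2| <= C * (1 + `|z| ^+ 2) * enorm (q1 - q2) /\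
          `|Gz x z q1 - Gz x z q2| <= C * (1 + `|z|) * enorm (q1 - q2)}) ->
  (forall k, Vset Omega alpha (v 0%N) l1 (v k)) ->
  (forall k, Uset Omega U l2 (u k)) ->
  normY Omega alpha (v k - v 0%N) @[k --> \oo] --> (0 : R) ->
  normLinf Omega (u k - u 0%N) @[k --> \oo] --> (0 : \bar R)%E ->
  exists2 w1 : 'rV[R]_n -> R,
    mountain_pass_endpoint Omega alpha F w1 &
    let W := mp_critical Omega alpha F w1 in
    [/\ \forall k \near \oo, W k !=set0 /\
          (forall w, W k w -> ~ (w = 0 %[ae mu]) /\ F k w <> 0),
        forall (w : nat -> 'rV[R]_n -> R) (k0 : nat),
          (forall k, (k0 <= k)%N -> W k (w k)) ->
          relatively_compact_in X0 N0 [set w k | k in [set k | (k0 <= k)%N]] &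
        Limsup_in X0 N0 W `<=` W 0%N].
Proof.
move=> mu c X0 N0 F n1 m0 /andP[al1 al2] BD LB l10 l20 dG mG cG [s /andP[s2 sc] grow]
  [p [a [r [p2 a0 r0 AR]]]] [zeta [b [zeta0 /andP[b0 bc] near0 v0z]]] lip vV uU vcv ucv.
(* Almost every value of every control lies in this bounded part of U, so one growth constant serves
   all k. *)
have [Cg Cg0 growU] := grow (U `&` [set q | enorm q <= l2]) ltac:(by move=> q []) (@enorm_bounded R m U l2).
have [zeta' zz v0z'] := ess_sup_lt v0z.
have [C5 C50 lipU] : exists2 C : R, 0 <= C & {ae mu, forall x, Omega x -> forall z q1 q2, U q1 -> U q2 ->
    enorm q1 <= l2 -> enorm q2 <= l2 -> `|Gz x z q1 - Gz x z q2| <= C * (1 + `|z|) * enorm (q1 - q2)}.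
  apply: lipschitz_on_ball => // qb eps Uq e0; have [C C0 hC] := lip qb eps Uq e0.
  by exists C => //; apply: filterS hC => x h Ox z q1 q2 U1 U2 e1 e2; case: (h Ox z q1 q2 U1 U2 e1 e2).
have ul k : {ae mu, forall x, Omega x -> enorm (u k x) <= l2}.
  by apply: normLinf_le; case: (uU k).
have uUU k : {ae mu, forall x, Omega x -> U (u k x)} by case: (uU k).
have /choice[dd hdd] : forall k, exists d, [/\ 0 <= d,
    {ae mu, forall x, Omega x -> enorm ((u k - u 0%N) x) <= d} &
    forall e : R, (normLinf Omega (u k - u 0%N)%R <= e%:E)%E -> d <= e].
  move=> k; apply: (@normLinf_bound _ _ _ _ _ (m%:R * (l2 + l2))).
    by rewrite mulr_ge0// addr_ge0 ?ltW.
  apply: filterS2 (ul k) (ul 0%N) => x h1 h2 Ox.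
  apply: (le_trans (enorm_le _ m0)); rewrite ler_wpM2l//.
  apply: (le_trans (ler_normB _ _)); apply: lerD.
    exact: le_trans (norm_le_enorm _) (h1 Ox).
  exact: le_trans (norm_le_enorm _) (h2 Ox).
(* Dyadic arguments are indexed by a precision and integers; being countably many, their exceptional
   null sets can be united. *)
pose G' (t : nat * int * 'rV[int]_m) x := G x (@dyadic R t.1.1 t.1.2) (dyadic_rv R t.1.1 t.2).
pose Gz' (t : nat * int * 'rV[int]_m) x := Gz x (@dyadic R t.1.1 t.1.2) (dyadic_rv R t.1.1 t.2).
have /choice[B1 hB1] : forall t, exists B : set 'rV[R]_n, [/\ measurable B, mu B = 0%E &
    forall D : set 'rV[R]_n, measurable D -> D `<=` Omega `\` B -> measurable_fun D (G' t)].
  by move=> t; apply: lebesgue_measurable_borel; case: (mG (@dyadic R t.1.1 t.1.2) (dyadic_rv R t.1.1 t.2)).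
have /choice[B2 hB2] : forall t, exists B : set 'rV[R]_n, [/\ measurable B, mu B = 0%E &
    forall D : set 'rV[R]_n, measurable D -> D `<=` Omega `\` B -> measurable_fun D (Gz' t)].
  by move=> t; apply: lebesgue_measurable_borel; case: (mG (@dyadic R t.1.1 t.1.2) (dyadic_rv R t.1.1 t.2)).
have avoid (B : nat * int * 'rV[int]_m -> set 'rV[R]_n) : (forall t, measurable (B t) /\ mu (B t) = 0%E) ->
    {ae mu, forall x, forall t, ~ B t x}.
  move=> hB; have [S [mS S0 hS]] : mu.-negligible (\bigcup_t B t).
    by apply: negligible_bigcup_countType => t; have [h1 h2] := hB t; exists (B t); split.
  exists S; split => // x /= h; apply: hS; apply: contrapT => h'; apply: h => t Bt.
  by apply: h'; exists t.
have av1 := avoid B1 ltac:(by move=> t; case: (hB1 t)).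
have av2 := avoid B2 ltac:(by move=> t; case: (hB2 t)).
have [A [mA A0 good]] : exists A : set 'rV[R]_n, [/\ measurable A, mu A = 0%E & forall x, (Omega `\` A) x ->
    [/\ continuous (fun p : R * 'rV[R]_m => G x p.1 p.2) /\ continuous (fun p : R * 'rV[R]_m => Gz x p.1 p.2),
        forall z q, (U `&` [set q | enorm q <= l2]) q ->
          `|G x z q| <= Cg * (1 + `|z| `^ s) /\ `|Gz x z q| <= Cg * (1 + `|z| `^ (s - 1)),
        forall z q, U q -> r <= `|z| -> a < p * G x z q /\ p * G x z q <= z * Gz x z q &
        forall z q, U q -> `|z| <= zeta -> `|G x z q + c / 2 * z ^+ 2| <= b / 2 * `|z - v 0%N x| ^+ 2] /\
    [/\ `|v 0%N x| <= zeta',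
        forall z q1 q2, U q1 -> U q2 -> enorm q1 <= l2 -> enorm q2 <= l2 ->
          `|Gz x z q1 - Gz x z q2| <= C5 * (1 + `|z|) * enorm (q1 - q2),
        forall k, [/\ enorm (u k x) <= l2, U (u k x) & enorm ((u k - u 0%N) x) <= dd k] &
        forall t, ~ B1 t x /\ ~ B2 t x]].
  apply: ae_conull.
  have hk : {ae mu, forall x, forall k, Omega x ->
      [/\ enorm (u k x) <= l2, U (u k x) & enorm ((u k - u 0%N) x) <= dd k]}.
    apply/ae_foralln => k; have [_ h3 _] := hdd k; near=> x; move=> Ox; split.
    - by have := near (ul k) x; apply.
    - by have := near (uUU k) x; apply.
    - by have := near h3 x; apply.
  near=> x; move=> Ox; split; split.
  - by have := near cG x; apply.
  - by have := near growU x; apply.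
  - by have := near AR x; apply.
  - by have := near near0 x; apply.
  - by have := near v0z' x; apply.
  - by have := near lipU x; apply.
  - by move=> k; have := near hk x; apply.
  - move=> t; split; first by have := near av1 x; apply.
    by have := near av2 x; apply.
have mD : measurable (Omega `\` A) by apply: measurableD => //; exact: measurable_domain BD.
have um k : measurable_fun (Omega `\` A) (u k).
  by have [mu_ _ _] := uU k; apply: measurable_funS mu_ => //; exact: measurable_domain BD.
have ee0 k : 0 <= C5 * dd k by rewrite mulr_ge0//; case: (hdd k).
(* The nonlinearity of index k is G along the control u k. Its z-derivative differs from that of
   index 0 by at most C5 [dd k] (1 + |z|), and this factor tends to 0 because u k tends to u 0. *)
apply: (@assembled_conclusion R n alpha Omega n1 al1 al2 BD LB A mA A0 l1 v vV vcv c s p a r Cg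
  (fun k x z => G x z (u k x)) (fun k x z => Gz x z (u k x)) (fun k => C5 * dd k) F
  (fun k w _ => erefl) s2 sc (ltW Cg0) p2 a0 r0 _ _ _ _ _ ee0 _ b zeta zeta' b0 bc zeta0 zz _ _).
- move=> k x Dx; have [[_ h2 h3 _] [_ _ /(_ k)[uk Uk _] _]] := good x Dx; split.
  + by move=> z; apply: dG; exact: Dx.1.
  + by move=> z; case: (h2 z (u k x)).
  + by move=> z; case: (h2 z (u k x)).
  + by move=> z rz; exact: h3.
- move=> k x Dx z; have [[[_ h] _ _ _] _] := good x Dx.
  apply: (@continuous_comp _ _ _ (fun z => (z, u k x)) (fun p => Gz x p.1 p.2)); last exact: h.
  exact: (@cvg_pair _ _ _ (nbhs z) (nbhs z) (nbhs (u k x)) _ _ _ id (fun=> u k x) cvg_id (cvg_cst _)).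
- move=> k w mw; apply: (measurable_caratheodory_comp mD (F := G) _ _ mw (um k)).
  + move=> j i q; have [_ _] := hB1 (j, i, q); apply => // x Dx; split; first exact: Dx.1.
    by have [_ [_ _ _ /(_ (j, i, q))[]]] := good x Dx.
  + by move=> x Dx; have [[[h _] _ _ _] _] := good x Dx.
- move=> k w mw; apply: (measurable_caratheodory_comp mD (F := Gz) _ _ mw (um k)).
  + move=> j i q; have [_ _] := hB2 (j, i, q); apply => // x Dx; split; first exact: Dx.1.
    by have [_ [_ _ _ /(_ (j, i, q))[]]] := good x Dx.
  + by move=> x Dx; have [[[_ h] _ _ _] _] := good x Dx.
- move=> k x z Dx; have [_ [_ h hu _]] := good x Dx.
  have [e1 U1 d1] := hu k; have [e2 U2 _] := hu 0%N.
  apply: (le_trans (h z _ _ U1 U2 e1 e2)).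
  rewrite mulrAC ler_wpM2r ?addr_ge0// ler_wpM2l//.
- move=> e e0; have e'0 : 0 < e / (C5 + 1) by rewrite divr_gt0// ltr_wpDl.
  have : \forall k \near \oo, (normLinf Omega (u k - u 0%N)%R < (e / (C5 + 1))%:E)%E.
    apply: (ucv [set y | (y < (e / (C5 + 1))%:E)%E]); apply: open_nbhs_nbhs; split.
      exact: open_ereal_lt_ereal.
    by rewrite /= lte_fin.
  move=> [k0 _ hk]; exists k0 => k kk; have [dk0 _ hd] := hdd k.
  have := hd _ (ltW (hk k kk)); rewrite ler_pdivlMr ?ltr_wpDl// => h.
  by apply: le_trans h; rewrite mulrDr mulr1 mulrC lerDl.
- by move=> x Dx; have [_ []] := good x Dx.
- move=> x z Dx hz; have [[_ _ _ h] [_ _ /(_ 0%N)[_ U0 _] _]] := good x Dx; exact: h.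
Unshelve. all: by end_near.
Qed.
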